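(* Suppose that there is a (not necessarily private) polynomial-time approximation algorithm for the $k$-means problem with approximation ratio $\kappa$. Then for any $\alpha > 0$, there is a one-round (non-interactive) $\varepsilon$-DP $\left(\kappa(1+\alpha),\; k^{O_{\alpha}(1)} \cdot \sqrt{nd} \cdot \mathrm{polylog}(n)/\varepsilon\right)$-approximation algorithm for $k$-means in the local DP model. The algorithm runs in time $\mathrm{poly}(n,d,k)$.
   Context: Input: $n$ users, user $i$ holding a point $x_i$ in the closed unit ball $\mathbb{B}^d \subseteq \mathbb{R}^d$; $\mathbf{X} = \{x_1,\dots,x_n\}$ (a multiset). For a set $\mathbf{C}$ of centers, $\mathrm{cost}_{\mathbf{X}}(\mathbf{C}) = \sum_{x\in\mathbf{X}} \min_{c\in\mathbf{C}}\|x-c\|^2$; $\mathrm{OPT}^k_{\mathbf{X}}$ is the minimum of this over all $\mathbf{C}$ with $|\mathbf{C}|=k$. A set $\mathbf{C}$ of $k$ centers is a $(\kappa,t)$-approximate solution if $\mathrm{cost}_{\mathbf{X}}(\mathbf{C}) \le \kappa\cdot \mathrm{OPT}^k_{\mathbf{X}} + t$; a $(\kappa,t)$-approximation algorithm outputs such a set. A randomized algorithm $\mathcal{A}$ is $(\varepsilon,\delta)$-DP if for all inputs $X,X'$ differing in one point and all output sets $S$, $\Pr[\mathcal{A}(X)\in S] \le e^{\varepsilon}\Pr[\mathcal{A}(X')\in S]+\delta$; $\varepsilon$-DP means $\delta=0$. A one-round local DP algorithm consists of an encoder applied independently by each user to its own input (producing messages) and a decoder applied to the concatenation of all messages; it is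 $(\varepsilon,\delta)$-DP in the local model if the map $(x_1,\dots,x_n)\mapsto(\mathrm{Enc}(x_1),\dots,\mathrm{Enc}(x_n))$ is $(\varepsilon,\delta)$-DP. Users and analyzer have access to shared public randomness. Throughout, $0<\varepsilon\le O(1)$. $O_\alpha$ hides constants depending on $\alpha$. *)

(* Defs.v *)
From mathcomp Require Import all_boot all_order all_algebra finmap.
From mathcomp Require Import all_classical all_reals all_analysis.

Set Implicit Arguments.
Unset Strict Implicit.
Unset Printing Implicit Defensive.

Import Order.TTheory GRing.Theory Num.Theory.

Local Open Scope fset_scope.
Local Open Scope classical_set_scope.
Local Open Scope ring_scope.

Section KMeans.
Context {R : realType}.

(* The library norm on 'rV[R]_d is the sup norm. *)
Definition enorm d (x : 'rV[R]_d) : R := Num.sqrt (\sum_(j < d) x 0 j ^+ 2).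

Definition uball d : set 'rV[R]_d := [set x | enorm x <= 1].

(* A family indexed by users renders the multiset of inputs. *)
Definition in_uball n d (X : 'I_n -> 'rV[R]_d) : Prop := forall i, uball (X i).

(* inf of a finite set, nonempty whenever C is: a minimum. *)
Definition cost n d (X : 'I_n -> 'rV[R]_d) (C : {fset 'rV[R]_d}) : R :=
  \sum_(i < n) inf [set enorm (X i - c) ^+ 2 | c in [set` C]].

(* For k, d > 0 this infimum is attained. *)
Definition opt n d (k : nat) (X : 'I_n -> 'rV[R]_d) : R :=
  inf [set cost X C | C in [set C : {fset 'rV[R]_d} | #|` C| = k]].

Definition approx_solution n d (k : nat) (X : 'I_n -> 'rV[R]_d) (kappa t : R)
    (C : {fset 'rV[R]_d}) : Prop :=
  #|` C| = k /\ cost X C <= kappa * opt k X + t.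

Definition coords d (x : 'rV[R]_d) : seq R := [seq x 0 j | j <- enum 'I_d].

(* Row-major layout of k points of dimension d. *)
Definition centers (d k : nat) (s : seq R) : {fset 'rV[R]_d} :=
  [fset y in [seq \row_(j < d) s`_(i * d + j) | i <- iota 0 k]].

End KMeans.

(* Probability under the uniform distribution on a finite set of coin tosses. *)
Definition Pr (R : realType) (W : finType) (E : set W) : R :=
  #|[pred w | `[< E w >]]|%:R / #|W|%:R.

(* D is the set of admissible data points; neighbouring inputs differ in at
   most one coordinate (the number n of users is public). *)
Definition dp (R : realType) (U O : Type) (W : finType) (n : nat) (D : set U)
    (M : ('I_n -> U) -> W -> O) (eps delta : R) : Prop :=
  forall X X' : 'I_n -> U,
    (forall i, D (X i)) -> (forall i, D (X' i)) ->
    (exists i, forall j, j != i -> X j = X' j) ->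
  forall S : set O,
    Pr R [set w | S (M X w)] <= expR eps * Pr R [set w | S (M X' w)] + delta.

(* Running time is measured on a real RAM: unbounded memories of natural
   numbers and of exact reals, both with indirect addressing; unit-cost exact
   field operations and comparisons on reals; no rounding of reals to naturals.
   Naturals have no product: with unit-cost addition and subtraction their
   length grows at most linearly in the time.  Programs contain no real
   constants, hence are finite objects; x / 0 = 0. *)
Inductive nexp : Type :=
  | NConst of nat
  | NGet of nexp
  | NAdd of nexp & nexp
  | NSub of nexp & nexp.

Inductive rexp : Type :=
  | RNat of nexp
  | RGet of nexp
  | RAdd of rexp & rexp
  | RSub of rexp & rexp
  | RMul of rexp & rexp
  | RDiv of rexp & rexp.

Inductive test : Type :=
  | NLe of nexp & nexp
  | RLe of rexp & rexp.

(* PrivateCoin e and PublicCoin e write the next bit of the corresponding tape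
   to the natural cell of address e; Emit appends a real to the output. *)
Inductive prog : Type :=
  | NPut of nexp & nexp
  | RPut of nexp & rexp
  | PrivateCoin of nexp
  | PublicCoin of nexp
  | Emit of rexp
  | Seq of prog & prog
  | If of test & prog & prog
  | While of test & prog.

Section RealRAM.
Context {R : realType}.

Record state := State {
  nmem : nat -> nat;
  rmem : nat -> R;
  private : seq bool;
  public : seq bool;
  out : seq R }.

Definition upd (T : Type) (f : nat -> T) (a : nat) (v : T) : nat -> T :=
  fun b => if b == a then v else f b.

Fixpoint neval (s : state) (e : nexp) : nat :=
  match e with
  | NConst c => c
  | NGet e => nmem s (neval s e)
  | NAdd e f => (neval s e + neval s f)%N
  | NSub e f => (neval s e - neval s f)%N
  end.

Fixpoint reval (s : state) (e : rexp) : R :=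
  match e with
  | RNat e => (neval s e)%:R
  | RGet e => rmem s (neval s e)
  | RAdd e f => reval s e + reval s f
  | RSub e f => reval s e - reval s f
  | RMul e f => reval s e * reval s f
  | RDiv e f => reval s e / reval s f
  end.

Definition teval (s : state) (b : test) : bool :=
  match b with
  | NLe e f => (neval s e <= neval s f)%N
  | RLe e f => reval s e <= reval s f
  end.

(* A configuration is the stack of programs still to be run and the state. *)
Definition step (c : seq prog * state) : seq prog * state :=
  let: (K, s) := c in
  let: State N M pr pu o := s in
  match K with
  | [::] => c
  | NPut a e :: K => (K, State (upd N (neval s a) (neval s e)) M pr pu o)
  | RPut a e :: K => (K, State N (upd M (neval s a) (reval s e)) pr pu o)
  | PrivateCoin a :: K =>
      (K, State (upd N (neval s a) (head false pr)) M (behead pr) pu o)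
  | PublicCoin a :: K =>
      (K, State (upd N (neval s a) (head false pu)) M pr (behead pu) o)
  | Emit e :: K => (K, State N M pr pu (rcons o (reval s e)))
  | Seq p q :: K => ([:: p, q & K], s)
  | If b p q :: K => ((if teval s b then p else q) :: K, s)
  | While b p :: K => (if teval s b then [:: p, While b p & K] else K, s)
  end.

Definition init (ns : seq nat) (rs : seq R) (pr pu : seq bool) : state :=
  State (nth 0%N ns) (nth 0 rs) pr pu [::].

Definition run (T : nat) (p : prog) (s : state) : seq prog * state :=
  iter T step ([:: p], s).

Definition halts (T : nat) (p : prog) (s : state) : Prop := nilp (run T p s).1.

Definition output (T : nat) (p : prog) (s : state) : seq R := out (run T p s).2.

End RealRAM.

(* A polynomial in n, d, k (all positive), up to domination. *)
Definition poly_bound (A n d k : nat) : nat := (A * (n + d + k) ^ A)%N.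

(* A run of T steps reads at most T bits of each tape, so tapes of length T lose
   nothing; the same T serves as time bound and as length of the coin tapes. *)

Section Algorithms.
Context {R : realType}.

(* Polynomial-time approximation algorithm with ratio kappa, possibly
   randomized with failure probability at most beta. *)
Definition ptime_kmeans_approx (kappa beta : R) : Prop :=
  exists (p : prog) (A : nat), forall (n d k : nat),
    (0 < n)%N -> (0 < d)%N -> (0 < k)%N ->
  forall X : 'I_n -> 'rV[R]_d, in_uball X ->
  let T := poly_bound A n d k in
  let start (w : T.-tuple bool) :=
    init [:: n; d; k] (flatten [seq coords (X i) | i <- enum 'I_n]) w [::] in
  (forall w, halts T p (start w)) /\
  1 - beta <= Pr R [set w : T.-tuple bool |
    approx_solution k X kappa 0 (centers d k (output T p (start w)))].

(* One-round protocols: all users run the same program enc on the public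
   parameters n, d, k, eps, their own point, their private coins and the public
   coins.  The decoder is given n, d, k, eps, the total length and the
   concatenation of the messages, private coins of its own and the public
   coins. *)
Definition enc_start (n d k : nat) (eps : R) (x : 'rV[R]_d)
    (pub w : seq bool) : state :=
  init [:: n; d; k] (eps :: coords x) w pub.

Definition messages (enc : prog) (T n d k : nat) (eps : R)
    (pub : T.-tuple bool) (X : 'I_n -> 'rV[R]_d)
    (w : {ffun 'I_n -> T.-tuple bool}) : seq (seq R) :=
  [seq output T enc (enc_start n k eps (X i) pub (w i)) | i <- enum 'I_n].

Definition dec_start (n d k : nat) (eps : R) (m : seq R)
    (pub w : seq bool) : state :=
  init [:: n; d; k; size m] (eps :: m) w pub.

(* The public coins are seen by everyone, so privacy is required for each fixed
   value of them. *)
Definition local_dp (enc : prog) (T n d k : nat) (eps delta : R) : Prop :=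
  forall pub : T.-tuple bool,
    dp (@uball R d) (@messages enc T n d k eps pub) eps delta.

Definition runs_in_time (enc dec : prog) (T n d k : nat) (eps : R) : Prop :=
  forall (X : 'I_n -> 'rV[R]_d) (pub : T.-tuple bool)
    (w : {ffun 'I_n -> T.-tuple bool}) (v : T.-tuple bool), in_uball X ->
  (forall i, halts T enc (enc_start n k eps (X i) pub (w i))) /\
  halts T dec (dec_start n d k eps (flatten (messages enc k eps pub X w)) pub v).

(* With probability at least 1 - beta over the public coins, the users' private
   coins and the decoder's private coins, the decoder outputs a
   (kappa, t)-approximate solution. *)
Definition protocol_approx (enc dec : prog) (T n d k : nat)
    (eps kappa t beta : R) : Prop :=
  forall X : 'I_n -> 'rV[R]_d, in_uball X ->
  1 - beta <= Pr R [set r : T.-tuple bool * {ffun 'I_n -> T.-tuple bool}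
                             * T.-tuple bool |
    let: (pub, w, v) := r in
    approx_solution k X kappa t (centers d k (output T dec
      (dec_start n d k eps (flatten (messages enc k eps pub X w)) pub v)))].

End Algorithms.

(* Submission.v *)
(* The public coins give q = O_alpha(log k) random sign projections.  The
   projection of a point, rescaled to the unit cube, has binary digits which,
   read level by level and coordinate by coordinate, form a path in a binary
   tree of depth H = O(q log n).  A user picks a random depth t and random
   signs u, s, and sends them together with one randomized bit whose bias is
   proportional to <u, (1, x)> times the character s of the first t + 1 bits
   of the path of x; since the bias is O(eps), this is eps-private.
   Correlating the answers with the characters gives, for every node of the
   tree, estimates of the number and of the vector sum of the points whose
   path passes through it, and by a Chernoff bound the error is
   polylog * sqrt(n) / eps for all the nodes at once.

   The decoder expands at each depth the Gam = H * 2^(O_alpha(q)) heaviest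
   nodes, replaces every leaf by copies of the estimated mean of its points,
   and runs the given algorithm on these synthetic data, once with private and
   once with public coins.  Keeping the better answer brings the failure
   probability from beta down to beta^2, which leaves room for the other
   failure events.

   Fix near-optimal centers.  Distances to the centers are preserved by the
   projection except for few users, whose contribution is bounded in
   expectation (Markov), so no union bound over the users is needed.  A point
   whose projected distance to its center is large compared with the diameter
   of its leaf is charged to that distance.  The remaining points lie in at
   most N = k * 2^(O_alpha(q)) cells of each depth; a leaf that was not
   expanded is, up to noise, lighter than Gam other nodes of its depth, of
   which all but N contain far points only, hence its weight is at most the
   noise plus a 1 / (Gam - N) fraction of the number of far points, again
   charged to their distances. *)
Require Import Defs.
From mathcomp Require Import all_boot all_order all_algebra finmap.
From mathcomp Require Import all_classical all_reals all_analysis.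
From mathcomp Require Import ring lra zify.
Set Implicit Arguments.
Unset Strict Implicit.
Unset Printing Implicit Defensive.
Import Order.TTheory GRing.Theory Num.Theory.
Local Open Scope ring_scope.

(** * Structured programs on the machine *)

Section Exec.
Context {R : realType}.
Implicit Types (s : @state R) (p : prog).

(** An answer that is good for the synthetic data has to be good for the users, although replacing
    the points of a leaf by copies of their mean discards their spread. What saves the ratio is that
    the discarded amount hardly depends on the centers: on each leaf the true and the synthetic cost
    are quadratic functions of the center with nearly equal leading and linear coefficients. Their
    differences are nearly nonnegative and enter the final bound with the factor [1 - kappa]. Hence
    [1 <= kappa] is required; it follows from the existence of the given algorithm, applied to two
    points of a line. The two runs of that algorithm fail independently because the messages depend
    on a prefix of the public tape only, and the second run reads what comes after it. If
    [eps * n < 1] or [n < d], the permitted error is at least of the order of [n], and any [k]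
    distinct centers of which one is close to the unit ball will do. In the remaining cases the
    reported bit carries information, and a union bound over the [d] coordinates is affordable. All
    random choices are made with fair coins on finite ranges, so privacy has to hold exactly in
    spite of rounding; this dictates [acoef] and [pV]. *)

Definition exec p s s' t := forall K, iter t step (p :: K, s) = (K, s').

Lemma exec_seq p q s1 s2 s3 t u :
  exec p s1 s2 t -> exec q s2 s3 u -> exec (Seq p q) s1 s3 (u + (t + 1)).
Proof.
move=> hp hq K; rewrite iterD iterD /=.
by case: s1 hp => N M pr pu o hp; rewrite hp hq.
Qed.

Lemma exec_if b p q s1 s2 t :
  exec (if teval s1 b then p else q) s1 s2 t -> exec (If b p q) s1 s2 (t + 1).
Proof. by move=> h K; rewrite iterD /=; case: s1 h => N M pr pu o h; rewrite h. Qed.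

Lemma exec_while0 b p s : ~~ teval s b -> exec (While b p) s s 1.
Proof. by case: s => N M pr pu o /= /negbTE hb K /=; rewrite hb. Qed.

Lemma exec_whileS b p s1 s2 s3 t u : teval s1 b ->
  exec p s1 s2 t -> exec (While b p) s2 s3 u -> exec (While b p) s1 s3 (u + (t + 1)).
Proof.
move=> hb hp hq K; rewrite iterD iterD /=.
by case: s1 hb hp => N M pr pu o hb hp /=; rewrite hb hp hq.
Qed.

Lemma exec_NPut a e s : exec (NPut a e) s (State
  (upd (nmem s) (neval s a) (neval s e)) (rmem s) (private s) (public s) (out s)) 1.
Proof. by move=> K; case: s. Qed.

Lemma exec_RPut a e s : exec (RPut a e) s (State
  (nmem s) (upd (rmem s) (neval s a) (reval s e)) (private s) (public s) (out s)) 1.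
Proof. by move=> K; case: s. Qed.

Lemma exec_PrivateCoin a s : exec (PrivateCoin a) s (State
  (upd (nmem s) (neval s a) (head false (private s))) (rmem s)
  (behead (private s)) (public s) (out s)) 1.
Proof. by move=> K; case: s. Qed.

Lemma exec_PublicCoin a s : exec (PublicCoin a) s (State
  (upd (nmem s) (neval s a) (head false (public s))) (rmem s)
  (private s) (behead (public s)) (out s)) 1.
Proof. by move=> K; case: s. Qed.

Lemma exec_Emit e s : exec (Emit e) s (State
  (nmem s) (rmem s) (private s) (public s) (rcons (out s) (reval s e))) 1.
Proof. by move=> K; case: s. Qed.

(** A configuration with an empty stack is a fixed point of [step], so running longer than necessary
    changes nothing and one bound [T] can serve every program. *)
Lemma exec_run p s s' t T : exec p s s' t -> (t <= T)%N -> run T p s = ([::], s').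
Proof.
move=> h tT; rewrite /run -(subnK tT) iterD h.
by elim: (T - t)%N => //= m ->; case: s' {h} => * //.
Qed.

End Exec.

(* A structured language compiled to [prog]: memory is split into 64 arrays of
   naturals and 64 arrays of reals, the [i]-th cell of the array [c] being
   stored at an address congruent to [c] modulo 64 (up to an offset skipping
   the input).  Array 0 holds the loop bounds: a loop [CFor c i b] runs [b] as
   many times as the cell [i] of array 0 says, with its counter in the cell 0
   of array [c]; as no loop body writes to array 0 the language is total and
   the running time can be bounded statically. *)
Inductive hnat : Type :=
  | HC of nat | HI of nat | HG of nat & hnat
  | HA of hnat & hnat | HS of hnat & hnat | HK of nat & hnat.

Inductive hreal : Type :=
  | QN of hnat | QI of hnat | QG of nat & hnat
  | QA of hreal & hreal | QS of hreal & hreal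
  | QM of hreal & hreal | QD of hreal & hreal.

Inductive htest : Type := TN of hnat & hnat | TR of hreal & hreal.

Inductive cmd : Type :=
  | CN of nat & hnat & hnat | CR of nat & hnat & hreal
  | CPriv of nat & hnat | CPub of nat & hnat | CEmit of hreal
  | CSeq of cmd & cmd | CIf of htest & cmd & cmd
  | CFor of nat & nat & cmd | CSkip.

Fixpoint nok e := match e with
  | HC _ => true | HI i => (i < 4)%N | HG c e => (c < 64)%N && nok e
  | HA e f | HS e f => nok e && nok f | HK _ e => nok e end.

Fixpoint rok e := match e with
  | QN e | QI e => nok e | QG c e => (c < 64)%N && nok e
  | QA e f | QS e f | QM e f | QD e f => rok e && rok f end.

Definition tok b := match b with
  | TN e f => nok e && nok f | TR e f => rok e && rok f end.

Fixpoint wN c : seq nat := match c with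
  | CN c _ _ | CPriv c _ | CPub c _ => [:: c]
  | CSeq a b | CIf _ a b => wN a ++ wN b
  | CFor c _ b => c :: wN b | _ => [::] end.

(* 64, 65, 66 stand for the output and the private and public tapes. *)
Fixpoint wR c : seq nat := match c with
  | CR c _ _ => [:: c] | CPriv _ _ => [:: 65%N] | CPub _ _ => [:: 66%N]
  | CEmit _ => [:: 64%N]
  | CSeq a b | CIf _ a b => wR a ++ wR b
  | CFor _ _ b => wR b | _ => [::] end.

(** The condition [0 \notin wN a] on a sequence makes a bound on array 0 at its start valid for its
    second half too. A command may thus write to array 0 only at its end, which is why the
    parameters are computed by a list of separate commands. *)
Fixpoint wfc c : bool := match c with
  | CN c e f => [&& (c < 64)%N, nok e & nok f]
  | CR c e f => [&& (c < 64)%N, nok e & rok f]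
  | CPriv c e | CPub c e => (c < 64)%N && nok e
  | CEmit e => rok e
  | CSeq a b => [&& wfc a, wfc b & 0%N \notin wN a]
  | CIf t a b => [&& tok t, wfc a & wfc b]
  | CFor c i b => [&& (c < 64)%N, c != 0%N, wfc b, c \notin wN b & 0%N \notin wN b]
  | CSkip => true end.

Fixpoint costb (f : nat -> nat) c : nat := match c with
  | CSeq a b | CIf _ a b => (costb f a + costb f b + 1)%N
  | CFor _ i b => (3 + f i * (3 + costb f b))%N
  | _ => 1%N end.

(** When all loop bounds are at most [M], the time is a polynomial whose degree depends on the text
    of the command alone. With base [M + 2] instead of [M], additive constants are absorbed by a
    larger exponent. *)
Lemma costb_poly c : exists K, forall M, (costb (fun=> M) c <= (M + 2) ^ K)%N.
Proof.
have base M K : (0 < (M + 2) ^ K)%N by rewrite expn_gt0 addn2.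
have pair A B M K1 K2 : (A <= (M + 2) ^ K1)%N -> (B <= (M + 2) ^ K2)%N ->
    (A + B + 1 <= (M + 2) ^ (K1 + K2 + 2))%N.
  rewrite !expnD; have := base M K1; have := base M K2.
  set x := (_ ^ K1)%N; set y := (_ ^ K2)%N => y0 x0 hA hB.
  have z4 : (4 <= (M + 2) ^ 2)%N by rewrite -[4%N]/(2 ^ 2)%N leq_exp2r // leq_addl.
  have h4 : (x * y * 4 <= x * y * (M + 2) ^ 2)%N by rewrite leq_mul2l z4 orbT.
  by apply: leq_trans h4; nia.
elim: c => /= [*|*|*|*|*|a [K1 h1] b [K2 h2]|_ a [K1 h1] b [K2 h2]|_ _ b [K h]|];
  try by exists 0%N.
- by exists (K1 + K2 + 2)%N => M; apply: pair.
- by exists (K1 + K2 + 2)%N => M; apply: pair.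
exists (K + 3)%N => M; have := h M; rewrite expnD; have := base M K.
set x := (_ ^ K)%N; move: (costb _ b) => A ? ?.
have h1 : (3 + M * (3 + A) <= 3 + M * (4 * x))%N by rewrite leq_add2l leq_mul2l; apply/orP; right; lia.
by apply: leq_trans h1 _; rewrite !expnS expn0; nia.
Qed.

Fixpoint m64 (j : nat) (e : nexp) : nexp := if j is j.+1 then NAdd (m64 j e) (m64 j e) else e.
(** Addresses 0 to 3 belong to the natural inputs. Six doublings stand for the product by 64, an
    operation the machine does not have; the lock keeps simplification from unfolding them. *)
Definition aN c e := locked (NAdd (NConst (4 + c)) (m64 6 e)).

Section Compile.
Variable rb : nexp.
(** [rb] is an expression for the length of the real input, which varies with the instance; the
    arrays of reals start behind that input. *)
Definition aR c e := locked (NAdd rb (NAdd (NConst c) (m64 6 e))).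
Fixpoint cN e := match e with
  | HC c => NConst c | HI i => NGet (NConst i) | HG c e => NGet (aN c (cN e))
  | HA e f => NAdd (cN e) (cN f) | HS e f => NSub (cN e) (cN f)
  | HK c e => iter c (NAdd (cN e)) (NConst 0) end.

Fixpoint cR e := match e with
  | QN e => RNat (cN e) | QI e => RGet (cN e) | QG c e => RGet (aR c (cN e))
  | QA e f => RAdd (cR e) (cR f) | QS e f => RSub (cR e) (cR f)
  | QM e f => RMul (cR e) (cR f) | QD e f => RDiv (cR e) (cR f) end.

Definition cT b := match b with
  | TN e f => NLe (cN e) (cN f) | TR e f => RLe (cR e) (cR f) end.

Fixpoint compile c : prog := match c with
  | CN c e f => NPut (aN c (cN e)) (cN f)
  | CR c e f => RPut (aR c (cN e)) (cR f)
  | CPriv c e => PrivateCoin (aN c (cN e))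
  | CPub c e => PublicCoin (aN c (cN e))
  | CEmit e => Emit (cR e)
  | CSeq a b => Seq (compile a) (compile b)
  | CIf t a b => If (cT t) (compile a) (compile b)
  | CFor c i b => let cnt := cN (HG c (HC 0)) in
      Seq (NPut (aN c (NConst 0)) (NConst 0))
        (While (NLe (NAdd cnt (NConst 1)) (cN (HG 0 (HC i))))
          (Seq (compile b) (NPut (aN c (NConst 0)) (NAdd cnt (NConst 1)))))
  | CSkip => While (NLe (NConst 1) (NConst 0)) (NPut (NConst 0) (NConst 0)) end.
End Compile.

(** * Semantics of the structured language and correctness of its compilation *)

Section Semantics.
Context {R : realType}.
Variables (ns : seq nat) (rs : seq R).

Record hst := HSt { hN : nat -> nat -> nat; hR : nat -> nat -> R;
  hpr : seq bool; hpu : seq bool; hout : seq R }.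
Implicit Types h : hst.

Definition upd2 (T : Type) (f : nat -> nat -> T) c i v : nat -> nat -> T :=
  fun c' i' => if (c' == c) && (i' == i) then v else f c' i'.

Definition setN c i v h := HSt (upd2 (hN h) c i v) (hR h) (hpr h) (hpu h) (hout h).
Definition setR c i v h := HSt (hN h) (upd2 (hR h) c i v) (hpr h) (hpu h) (hout h).

Fixpoint evN h e : nat := match e with
  | HC c => c | HI i => nth 0%N ns i | HG c e => hN h c (evN h e)
  | HA e f => (evN h e + evN h f)%N | HS e f => (evN h e - evN h f)%N
  | HK c e => (c * evN h e)%N end.

(* Past the input the real memory belongs to the arrays. *)
Definition input h i : R :=
  if (i < size rs)%N then rs`_i else hR h ((i - size rs) %% 64) ((i - size rs) %/ 64).

Fixpoint evR h e : R := match e with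
  | QN e => (evN h e)%:R | QI e => input h (evN h e) | QG c e => hR h c (evN h e)
  | QA e f => evR h e + evR h f | QS e f => evR h e - evR h f
  | QM e f => evR h e * evR h f | QD e f => evR h e / evR h f end.

Definition evT h b : bool := match b with
  | TN e f => (evN h e <= evN h f)%N | TR e f => evR h e <= evR h f end.

Fixpoint sem c h : hst := match c with
  | CN c e f => setN c (evN h e) (evN h f) h
  | CR c e f => setR c (evN h e) (evR h f) h
  | CPriv c e => let: HSt N M pr pu o := setN c (evN h e) (head false (hpr h)) h in
      HSt N M (behead pr) pu o
  | CPub c e => let: HSt N M pr pu o := setN c (evN h e) (head false (hpu h)) h in
      HSt N M pr (behead pu) o
  | CEmit e => HSt (hN h) (hR h) (hpr h) (hpu h) (rcons (hout h) (evR h e))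
  | CSeq a b => sem b (sem a h)
  | CIf t a b => if evT h t then sem a h else sem b h
  | CFor c i b => iter (hN h 0 i)
      (fun h => let h' := sem b h in setN c 0 (hN h' c 0).+1 h') (setN c 0 0 h)
  | CSkip => h end.

Lemma sem_seq a b h : sem (CSeq a b) h = sem b (sem a h). Proof. by []. Qed.
Lemma sem_CN c e f h : sem (CN c e f) h = setN c (evN h e) (evN h f) h. Proof. by []. Qed.
Lemma sem_CR c e f h : sem (CR c e f) h = setR c (evN h e) (evR h f) h. Proof. by []. Qed.
Lemma sem_if t a b h : sem (CIf t a b) h = if evT h t then sem a h else sem b h.
Proof. by []. Qed.

Lemma frame_N a h c : c \notin wN a -> hN (sem a h) c = hN h c.
Proof.
elim: a h => //=.
- by move=> c' e f h; rewrite inE /upd2 => /negbTE ->.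
- by move=> c' e h; rewrite inE /upd2 => /negbTE ->.
- by move=> c' e h; rewrite inE /upd2 => /negbTE ->.
- move=> a IHa b IHb h; rewrite mem_cat negb_or => /andP[ha hb].
  by rewrite IHb // IHa.
- move=> t a IHa b IHb h; rewrite mem_cat negb_or => /andP[ha hb].
  by case: ifP => _; rewrite ?IHb // IHa.
- move=> c' i b IHb h; rewrite inE negb_or => /andP[/negbTE hc hb].
  elim: (hN h 0 i) => /= [|m IH]; first by rewrite /upd2 hc.
  by rewrite /upd2 hc /= IHb // IH.
Qed.

Lemma frame_R a h c : (c < 64)%N -> c \notin wR a -> hR (sem a h) c = hR h c.
Proof.
move=> hc; elim: a h => //=.
- by move=> c' e f h; rewrite inE /upd2 => /negbTE ->.
- move=> a IHa b IHb h; rewrite mem_cat negb_or => /andP[ha hb].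
  by rewrite IHb // IHa.
- move=> t a IHa b IHb h; rewrite mem_cat negb_or => /andP[ha hb].
  by case: ifP => _; rewrite ?IHb // IHa.
- move=> c' i b IHb h hb.
  by elim: (hN h 0 i) => //= m IH; rewrite IHb.
Qed.

Lemma frame_tape (proj : hst -> seq bool) z a h :
  (proj, z) = (hpr, 65%N) \/ (proj, z) = (hpu, 66%N) ->
  z \notin wR a -> proj (sem a h) = proj h.
Proof.
move=> hz; have hproj h1 h2 : hpr h1 = hpr h2 -> hpu h1 = hpu h2 -> proj h1 = proj h2.
  by case: hz => [] [-> _].
elim: a h => //=.
- by move=> *; apply: hproj.
- by move=> *; apply: hproj.
- by case: hz => [] [-> ->] c' e h.
- by case: hz => [] [-> ->] c' e h.
- by move=> *; apply: hproj.
- move=> a IHa b IHb h; rewrite mem_cat negb_or => /andP[ha hb].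
  by rewrite IHb // IHa.
- move=> t a IHa b IHb h; rewrite mem_cat negb_or => /andP[ha hb].
  by case: ifP => _; rewrite ?IHb // IHa.
- move=> c' i b IHb h hb.
  elim: (hN h 0 i) => [|m IH] /=; first exact: hproj.
  by rewrite -IH -[in RHS]IHb //; apply: hproj.
Qed.

Definition frame_pr a h := @frame_tape hpr 65 a h (or_introl erefl).
Definition frame_pu a h := @frame_tape hpu 66 a h (or_intror erefl).

Lemma frame_out a h : 64%N \notin wR a -> hout (sem a h) = hout h.
Proof.
elim: a h => //=.
- move=> a IHa b IHb h; rewrite mem_cat negb_or => /andP[ha hb].
  by rewrite IHb // IHa.
- move=> t a IHa b IHb h; rewrite mem_cat negb_or => /andP[ha hb].
  by case: ifP => _; rewrite ?IHb // IHa.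
- move=> c' i b IHb h hb.
  by elim: (hN h 0 i) => [|m IH] //=; rewrite IHb.
Qed.

(** The loop rule behind all program correctness below. Besides the invariant, the body may assume
    the value of its counter and that every array which the loop never writes still has its content
    from before the loop, so invariants mention only what changes. *)
Lemma for_ind c i b (I : nat -> hst -> Prop) h :
  [&& c != 0%N, c \notin wN b & 0%N \notin wN b] ->
  I 0%N (setN c 0 0 h) ->
  (forall j h', (j < hN h 0 i)%N -> I j h' -> hN h' c 0 = j ->
    (forall c', c' \notin c :: wN b -> hN h' c' = hN h c') ->
    (forall c', (c' < 64)%N -> c' \notin wR b -> hR h' c' = hR h c') ->
    I j.+1 (setN c 0 j.+1 (sem b h'))) ->
  I (hN h 0 i) (sem (CFor c i b) h).
Proof.
case/and3P=> c0 cb b0 I0 IS /=.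
pose g h' := setN c 0 (hN (sem b h') c 0).+1 (sem b h').
rewrite -/g; have : (hN h 0 i <= hN h 0 i)%N by [].
(* Only the number of rounds is generalized; the right-hand side of [hm] keeps the true bound, so
   that the body may still use [j < hN h 0 i]. *)
move: {1 3 4}(hN h 0 i) => m hm.
suff [] : [/\ I m (iter m g (setN c 0 0 h)), hN (iter m g (setN c 0 0 h)) c 0 = m,
  (forall c', c' \notin c :: wN b -> hN (iter m g (setN c 0 0 h)) c' = hN h c') &
  (forall c', (c' < 64)%N -> c' \notin wR b -> hR (iter m g (setN c 0 0 h)) c' = hR h c')] by [].
elim: m hm => [|m IH] hm /=.
  split=> //; first by rewrite /upd2 !eqxx.
  by move=> c'; rewrite inE negb_or /upd2 => /andP[/negbTE ->].
have [h1 h2 h3 h4] := IH (ltnW hm); set h' := iter m g _ in h1 h2 h3 h4 *.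
have e : hN (sem b h') c 0 = m by rewrite frame_N.
split.
- by rewrite /g e; apply: IS.
- by rewrite /g /= /upd2 !eqxx /= e.
- move=> c' hc'; move: (hc'); rewrite inE negb_or => /andP[/negbTE c1 c2].
  by rewrite /g /= /upd2 c1 /= frame_N // h3.
- by move=> c' ? ?; rewrite /g /= frame_R // h4.
Qed.

Definition hinit pr pu := HSt (fun _ _ => 0%N) (fun _ _ => 0) pr pu [::].

(* [rel h s]: the machine state [s] represents the structured state [h]. *)
Definition rel h (s : @state R) :=
  [/\ forall c i, (c < 64)%N -> nmem s (4 + (c + 64 * i)) = hN h c i,
      forall c i, (c < 64)%N -> rmem s (size rs + (c + 64 * i)) = hR h c i,
      forall i, (i < 4)%N -> nmem s i = nth 0%N ns i,
      forall i, (i < size rs)%N -> rmem s i = rs`_i &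
      [/\ private s = hpr h, public s = hpu h & out s = hout h]].

Lemma rel_init pr pu : (size ns <= 4)%N -> rel (hinit pr pu) (init ns rs pr pu).
Proof.
move=> hns; split=> //= c i hc; rewrite nth_default //.
  by apply: leq_trans hns _; rewrite leq_addr.
by rewrite leq_addr.
Qed.

Variable rb : nexp.
Hypothesis rbE : forall s : @state R,
  (forall i, (i < 4)%N -> nmem s i = nth 0%N ns i) -> neval s rb = size rs.

Lemma neval_m64 (s : @state R) e : neval s (m64 6 e) = (64 * neval s e)%N :> nat.
Proof. by rewrite /=; lia. Qed.

Lemma neval_aN (s : @state R) c e : neval s (aN c e) = (4 + (c + 64 * neval s e))%N.
Proof. by rewrite /aN -lock; cbn [neval]; rewrite neval_m64 addnA. Qed.

Lemma neval_aR h s c e : rel h s ->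
  neval s (aR rb c e) = (size rs + (c + 64 * neval s e))%N.
Proof. by case=> _ _ hi _ _; rewrite /aR -lock; cbn [neval]; rewrite neval_m64 rbE. Qed.

Lemma cN_correct h s e : rel h s -> nok e -> neval s (cN e) = evN h e.
Proof.
move=> hs; have [hn _ hi _ _] := hs.
elim: e => //= [c e IH|e IHe f IHf|e IHe f IHf|c e IH].
- by case/andP=> hc /IH e1; rewrite neval_aN hn // e1.
- by case/andP=> /IHe -> /IHf ->.
- by case/andP=> /IHe -> /IHf ->.
- by move/IH => e1; elim: c => //= c ->; rewrite e1 mulSn.
Qed.

Lemma cR_correct h s e : rel h s -> rok e -> reval s (cR rb e) = evR h e.
Proof.
move=> hs; have [hn hr hi hin _] := hs.
elim: e => //= [e|e|c e|e IHe f IHf|e IHe f IHf|e IHe f IHf|e IHe f IHf].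
- by move=> he; rewrite (cN_correct hs).
- move=> he; rewrite (cN_correct hs) // /input; case: ltnP => hlt; first exact: hin.
  by rewrite -hr ?ltn_mod // [(_ %% _ + _)%N]addnC mulnC -divn_eq subnKC.
- by case/andP=> hc he; rewrite (neval_aR _ _ hs) hr // (cN_correct hs).
- by case/andP=> /IHe -> /IHf ->.
- by case/andP=> /IHe -> /IHf ->.
- by case/andP=> /IHe -> /IHf ->.
- by case/andP=> /IHe -> /IHf ->.
Qed.

Lemma cT_correct h s b : rel h s -> tok b -> teval s (cT rb b) = evT h b.
Proof.
move=> hs; case: b => e f /= /andP[he hf]; first by rewrite !(cN_correct hs).
by rewrite !(cR_correct hs).
Qed.

Lemma addr_eq c i c' i' : (c < 64)%N -> (c' < 64)%N ->
  ((c' + 64 * i')%N == (c + 64 * i)%N) = (c' == c) && (i' == i).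
Proof. by move=> hc hc'; apply/eqP/andP => [e|[/eqP -> /eqP ->]//]; split; apply/eqP; lia. Qed.

Lemma rel_putN h s c i v : rel h s -> (c < 64)%N ->
  rel (setN c i v h) (State (upd (nmem s) (4 + (c + 64 * i)) v) (rmem s) (private s) (public s) (out s)).
Proof.
case=> hn hr hi hin ht hc; split=> //=.
- by move=> c' i' hc'; rewrite /upd /upd2 eqn_add2l addr_eq // hn.
- move=> i' hi'; rewrite /upd ifF ?hi //; apply/negbTE/eqP => e.
  by move: hi'; rewrite e.
Qed.

Lemma rel_putR h s c i v : rel h s -> (c < 64)%N ->
  rel (setR c i v h) (State (nmem s) (upd (rmem s) (size rs + (c + 64 * i)) v) (private s) (public s) (out s)).
Proof.
case=> hn hr hi hin ht hc; split=> //=.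
- by move=> c' i' hc'; rewrite /upd /upd2 eqn_add2l addr_eq // hr.
- move=> i' hi'; rewrite /upd ifF ?hin //; apply/negbTE/eqP => e.
  by move: hi'; rewrite e ltnNge leq_addr.
Qed.

(** [f] bounds array 0 of the initial state only. This suffices because neither a loop body nor the
    first half of a sequence writes to that array. *)
Lemma compile_correct a h s f : wfc a -> rel h s -> (forall i, (hN h 0 i <= f i)%N) ->
  exists s' t, [/\ exec (compile rb a) s s' t, rel (sem a h) s' & (t <= costb f a)%N].
Proof.
elim: a h s => /=.
- move=> c e g h s /and3P[hc he hg] hs hf.
  eexists; exists 1%N; split; [exact: exec_NPut| |by []].
  by rewrite neval_aN !(cN_correct hs) //; apply: rel_putN.
- move=> c e g h s /and3P[hc he hg] hs hf.
  eexists; exists 1%N; split; [exact: exec_RPut| |by []].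
  by rewrite (neval_aR _ _ hs) (cN_correct hs) // (cR_correct hs) //; apply: rel_putR.
- move=> c e h s /andP[hc he] hs hf.
  eexists; exists 1%N; split; [exact: exec_PrivateCoin| |by []].
  have [hn hr hi hin [/= <- hpu' ho']] := rel_putN (evN h e) (head false (hpr h)) hs hc.
  by case: (hs) => _ _ _ _ [-> -> ->]; rewrite neval_aN (cN_correct hs) //; split.
- move=> c e h s /andP[hc he] hs hf.
  eexists; exists 1%N; split; [exact: exec_PublicCoin| |by []].
  have [hn hr hi hin [/= <- hpu' ho']] := rel_putN (evN h e) (head false (hpu h)) hs hc.
  by case: (hs) => _ _ _ _ [-> -> ->]; rewrite neval_aN (cN_correct hs) //; split.
- move=> e h s he hs hf.
  eexists; exists 1%N; split; [exact: exec_Emit| |by []].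
  by rewrite (cR_correct hs) //; case: hs => ? ? ? ? [-> -> ->]; split.
- move=> a IHa b IHb h s /and3P[wa wb a0] hs hf.
  have [s1 [t1 [e1 r1 c1]]] := IHa _ _ wa hs hf.
  have [|s2 [t2 [e2 r2 c2]]] := IHb _ _ wb r1.
    by move=> i; rewrite frame_N.
  exists s2, (t2 + (t1 + 1))%N; split=> //; first exact: exec_seq e1 e2.
  by rewrite addnA leq_add2r addnC leq_add.
- move=> t a IHa b IHb h s /and3P[wt wa wb] hs hf.
  have e0 := cT_correct hs wt.
  case: ifP => ht.
    have [s1 [t1 [e1 r1 c1]]] := IHa _ _ wa hs hf.
    exists s1, (t1 + 1)%N; split=> //; first by apply: exec_if; rewrite e0 ht.
    by rewrite leq_add2r (leq_trans c1) ?leq_addr.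
  have [s1 [t1 [e1 r1 c1]]] := IHb _ _ wb hs hf.
  exists s1, (t1 + 1)%N; split=> //; first by apply: exec_if; rewrite e0 ht.
  by rewrite leq_add2r (leq_trans c1) ?leq_addl.
- move=> c i b IH h s /and5P[hc c0 wb cb b0] hs hf.
  pose g h' := setN c 0 (hN (sem b h') c 0).+1 (sem b h').
  rewrite -/g.
  set body := Seq (compile rb b) _; set W := While _ _.
  have [s0 [e0 r0]] : exists s0, exec (NPut (aN c (NConst 0)) (NConst 0)) s s0 1 /\
      rel (setN c 0 0 h) s0.
    eexists; split; first exact: exec_NPut.
    by rewrite neval_aN; apply: rel_putN.
  set m := hN h 0 i.
  (* Induction on the number [j] of rounds left. Besides its body a round costs three steps: the
     test, the unfolding of [Seq] and the increment of the counter. *)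
  suff loop : forall j h' s', (j <= m)%N -> rel h' s' -> hN h' c 0 = (m - j)%N ->
      hN h' 0 = hN h 0 ->
      exists s'' t, [/\ exec W s' s'' t, rel (iter j g h') s'' &
        (t <= 1 + j * (3 + costb f b))%N].
    have [||s1 [t1 [e1 r1 c1]]] := loop m _ _ (leqnn _) r0.
    - by rewrite /= /upd2 !eqxx subnn.
    - by rewrite /= /upd2 eq_sym (negbTE c0).
    exists s1, (t1 + (1 + 1))%N; split=> //; first exact: exec_seq e0 e1.
    have := hf i; rewrite -/m => hm.
    have : (m * (3 + costb f b) <= f i * (3 + costb f b))%N by rewrite leq_mul2r hm orbT.
    lia.
  elim=> [|j IHj] h' s' hj hs' hc' h0.
    exists s', 1%N; split=> //; apply: exec_while0.
    rewrite -[NLe _ _]/(cT rb (TN (HA (HG c (HC 0)) (HC 1)) (HG 0 (HC i)))) (cT_correct hs') /= ?hc //.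
    by rewrite hc' h0 subn0 -/m addn1 ltnn.
  have [|s1 [t1 [e1 r1 c1]]] := IH _ _ wb hs'; first by move=> i'; rewrite h0.
  have [s2 [e2 r2]] : exists s2, exec (NPut (aN c (NConst 0)) (NAdd (cN (HG c (HC 0))) (NConst 1))) s1 s2 1 /\
      rel (g h') s2.
    eexists; split; first exact: exec_NPut.
    rewrite neval_aN -[NAdd _ _]/(cN (HA (HG c (HC 0)) (HC 1))) (cN_correct r1) /= ?hc //.
    by rewrite addn1; apply: rel_putN.
  have [||s3 [t3 [e3 r3 c3]]] := IHj _ _ (ltnW hj) r2.
  - by rewrite /g /= /upd2 !eqxx /= frame_N // hc' subnSK.
  - by rewrite /g /= /upd2 eq_sym (negbTE c0) /= frame_N.
  exists s3, (t3 + ((1 + (t1 + 1)) + 1))%N; split=> //.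
  + apply: exec_whileS e3; last exact: exec_seq e1 e2.
    rewrite -[NLe _ _]/(cT rb (TN (HA (HG c (HC 0)) (HC 1)) (HG 0 (HC i)))) (cT_correct hs') /= ?hc //.
    by rewrite hc' h0 -/m; lia.
  + by rewrite iterSr.
  + by rewrite mulSn; lia.
- move=> h s _ hs hf; exists s, 1%N; split=> //; exact: exec_while0.
Qed.

End Semantics.

(** * Simulation of the given algorithm inside the decoder *)

Section Embedding.
Context {R : realType}.
Variables (ns : seq nat) (rs : seq R) (rb : nexp).
Hypothesis rbE : forall s : @state R,
  (forall i, (i < 4)%N -> nmem s i = nth 0%N ns i) -> neval s rb = size rs.

(* A program working on a memory of its own is embedded by moving its memories
   to the arrays [cM] and [cQ]; its output goes to the array [cO], the length
   of which is kept in the array [cZ].  Its coins are taken from the public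
   tape when [pubc] holds. *)
Variables (cM cZ cQ cO : nat) (pubc : bool).
Hypothesis cM64 : (cM < 64)%N.
Hypothesis cZ64 : (cZ < 64)%N.
Hypothesis cQ64 : (cQ < 64)%N.
Hypothesis cO64 : (cO < 64)%N.
Hypothesis cMZ : (cM == cZ) = false.
Hypothesis cQO : (cQ == cO) = false.

Fixpoint trN e := match e with
  | NConst c => NConst c | NGet e => NGet (aN cM (trN e))
  | NAdd e f => NAdd (trN e) (trN f) | NSub e f => NSub (trN e) (trN f) end.

Fixpoint trR e := match e with
  | RNat e => RNat (trN e) | RGet e => RGet (aR rb cQ (trN e))
  | RAdd e f => RAdd (trR e) (trR f) | RSub e f => RSub (trR e) (trR f)
  | RMul e f => RMul (trR e) (trR f) | RDiv e f => RDiv (trR e) (trR f) end.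

Definition trT b := match b with
  | NLe e f => NLe (trN e) (trN f) | RLe e f => RLe (trR e) (trR f) end.

(** The given algorithm is started with an empty public tape, from which every coin reads as
    [false]; reading a public coin therefore becomes writing 0. *)
Fixpoint tr p := match p with
  | NPut a e => NPut (aN cM (trN a)) (trN e)
  | RPut a e => RPut (aR rb cQ (trN a)) (trR e)
  | PrivateCoin a => (if pubc then PublicCoin else PrivateCoin) (aN cM (trN a))
  | PublicCoin a => NPut (aN cM (trN a)) (NConst 0)
  | Emit e => let z := aN cZ (NConst 0) in
      Seq (RPut (aR rb cO (NGet z)) (trR e)) (NPut z (NAdd (NGet z) (NConst 1)))
  | Seq p q => Seq (tr p) (tr q)
  | If b p q => If (trT b) (tr p) (tr q)
  | While b p => While (trT b) (tr p) end.

(** [h0] is the state of the host when the simulation starts. Recording what still agrees with it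
    (the other arrays, the output, the tape not in use) allows the decoder to go on with its own
    data afterwards. *)
Definition psim (h0 h : @hst R) (s : @state R) :=
  [/\ hN h cM = nmem s, hR h cQ = rmem s,
      hR h cO = nth 0 (out s), hN h cZ 0 = size (out s) &
  [/\ (if pubc then hpu h else hpr h) = private s,
      (if pubc then hpr h else hpu h) = (if pubc then hpr h0 else hpu h0),
      public s = [::] &
  [/\ hout h = hout h0,
      forall c, c != cM -> c != cZ -> hN h c = hN h0 c &
      forall c, c != cQ -> c != cO -> hR h c = hR h0 c]]].

Lemma trN_correct h0 h s sL e : psim h0 h s -> rel ns rs h sL ->
  neval sL (trN e) = neval s e.
Proof.
case=> hM _ _ _ _ [hn _ _ _ _]; elim: e => //= [e IH|e -> f ->|e -> f ->] //.
by rewrite neval_aN hn // IH hM.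
Qed.

Lemma trR_correct h0 h s sL e : psim h0 h s -> rel ns rs h sL ->
  reval sL (trR e) = reval s e.
Proof.
move=> hp hs; case: (hp) => _ hQ _ _ _; case: (hs) => _ hr _ _ _.
elim: e => //= [e|e|e -> f ->|e -> f ->|e -> f ->|e -> f ->] //.
  by rewrite (trN_correct _ hp hs).
by rewrite (neval_aR rbE _ _ hs) hr // (trN_correct _ hp hs) hQ.
Qed.

Lemma trT_correct h0 h s sL b : psim h0 h s -> rel ns rs h sL ->
  teval sL (trT b) = teval s b.
Proof.
move=> hp hs; case: b => e f /=; first by rewrite !(trN_correct _ hp hs).
by rewrite !(trR_correct _ hp hs).
Qed.

Lemma psim_putN h0 h N M pr pu o i v : psim h0 h (State N M pr pu o) ->
  psim h0 (setN cM i v h) (State (upd N i v) M pr pu o).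
Proof.
case=> /= hM hQ hO hZ [h1 h2 h3 [h4 h5 h6]]; split=> //=.
- by apply: funext => j; rewrite /upd2 /upd eqxx hM.
- by rewrite /upd2 eq_sym cMZ.
- split=> //; split=> // c c1 c2.
  by apply: funext => j; rewrite /upd2 (negbTE c1) h5.
Qed.

(** The worst case is [Emit], which takes three host steps: unfolding a sequence, writing the value
    and incrementing the length of the output. [KL] is what the host still has to run. *)
Lemma psim_step h0 h K s sL : psim h0 h s -> rel ns rs h sL ->
  exists h' sL' t, [/\ (t <= 3)%N, psim h0 h' (step (K, s)).2, rel ns rs h' sL' &
   forall KL, iter t step (map tr K ++ KL, sL) = (map tr (step (K, s)).1 ++ KL, sL')].
Proof.
move=> hp hs; case: (hs) => hn hr hi hin [hpr' hpu' ho].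
have eN e := trN_correct e hp hs; have eR e := trR_correct e hp hs.
have eT e := trT_correct e hp hs.
case: s hp eN eR eT => N M pr pu o hp eN eR eT.
case: K => [|[a e|a e|a|a|e|p q|b p q|b p] K].
- by exists h, sL, 0%N.
- exists (setN cM (neval sL (trN a)) (neval sL (trN e)) h); eexists; exists 1%N.
  split=> //; last by move=> KL; exact: exec_NPut.
    by rewrite !eN; apply: psim_putN.
  by rewrite neval_aN; apply: rel_putN.
- exists (setR cQ (neval sL (trN a)) (reval sL (trR e)) h); eexists; exists 1%N.
  split=> //; last by move=> KL; exact: exec_RPut.
    case: hp => /= hM hQ hO hZ [h1 h2 h3 [h4 h5 h6]]; split=> //=.
    + by apply: funext => j; rewrite /upd2 /upd eqxx hQ eN eR.
    + by apply: funext => j; rewrite /upd2 eq_sym cQO hO.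
    + split=> //; split=> // c c1 c2.
      by apply: funext => j; rewrite /upd2 (negbTE c1) h6.
  by rewrite (neval_aR rbE _ _ hs); apply: rel_putR.
- have hp1 := psim_putN (neval sL (trN a)) (head false pr) hp.
  case: (hp) => /= _ _ _ _ [h1 _ _ _].
  have hs1 := rel_putN (neval sL (trN a)) (head false pr) hs cM64.
  case hpc : pubc h1 => h1.
    exists (HSt (hN (setN cM (neval sL (trN a)) (head false pr) h)) (hR h) (hpr h) (behead (hpu h)) (hout h)).
    eexists; exists 1%N; split=> //=; last by move=> KL; rewrite /= ?hpc; exact: exec_PublicCoin.
      have [/= hM hQ hO hZ [k1 k2 k3 [k4 k5 k6]]] := hp1; rewrite hpc in k2.
      by rewrite -eN; split=> //=; rewrite hpc; split=> //; rewrite h1.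
    rewrite neval_aN hpu' h1; case: hs1 => /= k1 k2 k3 k4 [k5 k6 k7].
    by split=> //=; rewrite hpr' ho.
  exists (HSt (hN (setN cM (neval sL (trN a)) (head false pr) h)) (hR h) (behead (hpr h)) (hpu h) (hout h)).
  eexists; exists 1%N; split=> //=; last by move=> KL; rewrite /= ?hpc; exact: exec_PrivateCoin.
    have [/= hM hQ hO hZ [k1 k2 k3 [k4 k5 k6]]] := hp1; rewrite hpc in k2.
    by rewrite -eN; split=> //=; rewrite hpc; split=> //; rewrite h1.
  rewrite neval_aN hpr' h1; case: hs1 => /= k1 k2 k3 k4 [k5 k6 k7].
  by split=> //=; rewrite hpu' ho.
- exists (setN cM (neval sL (trN a)) 0 h); eexists; exists 1%N.
  split=> //; last by move=> KL; exact: exec_NPut.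
    have epu : pu = [::] by case: hp => /= _ _ _ _ [].
    by subst pu; rewrite eN; exact: psim_putN.
  by rewrite neval_aN; apply: rel_putN.
- case: (hp) => /= hM hQ hO hZ [h1 h2 h3 [h4 h5 h6]].
  exists (setN cZ 0 (size o).+1 (setR cO (size o) (reval sL (trR e)) h)).
  have r1 := rel_putR (size o) (reval sL (trR e)) hs cO64.
  have r2 := rel_putN 0 (size o).+1 r1 cZ64.
  eexists; exists 3%N; split; [by []| |exact: r2|].
    split=> //=.
    + by apply: funext => j; rewrite /upd2 cMZ hM.
    + by apply: funext => j; rewrite /upd2 cQO hQ.
    + apply: funext => j; rewrite /upd2 eqxx hO eR nth_rcons /=.
      by case: ltngtP => // jo; rewrite nth_default // ltnW.
    + by rewrite /upd2 !eqxx size_rcons.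
    + split=> //; split=> // c c1 c2; apply: funext => j; rewrite /upd2.
        by rewrite (negbTE c2) h5.
      by rewrite (negbTE c2) h6.
  move=> KL.
  have := exec_seq (exec_RPut (aR rb cO (NGet (aN cZ (NConst 0)))) (trR e) (sL))
    (exec_NPut (aN cZ (NConst 0)) (NAdd (NGet (aN cZ (NConst 0))) (NConst 1)) _).
  move=> /(_ (map tr K ++ KL)) -> /=; congr (_, _).
  by rewrite !(neval_aN, neval_aR rbE _ _ hs) /= !neval_aN /= !hn // hZ addn1.
- by exists h, sL, 1%N; split=> // KL; case: sL {hs hn hr hi hin hpr' hpu' ho eN eR eT}.
- exists h, sL, 1%N; split=> // KL /=.
  by rewrite -eT; case: (sL) => *; case: ifP.
- exists h, sL, 1%N; split=> // KL /=.
  by rewrite -eT; case: (sL) => *; case: ifP.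
Qed.

Lemma psim_iter h0 T h K s sL : psim h0 h s -> rel ns rs h sL ->
  exists h' sL' t, [/\ (t <= 3 * T)%N, psim h0 h' (iter T step (K, s)).2, rel ns rs h' sL' &
   forall KL, iter t step (map tr K ++ KL, sL) = (map tr (iter T step (K, s)).1 ++ KL, sL')].
Proof.
move=> hp hs; elim: T => [|T [h1 [s1 [t1 [b1 p1 r1 e1]]]]] /=.
  by exists h, sL, 0%N.
case e: (iter T step (K, s)) p1 e1 => [K' s'] p1 e1.
have [h2 [s2 [t2 [b2 p2 r2 e2]]]] := psim_step K' p1 r1.
exists h2, s2, (t2 + t1)%N; split=> //; first by rewrite mulnS leq_add.
by move=> KL; rewrite iterD e1 e2.
Qed.

Lemma embed_correct p T s h sL : halts T p s -> psim h h s -> rel ns rs h sL ->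
  exists h' sL' t, [/\ exec (tr p) sL sL' t, (t <= 3 * T)%N, rel ns rs h' sL' &
    psim h h' (run T p s).2].
Proof.
move=> hh hp hs; have [h1 [s1 [t1 [b1 p1 r1 e1]]]] := psim_iter T [:: p] hp hs.
exists h1, s1, t1; split=> // KL; rewrite (e1 KL).
by move: hh; rewrite /halts /run /nilp; case: (iter _ _ _).1.
Qed.

End Embedding.

(** * Runs on a longer coin tape *)

Section Tapes.
Context {R : realType}.

Definition add_tape (r : seq bool) (s : @state R) :=
  State (nmem s) (rmem s) (private s ++ r) (public s) (out s).

(** At most [t] coins are read in [t] steps, so later coins are merely carried along. The given
    algorithm is specified on tapes whose length is its own time bound, whereas the protocol hands
    it longer ones. *)
Lemma iter_add_tape r t K s : (t <= size (private s))%N ->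
  iter t step (K, add_tape r s) = ((iter t step (K, s)).1, add_tape r (iter t step (K, s)).2).
Proof.
elim: t K s => [//|t IH] K s ht; rewrite !iterSr.
have e : step (K, add_tape r s) = ((step (K, s)).1, add_tape r (step (K, s)).2).
  have nE s' e : neval (add_tape r s') e = neval s' e.
    by elim: e => //= [e ->|e -> f ->|e -> f ->].
  have rE s' e : reval (add_tape r s') e = reval s' e.
    by elim: e => //= [e|e|e -> f ->|e -> f ->|e -> f ->|e -> f ->] //; rewrite nE.
  have tE s' b : teval (add_tape r s') b = teval s' b by case: b => e f /=; rewrite ?nE ?rE.
  case: s ht => N M pr pu o /= ht.
  have nE' e : neval (State N M (pr ++ r) pu o) e = neval (State N M pr pu o) e.
    by rewrite -(nE (State N M pr pu o)).
  have rE' e : reval (State N M (pr ++ r) pu o) e = reval (State N M pr pu o) e.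
    by rewrite -(rE (State N M pr pu o)).
  have tE' e : teval (State N M (pr ++ r) pu o) e = teval (State N M pr pu o) e.
    by rewrite -(tE (State N M pr pu o)).
  case: K => [|[a e|a e|a|a|e|p q|b p q|b p] K] //=; rewrite ?nE' ?rE' ?tE' //=.
  by case: pr ht {nE' rE' tE'}.
rewrite e; case E: (step (K, s)) => [K' s'] /=.
apply: IH; move: E ht; case: s {e} => N M pr pu o /=.
case: K => [|[a e|a e|a|a|e|p q|b p q|b p] K] //= [_ <-] /=; rewrite ?size_behead; lia.
Qed.

Lemma run_add_tape r T p s : (T <= size (private s))%N ->
  run T p (add_tape r s) = ((run T p s).1, add_tape r (run T p s).2).
Proof. exact: iter_add_tape. Qed.

End Tapes.

(** * The parameters of the protocol and their computation *)

Section Sizes.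
Variables (c0 G : nat).

Section Values.
Variables (n d k : nat).
(** [c0] and [G] are fixed at the end of the proof: [c0] makes all failure probabilities small, and
    [G] exceeds the exponent in the bound on the number of cells close to a center. *)
Definition pq := (c0 * (up_log 2 k + 1))%N.
Definition pen := up_log 2 n.
Definition pH0 := (pq * (pen + 1))%N.
Definition pm := up_log 2 pH0.
(** The depth is rounded up to a power of two so that [pm] fair coins draw a level exactly
    uniformly. *)
Definition pH := (2 ^ pm)%N.
(** Chosen so that [2 ^ pm2] is at least [16 * n * n], a granularity at which rounding the bias of a
    report harms neither privacy nor accuracy. *)
Definition pm2 := (2 * pen + 4)%N.
Definition pGam := (2 ^ (G * pq) * pH)%N.
Definition pV := (2 ^ pm2)%N.
(** Cell [i] of array 0 will hold the [i]-th entry. Entry 13 is a place reserved for the number of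
    synthetic points, which is unknown until the tree has been built. *)
Definition plist := [:: n; d; k; pq; pen; pH0; pm; pH; pm2; (d + 1)%N; (G * pq)%N;
  pGam; (2 * pGam)%N; 0%N; pV; (d + pH + 3)%N].
End Values.

Notation Sc c := (HG c (HC 0)).
Notation Pa i := (HG 0 (HC i)).

Definition PLog i := CSeq (CN 5 (HC 0) (HC 0)) (CSeq (CN 6 (HC 0) (HC 1))
  (CFor 1 i (CIf (TN (HA (Sc 6) (HC 1)) (Pa i))
     (CSeq (CN 6 (HC 0) (HA (Sc 6) (Sc 6))) (CN 5 (HC 0) (HA (Sc 5) (HC 1)))) CSkip))).
Definition PMul i e := CSeq (CN 6 (HC 0) (HC 0)) (CFor 1 i (CN 6 (HC 0) (HA (Sc 6) e))).
Definition PDbl i e := CSeq (CN 6 (HC 0) e) (CFor 1 i (CN 6 (HC 0) (HA (Sc 6) (Sc 6)))).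

Definition stages : seq (cmd * hnat) := [::
  (CSkip, HI 0); (CSkip, HI 1); (CSkip, HI 2);
  (PLog 2, HK c0 (HA (Sc 5) (HC 1))); (PLog 0, Sc 5);
  (PMul 3 (HA (Pa 4) (HC 1)), Sc 6); (PLog 5, Sc 5); (CSkip, Sc 6);
  (CSkip, HA (HK 2 (Pa 4)) (HC 4)); (CSkip, HA (Pa 1) (HC 1)); (CSkip, HK G (Pa 3));
  (PDbl 10 (Pa 7), Sc 6); (CSkip, HK 2 (Pa 11)); (CSkip, HC 0);
  (PDbl 8 (HC 1), Sc 6); (CSkip, HA (HA (Pa 1) (Pa 7)) (HC 3))].

Definition stage_cmd j := CSeq (nth (CSkip, HC 0) stages j).1
  (CN 0 (HC j) (nth (CSkip, HC 0) stages j).2).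

Definition param_cmds := [seq stage_cmd j | j <- iota 0 16].

Context {R : realType}.
Variables (ns : seq nat) (rs : seq R).
Local Notation sem := (sem ns rs).
Local Notation hst := (@hst R).
Local Notation evN := (evN ns).

(** The only loop bound at hand is the argument itself, so the loop idles once the power of two has
    reached it. That power remains in cell 6, from where a later stage takes it. *)
Lemma PLogP i (h : hst) : hN (sem (PLog i) h) 5 0 = up_log 2 (hN h 0 i) /\
  hN (sem (PLog i) h) 6 0 = (2 ^ up_log 2 (hN h 0 i))%N.
Proof.
set v := hN h 0 i; rewrite /PLog !sem_seq !sem_CN.
set b := CIf _ _ _; set h0 := setN 6 _ _ _.
(* If the power is still below [v], all [j] rounds have doubled it; for [j = v] this contradicts
   [v < 2 ^ v]. The last clause says that the latest doubling was necessary, which gives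
   minimality. *)
pose I j (h' : hst) := [/\ hN h' 6 0 = (2 ^ hN h' 5 0)%N,
  (hN h' 6 0 < v)%N ==> (hN h' 5 0 == j) & (hN h' 5 0 == 0) || (2 ^ (hN h' 5 0).-1 < v)%N].
suff [h1 h2 h3] : I v (sem (CFor 1 i b) h0).
  rewrite h1; suff -> : hN (sem (CFor 1 i b) h0) 5 0 = up_log 2 v by [].
  set e := hN _ 5 0 in h1 h2 h3 *.
  have hv : (v <= 2 ^ e)%N.
    rewrite leqNgt -h1; apply/negP => lt; move: h2; rewrite lt /= => /eqP ev.
    by move: lt; rewrite h1 ev ltnNge ltnW // ltn_expl.
  have aux w : (w <= 2 ^ 0)%N -> 0%N = up_log 2 w by case: w => [|[|]].
  case: (posnP e) h3 hv => [-> _|e0]; first exact: aux.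
  rewrite /= => h3 hv.
  rewrite -(prednK e0); apply/esym; apply: up_log_eq => //.
  by rewrite prednK // h3 hv.
apply: (for_ind (I := I)) => // [|j h' hj [i1 i2 i3] hc hfr _].
  by split=> //=; rewrite /upd2 //= implybT.
have e0 : hN h' 0 i = v by rewrite hfr.
rewrite /b /= e0 /I; case: ifP => hlt /=; rewrite /upd2 /=.
  split; first by rewrite addn1 expnS i1; lia.
    rewrite addn1 in hlt; move: i2; rewrite hlt /= => /eqP ->; rewrite addn1 eqxx.
    by rewrite implybT.
  by rewrite addn1 /= -i1; rewrite addn1 in hlt; rewrite hlt.
split=> //; move: hlt; rewrite addn1 => ->; by [].
Qed.

Lemma PMulP i e (h : hst) w : (forall h' : hst, hN h' 0 = hN h 0 -> evN h' e = w) ->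
  hN (sem (PMul i e) h) 6 0 = (hN h 0 i * w)%N.
Proof.
move=> he; rewrite /PMul !sem_seq sem_CN.
set b := CN _ _ _; set h0 := setN 6 _ _ _.
pose I j (h' : hst) := hN h' 6 0 = (j * w)%N.
suff : I (hN h 0 i) (sem (CFor 1 i b) h0) by [].
apply: (for_ind (I := I)) => // j h' hj i1 hc hfr _.
by rewrite /b /I /= /upd2 /= i1 he ?hfr // addnC mulSn.
Qed.

Lemma PDblP i e (h : hst) w : evN h e = w ->
  hN (sem (PDbl i e) h) 6 0 = (2 ^ hN h 0 i * w)%N.
Proof.
move=> he; rewrite /PDbl !sem_seq sem_CN he.
set b := CN _ _ _; set h0 := setN 6 _ _ _.
pose I j (h' : hst) := hN h' 6 0 = (2 ^ j * w)%N.
suff : I (hN h 0 i) (sem (CFor 1 i b) h0) by [].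
apply: (for_ind (I := I)) => // [|j h' hj i1 hc hfr _].
  by rewrite /I /= /upd2 /= mul1n.
by rewrite /b /I /= /upd2 /= i1 expnS; lia.
Qed.

Lemma stage_frame j (h : hst) : (j < 16)%N -> let a := (nth (CSkip, HC 0) stages j).1 in
  [/\ 0%N \notin wN a, forall c, c \notin [:: 0; 1; 5; 6]%N -> c \notin wN a,
      wR a = [::] & hR (sem a h) = hR h].
Proof.
have lf i b : (forall h' : hst, hR (sem b h') = hR h') ->
    forall h' : hst, hR (sem (CFor 1 i b) h') = hR h'.
  by move=> hb h' /=; elim: (hN h' 0 i) => //= m <-; rewrite hb.
have hlog i : hR (sem (PLog i) h) = hR h.
  by rewrite /PLog !sem_seq !sem_CN lf //= => h''; case: ifP.
have hmul i e : hR (sem (PMul i e) h) = hR h.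
  by rewrite /PMul !sem_seq ?sem_CN lf.
have hdbl i e : hR (sem (PDbl i e) h) = hR h.
  by rewrite /PDbl !sem_seq ?sem_CN lf.
do 16?[case: j => [|j]] => // _; split=> //;
  try (by move=> c; rewrite /= ?inE !negb_or => /and4P[_ h1 h5 h6]; rewrite ?h1 ?h5 ?h6);
  by [exact: hlog|exact: hmul|exact: hdbl].
Qed.

Variables (n d k : nat).
Hypothesis ns0 : nth 0%N ns 0 = n.
Hypothesis ns1 : nth 0%N ns 1 = d.
Hypothesis ns2 : nth 0%N ns 2 = k.
Local Notation pl := (plist n d k).

(** The final clause serves [pH]: the stage computing its logarithm leaves the power itself in cell
    6, and the next stage stores it without any computation. *)
Definition pstate pr pu j (h : hst) :=
  [/\ hN h 0 =1 nth 0%N (take j pl),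
      forall c, c \notin [:: 0; 1; 5; 6]%N -> forall i, hN h c i = 0%N,
      forall c i, hR h c i = 0 &
  [/\ hpr h = pr, hpu h = pu & hout h = [::]]] /\
  (7 <= j -> j <= 8 -> hN h 6 0 = pH n k)%N.

Lemma stage_step pr pu j h : (j < 16)%N -> pstate pr pu j h ->
  pstate pr pu j.+1 (sem (stage_cmd j) h).
Proof.
move=> hj [[hp hz hr [hpr' hpu' ho]] h7].
set a := (nth (CSkip, HC 0) stages j).1.
have P i : (i < j)%N -> hN h 0 i = nth 0%N pl i by move=> ij; rewrite hp nth_take.
have [w0 w1 wr fR] := stage_frame h hj; rewrite -/a in w0 w1 wr fR.
have key : evN (sem a h) (nth (CSkip, HC 0) stages j).2 = nth 0%N pl j.
  move: hj P h7; rewrite /a; clear hp a w0 w1 wr fR.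
  do 16?[case: j => [|j]] => // _ P h7; rewrite /stages; cbn [nth fst snd Submission.evN].
  - by have [-> _] := PLogP 2 h; rewrite P.
  - by have [-> _] := PLogP 0 h; rewrite P.
  - rewrite (@PMulP _ _ _ (pen n + 1)%N) ?P // => h' e /=.
    by rewrite e P.
  - by have [-> _] := PLogP 5 h; rewrite P.
  - by rewrite h7.
  - by rewrite [sem _ _]/= P.
  - by rewrite [sem _ _]/= P.
  - by rewrite [sem _ _]/= P.
  - by rewrite (@PDblP _ _ _ (pH n k)) ?P //; apply: P.
  - by rewrite [sem _ _]/= P.
  - by rewrite (@PDblP _ _ _ 1%N) // P // muln1.
  - by rewrite [sem _ _]/= !P.
rewrite /stage_cmd -/a sem_seq sem_CN; split; last first.
  move: hj h7 P; rewrite /a; clear hp a w0 w1 wr fR key.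
  do 16?[case: j => [|j]] => //= _ h7 P _ _.
  by rewrite /upd2 /=; move: (PLogP 5 h) => [_ ->]; rewrite P.
split=> [i|c hc i|c i|].
- have esz : size (take j pl) = j by rewrite size_takel // ltnW.
  rewrite [hN _ _ _]/= /upd2 eqxx (take_nth 0%N) // nth_rcons esz /= key.
  case: (ltngtP i j) => // ij; rewrite frame_N // hp // nth_default // esz.
  exact: ltnW.
- rewrite [hN _ _ _]/= /upd2 ifF /= ?frame_N ?hz ?w1 //.
  by move: hc; rewrite inE negb_or => /andP[/negbTE ->].
- by rewrite [hR _ _ _]/= fR hr.
- by rewrite [hpr _]/= [hpu _]/= [hout _]/= frame_pr ?frame_pu ?frame_out ?wr.
Qed.

Lemma stages_wf j : (j < 16)%N -> wfc (stage_cmd j).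
Proof. by do 16?[case: j => [|j]]. Qed.

End Sizes.

Section Stages.
Context {R : realType}.
Variables (ns : seq nat) (rs : seq R) (rb : nexp).
Hypothesis rbE : forall s : @state R,
  (forall i, (i < 4)%N -> nmem s i = nth 0%N ns i) -> neval s rb = size rs.

Definition compile_all cs := foldr (fun c => Seq (compile rb c)) (compile rb CSkip) cs.
Definition sem_all cs (h : @hst R) := foldl (fun h c => sem ns rs c h) h cs.
Definition cost_all M cs := foldr (fun c a => (costb (fun=> M) c + a + 1)%N) 1%N cs.

Lemma cost_all_poly cs : exists K, forall M, (cost_all M cs <= (M + 2) ^ K)%N.
Proof.
suff [c hc] : exists c, forall M, cost_all M cs = costb (fun=> M) c.
  by have [K hK] := costb_poly c; exists K => M; rewrite hc.
exists (foldr CSeq CSkip cs) => M.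
by elim: cs => //= c cs ->.
Qed.

(** Each stage adds a loop bound to array 0, so the bound [M] is required anew before every command
    of the list. *)
Fixpoint bounded M cs (h : @hst R) := if cs is c :: cs' then
  [/\ wfc c, forall i, (hN h 0 i <= M)%N & bounded M cs' (sem ns rs c h)] else True.

Lemma compile_all_correct M cs h s : bounded M cs h -> rel ns rs h s ->
  exists s' t, [/\ exec (compile_all cs) s s' t, rel ns rs (sem_all cs h) s' &
    (t <= cost_all M cs)%N].
Proof.
elim: cs h s => [|c cs IH] h s /=.
  by move=> _ hs; exists s, 1%N; split=> //; exact: exec_while0.
case=> wf hM hb hs.
have [s1 [t1 [e1 r1 b1]]] := compile_correct rbE wf hs hM.
have [s2 [t2 [e2 r2 b2]]] := IH _ _ hb r1.
exists s2, (t2 + (t1 + 1))%N; split=> //; first exact: exec_seq e1 e2.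
by rewrite addnA leq_add2r addnC leq_add.
Qed.

Lemma bounded_cat M cs1 cs2 h :
  bounded M cs1 h -> bounded M cs2 (sem_all cs1 h) -> bounded M (cs1 ++ cs2) h.
Proof. by elim: cs1 h => //= c cs IH h [? ? ?] ?; split=> //; apply: IH. Qed.

Lemma sem_all_cat cs1 cs2 h : sem_all (cs1 ++ cs2) h = sem_all cs2 (sem_all cs1 h).
Proof. exact: foldl_cat. Qed.

Variables (c0 G n d k : nat).
Hypothesis ns0 : nth 0%N ns 0 = n.
Hypothesis ns1 : nth 0%N ns 1 = d.
Hypothesis ns2 : nth 0%N ns 2 = k.

Lemma params_correct M pr pu : (forall x, x \in plist c0 G n d k -> (x <= M)%N) ->
  bounded M (param_cmds c0 G) (hinit pr pu) /\
  pstate c0 G n d k pr pu 16 (sem_all (param_cmds c0 G) (hinit pr pu)).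
Proof.
move=> hM.
suff gen j h : (j <= 16)%N -> pstate c0 G n d k pr pu j h ->
    bounded M [seq stage_cmd c0 G i | i <- iota j (16 - j)] h /\
    pstate c0 G n d k pr pu 16 (sem_all [seq stage_cmd c0 G i | i <- iota j (16 - j)] h).
  apply: (gen 0%N) => //; split=> //; split=> // i.
  by rewrite /= nth_nil.
move e : (16 - j)%N => r; elim: r j e h => [|r IH] j' e h hj hp /=.
  by move: hp; have -> : j' = 16%N by lia.
have hj' : (j' < 16)%N by lia.
have [] := IH j'.+1 _ (sem ns rs (stage_cmd c0 G j') h) hj'; [lia|exact: stage_step|].
move=> hb hs; split=> //; split=> //; first exact: stages_wf.
move=> i; case: hp => [[-> _ _ _] _].
have [ij|ij] := ltnP i (size (take j' (plist c0 G n d k))); last by rewrite nth_default.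
by apply: hM; apply: mem_take; apply: mem_nth ij.
Qed.

End Stages.

(** * The encoder *)

Notation Sc c := (HG c (HC 0)).
Notation Pa i := (HG 0 (HC i)).
Notation Re c := (QG c (HC 0)).
Notation "a ;; b" := (CSeq a b) (at level 90, right associativity).

Section EncoderSpec.
Context {R : realType}.

Definition sg (b : bool) : R := if b then 1 else -1.
Definition rad (w : seq bool) (xs : seq R) : R :=
  \sum_(j < size xs) sg (nth false w j) * xs`_j.
Definition bits2nat (w : seq bool) : nat := foldl (fun t b => (t + t + nat_of_bool b)%N) 0%N w.
Definition seg (o l : nat) (w : seq bool) : seq bool := mkseq (fun j => nth false w (o + j)) l.
Definition clip (B y : R) : R := if B <= y then B else if y <= - B then - B else y.

(** Binary expansion by the doubling map. The map sends the closed unit interval to itself and fixes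
    1, whose digits are therefore all 1. *)
Fixpoint zrem (z : R) l : R :=
  if l is l.+1 then let y := zrem z l in
    if 1 / 2 <= y then 2 * y - 1 else 2 * y else z.
Definition bitz z l : bool := 1 / 2 <= zrem z l.

Definition chi (s : seq bool) (v : nat -> bool) l : R :=
  \prod_(b < l) (if nth false s b && v b then -1 else 1).

(** The bias of a report is [eps] (at most 1) over 16. It is cut to 0 when [eps * n < 1], where the
    rounding of the bias could no longer be hidden behind [eps]; the permitted error is then at
    least of order [n], and an uninformative bit is good enough. *)
Definition acoef (eps : R) (n : nat) : R :=
  if 1 <= eps * n%:R then (if eps <= 1 then eps / 16 else 1 / 16) else 0.

Section Fixed.
Variables (c0 G n d k : nat) (eps : R).
Local Notation q := (pq c0 k).
Local Notation H := (pH c0 n k).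
(** Used both as half the side of the box that contains all projected points and as clipping level
    for the product of [u] with [(1, x)]. As [expR Bnd] is at least [n * q], sub-Gaussian tails
    beyond [Bnd] are negligible. *)
Definition Bnd : R := (q + pen n)%:R.

Definition pz (pub : seq bool) (xs : seq R) a : R :=
  (rad (drop (a * size xs) pub) xs + Bnd) / (2 * Bnd).
Definition path pub xs b : bool := bitz (pz pub xs (b %% q)) (b %/ q).

(** Comparing a uniform integer below [pV n] with this real number imitates a coin of real bias up
    to [1 / pV n]. *)
Definition threshold pub xs t u s : R := (pV n)%:R *
  (1 / 2 + acoef eps n * (clip Bnd (rad u (1 :: xs)) * chi s (path pub xs) (t + 1)) / Bnd).

Definition encout (xs : seq R) (pub w : seq bool) : seq R :=
  let t := bits2nat (seg 0 (pm c0 n k) w) in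
  let u := seg (pm c0 n k) (d + 1) w in
  let s := seg (pm c0 n k + (d + 1)) H w in
  let U := bits2nat (seg (pm c0 n k + (d + 1) + H) (pm2 n) w) in
  t%:R :: [seq sg b | b <- u] ++ [seq (nat_of_bool b)%:R | b <- s] ++
    [:: sg ((U + 1)%:R <= threshold pub xs t u s)].
End Fixed.

End EncoderSpec.

Definition QB : hreal := QN (HA (Pa 3) (Pa 4)).
Definition Qm1 : hreal := QS (QN (HC 0)) (QN (HC 1)).
Definition Qhalf : hreal := QD (QN (HC 1)) (QN (HC 2)).

Definition enc_proj_in := CPub 7 (HC 0) ;; CIf (TN (HC 1) (Sc 7))
    (CR 1 (HC 0) (QA (Re 1) (QI (HA (Sc 2) (HC 1)))))
    (CR 1 (HC 0) (QS (Re 1) (QI (HA (Sc 2) (HC 1))))).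
Definition enc_proj_body := CR 1 (HC 0) (QN (HC 0)) ;; CFor 2 1 enc_proj_in ;;
  CR 0 (Sc 1) (QD (QA (Re 1) QB) (QM (QN (HC 2)) QB)).
Definition enc_proj := CFor 1 3 enc_proj_body.
Definition enc_bits c i := CN c (HC 0) (HC 0) ;;
  CFor 1 i (CPriv 7 (HC 0) ;; CN c (HC 0) (HA (HA (Sc c) (Sc c)) (Sc 7))).
Definition enc_sign_body := CPriv 7 (HC 0) ;; CIf (TN (HC 1) (Sc 7))
    (CR 2 (HC 0) (QA (Re 2) (QI (HA (Sc 1) (HC 1)))) ;; CEmit (QN (HC 1)))
    (CR 2 (HC 0) (QS (Re 2) (QI (HA (Sc 1) (HC 1)))) ;; CEmit Qm1).
Definition enc_sign := (CPriv 7 (HC 0) ;; CIf (TN (HC 1) (Sc 7))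
    (CR 2 (HC 0) (QN (HC 1)) ;; CEmit (QN (HC 1))) (CR 2 (HC 0) Qm1 ;; CEmit Qm1)) ;;
  CFor 1 1 enc_sign_body.
Definition enc_clip := CIf (TR QB (Re 2)) (CR 2 (HC 0) QB)
  (CIf (TR (Re 2) (QS (QN (HC 0)) QB)) (CR 2 (HC 0) (QS (QN (HC 0)) QB)) CSkip).
(** Real array 0 holds the current remainders, so that reading a digit and doubling are done in
    place. Cell 9 runs cyclically through the coordinates, which replaces a division by [q], and the
    character is accumulated as the sign of real cell 2. *)
Definition enc_path_body := CPriv 7 (HC 0) ;; CEmit (QN (Sc 7)) ;;
  CIf (TR Qhalf (QG 0 (Sc 9)))
    (CR 0 (Sc 9) (QS (QM (QN (HC 2)) (QG 0 (Sc 9))) (QN (HC 1))) ;;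
     CIf (TN (Sc 1) (Sc 8)) (CIf (TN (HC 1) (Sc 7)) (CR 2 (HC 0) (QS (QN (HC 0)) (Re 2))) CSkip) CSkip)
    (CR 0 (Sc 9) (QM (QN (HC 2)) (QG 0 (Sc 9)))) ;;
  CN 9 (HC 0) (HA (Sc 9) (HC 1)) ;;
  CIf (TN (Pa 3) (Sc 9)) (CN 9 (HC 0) (HC 0)) CSkip.
Definition enc_path := CN 9 (HC 0) (HC 0) ;; CFor 1 7 enc_path_body.
Definition set_acoef := CIf (TR (QN (HC 1)) (QM (QI (HC 0)) (QN (Pa 0))))
  (CIf (TR (QI (HC 0)) (QN (HC 1))) (CR 4 (HC 0) (QD (QI (HC 0)) (QN (HC 16))))
     (CR 4 (HC 0) (QD (QN (HC 1)) (QN (HC 16)))))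
  (CR 4 (HC 0) (QN (HC 0))).
Definition enc_report := CIf (TR (QN (HA (Sc 10) (HC 1)))
    (QM (QN (Pa 14)) (QA Qhalf (QD (QM (Re 4) (Re 2)) QB))))
  (CEmit (QN (HC 1))) (CEmit Qm1).
Definition enc_main := enc_proj ;; enc_bits 8 6 ;; CEmit (QN (Sc 8)) ;; enc_sign ;;
  enc_clip ;; enc_path ;; enc_bits 10 8 ;; set_acoef ;; enc_report.

Section EncoderCorrect.
Context {R : realType}.
Variables (c0 G n d k : nat) (eps : R) (xs : seq R).
Hypothesis sxs : size xs = d.
Let rs := eps :: xs.
Let ns := [:: n; d; k].
Local Notation q := (pq c0 k).
Local Notation H := (pH c0 n k).
Local Notation sem := (sem ns rs).
Local Notation pl := (plist c0 G n d k).
Local Notation Bnd := (@Bnd R c0 n k).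
Implicit Types h : @hst R.

Lemma head_drop i (w : seq bool) : head false (drop i w) = nth false w i.
Proof. by rewrite -nth0 nth_drop addn0. Qed.

Lemma behead_drop i (w : seq bool) : behead (drop i w) = drop i.+1 w.
Proof. by elim: w i => [|b w IH] [|i] //=; rewrite ?drop0. Qed.

Lemma upd2E (T : Type) (f : nat -> nat -> T) c i v c' i' :
  upd2 f c i v c' i' = if (c' == c) && (i' == i) then v else f c' i'.
Proof. by []. Qed.

Lemma input_xs h i : (i < d)%N -> input rs h i.+1 = xs`_i.
Proof. by move=> hi; rewrite /input [size _]/= ltnS sxs hi. Qed.

Lemma enc_projP h pub : hN h 0 =1 nth 0%N pl -> hpu h = pub ->
  (forall a, (a < q)%N -> hR (sem enc_proj h) 0 a = pz c0 n k pub xs a) /\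
  hpu (sem enc_proj h) = drop (q * d) pub.
Proof.
move=> hp hu.
pose I a h' := (forall a', (a' < a)%N -> hR h' 0 a' = pz c0 n k pub xs a') /\
  hpu h' = drop (a * d) pub.
have q3 : hN h 0 3 = q by rewrite hp.
rewrite -q3; apply: (for_ind (I := I)) => // [|a h' ha [i1 i2] hc hf _].
  by split=> //=; rewrite mul0n drop0.
have hp' : hN h' 0 = hN h 0 by rewrite hf.
rewrite /enc_proj_body !sem_seq [X in Submission.sem _ _ (CFor _ _ _) X]sem_CR.
set h1 := setR _ _ _ h'.
pose J j h'' := hR h'' 1 0 = \sum_(i < j) sg (nth false pub (a * d + i)) * xs`_i /\
  hpu h'' = drop (a * d + j) pub.
have d1 : hN h1 0 1 = d by rewrite /= hp' hp.
set h2 := Submission.sem _ _ (CFor _ _ _) _.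
have [j1 j2] : J d h2.
  rewrite -d1; apply: (for_ind (I := J)) => // [|j h'' hj [k1 k2] kc kf _].
    by split=> /=; rewrite ?big_ord0 ?addn0.
  rewrite d1 in hj; rewrite /enc_proj_in !sem_seq sem_if [Submission.sem _ _ (CPub _ _) _]/=.
  rewrite k2 head_drop behead_drop /J big_ord_recr /= addnS -k1 upd2E /=.
  by case: (nth false pub _); rewrite /= !upd2E /= kc addn0 input_xs // /sg ?mul1r ?mulN1r ?addnS.
have r0 : hR h2 0 = hR h' 0 by rewrite frame_R.
have n1 : hN h2 1 0 = a by rewrite frame_N.
have n0 : hN h2 0 = hN h 0 by rewrite frame_N.
split=> [a'|]; last by rewrite /= j2 mulSn addnC.
rewrite ltnS /= upd2E /= n1 => ha'; case: eqP => [->|/eqP ne].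
  rewrite /pz /rad sxs j1 /= n0 !hp; congr ((_ + _) / _).
  by apply: eq_bigr => i _; rewrite nth_drop.
by rewrite r0 i1 // ltn_neqAle ne.
Qed.

Lemma enc_bitsP c i h l w : (1 < c)%N -> (c < 64)%N -> c != 7%N -> hN h 0 i = l -> hpr h = w ->
  hN (sem (enc_bits c i) h) c 0 = bits2nat (seg 0 l w) /\
  hpr (sem (enc_bits c i) h) = drop l w.
Proof.
move=> hc c64 c7 hl hw; rewrite /enc_bits sem_seq sem_CN; set h0 := setN _ _ _ _.
have c1 : (c == 1)%N = false by apply/negbTE; lia.
have c7' : (c == 7)%N = false by apply/negbTE.
have c0' : (c == 0)%N = false by apply/negbTE; lia.
pose I j h' := hN h' c 0 = bits2nat (seg 0 j w) /\ hpr h' = drop j w.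
have e0 : hN h0 0 i = l by rewrite /h0 /= upd2E eq_sym c0'.
rewrite -e0; apply: (for_ind (I := I)) => // [||j h' hj [i1 i2] hc' hf _].
- rewrite /= !inE; have [-> ->] : (0 == c)%N = false /\ (1 == c)%N = false by split; apply/negbTE; lia.
  by [].
- by split=> //=; rewrite ?upd2E ?c1 ?eqxx ?drop0.
split; rewrite /= ?upd2E ?c1 ?eqxx /= ?c7' /= ?i1 i2 ?head_drop ?behead_drop //.
by rewrite /seg /mkseq -addn1 iotaD map_cat /bits2nat foldl_cat.
Qed.

Lemma seg_cons o l (w : seq bool) : seg o l.+1 w = nth false w o :: seg o.+1 l w.
Proof.
rewrite /seg /mkseq /= addn0; congr (_ :: _).
rewrite -[1%N]/(1 + 0)%N iotaDl -map_comp; apply: eq_map => j /=.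
by rewrite add1n addnS.
Qed.

Lemma seg_rcons o l (w : seq bool) : seg o l.+1 w = rcons (seg o l w) (nth false w (o + l)).
Proof. by rewrite /seg /mkseq -addn1 iotaD map_cat /= add0n cats1. Qed.

Lemma enc_signP h w o : hN h 0 =1 nth 0%N pl -> hpr h = drop o w ->
  [/\ hR (sem enc_sign h) 2 0 = rad (seg o (d + 1) w) (1 :: xs),
      hpr (sem enc_sign h) = drop (o + (d + 1)) w &
      hout (sem enc_sign h) = hout h ++ [seq sg b | b <- seg o (d + 1) w]].
Proof.
move=> hp hw; rewrite /enc_sign sem_seq; set h0 := Submission.sem _ _ _ h.
pose b0 := nth false w o.
have [e1 e2 e3 e4] : [/\ hR h0 2 0 = sg b0, hpr h0 = drop o.+1 w,
    hout h0 = rcons (hout h) (sg b0) & hN h0 0 = hN h 0].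
  rewrite /h0 sem_seq sem_if [Submission.sem _ _ (CPriv _ _) _]/= hw head_drop behead_drop /=.
  rewrite upd2E /= -/b0; case: (b0); rewrite /= ?upd2E /sg ?sub0r; split=> //.
have d1 : hN h0 0 1 = d by rewrite e4 hp.
pose I j h' := [/\ hR h' 2 0 = sg b0 + \sum_(i < j) sg (nth false w (o.+1 + i)) * xs`_i,
  hpr h' = drop (o.+1 + j) w &
  hout h' = hout h ++ sg b0 :: [seq sg b | b <- seg o.+1 j w]].
suff [i1 i2 i3] : I d (sem (CFor 1 1 enc_sign_body) h0).
  rewrite i1 i2 i3 addn1 seg_cons addnS; split=> //.
  rewrite /rad /= big_ord_recl /= mulr1 sxs; congr (_ + _).
  apply: eq_bigr => i _; by rewrite add0n /seg nth_mkseq.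
rewrite -d1; apply: (for_ind (I := I)) => // [|j h' hj [i1 i2 i3] hc hf _].
  by split=> /=; rewrite ?big_ord0 ?addr0 ?addn0 // e3 cats1.
rewrite d1 in hj.
rewrite /enc_sign_body sem_seq sem_if [Submission.sem _ _ (CPriv _ _) _]/= i2 head_drop behead_drop.
rewrite /I seg_rcons map_rcons -rcons_cons -rcons_cat -i3 big_ord_recr /= addrA -i1 addnS.
by rewrite ?upd2E /=; case: (nth false w _); rewrite /= !upd2E /= hc addn0 input_xs // /sg
  ?mul1r ?mulN1r ?sub0r; split=> //; rewrite addnS.
Qed.

Lemma enc_clipP h y : hN h 0 =1 nth 0%N pl -> hR h 2 0 = y ->
  hR (sem enc_clip h) 2 0 = clip Bnd y.
Proof.
move=> hp hy; rewrite /enc_clip !sem_if /= !hp /= hy sub0r /clip.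
by do 2?[case: ifP => _] => /=; rewrite ?upd2E ?hp //= sub0r.
Qed.

Hypothesis q0 : (0 < q)%N.

Lemma enc_pathP h w o t y pub : hN h 0 =1 nth 0%N pl -> hpr h = drop o w ->
  hN h 8 0 = t -> hR h 2 0 = y ->
  (forall a, (a < q)%N -> hR h 0 a = pz c0 n k pub xs a) -> (t < H)%N ->
  [/\ hR (sem enc_path h) 2 0 = y * chi (seg o H w) (path c0 n k pub xs) (t + 1),
      hpr (sem enc_path h) = drop (o + H) w &
      hout (sem enc_path h) = hout h ++ [seq (nat_of_bool b)%:R | b <- seg o H w]].
Proof.
move=> hp hw ht hy hz tH; rewrite /enc_path sem_seq sem_CN; set h0 := setN _ _ _ _.
have H7 : hN h0 0 7 = H by rewrite /= upd2E /= hp.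
(* After [j] digits, the coordinates [a < j %% q] are one digit ahead of the others. The sign no
   longer changes after [t + 1] digits, whence the minimum. *)
pose I j h' := [/\ hR h' 2 0 = y * chi (seg o H w) (path c0 n k pub xs) (minn (t + 1) j),
  hpr h' = drop (o + j) w,
  hout h' = hout h ++ [seq (nat_of_bool b)%:R | b <- seg o j w],
  (forall a, (a < q)%N -> hR h' 0 a = zrem (pz c0 n k pub xs a) (j %/ q + (a < j %% q)%N)) &
  hN h' 9 0 = (j %% q)%N].
suff [i1 i2 i3 _ _] : I H (sem (CFor 1 7 enc_path_body) h0).
  by split=> //; rewrite i1; congr (_ * chi _ _ _); apply/minn_idPl; rewrite addn1.
rewrite -H7; apply: (for_ind (I := I)) => // [|j h' hj [i1 i2 i3 i4 i5] hc hf _].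
  by rewrite /I minn0 /chi big_ord0 mulr1 addn0 div0n mod0n cats0; split=> //=.
rewrite H7 in hj; have jq : (j %% q < q)%N by rewrite ltn_mod.
have hp' : hN h' 0 =1 nth 0%N pl by move=> i; rewrite hf // /= upd2E /= hp.
have ht' : hN h' 8 0 = t by rewrite hf.
set b := nth false w (o + j).
set pb := path c0 n k pub xs j.
have zj : hR h' 0 (j %% q) = zrem (pz c0 n k pub xs (j %% q)) (j %/ q).
  by rewrite i4 // ltnn addn0.
pose h1 := HSt (hN (setN 7 0 b h')) (hR h') (drop (o + j).+1 w) (hpu h') (rcons (hout h') (nat_of_bool b)%:R).
pose zn := if pb then 2 * hR h' 0 (j %% q) - 1 else 2 * hR h' 0 (j %% q).
pose h2 := setR 0 (j %% q)%N zn h1.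
pose h3 := if [&& pb, (j <= t)%N & b] then setR 2 0 (- hR h' 2 0) h2 else h2.
pose h4 := setN 9 0 (if (q <= j %% q + 1)%N then 0%N else (j %% q + 1)%N) h3.
have -> : sem enc_path_body h' = (if (q <= j %% q + 1)%N then setN 9 0 0 else id)
    (setN 9 0 (j %% q + 1)%N h3).
  have -> : sem enc_path_body h' = sem (CIf (TN (Pa 3) (Sc 9)) (CN 9 (HC 0) (HC 0)) CSkip)
      (setN 9 0 (j %% q + 1)%N h3).
    rewrite /enc_path_body !sem_seq; congr (Submission.sem _ _ _ _).
    rewrite [Submission.sem _ _ (CPriv _ _) _]/= i2 head_drop behead_drop -/b.
    rewrite [Submission.sem _ _ (CEmit _) _]/= upd2E [in X in rcons _ X]/= sem_if /=.
    have -> : upd2 (hN h') 7 0 b 9 0 = (j %% q)%N by rewrite upd2E.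
    have -> : upd2 (hN h') 7 0 b 8 0 = t by rewrite upd2E.
    have -> : upd2 (hN h') 7 0 b 1 0 = j by rewrite upd2E.
    have -> : upd2 (hN h') 7 0 b 7 0 = b by rewrite upd2E.
    have -> : (1 / 2 <= hR h' 0 (j %% q)%N) = pb by rewrite zj.
    rewrite /h3 /h2 /zn /h1; case: (pb) => /=; last by rewrite !upd2E /= i5.
    by case: (j <= t)%N; case: (b) => /=; rewrite !upd2E /= ?i5 ?sub0r.
  rewrite sem_if /= !upd2E /=.
  have -> : hN h3 0 3 = q by rewrite /h3; case: ifP => _; rewrite /= upd2E /= hp'.
  by case: ifP.
have hz4 X : hN (setN 9 0 X h3) 9 0 = X by rewrite /= upd2E.
(* Resetting cell 9 only overwrites its last value, so the two outcomes of the wrap-around test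
   reduce to the single state [h4]. *)
have E (P : @hst R -> Prop) : P h4 -> (forall u v h, P (setN 9 0 u (setN 9 0 v h)) <-> P (setN 9 0 u h)) ->
    P ((if (q <= j %% q + 1)%N then setN 9 0 0 else id) (setN 9 0 (j %% q + 1)%N h3)).
  by rewrite /h4; case: ifP => // _ h4P hiff; apply/hiff.
apply: (E (fun hh => I j.+1 (setN 1 0 j.+1 hh))); last first.
  by move=> u v h''; rewrite /I /= !upd2E /=.
have jS : ((j.+1 %/ q = j %/ q + (q <= j %% q + 1)%N) /\
    (j.+1 %% q = if q <= j %% q + 1 then 0 else j %% q + 1))%N.
  have e : j.+1 = (j %/ q * q + (j %% q).+1)%N by rewrite addnS -divn_eq.
  rewrite e divnMDl // modnMDl addn1.
  have [hq|hq] : ((j %% q).+1 < q \/ (j %% q).+1 = q)%N by lia.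
    by rewrite (divn_small hq) (modn_small hq) leqNgt hq.
  by rewrite hq divnn modnn q0 leqnn.
split.
- rewrite -[hR _ 2 0]/(hR h3 2 0).
  have -> : hR h3 2 0 = hR h' 2 0 * (if (j <= t)%N && (b && pb) then -1 else 1).
    rewrite /h3; case: (pb); case: (j <= t)%N; case: (b); rewrite /= ?upd2E /= ?mulr1 //.
    by rewrite mulrN1.
  rewrite i1 -mulrA; congr (_ * _); case: (leqP j t) => jt.
    have -> : minn (t + 1) j = j by apply/minn_idPr; lia.
    have -> : minn (t + 1) j.+1 = j.+1 by apply/minn_idPr; lia.
    by rewrite /chi big_ord_recr /= /seg nth_mkseq.
  rewrite mulr1; have -> : minn (t + 1) j = (t + 1)%N by apply/minn_idPl; lia.
  by have -> : minn (t + 1) j.+1 = (t + 1)%N by apply/minn_idPl; lia.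
- by rewrite -[hpr _]/(hpr h3) /h3; case: ifP; rewrite /= addnS.
- rewrite -[hout (setN _ _ _ _)]/(hout h3) seg_rcons map_rcons -rcons_cat -i3.
  by rewrite /h3; case: ifP.
- move=> a ha; rewrite -[hR _ 0 a]/(hR h3 0 a).
  have -> : hR h3 0 a = if a == (j %% q)%N then zn else hR h' 0 a.
    by rewrite /h3; case: ifP; rewrite /= !upd2E.
  case: jS => -> ->; case: eqP => [->|/eqP na].
    have -> : (j %/ q + (q <= j %% q + 1) + (j %% q < (if q <= j %% q + 1 then 0 else j %% q + 1)))%N = (j %/ q).+1.
      by case: (leqP q) => ?; lia.
    by rewrite /zn zj /pb /path /bitz /=.
  rewrite i4 //; congr zrem; case: (leqP q) => ?; last by lia.
  have -> : (a < j %% q)%N by lia.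
  by rewrite ltn0 addn0.
- by rewrite /= !upd2E /= jS.2.
Qed.

Lemma set_acoefP h : hN h 0 0 = n -> hR (sem set_acoef h) 4 0 = acoef eps n.
Proof.
move=> h0; rewrite /set_acoef !sem_if /= !h0 /input /= /acoef.
by do 2?[case: ifP => _]; rewrite /= ?upd2E /= /input.
Qed.

Lemma bits2nat_lt w : (bits2nat w < 2 ^ size w)%N.
Proof.
elim/last_ind: w => // w b IH; rewrite /bits2nat foldl_rcons size_rcons expnS -/(bits2nat w).
by case: b => /=; lia.
Qed.

Lemma enc_mainP h pub w : hN h 0 =1 nth 0%N pl -> hpu h = pub -> hpr h = w -> hout h = [::] ->
  hout (sem enc_main h) = encout c0 n d k eps xs pub w.
Proof.
move=> hp hu hw ho; rewrite /enc_main !sem_seq.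
have [z1 _] := enc_projP hp hu.
set h1 := Submission.sem _ _ enc_proj h in z1 *.
have p1 : hN h1 0 =1 nth 0%N pl by rewrite frame_N.
have w1 : hpr h1 = w by rewrite frame_pr.
have o1 : hout h1 = [::] by rewrite frame_out.
have [t2 w2] := @enc_bitsP 8 6 h1 (pm c0 n k) w isT isT isT (p1 6%N) w1.
set h2 := Submission.sem _ _ _ h1 in t2 w2 *.
set t := bits2nat _ in t2.
have tH : (t < H)%N by rewrite /pH (leq_trans (bits2nat_lt _)) // size_mkseq.
have p2 : hN h2 0 =1 nth 0%N pl by rewrite frame_N.
have z2 a : (a < q)%N -> hR h2 0 a = pz c0 n k pub xs a by rewrite frame_R //; exact: z1.
have o2 : hout h2 = [::] by rewrite frame_out.
set h3 := Submission.sem _ _ (CEmit _) _.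
have o3 : hout h3 = [:: t%:R] by rewrite /= o2 t2.
have [y4 w4 o4] := @enc_signP h3 w (pm c0 n k) p2 w2.
set h4 := Submission.sem _ _ enc_sign _ in y4 w4 o4 *.
have p4 : hN h4 0 =1 nth 0%N pl by rewrite frame_N.
have y5 := enc_clipP p4 y4.
set h5 := Submission.sem _ _ enc_clip _ in y5 *.
have p5 : hN h5 0 =1 nth 0%N pl by rewrite frame_N.
have w5 : hpr h5 = drop (pm c0 n k + (d + 1)) w by rewrite frame_pr.
have t5 : hN h5 8 0 = t by rewrite frame_N // frame_N.
have z5 a : (a < q)%N -> hR h5 0 a = pz c0 n k pub xs a.
  by rewrite frame_R // frame_R //; exact: z2.
have o5 : hout h5 = hout h4 by rewrite frame_out.
have [y6 w6 o6] := enc_pathP p5 w5 t5 y5 z5 tH.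
set h6 := Submission.sem _ _ enc_path _ in y6 w6 o6 *.
have p6 : hN h6 0 =1 nth 0%N pl by rewrite frame_N.
have [U7 _] := @enc_bitsP 10 8 h6 (pm2 n) _ isT isT isT (p6 8%N) w6.
set h7 := Submission.sem _ _ _ h6 in U7 *.
have p7 : hN h7 0 =1 nth 0%N pl by rewrite frame_N.
have o7 : hout h7 = hout h6 by rewrite frame_out.
have a8 := @set_acoefP h7 (p7 0%N).
set h8 := Submission.sem _ _ set_acoef h7 in a8 *.
have p8 : hN h8 0 =1 nth 0%N pl by rewrite frame_N.
have U8 : hN h8 10 0 = hN h7 10 0 by rewrite frame_N.
have y8 : hR h8 2 0 = hR h6 2 0 by rewrite frame_R // frame_R.
have o8 : hout h8 = hout h7 by rewrite frame_out.
have segD o l (v : seq bool) : seg 0 l (drop o v) = seg o l v.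
  by apply: eq_map => j; rewrite nth_drop.
rewrite /enc_report sem_if /= !p8 U8 U7 segD a8 y8 y6.
rewrite /encout -/t /threshold.
set th := (X in (_ <= X)); set th' := (X in sg (_ <= X)).
have <- : th = th' by [].
by case: ifP => _ /=; rewrite o8 o7 o6 o5 o4 o3 /sg /= ?sub0r -cats1 -!catA.
Qed.

End EncoderCorrect.

(** * The decoder *)

Section DecoderSpec.
Context {R : realType}.
Variables (c0 G n d k : nat) (eps : R) (m : seq R).
Local Notation q := (pq c0 k).
Local Notation H := (pH c0 n k).
Local Notation Gam := (pGam c0 G n k).

Definition stride := (d + H + 3)%N.
Definition field i o : R := m`_(i * stride + o).
(** A message speaks about a given depth with probability [1 / H], and its correlation with the
    right character has mean [2 * acoef / Bnd] times the desired quantity; this is the inverse of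
    the product of the two. *)
Definition scaleF : R := H%:R * Bnd c0 n k / (2 * acoef eps n).

(* The estimates of the number ([j = 0]) and of the coordinate sums
   ([1 <= j <= d]) of the points whose path starts with [v]. *)
Definition est (v : seq bool) j : R :=
  (\sum_(i < n) if field i 0 + 1 == (size v)%:R then
     field i (d + H + 2) * (\prod_(0 <= b < size v)
        (1 - 2 * field i (d + 2 + b) * (nat_of_bool (nth false v b))%:R)) * field i (1 + j)
   else 0) * scaleF.

Definition rank cand v := count (fun v' => est v 0 <= est v' 0) cand.
Definition expanded t cand v := (rank cand v <= Gam)%N && (t < H)%N.
Definition children (vs : seq (seq bool)) :=
  flatten [seq [:: rcons v false; rcons v true] | v <- vs].
(* The candidates of depth [t.+1]. *)
Fixpoint cands t := if t is t'.+1
  then children [seq v <- cands t' | expanded t (cands t') v]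
  else [:: [:: false]; [:: true]].
Definition leaves t := flatten
  [seq [seq v <- cands j | ~~ expanded j.+1 (cands j) v] | j <- iota 0 t].

(** Half of the estimated mean: the test in [mult] only ensures that an estimated mean has norm at
    most 2, and the given algorithm expects points of the unit ball. *)
Definition point v : seq R := [seq est v j.+1 / (2 * est v 0) | j <- iota 0 d].
(** The estimated weight rounded down and confined to the range from 0 to [n], by counting, as the
    machine does not round reals. The true mean of a leaf has norm at most 1, so an estimated mean
    of norm above 2 reveals that noise dominates, and the leaf is dropped. *)
Definition mult v : nat := if \sum_(j < d) est v j.+1 ^+ 2 <= 4 * est v 0 * est v 0
  then count (fun i => (i + 1)%:R <= est v 0) (iota 0 n) else 0.
(** The additional origin keeps the data set nonempty, which the given algorithm presupposes, at the
    price of an additive constant. *)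
Definition synth := nseq d 0 :: flatten [seq nseq (mult v) (point v) | v <- leaves H].

(** Every selected node is at least as heavy as the lightest selected one and is therefore counted
    in the rank of the latter. Ties do no harm, because the rank includes them. *)
Lemma size_filter_rank cand : (size [seq v <- cand | rank cand v <= Gam] <= Gam)%N.
Proof.
set s := [seq v <- cand | _].
have [s0|s0] := posnP (size s); first by rewrite s0.
pose f j := est (nth [::] s j) 0.
have [j js jmin] : exists2 j, (j < size s)%N & forall i, (i < size s)%N -> f j <= f i.
  elim: (size s) s0 => // r IH _; have [->|r0] := posnP r.
    by exists 0%N => // -[].
  have [j js jm] := IH r0.
  have [fj|fj] := leP (f j) (f r).
    exists j; first exact: ltnW.
    by move=> i; rewrite ltnS leq_eqVlt => /orP[/eqP ->|/jm].
  exists r => // i; rewrite ltnS leq_eqVlt => /orP[/eqP -> //|/jm]; exact/le_trans/ltW.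
have := mem_nth [::] js; set v := nth _ _ j; rewrite mem_filter => /andP[hv _].
apply: leq_trans hv; rewrite size_filter /rank.
have -> : count (fun v => rank cand v <= Gam)%N cand = count predT s by rewrite count_predT size_filter.
apply: (@leq_trans (count (fun v' => est v 0 <= est v' 0) s)).
  rewrite count_predT; apply/eq_leq/esym/eqP; rewrite -all_count; apply/allP.
  by move=> v' /(nthP [::]) [i hi <-]; apply: jmin.
by apply: leq_count_subseq; exact: filter_subseq.
Qed.

Lemma size_children vs : size (children vs) = (2 * size vs)%N.
Proof. by elim: vs => //= v vs; rewrite /children /= => ->; rewrite mulnS. Qed.

Lemma size_cands t : (size (cands t) <= 2 * Gam)%N.
Proof.
case: t => [|t] /=; first by rewrite leq_pmulr // /pGam muln_gt0 !expn_gt0.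
rewrite size_children leq_mul2l /=.
apply: leq_trans (size_filter_rank (cands t)).
by rewrite !size_filter; apply: sub_count => v /andP[].
Qed.

Lemma cands_size t v : v \in cands t -> size v = t.+1.
Proof.
elim: t v => [|t IH] v /=; first by rewrite !inE => /orP[] /eqP ->.
case/flattenP => s /mapP[v']; rewrite mem_filter => /andP[_ /IH hv'] ->.
by rewrite !inE => /orP[] /eqP ->; rewrite size_rcons hv'.
Qed.

Lemma leavesS t : leaves t.+1 = leaves t ++ [seq v <- cands t | ~~ expanded t.+1 (cands t) v].
Proof. by rewrite /leaves -[X in iota 0 X]addn1 iotaD map_cat flatten_cat add0n /= cats0. Qed.

End DecoderSpec.

Definition Qi i := QI (HA (Sc 18) i).
(** A node is stored by its parent (array 14) and its last bit (array 5), so the product over the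
    bits of its path is taken from the last bit towards the root. The enclosing loop makes [H]
    rounds and idles once cell 17 is 0. *)
Definition est_walk := CIf (TN (HC 1) (Sc 17)) (CN 17 (HC 0) (HS (Sc 17) (HC 1)) ;;
  CR 8 (HC 0) (QM (Re 8) (QS (QN (HC 1)) (QM (QM (QN (HC 2))
    (Qi (HA (HA (Pa 1) (HC 2)) (Sc 17)))) (QG 5 (Sc 16))))) ;;
  CN 16 (HC 0) (HG 14 (Sc 16))) CSkip.
Definition est_add := CR 7 (Sc 4) (QA (QG 7 (Sc 4)) (QM (Re 8) (Qi (HA (HC 1) (Sc 4))))).
Definition est_msg := CR 8 (HC 0) (Qi (HA (HA (Pa 1) (Pa 7)) (HC 2))) ;;
  CN 16 (HC 0) (Sc 15) ;; CN 17 (HC 0) (Sc 22) ;; CFor 4 7 est_walk ;; CFor 4 9 est_add.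
Definition est_body := CIf (TR (QA (Qi (HC 0)) (QN (HC 1))) (QN (Sc 22)))
   (CIf (TR (QN (Sc 22)) (QA (Qi (HC 0)) (QN (HC 1)))) est_msg CSkip) CSkip ;;
  CN 18 (HC 0) (HA (Sc 18) (Pa 15)).
Definition est_cmd := CFor 4 9 (CR 7 (Sc 4) (QN (HC 0))) ;; CN 18 (HC 0) (HC 1) ;;
  CFor 3 0 est_body ;; CFor 4 9 (CR 7 (Sc 4) (QM (QG 7 (Sc 4)) (Re 10))).

Section EstCorrect.
Context {R : realType}.
Variables (c0 G n d k : nat) (eps : R) (m : seq R).
Local Notation q := (pq c0 k).
Local Notation H := (pH c0 n k).
Local Notation Gam := (pGam c0 G n k).
Let rs := eps :: m.
Let ns := [:: n; d; k; size m].
Hypothesis sm : size m = (n * stride c0 n d k)%N.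
Local Notation sem := (sem ns rs).
Local Notation pl := (plist c0 G n d k).
Local Notation field := (field c0 n d k m).
Local Notation est := (est c0 n d k eps m).
Implicit Types h : @hst R.

(* The nodes created so far, listed in the order of creation; node 0 is the root. *)
Definition tree_mem h (nd : seq (seq bool)) := nth [::] nd 0 = [::] /\
  forall g, (0 < g < size nd)%N -> (hN h 14 g < size nd)%N /\
   exists b : bool, nth [::] nd g = rcons (nth [::] nd (hN h 14 g)) b /\
     hR h 5 g = (nat_of_bool b)%:R.

Lemma input_field h i o : (i < n)%N -> (o < stride c0 n d k)%N ->
  input rs h (i * stride c0 n d k + 1 + o) = field i o.
Proof.
move=> hi ho; rewrite /input /field addnAC addn1 /= ltnS sm.
suff -> : (i * stride c0 n d k + o < n * stride c0 n d k)%N by [].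
apply: (@leq_trans (i.+1 * stride c0 n d k)%N); last by rewrite leq_mul2r hi orbT.
by rewrite mulSn addnC ltn_add2r.
Qed.

Lemma est_msgP h nd i v : hN h 0 =1 nth 0%N pl -> tree_mem h nd ->
  (hN h 15 0 < size nd)%N -> nth [::] nd (hN h 15 0) = v -> hN h 22 0 = size v ->
  (size v <= H)%N -> (i < n)%N -> hN h 18 0 = (i * stride c0 n d k + 1)%N ->
  forall j, (j < d + 1)%N -> hR (sem est_msg h) 7 j = hR h 7 j +
    field i (d + H + 2) * (\prod_(0 <= b < size v)
        (1 - 2 * field i (d + 2 + b) * (nat_of_bool (nth false v b))%:R)) * field i (1 + j).
Proof.
move=> hp [nd0 hnd] hg hv ht sH hi hptr j hj; rewrite /est_msg !sem_seq.
pose f b : R := 1 - 2 * field i (d + 2 + b) * (nat_of_bool (nth false v b))%:R.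
set h1 := Submission.sem _ _ (CR 8 _ _) h; rewrite !sem_CN.
set h2 := setN 16 _ _ h1; set h3 := setN 17 _ _ h2.
have sg1 : hR h1 8 0 = field i (d + H + 2).
  rewrite /h1 sem_CR /= upd2E /= !hp /= hptr -[RHS](input_field h hi) ?/stride; last lia.
  by congr (input _ _ _); lia.
set h4 := Submission.sem _ _ (CFor 4 7 _) _.
pose I s h' := [/\ hN h' 17 0 = (size v - s)%N, (hN h' 16 0 < size nd)%N,
  nth [::] nd (hN h' 16 0) = take (size v - s) v &
  hR h' 8 0 = field i (d + H + 2) * \prod_(size v - s <= b < size v) f b].
have H7 : hN h3 0 7 = H by rewrite /= ?upd2E /= hp.
have [_ _ _ i4] : I H h4.
  rewrite -H7; apply: (for_ind (I := I)) => // [|s h' hs [i1 i2 i3 i4] hc hf hfr].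
    rewrite /I subn0 big_geq // mulr1 /= ?upd2E /= ?upd2E /=; split=> //.
    by rewrite take_size.
  have hp' : hN h' 0 =1 nth 0%N pl by move=> x; rewrite hf // /= ?upd2E /= hp.
  have ptr' : hN h' 18 0 = (i * stride c0 n d k + 1)%N by rewrite hf // /= ?upd2E /= hptr.
  rewrite /I /est_walk sem_if [evT _ _ _ _]/= i1.
  case: ltnP => hsv; last first.
    have e : (size v - s.+1 = size v - s)%N by lia.
    by rewrite e /= ?upd2E /= ?upd2E.
  have v0 : (0 < hN h' 16 0 < size nd)%N.
    rewrite i2 andbT lt0n; apply/eqP => e; move: i3; rewrite e nd0 => /(congr1 size).
    by rewrite size_takel ?leq_subr //= => e'; move: hsv; rewrite -e'.
  have r5 : hR h' 5 = hR h 5 by rewrite hfr.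
  have n14 : hN h' 14 = hN h 14 by rewrite hf.
  have := hnd _ v0; rewrite -n14 -r5 => -[gpar [b [hb hbr]]].
  have eS : (size v - s = (size v - s.+1).+1)%N by lia.
  have sv : (size v - s.+1 < size v)%N by lia.
  move: hb; rewrite i3 eS (take_nth false) // => /rcons_inj [ev eb].
  rewrite /= ?upd2E /= ?upd2E /= ?upd2E /= i1 subn1 eS /=; split=> //.
  rewrite hp' /= ptr' hbr i4 -eb eS [in RHS]big_ltn // /f.
  rewrite -mulrA; congr (_ * _); rewrite mulrC; congr (_ * _).
  congr (_ - 2 * _ * _); rewrite -(input_field h' hi) /stride; last lia.
  by congr (input _ _ _); lia.
have i4' : hR h4 8 0 = field i (d + H + 2) * \prod_(0 <= b < size v) f b.
  by rewrite i4 (_ : (size v - H = 0)%N) //; apply/eqP; rewrite subn_eq0.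
have p4 : hN h4 0 =1 nth 0%N pl by move=> x; rewrite frame_N // /= ?upd2E /= hp.
have ptr4 : hN h4 18 0 = (i * stride c0 n d k + 1)%N by rewrite frame_N // /= ?upd2E /= hptr.
have r4 : hR h4 7 = hR h 7 by rewrite frame_R.
have d9 : hN h4 0 9 = (d + 1)%N by rewrite p4.
pose J s h' := forall j, hR h' 7 j = hR h 7 j + (if (j < s)%N then
   field i (d + H + 2) * (\prod_(0 <= b < size v) f b) * field i (1 + j) else 0).
suff : J (d + 1)%N (sem (CFor 4 9 est_add) h4) by move=> ->; rewrite hj.
rewrite -d9; apply: (for_ind (I := J)) => // [x|s h' hs jJ hc hf hfr x].
  by rewrite ltn0 addr0 /= r4.
rewrite d9 in hs.
have r8 : hR h' 8 = hR h4 8 by rewrite hfr.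
have ptr' : hN h' 18 0 = (i * stride c0 n d k + 1)%N by rewrite hf.
rewrite /= upd2E /= hc jJ r8 i4' ptr'.
case: eqP => [->|/eqP ne]; last by rewrite jJ ltnS [(x <= s)%N]leq_eqVlt (negbTE ne).
rewrite ltnSn ltnn addr0 -[field i (1 + s)](input_field h' hi) // /stride; lia.
Qed.

Lemma est_cmdP h nd v : hN h 0 =1 nth 0%N pl -> tree_mem h nd ->
  (hN h 15 0 < size nd)%N -> nth [::] nd (hN h 15 0) = v -> hN h 22 0 = size v ->
  (size v <= H)%N -> hR h 10 0 = scaleF c0 n k eps ->
  forall j, (j < d + 1)%N -> hR (sem est_cmd h) 7 j = est v j.
Proof.
move=> hp hnd hg hv ht sH hF j hj; rewrite /est_cmd !sem_seq.
set h1 := Submission.sem _ _ (CFor _ _ _) h; rewrite sem_CN; set h2 := setN _ _ _ h1.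
pose term (i j : nat) : R := if field i 0 + 1 == (size v)%:R then
     field i (d + H + 2) * (\prod_(0 <= b < size v)
        (1 - 2 * field i (d + 2 + b) * (nat_of_bool (nth false v b))%:R)) * field i (1 + j)
   else 0.
have z1 x : (x < d + 1)%N -> hR h1 7 x = 0.
  pose I s h' := forall x, (x < s)%N -> hR h' 7 x = 0.
  have d9 : hN h 0 9 = (d + 1)%N by rewrite hp.
  rewrite -d9; move: x; apply: (for_ind (I := I)) => // s h' hs i1 hc _ _ x xs.
  rewrite /= upd2E /= hc; case: eqP => // /eqP xs'; apply: i1.
  by rewrite ltn_neqAle xs'.
set h3 := Submission.sem _ _ (CFor 3 _ _) _.
pose I i h' := hN h' 18 0 = (i * stride c0 n d k + 1)%N /\
  forall x, (x < d + 1)%N -> hR h' 7 x = \sum_(i' < i) term i' x.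
have [_ i3] : I n h3.
  have n0 : hN h2 0 0 = n by rewrite /= ?upd2E /= frame_N // hp.
  rewrite -n0; apply: (for_ind (I := I)) => // [|i h' hi [i1 i2] hc hf hfr].
    split=> [|x hx]; first by rewrite /= ?upd2E.
    by rewrite big_ord0 /= z1.
  have E c : c \notin [:: 0; 18; 3; 4]%N -> (c \in [:: 15; 22; 14]%N) -> hN h' c = hN h c.
    by move=> _; rewrite !inE => /or3P[] /eqP ->; rewrite hf //; apply: funext => x;
      rewrite /= upd2E /= frame_N.
  have hp' : hN h' 0 =1 nth 0%N pl by move=> x; rewrite hf //= ?upd2E /= frame_N // hp.
  have tm' : tree_mem h' nd.
    case: hnd => e0 e1; split=> // g /e1.
    by rewrite E // (_ : hR h' 5 = hR h 5) // hfr // frame_R.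
  have r10 : hR h' 10 = hR h 10 by rewrite hfr // frame_R.
  rewrite n0 in hi.
  have F0 : input rs h' (hN h' 18 0 + 0) = field i 0.
    by rewrite i1 input_field // /stride; lia.
  rewrite /est_body sem_seq !sem_if.
  have -> : evT ns rs h' (TR (QA (Qi (HC 0)) (QN (HC 1))) (QN (Sc 22))) = (field i 0 + 1 <= (size v)%:R).
    by rewrite /= F0 E //= ht.
  have -> : evT ns rs h' (TR (QN (Sc 22)) (QA (Qi (HC 0)) (QN (HC 1)))) = ((size v)%:R <= field i 0 + 1).
    by rewrite /= F0 E //= ht.
  set b1 := _ <= (size v)%:R; set b2 := (size v)%:R <= _.
  have eb : (field i 0 + 1 == (size v)%:R) = b1 && b2 by rewrite eq_le.
  split=> [|x hx].
    set X := if b1 then _ else _.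
    transitivity (hN X 18 0 + hN X 0 15)%N; first by rewrite /= ?upd2E.
    have [-> ->] : hN X 18 = hN h' 18 /\ hN X 0 15 = stride c0 n d k.
      by rewrite /X; case: (b1); case: (b2); cbv iota; split; rewrite ?frame_N // hp'.
    by rewrite i1 mulSn; lia.
  transitivity (hR h' 7 x + term i x); last by rewrite big_ord_recr i2.
  rewrite /term eb /=.
  case: b1 b2 {eb} => [] [] /=; rewrite ?addr0 //.
  by apply: (est_msgP hp' tm') => //; rewrite E.
have p3 : hN h3 0 =1 nth 0%N pl by move=> x; rewrite frame_N //= ?upd2E /= frame_N // hp.
have r10 : hR h3 10 0 = scaleF c0 n k eps by rewrite frame_R // frame_R.
have d9 : hN h3 0 9 = (d + 1)%N by rewrite p3.
pose J s h' := forall x, (x < d + 1)%N -> hR h' 7 x = (if (x < s)%N then est v x else \sum_(i < n) term i x).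
suff : J (d + 1)%N (sem (CFor 4 9 (CR 7 (Sc 4) (QM (QG 7 (Sc 4)) (Re 10)))) h3).
  by move=> ->; rewrite ?hj.
rewrite -{1}d9; apply: (for_ind (I := J)) => // s h' hs jJ hc hf hfr x hx.
rewrite d9 in hs; rewrite /= upd2E /= hc.
have -> : hR h' 10 = hR h3 10 by rewrite hfr.
case: eqP => [->|/eqP ne]; last by rewrite jJ // ltnS [(x <= s)%N]leq_eqVlt (negbTE ne).
by rewrite jJ // ltnSn ltnn r10.
Qed.

End EstCorrect.

(** The candidates of one depth are consecutive nodes: cell 11 is the first of them, cell 12 the
    first one after them. Since their number is not among the parameters, the loops over them have
    the fixed length [2 * pGam] and test against cell 12. Cell 13 is the next free node. *)
Definition Lo := HA (Sc 11) (Sc 2).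
Definition wts_body := CIf (TN (HA Lo (HC 1)) (Sc 12))
  (CN 15 (HC 0) Lo ;; est_cmd ;; CR 6 (Sc 15) (QG 7 (HC 0))) CSkip.
Definition wts := CFor 2 12 wts_body.
Definition rank_body := CIf (TN (HA (HA (Sc 11) (Sc 3)) (HC 1)) (Sc 12))
  (CIf (TR (QG 6 (Sc 15)) (QG 6 (HA (Sc 11) (Sc 3)))) (CN 19 (HC 0) (HA (Sc 19) (HC 1))) CSkip) CSkip.
Definition rank_cmd := CN 19 (HC 0) (HC 0) ;; CFor 3 12 rank_body.
Definition expand := CN 14 (Sc 13) (Sc 15) ;; CR 5 (Sc 13) (QN (HC 0)) ;;
  CN 14 (HA (Sc 13) (HC 1)) (Sc 15) ;; CR 5 (HA (Sc 13) (HC 1)) (QN (HC 1)) ;;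
  CN 13 (HC 0) (HA (Sc 13) (HC 2)).
Definition sq e := QM e e.
Definition coordS c := QG 7 (HA (Sc c) (HC 1)).
Definition mean := QD (coordS 4) (QM (QN (HC 2)) (QG 7 (HC 0))).
(** Three copies of the synthetic data are written: array 40 is used to compare the answers, while
    41 and 42 become the memories of the two runs, which may overwrite them. *)
Definition copy_body := CR 40 (Sc 21) mean ;; CR 41 (Sc 21) mean ;; CR 42 (Sc 21) mean ;; CN 21 (HC 0) (HA (Sc 21) (HC 1)).
Definition push_body := CIf (TR (QN (HA (Sc 3) (HC 1))) (QG 7 (HC 0)))
  (CFor 4 1 copy_body ;; CN 20 (HC 0) (HA (Sc 20) (HC 1))) CSkip.
Definition push := CR 9 (HC 0) (QN (HC 0)) ;;
  CFor 3 1 (CR 9 (HC 0) (QA (Re 9) (sq (coordS 3)))) ;;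
  CIf (TR (Re 9) (QM (QM (QN (HC 4)) (QG 7 (HC 0))) (QG 7 (HC 0)))) (CFor 3 0 push_body) CSkip.
Definition leaf_cmd := est_cmd ;; push.
Definition grow_body := CIf (TN (HA Lo (HC 1)) (Sc 12))
  (CN 15 (HC 0) Lo ;; rank_cmd ;;
   CIf (TN (Sc 19) (Pa 11)) (CIf (TN (HA (Sc 22) (HC 1)) (Pa 7)) expand leaf_cmd) leaf_cmd) CSkip.
Definition grow := CFor 2 12 grow_body.
Definition depth_body := CN 22 (HC 0) (HA (Sc 1) (HC 1)) ;; wts ;; CN 13 (HC 0) (Sc 12) ;;
  grow ;; CN 11 (HC 0) (Sc 12) ;; CN 12 (HC 0) (Sc 13).
Definition tree_init := set_acoef ;;
  CR 10 (HC 0) (QD (QM (QN (Pa 7)) QB) (QM (QN (HC 2)) (Re 4))) ;;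
  CR 5 (HC 2) (QN (HC 1)) ;; CN 11 (HC 0) (HC 1) ;; CN 12 (HC 0) (HC 3) ;;
  CN 20 (HC 0) (HC 1) ;; CN 21 (HC 0) (Pa 1).
Definition tree_cmd := tree_init ;; CFor 1 7 depth_body.

Section TreeCorrect.
Context {R : realType}.
Variables (c0 G n d k : nat) (eps : R) (m : seq R).
Local Notation q := (pq c0 k).
Local Notation H := (pH c0 n k).
Local Notation Gam := (pGam c0 G n k).
Let rs := eps :: m.
Let ns := [:: n; d; k; size m].
Hypothesis sm : size m = (n * stride c0 n d k)%N.
Local Notation sem := (sem ns rs).
Local Notation pl := (plist c0 G n d k).
Local Notation est := (est c0 n d k eps m).
Local Notation rank := (rank c0 n d k eps m).
Local Notation expanded := (expanded c0 G n d k eps m).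
Local Notation cands := (cands c0 G n d k eps m).
Local Notation leaves := (leaves c0 G n d k eps m).
Local Notation point := (point c0 n d k eps m).
Local Notation mult := (mult c0 n d k eps m).
Local Notation synth := (synth c0 G n d k eps m).
Implicit Types h : @hst R.

Definition Yst h (Y : seq (seq R)) := [/\ hR h 40 =1 nth 0 (flatten Y), hR h 41 =1 nth 0 (flatten Y),
  hR h 42 =1 nth 0 (flatten Y), hN h 21 0 = size (flatten Y) & hN h 20 0 = size Y].

Lemma Yst_frame h h' Y : hR h' 40 = hR h 40 -> hR h' 41 = hR h 41 -> hR h' 42 = hR h 42 -> hN h' 21 = hN h 21 ->
  hN h' 20 = hN h 20 -> Yst h Y -> Yst h' Y.
Proof. by rewrite /Yst => -> -> -> -> ->. Qed.

Lemma size_point v : size (point v) = d.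
Proof. by rewrite size_map size_iota. Qed.

Lemma pushP h v Y : hN h 0 =1 nth 0%N pl -> (forall j, (j < d + 1)%N -> hR h 7 j = est v j) ->
  Yst h Y -> Yst (sem push h) (Y ++ nseq (mult v) (point v)).
Proof.
move=> hp h7 hY; rewrite /push !sem_seq sem_CR; set h1 := setR _ _ _ h.
set h2 := Submission.sem _ _ (CFor _ _ _) h1.
have d1 : hN h1 0 1 = d by rewrite /= hp.
pose I j h' := hR h' 9 0 = \sum_(i < j) est v i.+1 ^+ 2.
have nrm : I d h2.
  rewrite -d1; apply: (for_ind (I := I)) => // [|j h' hj i1 hc hf hfr].
    by rewrite /I big_ord0 /= upd2E.
  rewrite d1 in hj; rewrite /I big_ord_recr /= ?upd2E /= i1 hc expr2.
  have -> : hR h' 7 = hR h 7 by rewrite hfr // /= funeqE => x; rewrite upd2E.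
  by rewrite ?addn0 addn1 h7 // addn1 ltnS.
have hp2 : hN h2 0 =1 nth 0%N pl by move=> x; rewrite frame_N //= hp.
have r7 : hR h2 7 = hR h 7 by rewrite frame_R // funeqE => x; rewrite /= upd2E.
have Y2 : Yst h2 Y.
  by apply: Yst_frame hY; rewrite ?frame_R ?frame_N // funeqE => x; rewrite /= upd2E.
have d0 : (0 < d + 1)%N by rewrite addn1.
have -> : sem (CIf (TR (Re 9) (QM (QM (QN (HC 4)) (QG 7 (HC 0))) (QG 7 (HC 0)))) (CFor 3 0 push_body) CSkip) h2 =
  if \sum_(j < d) est v j.+1 ^+ 2 <= 4 * est v 0 * est v 0 then sem (CFor 3 0 push_body) h2 else h2.
  by rewrite sem_if [evT _ _ _ _]/= nrm r7 !h7.
rewrite /mult; case: ifP => _; last by rewrite cats0.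
have n0 : hN h2 0 0 = n by rewrite hp2.
pose J i h' := Yst h' (Y ++ nseq (count (fun i => (i + 1)%:R <= est v 0) (iota 0 i)) (point v)).
suff : J n (sem (CFor 3 0 push_body) h2) by [].
rewrite -n0; apply: (for_ind (I := J)) => // [|i h' hi jJ hc hf hfr].
  by rewrite /J /= cats0; apply: Yst_frame Y2.
have r7' : hR h' 7 = hR h 7 by rewrite hfr.
have hp' : hN h' 0 =1 nth 0%N pl by move=> x; rewrite hf.
rewrite /J -[X in iota 0 X]addn1 iotaD count_cat add0n [count _ (iota i 1)]/= addn0.
set c := count _ _ in jJ *.
have -> : sem push_body h' = if (i + 1)%:R <= est v 0 then
    sem (CFor 4 1 copy_body ;; CN 20 (HC 0) (HA (Sc 20) (HC 1))) h' else h'.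
  by rewrite /push_body sem_if [evT _ _ _ _]/= hc r7' h7 // ?addn0.
case: ifP => _; last by rewrite addn0; apply: Yst_frame jJ.
rewrite sem_seq; set Y1 := Y ++ nseq c (point v) in jJ *.
have -> : Y ++ nseq (c + true) (point v) = rcons Y1 (point v).
  by rewrite /Y1 nseqD catA cats1.
have d1' : hN h' 0 1 = d by rewrite hp'.
pose K j h'' := [/\ hR h'' 40 =1 nth 0 (flatten Y1 ++ take j (point v)),
  hR h'' 41 =1 nth 0 (flatten Y1 ++ take j (point v)),
  hR h'' 42 =1 nth 0 (flatten Y1 ++ take j (point v)) &
  hN h'' 21 0 = size (flatten Y1 ++ take j (point v))].
have [k0 k1 k2 k3] : K d (sem (CFor 4 1 copy_body) h').
  case: jJ => y0 y1 y2 y3 y4.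
  rewrite -d1'; apply: (for_ind (I := K)) => // [|j h'' hj [k0 k1 k2 k3] kc kf kfr].
    by rewrite /K take0 cats0; split.
  rewrite d1' in hj; have r7'' : hR h'' 7 = hR h 7 by rewrite kfr.
  have pj : hR h'' 7 (j + 1)%N / (2%:R * hR h'' 7 0) = nth 0 (point v) j.
    by rewrite r7'' !h7 ?addn1 // (nth_map 0%N) ?size_iota // nth_iota.
  have sj : size (take j (point v)) = j by rewrite size_takel // size_point ltnW.
  rewrite /K (take_nth 0) ?size_point // -rcons_cat.
  split; last by rewrite /= ?upd2E /= k3 size_rcons addn1.
    by move=> x; rewrite /= ?upd2E /= kc ?upd2E /= k3 nth_rcons -pj; case: ltngtP => // xs;
      rewrite k0 // nth_default // ltnW.
    by move=> x; rewrite /= ?upd2E /= kc ?upd2E /= k3 nth_rcons -pj; case: ltngtP => // xs;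
      rewrite k1 // nth_default // ltnW.
  by move=> x; rewrite /= ?upd2E /= kc ?upd2E /= k3 nth_rcons -pj; case: ltngtP => // xs;
      rewrite k2 // nth_default // ltnW.
rewrite take_oversize ?size_point // -[point v]cats0 -[_ ++ [::]]/(flatten [:: point v]) -flatten_cat cats1 in k0 k1 k2 k3.
have e20 : hN (sem (CFor 4 1 copy_body) h') 20 0 = size Y1.
  by rewrite frame_N //; case: jJ => _ _ _ _ ->.
move: k0 k1 k2 k3 e20; set h5 := Submission.sem _ _ (CFor 4 1 _) _ => k0 k1 k2 k3 e20.
split; [by move=> x; rewrite /= k0|by move=> x; rewrite /= k1|by move=> x; rewrite /= k2|by rewrite /= ?upd2E|].
by rewrite /= ?upd2E /= e20 size_rcons addn1.
Qed.

Lemma leafP h nd v Y : hN h 0 =1 nth 0%N pl -> tree_mem h nd ->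
  (hN h 15 0 < size nd)%N -> nth [::] nd (hN h 15 0) = v -> hN h 22 0 = size v ->
  (size v <= H)%N -> hR h 10 0 = scaleF c0 n k eps -> Yst h Y ->
  Yst (sem leaf_cmd h) (Y ++ nseq (mult v) (point v)).
Proof.
move=> hp tm hg hv ht hs hF hY; rewrite /leaf_cmd sem_seq; apply: pushP.
- by move=> x; rewrite frame_N.
- exact: (est_cmdP sm hp tm).
- by apply: Yst_frame hY; rewrite ?frame_R ?frame_N.
Qed.

Lemma tree_mem_frame h h' nd : hN h' 14 = hN h 14 -> hR h' 5 = hR h 5 ->
  tree_mem h nd -> tree_mem h' nd.
Proof. by rewrite /tree_mem => -> ->. Qed.

Lemma wtsP h nd t : hN h 0 =1 nth 0%N pl -> tree_mem h nd -> hN h 12 0 = size nd ->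
  hR h 10 0 = scaleF c0 n k eps -> hN h 22 0 = t -> (t <= H)%N ->
  (forall g, (hN h 11 0 <= g < size nd)%N -> size (nth [::] nd g) = t) ->
  (size nd <= hN h 11 0 + 2 * Gam)%N ->
  forall g, (hN h 11 0 <= g < size nd)%N -> hR (sem wts h) 6 g = est (nth [::] nd g) 0.
Proof.
move=> hp tm h12 hF ht tH hsz hG g /andP[g1 g2].
pose I j h' := forall g, (hN h 11 0 <= g < size nd)%N -> (g < hN h 11 0 + j)%N ->
  hR h' 6 g = est (nth [::] nd g) 0.
suff : I (2 * Gam)%N (sem wts h) by apply; rewrite ?g1 ?g2 //; apply: leq_trans hG.
have e12 : hN h 0 12 = (2 * Gam)%N by rewrite hp.
rewrite -e12; apply: (for_ind (I := I)) => // [g' /andP[h1 _]|j h' hj i1 hc hf hfr].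
  by rewrite addn0 ltnNge h1.
have E c : c \in [:: 11; 12; 14; 22]%N -> hN h' c = hN h c.
  by rewrite !inE => /or4P[] /eqP ->; rewrite hf.
have hp' : hN h' 0 =1 nth 0%N pl by move=> x; rewrite hf.
have hF' : hR h' 10 = hR h 10 by rewrite hfr.
have tm' : tree_mem h' nd by apply: tree_mem_frame tm; [rewrite E|rewrite hfr].
have -> : sem wts_body h' = if (hN h 11 0 + j + 1 <= size nd)%N then
    sem (CN 15 (HC 0) Lo ;; est_cmd ;; CR 6 (Sc 15) (QG 7 (HC 0))) h' else h'.
  by rewrite /wts_body sem_if [evT _ _ _ _]/= (E 11%N) // (E 12%N) // hc h12.
rewrite addn1; move=> g' hg' hgj; move: (hg') => /andP[g1' g2'].
case: (ltnP (hN h 11 0 + j) (size nd)) => hlt; last first.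
  by apply: (i1 g' hg'); apply: leq_trans g2' _.
rewrite 2!sem_seq sem_CN; set h1 := setN _ _ _ h'.
have g15 : hN h1 15 0 = (hN h 11 0 + j)%N by rewrite /= ?upd2E /= (E 11%N) // hc.
have sz : size (nth [::] nd (hN h 11 0 + j)) = t by rewrite hsz // hlt leq_addr.
set h2 := Submission.sem _ _ est_cmd h1.
have n15 : hN h2 15 0 = (hN h 11 0 + j)%N by rewrite frame_N.
have r6 : hR h2 6 = hR h' 6 by rewrite frame_R.
have k7 : hR h2 7 0 = est (nth [::] nd (hN h 11 0 + j)) 0.
  apply: (est_cmdP sm (nd := nd)) => //; rewrite ?g15 ?sz ?addn1 //.
  - by move=> x; rewrite /= ?upd2E /= hp'.
  - by rewrite /= ?upd2E /= (E 22%N).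
  - by rewrite hF'.
rewrite sem_CR /= upd2E /= n15 k7 r6.
case: eqP => [->//|/eqP ne]; rewrite i1 //.
by move: hgj; rewrite addnS ltnS leq_eqVlt (negbTE ne).
Qed.

Lemma rankP h nd g : hN h 0 =1 nth 0%N pl -> hN h 12 0 = size nd -> hN h 15 0 = g ->
  (hN h 11 0 <= g < size nd)%N -> (size nd <= hN h 11 0 + 2 * Gam)%N ->
  (forall g, (hN h 11 0 <= g < size nd)%N -> hR h 6 g = est (nth [::] nd g) 0) ->
  hN (sem rank_cmd h) 19 0 = rank (drop (hN h 11 0) nd) (nth [::] nd g).
Proof.
move=> hp h12 hg hgr hG h6; rewrite /rank_cmd sem_seq sem_CN; set h1 := setN _ _ _ h.
set cand := drop _ _; set v := nth _ _ g.
pose I j h' := hN h' 19 0 = count (fun v' => est v 0 <= est v' 0) (take j cand).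
have szc : size cand = (size nd - hN h 11 0)%N by rewrite size_drop.
suff : I (2 * Gam)%N (sem (CFor 3 12 rank_body) h1).
  by rewrite /I take_oversize // szc; lia.
have e12 : hN h1 0 12 = (2 * Gam)%N by rewrite /= ?upd2E /= hp.
rewrite -e12; apply: (for_ind (I := I)) => // [|j h' hj i1 hc hf hfr].
  by rewrite /I take0 /= ?upd2E.
have E c : c \in [:: 11; 12; 15]%N -> hN h' c 0 = hN h c 0.
  by rewrite !inE => /or3P[] /eqP ->; rewrite hf //= ?upd2E.
have E6 : hR h' 6 = hR h 6 by rewrite hfr.
rewrite /I /rank_body !sem_if.
have -> : evT ns rs h' (TN (HA (HA (Sc 11) (Sc 3)) (HC 1)) (Sc 12)) = (j < size cand)%N.
  by rewrite [LHS]/= (E 11%N) // (E 12%N) // hc h12 szc; apply/idP/idP; lia.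
case: ltnP => hjc; last first.
  by rewrite /= ?upd2E /= i1 !take_oversize //; apply: leq_trans hjc _.
have -> : evT ns rs h' (TR (QG 6 (Sc 15)) (QG 6 (HA (Sc 11) (Sc 3)))) =
    (est v 0 <= est (nth [::] cand j) 0).
  rewrite /= (E 11%N) // (E 15%N) // hc E6 hg !h6 //; last by rewrite leq_addr /=; lia.
  by rewrite nth_drop.
rewrite (take_nth [::]) // -cats1 count_cat -i1 /= addn0.
by case: ifP => _; rewrite /= ?upd2E /= ?addn0 ?upd2E.
Qed.

Lemma expandP h nd g v : tree_mem h nd -> hN h 13 0 = size nd -> hN h 15 0 = g ->
  (0 < g < size nd)%N -> nth [::] nd g = v ->
  tree_mem (sem expand h) (nd ++ [:: rcons v false; rcons v true]) /\
  hN (sem expand h) 13 0 = (size nd + 2)%N.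
Proof.
move=> [e0 e1] h13 h15 /andP[g0 hg] hv.
have s0 : (0 < size nd)%N by apply: leq_trans hg.
have N14 x : hN (sem expand h) 14 x = if (x == size nd) || (x == size nd + 1)%N then g else hN h 14 x.
  rewrite /= ?upd2E /= ?upd2E /= ?upd2E /= h13 h15.
  by case: eqP => // ; case: eqP => //.
have R5 x : hR (sem expand h) 5 x = if (x == size nd + 1)%N then 1 else if x == size nd then 0 else hR h 5 x.
  by rewrite /= ?upd2E /= ?upd2E /= ?upd2E /= h13.
split; last by rewrite /= ?upd2E /= ?upd2E /= h13.
split=> [|x /andP[x0]]; first by rewrite nth_cat s0.
rewrite size_cat [size [:: _; _]]/= => hx; rewrite N14 R5 !nth_cat.
have [xs|xs] := ltnP x (size nd).
  have [hpar [b [hb1 hb2]]] := e1 x (introT andP (conj x0 xs)).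
  rewrite (ltn_eqF xs) (ltn_eqF (_ : x < size nd + 1)%N) /=; last by rewrite addn1 ltnW.
  by split; [rewrite ltn_addr|exists b; rewrite hpar].
have [-> |->] : x = size nd \/ x = (size nd + 1)%N by lia.
  rewrite eqxx /= hg subnn /=; split; first by rewrite ltn_addr.
  exists false; rewrite hv; split=> //.
  by case: eqP => //; lia.
rewrite eqxx orbT hg addKn /=; split; first by rewrite ltn_addr.
by exists true; rewrite hv.
Qed.

Lemma growP h nd t Y (cand := drop (hN h 11 0) nd) :
  hN h 0 =1 nth 0%N pl -> tree_mem h nd -> hN h 12 0 = size nd -> hN h 13 0 = size nd ->
  hR h 10 0 = scaleF c0 n k eps -> hN h 22 0 = t -> (t <= H)%N -> (0 < hN h 11 0)%N ->
  (forall g, (hN h 11 0 <= g < size nd)%N -> size (nth [::] nd g) = t) ->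
  (size nd <= hN h 11 0 + 2 * Gam)%N ->
  (forall g, (hN h 11 0 <= g < size nd)%N -> hR h 6 g = est (nth [::] nd g) 0) ->
  Yst h Y ->
  let nd' := nd ++ children [seq v <- cand | expanded t cand v] in
  [/\ tree_mem (sem grow h) nd', hN (sem grow h) 13 0 = size nd' &
  Yst (sem grow h) (Y ++ flatten [seq nseq (mult v) (point v) | v <- [seq v <- cand | ~~ expanded t cand v]])].
Proof.
move=> hp tm h12 h13 hF ht tH lo0 hsz hG h6 hY.
pose I j h' := let nd' := nd ++ children [seq v <- take j cand | expanded t cand v] in
  [/\ tree_mem h' nd', hN h' 13 0 = size nd' &
  Yst h' (Y ++ flatten [seq nseq (mult v) (point v) | v <- [seq v <- take j cand | ~~ expanded t cand v]])].
have szc : size cand = (size nd - hN h 11 0)%N by rewrite size_drop.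
suff : I (2 * Gam)%N (sem grow h) by rewrite /I take_oversize // szc; lia.
have e12 : hN h 0 12 = (2 * Gam)%N by rewrite hp.
rewrite -e12; apply: (for_ind (I := I)) => // [|j h' hj [i1 i2 i3] hc hf hfr].
  by rewrite /I take0 /= !cats0; split.
have E c : c \in [:: 11; 12; 22]%N -> hN h' c = hN h c.
  by rewrite !inE => /or3P[] /eqP ->; rewrite hf.
have hp' : hN h' 0 =1 nth 0%N pl by move=> x; rewrite hf.
have hF' : hR h' 10 = hR h 10 by rewrite hfr.
have E6 : hR h' 6 = hR h 6 by rewrite hfr.
suff : I j.+1 (sem grow_body h').
  move: (sem grow_body h') => hh [j1 j2 j3]; split; first exact: tree_mem_frame j1.
    by rewrite /= ?upd2E.
  exact: Yst_frame j3.
have -> : sem grow_body h' = if (j < size cand)%N then sem (CN 15 (HC 0) Lo ;; rank_cmd ;;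
   CIf (TN (Sc 19) (Pa 11)) (CIf (TN (HA (Sc 22) (HC 1)) (Pa 7)) expand leaf_cmd) leaf_cmd) h' else h'.
  rewrite /grow_body sem_if; congr (if _ then _ else _).
  by rewrite [LHS]/= (E 11%N) // (E 12%N) // hc h12 szc; apply/idP/idP; lia.
case: ltnP => hjc; last first.
  by move: i1 i2 i3; rewrite /I !take_oversize //; apply: leq_trans hjc _.
rewrite 2!sem_seq sem_CN; set h1 := setN _ _ _ h'.
set nd1 := nd ++ children _ in i1 i2.
set g := (hN h 11 0 + j)%N.
have gs : (g < size nd)%N by rewrite /g; lia.
have gs1 : (g < size nd1)%N by rewrite size_cat ltn_addr.
have g15 : hN h1 15 0 = g by rewrite /= ?upd2E /= (E 11%N) // hc.
set v := nth [::] cand j.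
have gv : nth [::] nd g = v by rewrite /v nth_drop.
have gv1 : nth [::] nd1 g = v by rewrite nth_cat gs gv.
have hr : hN (sem rank_cmd h1) 19 0 = rank cand v.
  have [l11 l12] : hN h1 11 = hN h 11 /\ hN h1 12 = hN h 12 by rewrite -!E.
  rewrite (@rankP h1 nd g) ?l11 ?l12 ?gv // /g ?leq_addr ?gs //.
  by move=> g' hg'; rewrite -h6 // -E6.
set h2 := sem rank_cmd h1 in hr *.
have hp2 : hN h2 0 =1 nth 0%N pl by move=> x; rewrite frame_N //= ?upd2E /= hp'.
have E2 c : c \in [:: 13; 14; 15; 20; 21; 22]%N -> hN h2 c = hN h1 c.
  by rewrite !inE => /or4P[|||/or3P[]] /eqP ->; rewrite frame_N.
have Er c : (c < 64)%N -> hR h2 c = hR h' c by move=> hc'; rewrite frame_R.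
have tm2 : tree_mem h2 nd1 by apply: tree_mem_frame i1; rewrite ?Er ?E2.
have Y2 : Yst h2 (Y ++ flatten [seq nseq (mult v) (point v) | v <- [seq v <- take j cand | ~~ expanded t cand v]]).
  by apply: Yst_frame i3; rewrite ?Er ?E2.
have sv : size v = t by rewrite -gv hsz // gs /g leq_addr.
have N22 : hN h2 22 0 = t by rewrite E2 // -ht -E.
have n22' := N22.
have hx : sem (CIf (TN (Sc 19) (Pa 11)) (CIf (TN (HA (Sc 22) (HC 1)) (Pa 7)) expand leaf_cmd) leaf_cmd) h2 =
    if expanded t cand v then sem expand h2 else sem leaf_cmd h2.
  rewrite !sem_if.
  have -> : evT ns rs h2 (TN (Sc 19) (Pa 11)) = (rank cand v <= Gam)%N by rewrite [LHS]/= hr hp2.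
  have -> : evT ns rs h2 (TN (HA (Sc 22) (HC 1)) (Pa 7)) = (t < H)%N by rewrite [LHS]/= N22 hp2 addn1.
  by rewrite /expanded; case: (rank cand v <= Gam)%N; case: (t < H)%N.
rewrite hx /I (take_nth [::]) // -/v !filter_rcons.
case: (boolP (expanded t cand v)) => hexp; cbn [negb]; cbv iota.
  have n13 : hN h2 13 0 = size nd1 by rewrite E2.
  have n15 : hN h2 15 0 = g by rewrite E2.
  have hg0 : (0 < g < size nd1)%N by rewrite gs1 andbT /g ltn_addr.
  have [j1 j2] := expandP tm2 n13 n15 hg0 gv1.
  have -> : nd ++ children (rcons [seq v <- take j cand | expanded t cand v] v) =
      nd1 ++ [:: rcons v false; rcons v true].
    by rewrite /nd1 /children map_rcons -cats1 flatten_cat /= -catA.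
  split; [exact: j1|by rewrite j2 size_cat|by apply: Yst_frame Y2; rewrite ?frame_N ?frame_R].
rewrite -/nd1; split.
- by apply: tree_mem_frame tm2; rewrite ?frame_N ?frame_R //.
- by rewrite frame_N // E2.
- rewrite map_rcons -cats1 flatten_cat [flatten [:: _]]/= cats0 catA.
  apply: (leafP hp2 tm2) => //; rewrite ?E2 ?g15 ?sv ?Er ?hF' // -E2 // n22'.
Qed.

Definition tstate t h := exists nd, [/\ tree_mem h nd, hN h 12 0 = size nd,
  drop (hN h 11 0) nd = cands t, (0 < hN h 11 0 <= size nd)%N &
  Yst h (nseq d 0 :: flatten [seq nseq (mult v) (point v) | v <- leaves t])].

Lemma depthP h t : hN h 0 =1 nth 0%N pl -> hR h 10 0 = scaleF c0 n k eps -> hN h 1 0 = t ->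
  (t < H)%N -> tstate t h -> tstate t.+1 (sem depth_body h).
Proof.
move=> hp hF ht tH [nd [tm h12 hcand /andP[lo0 hlo] hY]].
rewrite /depth_body !sem_seq [X in Submission.sem _ _ wts X]sem_CN; set h1 := setN 22 _ _ h.
have szc := size_cands c0 G n d k eps m t.
have hG : (size nd <= hN h 11 0 + 2 * Gam)%N.
  by move: szc; rewrite -hcand size_drop; lia.
have hsz g : (hN h 11 0 <= g < size nd)%N -> size (nth [::] nd g) = t.+1.
  case/andP=> g1 g2; apply: (@cands_size _ c0 G n d k eps m); rewrite -hcand.
  by rewrite -(subnKC g1) -nth_drop; apply: mem_nth;
    rewrite size_drop ltn_sub2r // (leq_ltn_trans g1 g2).
have p1 : hN h1 0 =1 nth 0%N pl by move=> x; rewrite /= ?upd2E /= hp.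
have n22 : hN h1 22 0 = t.+1 by rewrite /= ?upd2E /= ht addn1.
have W := @wtsP h1 nd t.+1 p1 tm h12 hF n22 tH hsz hG.
set h2 := Submission.sem _ _ wts h1 in W *.
rewrite [X in Submission.sem _ _ grow X]sem_CN; set h3 := setN 13 _ _ h2.
have N c : c \in [:: 0; 11; 12; 14; 20; 21; 22]%N -> hN h3 c = hN h1 c.
  move=> hc; rewrite /= funeqE => x; rewrite upd2E; case: eqP hc => [-> //|_ /=] hc.
  by move: hc; rewrite !inE => /or4P[|||/or4P[]] /eqP ->; rewrite frame_N.
have hRR c : (c < 64)%N -> c \notin [:: 6; 7; 8]%N -> hR h3 c = hR h c.
  by rewrite !inE !negb_or => c64 /and3P[] c6 c7 c8; rewrite /= frame_R //= !inE
    (negbTE c6) (negbTE c7) (negbTE c8).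
have lo3 : hN h3 11 = hN h 11 by rewrite N.
have := @growP h3 nd t.+1 _ _ _ _ _ _ _ _ _ _ _ _ _.
rewrite lo3 hcand => /(_ _) grow.
have {grow} [] := grow (nseq d 0 :: flatten [seq nseq (mult v) (point v) | v <- leaves t]).
- by move=> x; rewrite N // p1.
- by apply: tree_mem_frame tm; rewrite ?N ?hRR.
- by rewrite N.
- by rewrite /= ?upd2E /= frame_N.
- by rewrite hRR.
- by rewrite N.
- by [].
- by [].
- exact: hsz.
- exact: hG.
- exact: W.
- by apply: Yst_frame hY; rewrite ?hRR ?N.
set h4 := Submission.sem _ _ grow h3; move=> g1 g2 g3.
exists (nd ++ children [seq v <- cands t | expanded t.+1 (cands t) v]).
have e12 : hN h4 12 0 = size nd by rewrite frame_N // N.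
split.
- by apply: tree_mem_frame g1.
- by rewrite /= ?upd2E /= ?upd2E.
- by rewrite /= ?upd2E /= e12 drop_size_cat.
- rewrite /= ?upd2E /= e12 size_cat leq_addr andbT; lia.
- rewrite leavesS map_cat flatten_cat -cat_cons.
  by apply: Yst_frame g3.
Qed.

Lemma tree_cmdP h : hN h 0 =1 nth 0%N pl ->
  (forall i, hN h 14 i = 0%N) ->
  (forall c i, hR h c i = 0) ->
  Yst (sem tree_cmd h) synth.
Proof.
move=> hp hz hr; rewrite /tree_cmd sem_seq /tree_init !sem_seq.
set h0 := Submission.sem _ _ set_acoef h.
have n0 c : hN h0 c = hN h c by rewrite frame_N.
have r0 c : (c < 64)%N -> c != 4%N -> forall x, hR h0 c x = 0.
  by move=> c64 c4 x; rewrite frame_R // !inE !negb_or c4.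
have a0 : hR h0 4 0 = acoef eps n.
  rewrite /h0 /set_acoef !sem_if /= !hp /input /= /acoef.
  by do 2?[case: ifP => _]; rewrite /= ?upd2E /= /input.
set h1 := Submission.sem _ _ (CN 21 _ _) _.
have p1 : hN h1 0 =1 nth 0%N pl by move=> x; rewrite /h1 /= ?upd2E /= n0 hp.
have F1 : hR h1 10 0 = scaleF c0 n k eps by rewrite /h1 /= ?upd2E /= a0 !n0 !hp.
have H7 : hN h1 0 7 = H by rewrite p1.
pose I t h' := tstate t h'.
suff [nd [_ _ _ _]] : I H (sem (CFor 1 7 depth_body) h1) by [].
rewrite -H7; apply: (for_ind (I := I)) => // [|t h' htH hI hc hf hfr].
  exists [:: [::]; [:: false]; [:: true]].
  have h5 x : hR h1 5 x = if x == 2%N then 1 else 0 by rewrite /h1 /= ?upd2E /= r0.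
  have h14 x : hN h1 14 x = 0%N by rewrite /h1 /= ?upd2E /= n0 hz.
  have [h11 h12 h20 h21] : [/\ hN h1 11 0 = 1, hN h1 12 0 = 3, hN h1 20 0 = 1 & hN h1 21 0 = d]%N.
    by rewrite /h1 /= ?upd2E /= ?upd2E /= n0 hp.
  have [h41 h42] : (forall x, hR h1 41 x = 0) /\ (forall x, hR h1 42 x = 0).
    by split=> x; rewrite /h1 /= ?upd2E /= r0.
  split; rewrite ?[hN (setN _ _ _ _) _ _]/= ?upd2E /= ?h11 ?h12 //.
  - suff tm1 : tree_mem h1 [:: [::]; [:: false]; [:: true]] by apply: tree_mem_frame tm1.
    split=> // g /andP[g0 g3]; rewrite h14 h5.
    have [->|->] : g = 1%N \/ g = 2%N by move: g3; rewrite /=; lia.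
      by split=> //; exists false.
    by split=> //; exists true.
  - have nd0 (x : nat) : nth (0 : R) (nseq d 0 ++ [::]) x = 0 by rewrite cats0 nth_nseq if_same.
    split=> [x|x|x||]; rewrite /= ?upd2E /= ?nd0 ?r0 //.
    by rewrite n0 hp cats0 size_nseq.
rewrite H7 in htH.
have [nd [t1 t2 t3 t4 t5]] : tstate t.+1 (sem depth_body h').
  apply: depthP => //; first by move=> x; rewrite hf.
  by rewrite hfr.
by move: (sem depth_body h') t1 t2 t3 t4 t5 => hh ? ? ? ? ?; exists nd; split.
Qed.

End TreeCorrect.

(** * Choosing between the two answers *)

Section Selection.
Context {R : realType}.
Variables (d k : nat).

Definition sqdist (f g : nat -> R) x y : R := \sum_(j < d) (f (x + j)%N - g (y + j)%N) ^+ 2.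
Fixpoint minval (f : nat -> R) c : R :=
  if c is c'.+1 then if c' == 0%N then f 0%N else Num.min (minval f c') (f c') else 0.
Definition cost_val (f o : nat -> R) l : R :=
  \sum_(y < l) minval (fun c => sqdist f o (y * d) (c * d)) k.
Definition repeats (o : nat -> R) : bool :=
  has (fun i => has (fun j => (i < j)%N && (sqdist o o (i * d) (j * d) <= 0)) (iota 0 k)) (iota 0 k).
(** An answer with a repeated point does not consist of [k] centers and is discarded before costs
    are compared, whatever its cost. *)
Definition better (f o1 o2 : nat -> R) l : nat -> R :=
  if repeats o1 then o2 else if repeats o2 then o1
  else if cost_val f o1 l <= cost_val f o2 l then o1 else o2.
End Selection.

Definition dist_cmd a ea b eb := CR 45 (HC 0) (QN (HC 0)) ;;
  CFor 3 1 (CR 45 (HC 0) (QA (Re 45) (sq (QS (QG a (HA ea (Sc 3))) (QG b (HA eb (Sc 3))))))).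
Definition near_body o := dist_cmd 40 (Sc 21) o (Sc 23) ;;
  CIf (TN (Sc 2) (HC 0)) (CR 46 (HC 0) (Re 45))
    (CIf (TR (Re 46) (Re 45)) CSkip (CR 46 (HC 0) (Re 45))) ;;
  CN 23 (HC 0) (HA (Sc 23) (Pa 1)).
Definition cost_body o cs := CN 23 (HC 0) (HC 0) ;; CFor 2 2 (near_body o) ;;
  CR cs (HC 0) (QA (Re cs) (Re 46)) ;; CN 21 (HC 0) (HA (Sc 21) (Pa 1)).
Definition cost_cmd o cs := CR cs (HC 0) (QN (HC 0)) ;; CN 21 (HC 0) (HC 0) ;; CFor 1 13 (cost_body o cs).
Definition rep_in o cb := dist_cmd o (Sc 23) o (Sc 24) ;;
  CIf (TN (HA (Sc 1) (HC 1)) (Sc 2)) (CIf (TR (Re 45) (QN (HC 0))) (CN cb (HC 0) (HC 1)) CSkip) CSkip ;;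
  CN 24 (HC 0) (HA (Sc 24) (Pa 1)).
Definition rep_body o cb := CN 24 (HC 0) (HC 0) ;; CFor 2 2 (rep_in o cb) ;; CN 23 (HC 0) (HA (Sc 23) (Pa 1)).
Definition rep_cmd o cb := CN cb (HC 0) (HC 0) ;; CN 23 (HC 0) (HC 0) ;; CFor 1 2 (rep_body o cb).
(** The factor 2 undoes the halving in [point]. *)
Definition emit_in o := CEmit (QM (QN (HC 2)) (QG o (Sc 26))) ;; CN 26 (HC 0) (HA (Sc 26) (HC 1)).
Definition emit_cmd o := CN 26 (HC 0) (HC 0) ;; CFor 1 2 (CFor 2 1 (emit_in o)).
Definition choose_cmd := cost_cmd 43 47 ;; cost_cmd 44 48 ;; rep_cmd 43 27 ;; rep_cmd 44 28 ;;
  CIf (TN (HC 1) (Sc 27)) (emit_cmd 44) (CIf (TN (HC 1) (Sc 28)) (emit_cmd 43)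
    (CIf (TR (Re 47) (Re 48)) (emit_cmd 43) (emit_cmd 44))).

Section ChooseCorrect.
Context {R : realType}.
Variables (ns : seq nat) (rs : seq R) (d k l : nat).
Local Notation sem := (sem ns rs).
Implicit Types h : @hst R.
Definition dims h := [/\ hN h 0 1 = d, hN h 0 2 = k & hN h 0 13 = l].

Lemma dims_frame h h' : hN h' 0 = hN h 0 -> dims h -> dims h'.
Proof. by rewrite /dims => ->. Qed.

Lemma dist_cmdP a ea b eb h x y : a \notin [:: 45%N] -> b \notin [:: 45%N] ->
  (a < 64)%N -> (b < 64)%N -> dims h ->
  (forall h', (forall c, c != 3%N -> hN h' c = hN h c) -> evN ns h' ea = x /\ evN ns h' eb = y) ->
  hR (sem (dist_cmd a ea b eb) h) 45 0 = sqdist d (hR h a) (hR h b) x y.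
Proof.
rewrite !inE => a45 b45 a64 b64 [d1 _ _] he; rewrite /dist_cmd sem_seq sem_CR; set h1 := setR _ _ _ h.
pose I j h' := hR h' 45 0 = \sum_(j < j) (hR h a (x + j)%N - hR h b (y + j)%N) ^+ 2.
suff : I d (sem (CFor 3 1 (CR 45 (HC 0) (QA (Re 45) (sq (QS (QG a (HA ea (Sc 3))) (QG b (HA eb (Sc 3)))))))) h1) by [].
have e1 : hN h1 0 1 = d by [].
rewrite -e1; apply: (for_ind (I := I)) => // [|j h' hj i1 hc hf hfr].
  by rewrite /I big_ord0 /= upd2E.
have [|ex ey] := he h'; first by move=> c hc'; rewrite hf // !inE negb_or hc'.
rewrite /I big_ord_recr -i1 /= upd2E /= ex ey hc expr2.
have ea' : hR h' a = hR h a.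
  by rewrite hfr ?inE // funeqE => z; rewrite /= upd2E (negbTE a45).
have eb' : hR h' b = hR h b.
  by rewrite hfr ?inE // funeqE => z; rewrite /= upd2E (negbTE b45).
by rewrite ea' eb'.
Qed.

Hypothesis k0 : (0 < k)%N.

Lemma cost_cmdP o cs h : o \in [:: 43; 44]%N -> cs \in [:: 47; 48]%N -> dims h ->
  hR (sem (cost_cmd o cs) h) cs 0 = cost_val d k (hR h 40) (hR h o) l.
Proof.
move=> ho hcs hd; rewrite /cost_cmd 2!sem_seq sem_CR [X in Submission.sem _ _ (CFor _ _ _) X]sem_CN.
have [u64 u45 u46 ucs] : [/\ (o < 64)%N, o != 45%N, o != 46%N & o != cs].
  by move: ho hcs; rewrite !inE => /orP[] /eqP -> /orP[] /eqP ->.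
have [cs64 cs45 cs46 cs40] : [/\ (cs < 64)%N, cs != 45%N, cs != 46%N & cs != 40%N].
  by move: hcs; rewrite !inE => /orP[] /eqP ->.
have f40 : (40 == cs)%N = false by rewrite eq_sym (negbTE cs40).
set h1 := setR _ _ _ h; set h2 := setN _ _ _ h1.
pose f y := minval (fun c => sqdist d (hR h 40) (hR h o) (y * d) (c * d)) k.
pose I j h' := hR h' cs 0 = \sum_(y < j) f y /\ hN h' 21 0 = (j * d)%N.
suff [] : I l (sem (CFor 1 13 (cost_body o cs)) h2) by [].
have d2 : dims h2 by [].
have e1 : hN h2 0 13 = l by case: d2.
rewrite -e1; apply: (for_ind (I := I)) => // [|j h' hj [i1 i2] hc hf hfr].
  by split; rewrite /= ?upd2E ?eqxx ?big_ord0 // mul0n.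
have d' : dims h' by apply: dims_frame d2; rewrite hf.
have c40 : 40%N \notin wR (cost_body o cs) by rewrite !inE f40.
have co : o \notin wR (cost_body o cs) by rewrite !inE (negbTE u45) (negbTE u46) (negbTE ucs).
have r40 : hR h' 40 = hR h 40.
  by rewrite hfr // funeqE => z; rewrite /= upd2E f40.
have ro : hR h' o = hR h o by rewrite hfr // funeqE => z; rewrite /= upd2E (negbTE ucs).
rewrite /cost_body !sem_seq [X in Submission.sem _ _ (CFor _ _ _) X]sem_CN; set h3 := setN _ _ _ h'.
set h4 := Submission.sem _ _ (CFor _ _ _) h3.
have d3 : dims h3 by apply: dims_frame d'; rewrite /= funeqE => z; rewrite upd2E.
pose J c h'' := (c = 0%N \/ hR h'' 46 0 = minval (fun c => sqdist d (hR h 40) (hR h o) (j * d) (c * d)) c)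
   /\ hN h'' 23 0 = (c * d)%N.
have wn : [&& 2 != 0, 2 \notin wN (near_body o) & 0 \notin wN (near_body o)]%N by [].
have [j1 _] : J k h4.
  have e2 : hN h3 0 2 = k by case: d3.
  rewrite -e2; apply: (for_ind (I := J)) => // [|c h'' hj' [k1 k2] kc kf kfr].
    by split; [left|rewrite /= upd2E /= mul0n].
  have d'' : dims h'' by apply: dims_frame d3; rewrite kf.
  have wr c' : c' \notin [:: 45; 46]%N -> c' \notin wR (near_body o).
    by rewrite !inE !negb_or => /andP[-> ->].
  have r40' : hR h'' 40 = hR h 40 by rewrite kfr.
  have ro' : hR h'' o = hR h o.
    by rewrite kfr // wr // !inE (negbTE u45) (negbTE u46).
  rewrite /near_body 2!sem_seq; set h5 := Submission.sem _ _ (dist_cmd _ _ _ _) h''.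
  have r45 : hR h5 45 0 = sqdist d (hR h 40) (hR h o) (j * d) (c * d).
    rewrite -r40' -ro'; apply: dist_cmdP; rewrite ?inE // => h0 hh0 /=.
    by rewrite !hh0 // k2 kf //; split=> //; rewrite /= upd2E.
  have r46 : hR h5 46 = hR h'' 46 by rewrite frame_R.
  have n2 : hN h5 2 0 = c by rewrite frame_N.
  have n23 : hN h5 23 0 = (c * d)%N by rewrite frame_N.
  have n01 : hN h5 0 1 = d by rewrite frame_N //; case: d''.
  rewrite sem_CN /J; split; last first.
    rewrite sem_if; case: ifP => _; [|rewrite sem_if; case: ifP => _];
      by rewrite /= ?upd2E /= ?upd2E /= n23 n01 mulSn addnC.
  right; rewrite sem_if [evT _ _ _ _]/= n2 leqn0.
  have [e|c0'] := eqVneq c 0%N; first by rewrite /= upd2E /= r45 e.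
  have {}k1 : hR h'' 46 0 = minval (fun c => sqdist d (hR h 40) (hR h o) (j * d) (c * d)) c.
    by case: k1 => // e; rewrite e in c0'.
  rewrite [minval _ _.+1]/= (negbTE c0') sem_if [evT _ _ _ _]/= r45 r46 k1 minEle.
  by case: ifP => _; rewrite /= ?upd2E /= ?r45 ?r46 ?k1.
have j1' : k = 0%N \/ hR h4 46 0 = f j by [].
have rcs : hR h4 cs = hR h' cs.
  by rewrite frame_R // !inE (negbTE cs45) (negbTE cs46).
have n21 : hN h4 21 0 = (j * d)%N by rewrite frame_N //= upd2E.
have n01 : hN h4 0 1 = d by rewrite frame_N //; case: d3.
split; last by rewrite /= ?upd2E /= ?upd2E /= n21 n01 mulSn addnC.
rewrite big_ord_recr -i1 /= ?upd2E !eqxx /= rcs; congr (_ + _).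
by case: j1' => // e; move: k0; rewrite e.
Qed.

Lemma iotaS i : iota 0 i.+1 = iota 0 i ++ [:: i].
Proof. by rewrite -addn1 iotaD. Qed.

Lemma rep_cmdP o cb h : o \in [:: 43; 44]%N -> cb \in [:: 27; 28]%N -> dims h ->
  hN (sem (rep_cmd o cb) h) cb 0 = repeats d k (hR h o).
Proof.
move=> ho hcb hd; rewrite /rep_cmd 2!sem_seq 2!sem_CN.
have [u64 u45] : (o < 64)%N /\ o != 45%N by move: ho; rewrite !inE => /orP[] /eqP ->.
have [cb64 cb23 cb24 cb12] : [/\ (cb < 64)%N, cb != 23%N, cb != 24%N & [&& cb != 1, cb != 2, cb != 3 & cb != 0]%N].
  by move: hcb; rewrite !inE => /orP[] /eqP ->.
case/and4P: cb12 => cb1 cb2 cb3 cb0.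
have F : ((23 == cb) = false) /\ ((24 == cb) = false) /\ ((1 == cb) = false) /\ ((2 == cb) = false) /\ ((0 == cb) = false) /\ ((3 == cb) = false).
  by move: hcb; rewrite !inE => /orP[] /eqP ->.
move: F => [f23 [f24 [f1 [f2 [f0 f3]]]]].
set h2 := setN 23 _ _ _.
pose P i j := (i < j)%N && (sqdist d (hR h o) (hR h o) (i * d) (j * d) <= 0).
pose I i h' := hN h' cb 0 = has (fun i => has (P i) (iota 0 k)) (iota 0 i) /\
  hN h' 23 0 = (i * d)%N.
suff [] : I k (sem (CFor 1 2 (rep_body o cb)) h2) by [].
have d2 : dims h2 by apply: dims_frame hd; rewrite funeqE => z; rewrite /= ?upd2E f0.
have e1 : hN h2 0 2 = k by case: d2.
have w1 : [&& 1 != 0, 1 \notin wN (rep_body o cb) & 0 \notin wN (rep_body o cb)]%N.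
  by rewrite /= !inE f1 f0.
have w2 : [&& 2 != 0, 2 \notin wN (rep_in o cb) & 0 \notin wN (rep_in o cb)]%N.
  by rewrite /= !inE f2 f0.
rewrite -{1}e1; apply: (for_ind (I := I)) => // [|i h' hi [i1 i2] hc hf hfr].
  by rewrite /I /= ?upd2E ?eqxx ?(negbTE cb23) ?(negbTE cb1) /= mul0n.
have d' : dims h' by apply: dims_frame d2; rewrite hf // !inE f0.
have ro : hR h' o = hR h o by rewrite hfr // !inE (negbTE u45).
rewrite /rep_body !sem_seq sem_CN [X in Submission.sem _ _ (CFor _ _ _) X]sem_CN; set h3 := setN _ _ _ h'.
set h4 := Submission.sem _ _ (CFor _ _ _) h3.
have d3 : dims h3 by apply: dims_frame d'; rewrite /= funeqE => z; rewrite upd2E.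
pose J c h'' := hN h'' cb 0 = (has (fun i => has (P i) (iota 0 k)) (iota 0 i) || has (P i) (iota 0 c))
   /\ hN h'' 24 0 = (c * d)%N.
have [j1 _] : J k h4.
  have e2 : hN h3 0 2 = k by case: d3.
  rewrite -{1}e2; apply: (for_ind (I := J)) => // [|c h'' hj' [k1 k2] kc kf kfr].
    by split; rewrite /= ?upd2E ?(negbTE cb2) ?(negbTE cb24) /= ?orbF.
  have d'' : dims h'' by apply: dims_frame d3; rewrite kf // !inE f0.
  have ro' : hR h'' o = hR h o by rewrite kfr // !inE (negbTE u45).
  rewrite /rep_in 2!sem_seq; set h5 := Submission.sem _ _ (dist_cmd _ _ _ _) h''.
  have r45 : hR h5 45 0 = sqdist d (hR h o) (hR h o) (i * d) (c * d).
    rewrite -ro'; apply: dist_cmdP; rewrite ?inE // => h0 hh0 /=.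
    by rewrite !hh0 // k2 kf ?inE ?f23 //= upd2E.
  have n1 : hN h5 1 0 = i.
    by rewrite frame_N // kf ?inE ?f1 //= upd2E /=.
  have n2 : hN h5 2 0 = c by rewrite frame_N.
  have n24 : hN h5 24 0 = (c * d)%N by rewrite frame_N.
  have ncb : hN h5 cb 0 = hN h'' cb 0 by rewrite frame_N // !inE (negbTE cb3).
  have n01 : hN h5 0 1 = d by rewrite frame_N //; case: d''.
  have hx : sem (CIf (TN (HA (Sc 1) (HC 1)) (Sc 2)) (CIf (TR (Re 45) (QN (HC 0))) (CN cb (HC 0) (HC 1)) CSkip) CSkip) h5 =
      if P i c then setN cb 0 1 h5 else h5.
    rewrite !sem_if /P [evT _ _ _ _]/= n1 n2 addn1 [in X in (if _ then X else _)]/= r45.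
    by case: (i < c)%N.
  rewrite hx sem_CN /J iotaS has_cat orbA [has _ [:: c]]/= orbF.
  split; last by case: ifP => _; rewrite /= ?upd2E ?f24 ?f0 /= n24 n01 mulSn addnC.
  by case: (P i c); rewrite /= ?upd2E ?(negbTE cb24) ?(negbTE cb2) /= ?eqxx ?orbT // ncb k1 orbF.
have n23 : hN h4 23 0 = (i * d)%N.
  by rewrite frame_N ?inE ?f23 //= upd2E.
have n01 : hN h4 0 1 = d by rewrite frame_N ?inE ?f0 //; case: d3.
split; last by rewrite /= ?upd2E /= n23 n01 mulSn addnC.
rewrite iotaS has_cat /= orbF ?upd2E (negbTE cb1) (negbTE cb23) /=.
exact: j1.
Qed.

Lemma emit_cmdP o h : dims h -> (o < 64)%N ->
  hout (sem (emit_cmd o) h) = hout h ++ mkseq (fun x => 2 * hR h o x) (k * d).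
Proof.
move=> hd u64; rewrite /emit_cmd sem_seq sem_CN; set h1 := setN _ _ _ h.
pose I i h' := hout h' = hout h ++ mkseq (fun x => 2 * hR h o x) (i * d) /\ hN h' 26 0 = (i * d)%N.
suff [] : I k (sem (CFor 1 2 (CFor 2 1 (emit_in o))) h1) by [].
have d1 : dims h1 by [].
have e1 : hN h1 0 2 = k by case: d1.
rewrite -e1; apply: (for_ind (I := I)) => // [|i h' hi [i1 i2] hc hf hfr].
  by rewrite /I mul0n cats0.
have d' : dims h' by apply: dims_frame d1; rewrite hf.
pose J j h'' := hout h'' = hout h ++ mkseq (fun x => 2 * hR h o x) (i * d + j) /\ hN h'' 26 0 = (i * d + j)%N.
suff [j1 j2] : J d (sem (CFor 2 1 (emit_in o)) h').
  by move: (sem (CFor 2 1 (emit_in o)) h') j1 j2 => hh j1 j2; rewrite /I mulSn addnC.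
have e2 : hN h' 0 1 = d by case: d'.
rewrite -e2; apply: (for_ind (I := J)) => // [|j h'' hj [j1 j2] kc kf kfr].
  by rewrite /J addn0.
have oe : o \notin [:: 64%N] by rewrite inE neq_ltn u64.
have ro : hR h'' o = hR h o by rewrite (kfr _ u64 oe) (hfr _ u64 oe).
rewrite /J /= ?upd2E /= j2 ro j1 addnS addn1; split=> //.
by rewrite /mkseq iotaS map_cat catA cats1.
Qed.

Lemma choose_cmdP h : dims h -> hout h = [::] ->
  hout (sem choose_cmd h) = mkseq (fun x => 2 * better d k (hR h 40) (hR h 43) (hR h 44) l x) (k * d).
Proof.
move=> hd ho; rewrite /choose_cmd.
rewrite sem_seq; set h1 := Submission.sem _ _ (cost_cmd 43 47) h.
rewrite sem_seq; set h2 := Submission.sem _ _ (cost_cmd 44 48) h1.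
rewrite sem_seq; set h3 := Submission.sem _ _ (rep_cmd 43 27) h2.
rewrite sem_seq; set h4 := Submission.sem _ _ (rep_cmd 44 28) h3.
have D1 : dims h1 by apply: dims_frame hd; rewrite frame_N.
have D2 : dims h2 by apply: dims_frame D1; rewrite frame_N.
have D3 : dims h3 by apply: dims_frame D2; rewrite frame_N.
have D4 : dims h4 by apply: dims_frame D3; rewrite frame_N.
have O4 : hout h4 = [::] by rewrite !frame_out.
have R1 c : c \in [:: 40; 43; 44]%N -> hR h1 c = hR h c.
  by rewrite !inE => /or3P[] /eqP ->; rewrite frame_R.
have R2 c : c \in [:: 40; 43; 44]%N -> hR h2 c = hR h c.
  by move=> hc; rewrite -R1 //; move: hc; rewrite !inE => /or3P[] /eqP ->; rewrite frame_R.
have R3 c : c \in [:: 40; 43; 44]%N -> hR h3 c = hR h c.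
  by move=> hc; rewrite -R2 //; move: hc; rewrite !inE => /or3P[] /eqP ->; rewrite frame_R.
have R4 c : c \in [:: 40; 43; 44]%N -> hR h4 c = hR h c.
  by move=> hc; rewrite -R3 //; move: hc; rewrite !inE => /or3P[] /eqP ->; rewrite frame_R.
have c1 : hR h4 47 0 = cost_val d k (hR h 40) (hR h 43) l.
  by rewrite frame_R // frame_R // frame_R // cost_cmdP.
have c2 : hR h4 48 0 = cost_val d k (hR h 40) (hR h 44) l.
  by rewrite frame_R // frame_R // cost_cmdP // !R1.
have b1 : hN h4 27 0 = repeats d k (hR h 43) by rewrite frame_N // rep_cmdP // R2.
have b2 : hN h4 28 0 = repeats d k (hR h 44) by rewrite rep_cmdP // R3.
rewrite !sem_if.
have -> : evT ns rs h4 (TN (HC 1) (Sc 27)) = repeats d k (hR h 43) by rewrite /= b1; case: repeats.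
have -> : evT ns rs h4 (TN (HC 1) (Sc 28)) = repeats d k (hR h 44) by rewrite /= b2; case: repeats.
have -> : evT ns rs h4 (TR (Re 47) (Re 48)) =
   (cost_val d k (hR h 40) (hR h 43) l <= cost_val d k (hR h 40) (hR h 44) l) by rewrite /= c1 c2.
by rewrite /better; do 3?[case: ifP => _]; rewrite emit_cmdP // O4 R4.
Qed.

End ChooseCorrect.

(** * The complete programs of users and decoder *)

Definition enc_rb := NAdd (NGet (NConst 1)) (NConst 1).
Definition dec_rb := NAdd (NGet (NConst 3)) (NConst 1).
(** Discards the public coins that determined the projections, so that the second run of the given
    algorithm gets coins independent of the messages. *)
Definition skip_cmd := CFor 1 3 (CFor 2 1 (CPub 7 (HC 0))).
Definition pmem_cmd := CN 31 (HC 0) (Sc 20) ;; CN 31 (HC 1) (Pa 1) ;; CN 31 (HC 2) (Pa 2) ;;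
  CN 32 (HC 0) (Sc 20) ;; CN 32 (HC 1) (Pa 1) ;; CN 32 (HC 2) (Pa 2).
Definition ny_cmd := CN 0 (HC 13) (Sc 20).

Section Programs.
Variables (c0 G : nat).

Definition enc_cmds := param_cmds c0 G ++ [:: enc_main].
Definition enc_prog := compile_all enc_rb enc_cmds.
Definition pre_cmds := param_cmds c0 G ++ [:: skip_cmd; tree_cmd; pmem_cmd; ny_cmd].
Definition dec_prog (p : prog) :=
  Seq (compile_all dec_rb pre_cmds)
    (Seq (tr dec_rb 31 33 41 43 false p)
      (Seq (tr dec_rb 32 34 42 44 true p) (compile_all dec_rb [:: choose_cmd]))).

Context {R : realType}.
Variables (n d k : nat).
Hypothesis c00 : (0 < c0)%N.
Hypothesis k0 : (0 < k)%N.
Local Notation q := (pq c0 k).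
Local Notation pl := (plist c0 G n d k).
Definition pmax := sumn pl.

Lemma q_gt0 : (0 < q)%N. Proof. by rewrite muln_gt0 c00 addn1. Qed.

Lemma plist_le x : x \in pl -> (x <= pmax)%N.
Proof.
rewrite /pmax; elim: pl => //= y s IH; rewrite inE => /orP[/eqP ->|/IH h].
  exact: leq_addr.
by apply: leq_trans h _; rewrite leq_addl.
Qed.

Lemma plist_nth_le i : (nth 0%N pl i <= pmax)%N.
Proof.
have [hi|hi] := ltnP i (size pl); last by rewrite nth_default.
by apply: plist_le; apply: mem_nth.
Qed.

Section Encoder.
Variables (eps : R) (x : 'rV[R]_d) (pub w : seq bool).

Lemma enc_rbE (s : @state R) : (forall i, (i < 4)%N -> nmem s i = nth 0%N [:: n; d; k] i) ->
  neval s enc_rb = size (eps :: coords x).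
Proof. by move=> h; rewrite /= h //= size_map size_enum_ord addn1. Qed.

Lemma enc_correct : exists s t, [/\ exec enc_prog (enc_start n k eps x pub w) s t,
  out s = encout c0 n d k eps (coords x) pub w & (t <= cost_all pmax enc_cmds)%N].
Proof.
have sx : size (coords x) = d by rewrite size_map size_enum_ord.
have [hb [[hp hz hr [h1 h2 h3]] _]] := @params_correct R [:: n; d; k] (eps :: coords x)
   c0 G n d k erefl erefl erefl pmax w pub plist_le.
set h := sem_all _ _ _ _ in hp hz hr h1 h2 h3.
have hb' : bounded [:: n; d; k] (eps :: coords x) pmax enc_cmds (hinit w pub).
  apply: bounded_cat => //; split=> // i.
  by rewrite -/h hp plist_nth_le.
have [|s [t [e1 [_ _ _ _ [_ _ eo]] c1]]] := compile_all_correct enc_rbE hb' (s := enc_start n k eps x pub w).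
  exact: rel_init.
exists s, t; split=> //; rewrite eo sem_all_cat -/h.
exact: (enc_mainP eps sx q_gt0 hp h2 h1 h3).
Qed.
End Encoder.

Section Decoder.
Variables (eps : R) (m : seq R) (pub v : seq bool) (p : prog) (T : nat).
Hypothesis sm : size m = (n * stride c0 n d k)%N.
Local Notation Y := (synth c0 G n d k eps m).
Local Notation sem := (sem [:: n; d; k; size m] (eps :: m)).

Definition run1 := init [:: size Y; d; k] (flatten Y) v [::].
Definition run2 := init [:: size Y; d; k] (flatten Y) (drop (q * d) pub) [::].

Lemma dec_rbE (s : @state R) : (forall i, (i < 4)%N -> nmem s i = nth 0%N [:: n; d; k; size m] i) ->
  neval s dec_rb = size (eps :: m).
Proof. by move=> h; rewrite /= h //= addn1. Qed.

Lemma skip_cmdP (h : @hst R) : hN h 0 =1 nth 0%N pl -> hpu h = pub ->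
  hpu (sem skip_cmd h) = drop (q * d) pub.
Proof.
move=> hp hu; pose I a (h' : @hst R) := hpu h' = drop (a * d) pub.
have q3 : hN h 0 3 = q by rewrite hp.
suff : I q (sem skip_cmd h) by [].
rewrite -q3; apply: (for_ind (I := I)) => // [|a h' ha i1 hc hf _].
  by rewrite /I /= mul0n drop0.
pose J j (h'' : @hst R) := hpu h'' = drop (a * d + j) pub.
have d1 : hN h' 0 1 = d by rewrite hf // hp.
suff : J d (sem (CFor 2 1 (CPub 7 (HC 0))) h').
  by move: (sem _ _) => hh; rewrite /I /J mulSn addnC.
rewrite -d1; apply: (for_ind (I := J)) => // [|j h'' hj j1 _ _ _]; first by rewrite /J addn0.
by rewrite /J /= j1 behead_drop addnS.
Qed.

Lemma pmem_cmdP l (h : @hst R) : hN h 0 1 = d -> hN h 0 2 = k -> hN h 20 0 = l ->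
  (forall i, hN h 31 i = 0%N) -> (forall i, hN h 32 i = 0%N) ->
  forall c i, c \in [:: 31; 32]%N -> hN (sem pmem_cmd h) c i = nth 0%N [:: l; d; k] i.
Proof.
move=> h1 h2 h20 h31 h32 c i; rewrite !inE => /orP[] /eqP -> /=; rewrite ?upd2E /= h1 h2 h20;
  by case: i => [|[|[|i]]] //=; rewrite ?h31 ?h32 nth_nil.
Qed.

Lemma pre_state (h := sem_all [:: n; d; k; size m] (eps :: m) pre_cmds (hinit v pub)) :
  bounded [:: n; d; k; size m] (eps :: m) (pmax + size Y) pre_cmds (hinit v pub) /\
  [/\ dims d k (size Y) h /\ forall i, (hN h 0 i <= pmax + size Y)%N,
      hN h 31 = nth 0%N [:: size Y; d; k] /\ hN h 32 = nth 0%N [:: size Y; d; k],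
      [/\ hR h 40 = nth 0 (flatten Y), hR h 41 = nth 0 (flatten Y) & hR h 42 = nth 0 (flatten Y)],
      [/\ hR h 43 = nth 0 [::], hR h 44 = nth 0 [::], hN h 33 0 = 0%N & hN h 34 0 = 0%N] &
      [/\ hpr h = v, hpu h = drop (q * d) pub & hout h = [::]]].
Proof.
have hM x : x \in pl -> (x <= pmax + size Y)%N.
  by move=> /plist_le hx; apply: leq_trans hx (leq_addr _ _).
have [hb [[hp hz hr [t1 t2 t3]] _]] := @params_correct R [:: n; d; k; size m] (eps :: m)
   c0 G n d k erefl erefl erefl _ v pub hM.
have [h0 e0] : exists h0, h0 = sem_all [:: n; d; k; size m] (eps :: m) (param_cmds c0 G) (hinit v pub).
  by eexists.
rewrite -e0 in hp hz hr t1 t2 t3.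
have hM' i : (nth 0%N pl i <= pmax + size Y)%N.
  by apply: leq_trans (plist_nth_le i) (leq_addr _ _).
have -> : h = sem_all [:: n; d; k; size m] (eps :: m) [:: skip_cmd; tree_cmd; pmem_cmd; ny_cmd] h0.
  by rewrite /h /pre_cmds sem_all_cat -e0.
rewrite {h}.
have [h1 eh1] : exists h1, h1 = sem skip_cmd h0 by eexists.
have [h2 eh2] : exists h2, h2 = sem tree_cmd h1 by eexists.
have [h3 eh3] : exists h3, h3 = sem pmem_cmd h2 by eexists.
have p1 : hN h1 0 =1 nth 0%N pl by move=> i; rewrite eh1 frame_N.
have p2 : hN h2 0 =1 nth 0%N pl by move=> i; rewrite eh2 frame_N.
have p3 : hN h3 0 =1 nth 0%N pl by move=> i; rewrite eh3 frame_N.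
split.
  apply: bounded_cat; first exact: hb.
  rewrite -e0.
  do 4?[split=> //] => i; rewrite -?eh1 -?eh2 -?eh3 ?hp ?p1 ?p2 ?p3 //.
have r1 c : (c < 64)%N -> forall i, hR h1 c i = 0 by move=> hc i; rewrite eh1 frame_R // inE neq_ltn (leq_trans hc).
have z14 i : hN h1 14 i = 0%N by rewrite eh1 frame_N // hz.
have rz c i : hR h1 c i = 0.
  have [hc|hc] := ltnP c 64; first exact: r1.
  suff -> : hR h1 c = hR h0 c by exact: hr.
  rewrite eh1 /skip_cmd /=; elim: (hN h0 0 3) => //= j <-.
  by elim: (hN _ 0 1).
have Y2 := tree_cmdP eps sm p1 z14 rz; rewrite -eh2 in Y2.
case: Y2 => y0 y1 y2 y3 y4.
have e31 c i : c \in [:: 31; 32; 33; 34]%N -> hN h2 c i = 0%N.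
  by move=> hc; rewrite eh2 frame_N ?eh1 ?frame_N ?hz //; move: hc; rewrite !inE => /or4P[] /eqP ->.
have p3' c i : (c \in [:: 0; 20; 33; 34])%N -> hN h3 c i = hN h2 c i.
  by rewrite eh3 !inE => /or4P[] /eqP ->; rewrite frame_N.
have e3 c i : c \in [:: 31; 32]%N -> hN h3 c i = nth 0%N [:: size Y; d; k] i.
  have n20 : hN h2 20 0 = size Y by [].
  by rewrite eh3; apply: pmem_cmdP; rewrite ?p2 // => j; rewrite e31.
have rr c : (c < 64)%N -> hR (sem ny_cmd h3) c = hR h2 c by move=> hc; rewrite frame_R // eh3 frame_R.
have -> : sem_all [:: n; d; k; size m] (eps :: m) [:: skip_cmd; tree_cmd; pmem_cmd; ny_cmd] h0 = sem ny_cmd h3.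
  by rewrite eh3 eh2 eh1.
have n20 : hN h3 20 0 = size Y by rewrite p3'.
have n4 c i : hN (sem ny_cmd h3) c i = if (c == 0)%N && (i == 13)%N then size Y else hN h3 c i.
  by rewrite -n20.
have r43 c : c \in [:: 43; 44]%N -> hR (sem ny_cmd h3) c = nth 0 [::].
  by rewrite !inE => /orP[] /eqP ->; rewrite rr // eh2 frame_R // funeqE => i;
    rewrite nth_nil r1.
split; first split.
- by split; rewrite n4 //= p3.
- by move=> i; rewrite n4 /=; case: eqP => [_|_]; rewrite ?p3 // leq_addl.
- by split; rewrite funeqE => i; rewrite n4 /= e3.
- by split; rewrite rr // funeqE.
- by split; rewrite ?r43 // n4 /= p3' // e31.
- rewrite frame_pr // frame_pu // frame_out // eh3 frame_pr // frame_pu // frame_out //.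
  rewrite eh2 frame_pr // frame_pu // frame_out // eh1 frame_pr // frame_out //.
  by split=> //; apply: skip_cmdP.
Qed.

(** The term [6 * T] stands for two simulated runs at three host steps per step. The number of
    synthetic points is added to [pmax] because it bounds the loops of the comparison. *)
Lemma dec_correct : halts T p run1 -> halts T p run2 ->
  exists s t, [/\ exec (dec_prog p) (dec_start n d k eps m pub v) s t,
  out s = mkseq (fun x => 2 * better d k (nth 0 (flatten Y)) (nth 0 (output T p run1))
     (nth 0 (output T p run2)) (size Y) x) (k * d) &
  (t <= cost_all (pmax + size Y) pre_cmds + cost_all (pmax + size Y) [:: choose_cmd] + 6 * T + 3)%N].
Proof.
move=> halt1 halt2; have [hb] := pre_state.
have [h eh] : exists h, h = sem_all [:: n; d; k; size m] (eps :: m) pre_cmds (hinit v pub) by eexists.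
rewrite -eh => -[[D hM] [e31 e32] [e40 e41 e42] [e43 e44 e33 e34] [t1 t2 t3]].
have [|s1 [u1 [x1 r1 c1]]] := compile_all_correct dec_rbE hb (s := dec_start n d k eps m pub v).
  exact: rel_init.
rewrite -eh in r1.
have ps1 : psim 31 33 41 43 false h h run1 by split; [rewrite e31|rewrite e41|rewrite e43|rewrite e33|].
have [h2 [s2 [u2 [x2 c2 r2 ps2]]]] :=
  embed_correct dec_rbE (cM := 31) (cZ := 33) (cQ := 41) (cO := 43) isT isT isT isT erefl erefl halt1 ps1 r1.
case: (ps2) => _ _ b43 _ [_ b2 _ [b3 bN bR]].
have ps3 : psim 32 34 42 44 true h2 h2 run2.
  split; [by rewrite bN // e32|by rewrite bR // e42|by rewrite bR // e44|by rewrite bN // e34|].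
  by split=> //; rewrite b2.
have [h3 [s3 [u3 [x3 c3 r3 ps4]]]] :=
  embed_correct dec_rbE (cM := 32) (cZ := 34) (cQ := 42) (cO := 44) isT isT isT isT erefl erefl halt2 ps3 r2.
case: (ps4) => _ _ d44 _ [_ _ _ [d3 dN dR]].
have D3 : dims d k (size Y) h3 by apply: dims_frame D; rewrite dN // bN.
have hb3 : bounded [:: n; d; k; size m] (eps :: m) (pmax + size Y) [:: choose_cmd] h3.
  by split=> // i; rewrite dN // bN.
have [s4 [u4 [x4 r4 c4]]] := compile_all_correct dec_rbE hb3 r3.
exists s4; eexists; split.
- by apply: exec_seq x1 _; apply: exec_seq x2 _; apply: exec_seq x3 x4.
- case: r4 => _ _ _ _ [_ _ ->].
  have E := @choose_cmdP R [:: n; d; k; size m] (eps :: m) d k (size Y) k0 h3 D3 (etrans d3 (etrans b3 t3)).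
  apply: etrans E _.
  by rewrite (dR 40%N) // (bR 40%N) // e40 (dR 43%N) // b43 d44.
- by move: c1 c2 c3 c4; rewrite -/pre_cmds; lia.
Qed.

End Decoder.
End Programs.

(** * Expectations over coin tapes *)

Section Expectation.
Context {R : realType}.
Implicit Types (f g : seq bool -> R) (P Q : seq bool -> Prop).

(* Expectation over a tape of [l] fair coins. *)
Fixpoint ex (l : nat) f : R := if l is l'.+1
  then (ex l' (fun w => f (false :: w)) + ex l' (fun w => f (true :: w))) / 2 else f [::].

Lemma eq_ex l f g : (forall w, size w = l -> f w = g w) -> ex l f = ex l g.
Proof.
elim: l f g => [|l IH] f g h /=; first exact: h.
by congr ((_ + _) / 2); apply: IH => w hw; apply: h; rewrite /= hw.
Qed.

Lemma ex_le l f g : (forall w, size w = l -> f w <= g w) -> ex l f <= ex l g.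
Proof.
elim: l f g => [|l IH] f g h /=; first exact: h.
by rewrite ler_pM2r ?invr_gt0 //; apply: lerD; apply: IH => w hw; apply: h; rewrite /= hw.
Qed.

Lemma ex_cst l (c : R) : ex l (fun=> c) = c.
Proof. by elim: l => //= l ->; field. Qed.

Lemma exD l f g : ex l (fun w => f w + g w) = ex l f + ex l g.
Proof. by elim: l f g => //= l IH f g; rewrite !IH; field. Qed.

Lemma exZ l (c : R) f : ex l (fun w => c * f w) = c * ex l f.
Proof. by elim: l f => //= l IH f; rewrite !IH; field. Qed.

Lemma exZr l (c : R) f : ex l (fun w => f w * c) = ex l f * c.
Proof. by rewrite mulrC -exZ; apply: eq_ex => w _; rewrite mulrC. Qed.

Lemma exB l f g : ex l (fun w => f w - g w) = ex l f - ex l g.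
Proof. by elim: l f g => //= l IH f g; rewrite !IH; field. Qed.

Lemma ex_ge0 l f : (forall w, size w = l -> 0 <= f w) -> 0 <= ex l f.
Proof. by move=> h; rewrite -(ex_cst l 0); apply: ex_le. Qed.

Lemma ex_sum (I : Type) (r : seq I) (F : I -> seq bool -> R) l :
  ex l (fun w => \sum_(i <- r) F i w) = \sum_(i <- r) ex l (F i).
Proof.
elim: r => [|i r IH]; first by rewrite big_nil -[RHS](ex_cst l); apply: eq_ex => w _; rewrite big_nil.
by rewrite big_cons -IH -exD; apply: eq_ex => w _; rewrite big_cons.
Qed.

Lemma ex_cat a b f : ex (a + b) f = ex a (fun u => ex b (fun v => f (u ++ v))).
Proof. by elim: a f => //= a IH f; rewrite !IH. Qed.

Lemma ex_norm l f : `|ex l f| <= ex l (fun w => `|f w|).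
Proof.
elim: l f => //= l IH f; rewrite normrM normfV (ger0_norm (ler0n _ 2)).
by rewrite ler_pM2r ?invr_gt0 //; apply: le_trans (ler_normD _ _) _; apply: lerD.
Qed.

Definition ind (p : Prop) : R := (`[< p >] : nat)%:R.
Definition pr l P : R := ex l (fun w => ind (P w)).

Lemma ind_ge0 p : 0 <= ind p. Proof. exact: ler0n. Qed.
Lemma ind_le1 p : ind p <= 1. Proof. by rewrite /ind; case: asbool; rewrite ?ler01. Qed.
Lemma ind_le p q : (p -> q) -> ind p <= ind q.
Proof.
rewrite /ind => h; case: asboolP => [/h hq|_]; last exact: ler0n.
by case: asboolP.
Qed.
Lemma indT (p : Prop) : p -> ind p = 1. Proof. by rewrite /ind; case: asboolP. Qed.
Lemma indF (p : Prop) : ~ p -> ind p = 0. Proof. by rewrite /ind; case: asboolP. Qed.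
Lemma ind_or p q : ind (p \/ q) <= ind p + ind q.
Proof.
rewrite {1}/ind; case: asboolP => [[h|h]|_]; last by rewrite addr_ge0 ?ind_ge0.
  by rewrite (indT h) lerDl ind_ge0.
by rewrite (indT h) lerDr ind_ge0.
Qed.

Lemma pr_ge0 l P : 0 <= pr l P. Proof. by apply: ex_ge0 => w _; exact: ind_ge0. Qed.
Lemma pr_or l P Q : pr l (fun w => P w \/ Q w) <= pr l P + pr l Q.
Proof. by rewrite -exD; apply: ex_le => w _; exact: ind_or. Qed.

Lemma ind_exists (I : eqType) (r : seq I) (F : I -> Prop) :
  ind (exists2 i, i \in r & F i) <= \sum_(i <- r) ind (F i).
Proof.
rewrite {1}/ind; case: asboolP => [[i ir hi]|_]; last by apply: sumr_ge0 => i _; exact: ind_ge0.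
rewrite (big_rem i ir) /= (indT hi) lerDl; apply: sumr_ge0 => j _; exact: ind_ge0.
Qed.

Lemma pr_exists (I : eqType) (r : seq I) (F : I -> seq bool -> Prop) l c :
  (forall i, i \in r -> pr l (F i) <= c) ->
  pr l (fun w => exists2 i, i \in r & F i w) <= (size r)%:R * c.
Proof.
move=> h; apply: (@le_trans _ _ (\sum_(i <- r) pr l (F i))).
  by rewrite -ex_sum; apply: ex_le => w _; exact: ind_exists.
have -> : (size r)%:R * c = \sum_(i <- r) c.
  by rewrite big_const_seq count_predT iter_addr_0 mulr_natl.
by rewrite big_seq [X in _ <= X]big_seq; apply: ler_sum.
Qed.

Lemma pr_markov l f (c : R) : 0 < c -> (forall w, size w = l -> 0 <= f w) ->
  pr l (fun w => c <= f w) <= ex l f / c.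
Proof.
move=> c0 f0; rewrite -exZr; apply: ex_le => w hw.
rewrite /ind; case: asboolP => [h|_]; last by rewrite divr_ge0 ?f0 // ltW.
by rewrite ler_pdivlMr // mul1r.
Qed.

Section Finite.
Variable W : finType.
Definition av (f : W -> R) : R := (\sum_w f w) / #|W|%:R.

Lemma Pr_av (E : set W) : Pr R E = av (fun w => ind (E w)).
Proof.
rewrite /Pr /av; congr (_ / _); rewrite -sum1_card natr_sum big_mkcond /=.
by apply: eq_bigr => w _; rewrite inE /ind; case: asbool.
Qed.

Lemma av_le (f g : W -> R) : (forall w, f w <= g w) -> av f <= av g.
Proof. by move=> h; rewrite ler_wpM2r ?invr_ge0 ?ler0n //; apply: ler_sum. Qed.
Lemma avD (f g : W -> R) : av (fun w => f w + g w) = av f + av g.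
Proof. by rewrite /av big_split mulrDl. Qed.
Lemma avZ c (f : W -> R) : av (fun w => c * f w) = c * av f.
Proof. by rewrite /av -mulr_sumr mulrA. Qed.
Lemma av_sum (I : Type) (r : seq I) (F : I -> W -> R) :
  av (fun w => \sum_(i <- r) F i w) = \sum_(i <- r) av (F i).
Proof. by rewrite /av exchange_big /= mulr_suml. Qed.
Lemma av_cst (c : R) : (0 < #|W|)%N -> av (fun=> c) = c.
Proof.
move=> h; rewrite /av sumr_const -[c *+ _]mulr_natr mulfK // pnatr_eq0 -lt0n.
by apply: leq_trans h _; rewrite cardT.
Qed.
Lemma eq_av (f g : W -> R) : f =1 g -> av f = av g.
Proof. by move=> h; rewrite /av (eq_bigr g). Qed.
End Finite.

Lemma av_tuple T (f : seq bool -> R) : av (fun w : T.-tuple bool => f w) = ex T f.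
Proof.
elim: T f => [|T IH] f.
  rewrite /av card_tuple expn0 divr1 (big_pred1 [tuple]) // => w.
  by rewrite [w]tuple0 /= eqxx.
rewrite /= -!IH /av !card_tuple card_bool.
have -> : \sum_(w : T.+1.-tuple bool) f w =
    \sum_(w : T.-tuple bool) f (false :: w) + \sum_(w : T.-tuple bool) f (true :: w).
  rewrite (reindex (fun p : bool * T.-tuple bool => [tuple of p.1 :: p.2])) /=.
    rewrite -(pair_bigA _ (fun b (w : T.-tuple bool) => f (b :: w))) /=.
    by rewrite big_bool addrC.
  exists (fun w : T.+1.-tuple bool => (thead w, [tuple of behead w])) => [[b w] _|w _] /=.
    by congr (_, _); apply: val_inj.
  by rewrite -tuple_eta.
have n0 : (2 ^ T)%:R != 0 :> R by rewrite pnatr_eq0 expn_eq0.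
by rewrite expnS natrM; field.
Qed.

Lemma av_pair (W1 W2 : finType) (f : W1 * W2 -> R) :
  av f = av (fun a => av (fun b => f (a, b))).
Proof.
rewrite /av -mulr_suml card_prod natrM invfM -mulrA [X in _ = _ * X]mulrC; congr (_ * _).
by rewrite (pair_bigA _ (fun a b => f (a, b))) /=; apply: eq_bigr => -[].
Qed.

Lemma av_prod n (W : finType) (g : 'I_n -> W -> R) :
  av (fun w : {ffun 'I_n -> W} => \prod_i g i (w i)) = \prod_i av (g i).
Proof.
rewrite /av card_ffun card_ord big_split /= -bigA_distr_bigA /=; congr (_ * _).
by rewrite prodr_const card_ord natrX exprVn.
Qed.

(** Exchanging the fresh value with coordinate [i0] is an involution on the pairs, so redrawing the
    coins of one user preserves averages. This isolates the one user whose point differs between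
    neighbouring inputs. *)
Lemma av_resample n (W : finType) (i0 : 'I_n) (f : {ffun 'I_n -> W} -> R) : (0 < #|W|)%N ->
  av f = av (fun w : {ffun 'I_n -> W} => av (fun a : W => f [ffun i => if i == i0 then a else w i])).
Proof.
move=> W0; have W0' : #|W|%:R != 0 :> R by rewrite pnatr_eq0 -lt0n.
rewrite /av -mulr_suml; congr (_ / _).
apply: (@mulIf _ #|W|%:R) => //; rewrite -mulrA mulVf // mulr1.
pose s (p : {ffun 'I_n -> W} * W) : {ffun 'I_n -> W} * W :=
  ([ffun i => if i == i0 then p.2 else p.1 i], p.1 i0).
have ss : involutive s.
  case=> w a; rewrite /s /= ffunE eqxx; congr (_, _).
  by apply/ffunP => i; rewrite !ffunE; case: eqP => // ->.
have E : (\sum_(p : {ffun 'I_n -> W} * W) f p.1) = (\sum_(p : {ffun 'I_n -> W} * W) f (s p).1).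
  exact: (reindex_inj (inv_inj ss)).
rewrite (pair_bigA _ (fun (w : {ffun 'I_n -> W}) (a : W) => f [ffun i => if i == i0 then a else w i])) /=.
apply: etrans E.
rewrite -(pair_bigA _ (fun w _ => f w)) /=.
by rewrite mulr_suml; apply: eq_bigr => w _; rewrite sumr_const mulr_natr.
Qed.

End Expectation.

(** * Privacy *)

Section Message.
Context {R : realType}.
Variables (c0 n d k : nat).
Local Notation q := (pq c0 k).
Local Notation H := (pH c0 n k).
Local Notation m := (pm c0 n k).
Local Notation B := (@Bnd R c0 n k).
Hypothesis n0 : (0 < n)%N.
Hypothesis q0 : (0 < q)%N.

Definition msg (t : nat) (u s : seq bool) (b : bool) : seq R :=
  t%:R :: [seq sg b | b <- u] ++ [seq (nat_of_bool b)%:R | b <- s] ++ [:: sg b].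

Definition used := (m + ((d + 1) + (H + pm2 n)))%N.

Lemma seg_cat0 l (a b : seq bool) : size a = l -> seg 0 l (a ++ b) = a.
Proof.
move=> <-; apply: (@eq_from_nth _ false); rewrite size_mkseq // => i hi.
by rewrite nth_mkseq // add0n nth_cat hi.
Qed.

Lemma seg_catD o o' l (a b : seq bool) : size a = o -> seg (o + o') l (a ++ b) = seg o' l b.
Proof. by move=> <-; apply: eq_map => j; rewrite nth_cat -addnA ltnNge leq_addr addKn. Qed.

Lemma ex_encout eps xs pub T (F : seq R -> R) : (used <= T)%N ->
  ex T (fun w => F (encout c0 n d k eps xs pub w)) =
  ex m (fun t => ex (d + 1) (fun u => ex H (fun s => ex (pm2 n) (fun U =>
    F (msg (bits2nat t) u s ((bits2nat U + 1)%:R <=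
         threshold c0 n k eps pub xs (bits2nat t) u s)))))).
Proof.
move=> /subnKC <-; move: (T - used)%N => T'; rewrite /used -addnA ex_cat; apply: eq_ex => t ht.
rewrite -[X in ex X _ = _](addnA (d + 1)) ex_cat; apply: eq_ex => u hu.
rewrite -[X in ex X _ = _](addnA H) ex_cat; apply: eq_ex => s hs.
rewrite ex_cat; apply: eq_ex => U hU; rewrite -[RHS](ex_cst T'); apply: eq_ex => r _.
congr F; rewrite /encout.
have -> : seg 0 m (t ++ u ++ s ++ U ++ r) = t by rewrite seg_cat0.
have -> : seg m (d + 1) (t ++ u ++ s ++ U ++ r) = u.
  by rewrite -[m]addn0 (seg_catD _ _ _ ht) seg_cat0.
have -> : seg (m + (d + 1)) H (t ++ u ++ s ++ U ++ r) = s.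
  by rewrite (seg_catD _ _ _ ht) -[(d + 1)%N]addn0 (seg_catD _ _ _ hu) seg_cat0.
have -> // : seg (m + (d + 1) + H) (pm2 n) (t ++ u ++ s ++ U ++ r) = U.
by rewrite -addnA (seg_catD _ _ _ ht) (seg_catD _ _ _ hu) -[H]addn0 (seg_catD _ _ _ hs) seg_cat0.
Qed.

Lemma bits2nat_cons b w : bits2nat (b :: w) = (b * 2 ^ size w + bits2nat w)%N.
Proof.
suff E t w' : foldl (fun t b => t + t + nat_of_bool b)%N t w' = (t * 2 ^ size w' + bits2nat w')%N.
  by rewrite {1}/bits2nat /= E.
rewrite /bits2nat; elim: w' t => [|c w' IH] t /=; first by rewrite muln1 addn0.
by rewrite IH [in RHS]IH expnS; lia.
Qed.

Lemma ex_bits2nat l (g : nat -> R) :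
  ex l (fun w => g (bits2nat w)) = (\sum_(0 <= U < 2 ^ l) g U) / (2 ^ l)%:R.
Proof.
elim: l g => [|l IH] g /=; first by rewrite expn0 big_nat1 divr1.
rewrite (eq_ex (g := fun w => g (bits2nat w))); last by move=> w _; rewrite bits2nat_cons.
rewrite [X in _ + X](eq_ex (g := fun w => g (2 ^ l + bits2nat w)%N)); last first.
  by move=> w hw; rewrite bits2nat_cons hw mul1n.
rewrite (IH g) (IH (fun U => g (2 ^ l + U)%N)).
have -> : \sum_(0 <= U < 2 ^ l.+1) g U = \sum_(0 <= U < 2 ^ l) g U + \sum_(0 <= U < 2 ^ l) g (2 ^ l + U)%N.
  rewrite expnS mul2n -addnn (@big_cat_nat _ _ _ (2 ^ l)) ?leq_addr //=; congr (_ + _).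
  by rewrite -{1}[(2 ^ l)%N]add0n big_addn addnK; apply: eq_bigr => i _; rewrite addnC.
have h0 : (2 ^ l)%:R != 0 :> R by rewrite pnatr_eq0 expn_eq0.
by rewrite expnS natrM; field.
Qed.

(** The sum counts the positive integers up to [th], so it is the floor of [th]. *)
Lemma count_le (th : R) V : 0 <= th <= V%:R ->
  th - 1 < \sum_(0 <= U < V) (nat_of_bool ((U + 1)%:R <= th))%:R <= th.
Proof.
pose S V : R := \sum_(0 <= U < V) (nat_of_bool ((U + 1)%:R <= th))%:R.
have rec W : S W.+1 = S W + (nat_of_bool (W%:R + 1 <= th))%:R.
  have -> : W%:R + 1 = (W + 1)%:R :> R by rewrite addn1 natr1.
  by rewrite /S big_nat_recr.
have full W : W%:R <= th -> S W = W%:R.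
  elim: W => [|W IH] h; first by rewrite /S big_geq.
  rewrite -natr1 in h; have hW : W%:R <= th by apply: le_trans h; rewrite lerDl.
  by rewrite rec h (IH hW) natr1.
rewrite -/(S V); elim: V => [|V IH] /andP[th0 thV].
  by rewrite /S big_geq // th0 andbT; lra.
rewrite rec; have [hV|hV] := leP th V%:R.
  have -> : (nat_of_bool (V%:R + 1 <= th))%:R = 0 :> R.
    by rewrite leNgt (le_lt_trans hV) // ltrDl.
  by rewrite addr0; apply: IH; rewrite th0.
rewrite (full _ (ltW hV)); rewrite -natr1 in thV.
by case: (lerP (V%:R + 1) th) => h; rewrite ?mulr0n ?mulr1n ?addr0; apply/andP; split; lra.
Qed.

Definition rr (th : R) : R :=
  ex (pm2 n) (fun U => (nat_of_bool ((bits2nat U + 1)%:R <= th))%:R).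

Lemma rrE th : rr th = (\sum_(0 <= U < pV n) (nat_of_bool ((U + 1)%:R <= th))%:R) / (pV n)%:R.
Proof. exact: (ex_bits2nat _ (fun U => (nat_of_bool ((U + 1)%:R <= th))%:R)). Qed.

Lemma pV_gt0 : 0 < (pV n)%:R :> R. Proof. by rewrite ltr0n expn_gt0. Qed.

Lemma pV_ge : (16 * n * n <= pV n)%N.
Proof.
rewrite /pV /pm2 expnD mul2n -addnn expnD (_ : (2 ^ 4 = 16)%N) // mulnC mulnCA -mulnA mulnC.
have h := @up_logP 2 n isT; rewrite -/(pen n) in h.
by have := leq_mul h h; lia.
Qed.

Lemma rr_bounds th : 0 <= th <= (pV n)%:R ->
  th / (pV n)%:R - (pV n)%:R^-1 < rr th <= th / (pV n)%:R.
Proof.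
move=> hth; rewrite rrE.
have /andP[h1 h2] := count_le hth.
by rewrite -[X in _ - X < _]mul1r -mulrBl ltr_pM2r ?invr_gt0 ?pV_gt0 // h1 ler_pM2r ?invr_gt0 ?pV_gt0.
Qed.

(** No rounding occurs at 1/2 since [pV n] is even. When [acoef] is 0 the reports are thus exactly
    fair and reveal nothing. *)
Lemma rr_half : rr ((pV n)%:R * (1 / 2)) = 1 / 2.
Proof.
have [W hW] : exists W, (pV n = 2 * W)%N by exists (2 ^ (2 * pen n + 3))%N; rewrite -expnS -addnS.
have e : (pV n)%:R * (1 / 2) = W%:R :> R by rewrite hW natrM; field.
have W0 : (W%:R != 0 :> R).
  by apply/eqP => h0; have := pV_gt0; rewrite hW natrM h0 mulr0 ltxx.
rewrite e rrE.
have : 0 <= (W%:R : R) <= (pV n)%:R.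
  by apply/andP; split; [exact: ler0n|rewrite ler_nat hW mul2n -addnn leq_addr].
move=> /count_le; rewrite -natr_sum => /andP[].
rewrite ltrBlDr natr1 ltr_nat ler_nat ltnS => h1 h2.
rewrite (anti_leq (introT andP (conj h2 h1))).
by rewrite hW natrM; field.
Qed.

Lemma Bnd_gt0 : 0 < B. Proof. by rewrite ltr0n addn_gt0 q0. Qed.

Lemma norm_clip (b y : R) : 0 <= b -> `|clip b y| <= b.
Proof.
move=> b0; rewrite /clip; case: (leP b y) => [_|h1]; first by rewrite ger0_norm.
case: (leP y (- b)) => [_|h2]; first by rewrite normrN ger0_norm.
by rewrite ler_norml !ltW.
Qed.

Lemma norm_chi s v l : `|chi s v l : R| = 1.
Proof.
rewrite /chi normr_prod big1 // => b _; case: ifP => _; first by rewrite normrN normr1.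
by rewrite normr1.
Qed.

Definition ratio (xs : seq R) pub t u s : R :=
  clip B (rad u (1 :: xs)) * chi s (path c0 n k pub xs) (t + 1) / B.

Lemma norm_ratio xs pub t u s : `|ratio xs pub t u s| <= 1.
Proof.
rewrite /ratio !normrM norm_chi mulr1 normfV (gtr0_norm Bnd_gt0).
by rewrite ler_pdivrMr ?Bnd_gt0 // mul1r norm_clip // ltW // Bnd_gt0.
Qed.

Lemma thresholdE eps xs pub t u s : threshold c0 n k eps pub xs t u s =
  (pV n)%:R * (1 / 2 + acoef eps n * ratio xs pub t u s).
Proof. by rewrite /threshold /ratio !mulrA. Qed.

Lemma acoef_bounds (eps : R) : 0 <= acoef eps n <= 1 / 16.
Proof.
rewrite /acoef; case: ifP => [h1|_]; last by lra.
have : 0 < eps by rewrite -(pmulr_lgt0 _ (_ : 0 < n%:R)) ?ltr0n // (lt_le_trans ltr01).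
by case: ifP => h2 h3; apply/andP; split; lra.
Qed.

Lemma rr_near (eps : R) xs pub t u s :
  `|rr (threshold c0 n k eps pub xs t u s) - (1 / 2 + acoef eps n * ratio xs pub t u s)| <= (pV n)%:R^-1.
Proof.
rewrite thresholdE; set r := ratio _ _ _ _ _; set a := acoef _ _.
have := norm_ratio xs pub t u s; rewrite -/r ler_norml => /andP[r1 r2].
have /andP[a0 a1] := acoef_bounds eps; rewrite -/a in a0 a1.
have ar : -(1/16) <= a * r <= 1/16 by apply/andP; split; nra.
case/andP: ar => ar1 ar2.
have h : 0 <= (pV n)%:R * (1 / 2 + a * r) <= (pV n)%:R.
  by have := pV_gt0; set V := _%:R => V0; apply/andP; split; nra.
have V0 : (pV n)%:R != 0 :> R by rewrite lt0r_neq0 // pV_gt0.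
have := rr_bounds h; rewrite mulrAC divff // mul1r => /andP[h1 h2].
rewrite ler_norml; apply/andP; split; first by lra.
have : 0 < (pV n)%:R^-1 :> R by rewrite invr_gt0 pV_gt0.
by lra.
Qed.

(** Both probabilities differ from 1/2 by at most [e' / 8] for some [e'] below 1 and [eps], and the
    quotient of [1/2 + e' / 8] and [1/2 - e' / 8] is at most [1 + e']. *)
Lemma dp_factor (eps : R) xs xs' pub t u s : 0 < eps ->
  let p := rr (threshold c0 n k eps pub xs t u s) in
  let p' := rr (threshold c0 n k eps pub xs' t u s) in
  p <= expR eps * p' /\ 1 - p <= expR eps * (1 - p').
Proof.
move=> e0 p p'; have hexp : 1 + eps <= expR eps by exact: expR_ge1Dx.
have [a0|a0] := eqVneq (acoef eps n) 0.
  rewrite /p /p' !thresholdE a0 !mul0r !addr0 rr_half; split; nra.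
have near xs0 : 1/2 - (acoef eps n + (pV n)%:R^-1) <= rr (threshold c0 n k eps pub xs0 t u s)
    <= 1/2 + (acoef eps n + (pV n)%:R^-1).
  have := rr_near eps xs0 pub t u s; have := norm_ratio xs0 pub t u s.
  have /andP[a1 a2] := acoef_bounds eps.
  rewrite !ler_norml; set r := ratio _ _ _ _ _ => /andP[r1 r2] /andP[h1 h2].
  by apply/andP; split; nra.
(* [e'] is the minimum of [eps] and 1. The bias takes [e' / 16], and the rounding another [e' / 16]
   because [pV n >= 16 * n * n] and [e' * n >= 1]. *)
have [e' [he1 he2 he3 ha]] : exists e', [/\ 0 < e', e' <= 1, e' <= eps &
    acoef eps n + (pV n)%:R^-1 <= e' / 8].
  have nn : 0 < n%:R :> R by rewrite ltr0n.
  have hV : 16 * n%:R * n%:R <= (pV n)%:R :> R by rewrite -!natrM ler_nat pV_ge.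
  have n1 : 1 <= n%:R :> R by rewrite ler1n.
  have V0 := pV_gt0.
  have iV (c : R) : 1 <= c * n%:R -> (pV n)%:R^-1 <= c / 16.
    move=> hc; have cp : 0 < c by rewrite ltNge; apply/negP => c0'; nra.
    have h : c * (16 * n%:R * n%:R) <= c * (pV n)%:R by rewrite ler_pM2l.
    have h2 : 1 * 1 <= c * n%:R * n%:R by apply: ler_pM.
    rewrite -[X in X <= _]mul1r ler_pdivrMr //; lra.
  move: a0; rewrite /acoef; case: ifP => h1; last by rewrite eqxx.
  case: ifP => h2 _; [exists eps|exists 1]; split=> //.
  - by have := iV _ h1; lra.
  - by move/negbT: h2; rewrite -ltNge => /ltW.
  - by have := iV 1 _; rewrite mul1r => /(_ n1); lra.
have := near xs; have := near xs'; rewrite -/p -/p' => /andP[h1 h2] /andP[h3 h4].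
by split; nra.
Qed.

(** Depth, signs and character index are drawn independently of the data. For fixed values of them,
    only the last sign of the message depends on the point, so the two cases of [dp_factor] are all
    there is to compare. *)
Lemma dp_local (eps : R) xs xs' pub T (F : seq R -> R) : (used <= T)%N -> 0 < eps ->
  (forall o, 0 <= F o) ->
  ex T (fun w => F (encout c0 n d k eps xs pub w)) <=
  expR eps * ex T (fun w => F (encout c0 n d k eps xs' pub w)).
Proof.
move=> hT e0 F0; rewrite !ex_encout // -exZ; apply: ex_le => t _.
rewrite -exZ; apply: ex_le => u _; rewrite -exZ; apply: ex_le => s _.
have E th : ex (pm2 n) (fun U => F (msg (bits2nat t) u s ((bits2nat U + 1)%:R <= th))) =
    rr th * F (msg (bits2nat t) u s true) + (1 - rr th) * F (msg (bits2nat t) u s false).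
  rewrite /rr mulrBl mul1r -!exZr -[X in _ + (X - _)](ex_cst (pm2 n)) -exB -exD.
  by apply: eq_ex => U _; case: (_ <= th); rewrite /= ?mul1r ?mul0r ?subr0 ?subrr ?addr0 ?add0r.
rewrite !E; have [h1 h2] := dp_factor xs xs' pub (bits2nat t) u s e0.
rewrite mulrDr !mulrA; apply: lerD; apply: ler_wpM2r; by [exact: F0|].
Qed.

End Message.

(** * Noise of the estimates *)

Section Rademacher.
Context {R : realType}.
Implicit Types (xs : seq R) (w : seq bool).

Definition sqs xs : R := \sum_(x <- xs) x ^+ 2.

Lemma rad_cons b w x xs : rad (b :: w) (x :: xs) = sg b * x + rad w xs :> R.
Proof. by rewrite /rad /= big_ord_recl. Qed.

Lemma rad_nil w : rad w ([::] : seq R) = 0.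
Proof. by rewrite /rad big_ord0. Qed.

Lemma sqs_cons x xs : sqs (x :: xs) = x ^+ 2 + sqs xs.
Proof. by rewrite /sqs big_cons. Qed.

Lemma sqs_ge0 xs : 0 <= sqs xs.
Proof. by apply: sumr_ge0 => x _; exact: sqr_ge0. Qed.

(** Squaring [1 - z / 2 <= expR (- (z / 2))] bounds [expR z] by the inverse of [(1 - z / 2) ^+ 2],
    and what remains is a polynomial inequality. *)
Lemma expR_quad (z : R) : `|z| <= 1 -> expR z <= 1 + z + 2 * z ^+ 2.
Proof.
rewrite ler_norml => /andP[z1 z2].
have h0 : 1 - z / 2 <= expR (- (z / 2)) by have := expR_ge1Dx (- (z / 2)); lra.
have h1 : expR (z / 2) * expR (- (z / 2)) = 1 by rewrite expRxMexpNx_1.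
have h2 : expR z = expR (z / 2) ^+ 2 by rewrite -expRM_natl; congr expR; rewrite -mulr_natl; field.
have p0 := expR_gt0 (z / 2).
have h3 : expR (z / 2) * (1 - z / 2) <= 1 by rewrite -[X in _ <= X]h1 ler_pM2l.
have h4 : expR z * (1 - z / 2) ^+ 2 <= 1.
  by rewrite h2 -exprMn -[X in _ <= X](expr1n _ 2) ler_pXn2r ?nnegrE //; nra.
have h5 : 1 <= (1 + z + 2 * z ^+ 2) * (1 - z / 2) ^+ 2.
  have -> : (1 + z + 2 * z ^+ 2) * (1 - z / 2) ^+ 2 =
    1 + z ^+ 2 * ((1 - z) * (5 / 4 - z / 2)) by field.
  by rewrite lerDl mulr_ge0 ?sqr_ge0 // mulr_ge0; lra.
have h6 : 0 < (1 - z / 2) ^+ 2 by rewrite exprn_gt0 //; lra.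
by rewrite -(ler_pM2r h6); apply: le_trans h4 h5.
Qed.

(** The optimal constant would be 1/2; 2 is what [expR_quad] yields, and it only affects
    constants. *)
Lemma cosh_le (z : R) : (expR z + expR (- z)) / 2 <= expR (2 * z ^+ 2).
Proof.
have h := expR_ge1Dx (2 * z ^+ 2).
have [z1|z1] := leP `|z| 1.
  have := expR_quad z1; have : `|- z| <= 1 by rewrite normrN.
  by move/expR_quad; rewrite sqrrN; lra.
have z2 : `|z| <= 2 * z ^+ 2 by rewrite -real_normK ?num_real //; nra.
have e1 : expR z <= expR (2 * z ^+ 2) by rewrite ler_expR (le_trans (ler_norm z)).
have e2 : expR (- z) <= expR (2 * z ^+ 2) by rewrite ler_expR (le_trans _ z2) // -normrN ler_norm.
lra.
Qed.

(** Sub-Gaussian exponential moment of a Rademacher sum. The shift [a] is carried through the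
    induction. *)
Lemma ex_exp_rad (l a : R) xs : ex (size xs) (fun w => expR (l * (a + rad w xs))) <=
  expR (l * a + 2 * l ^+ 2 * sqs xs).
Proof.
elim: xs a => [|x xs IH] a /=; first by rewrite rad_nil addr0 /sqs big_nil mulr0 addr0.
rewrite -exD -exZr.
have h : forall w, (expR (l * (a + rad (false :: w) (x :: xs))) + expR (l * (a + rad (true :: w) (x :: xs)))) / 2
   = expR (l * (a + rad w xs)) * ((expR (l * x) + expR (- (l * x))) / 2).
  move=> w; rewrite !rad_cons /sg mulN1r mul1r.
  have -> : l * (a + (- x + rad w xs)) = l * (a + rad w xs) + - (l * x) by ring.
  have -> : l * (a + (x + rad w xs)) = l * (a + rad w xs) + l * x by ring.
  by rewrite !expRD; ring.
rewrite (eq_ex (g := fun w => expR (l * (a + rad w xs)) * ((expR (l * x) + expR (- (l * x))) / 2))).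
  2: by move=> w _; exact: h.
rewrite exZr sqs_cons.
apply: le_trans (ler_pM _ _ (IH a) (cosh_le (l * x))) _.
- by apply: ex_ge0 => w _; exact: expR_ge0.
- by rewrite mulr_ge0 // addr_ge0 ?expR_ge0.
- by rewrite -expRD ler_expR exprMn; lra.
Qed.

(* Averaging [exp (l * (y + x s) ^ 2)] over the sign [s] replaces [l] by
   [l + 8 l^2 x^2], so [l] stays of the same order along the induction. *)
Lemma ex_exp_sqr (l : R) xs : `|l| * sqs xs <= 1 / 32 ->
  ex (size xs) (fun w => expR (l * rad w xs ^+ 2)) <= expR (l * sqs xs + 8 * (l * sqs xs) ^+ 2).
Proof.
elim: xs l => [|x xs IH] l h.
  by rewrite [ex _ _]/= rad_nil /sqs big_nil !mulr0 !expr0n /= !mulr0 addr0.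
pose l1 := l + 8 * l ^+ 2 * x ^+ 2.
have hx := sqr_ge0 x; have ht := sqs_ge0 xs; rewrite sqs_cons in h *.
set X := x ^+ 2 in hx h l1 *; set t := sqs xs in ht h *.
have hp : 0 <= `|l| * X by rewrite mulr_ge0. have hr : 0 <= `|l| * t by rewrite mulr_ge0.
have l2 : l ^+ 2 = `|l| ^+ 2 by rewrite real_normK ?num_real.
have h1 : `|l1| * t <= 1 / 32.
  apply: (@le_trans _ _ ((`|l| + 8 * `|l| ^+ 2 * X) * t)).
    apply: ler_wpM2r => //; apply: le_trans (ler_normD _ _) _; rewrite lerD2l l2 ger0_norm //.
    by rewrite mulr_ge0 // mulr_ge0 // sqr_ge0.
  rewrite mulrDr in h; set p := `|l| * X in h hp; set r := `|l| * t in h hr.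
  have -> : (`|l| + 8 * `|l| ^+ 2 * X) * t = r + 8 * p * r by rewrite /p /r; ring.
  nra.
have step w : (expR (l * rad (false :: w) (x :: xs) ^+ 2) + expR (l * rad (true :: w) (x :: xs) ^+ 2)) / 2
   <= expR (l * X) * expR (l1 * rad w xs ^+ 2).
  rewrite !rad_cons /sg mulN1r mul1r; set y := rad w xs.
  have -> : l * (- x + y) ^+ 2 = l * X + l * y ^+ 2 + - (2 * l * x * y) by rewrite /X; ring.
  have -> : l * (x + y) ^+ 2 = l * X + l * y ^+ 2 + 2 * l * x * y by rewrite /X; ring.
  have c := cosh_le (2 * l * x * y).
  have -> : l1 * y ^+ 2 = l * y ^+ 2 + 2 * (2 * l * x * y) ^+ 2 by rewrite /l1 /X; ring.
  rewrite !expRD mulrA -mulrDr -mulrA ler_pM2l; first by lra.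
  by rewrite mulr_gt0 ?expR_gt0.
apply: (@le_trans _ _ (expR (l * X) * ex (size xs) (fun w => expR (l1 * rad w xs ^+ 2)))).
  by rewrite /= -exD -exZr -exZ; apply: ex_le => w _; exact: step.
apply: (@le_trans _ _ (expR (l * X) * expR (l1 * t + 8 * (l1 * t) ^+ 2))).
  by rewrite ler_pM2l ?expR_gt0 //; exact: IH.
rewrite -expRD ler_expR.
have e1 : l1 * t = l * t + 8 * (l * X) * (l * t) by rewrite /l1; ring.
rewrite mulrDr e1; rewrite mulrDr in h.
have a1 : (l * X) * (l * t) = (`|l| * X) * (`|l| * t).
  by rewrite mulrACA -expr2 l2 expr2 mulrACA.
have a2 : (l * t) ^+ 2 = (`|l| * t) ^+ 2 by rewrite !exprMn l2.
have a3 : (l * X) ^+ 2 = (`|l| * X) ^+ 2 by rewrite !exprMn l2.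
have a4 : `|l * X| = `|l| * X by rewrite normrM (ger0_norm hx).
have a5 := ler_norm (l * X); rewrite a4 in a5.
move: a1 a2 a3 a5; set P := l * X; set Q := l * t; set p := `|l| * X in hp h *; set r := `|l| * t in hr h *.
move=> a1 a2 a3 a5.
have -> : (Q + 8 * P * Q) ^+ 2 = Q ^+ 2 + 16 * (P * Q) * Q * 1 + 64 * (P * Q) ^+ 2 by ring.
have -> : (P + Q) ^+ 2 = P ^+ 2 + 2 * (P * Q) + Q ^+ 2 by ring.
have -> : 8 * P * Q = 8 * (P * Q) by ring.
have a6 : `|Q| = r by rewrite normrM (ger0_norm ht).
have a7 := ler_norm Q; rewrite a6 in a7.
rewrite a1 a2 a3.
have pr0 : 0 <= p * r by rewrite mulr_ge0.
have b1 : 16 * (p * r) * Q * 1 <= (p * r) / 2 by nra.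
have b2 : 64 * (p * r) ^+ 2 <= (p * r) / 4.
  have b3 : p * r <= 1 / 512 by nra.
  by nra.
have := sqr_ge0 p; lra.
Qed.

(** Distinct signs are uncorrelated. This is how the decoder extracts coordinate [j] of a vector of
    which a user reports one random signed sum only. *)
Lemma ex_rad_sg xs j : (j < size xs)%N ->
  ex (size xs) (fun w => rad w xs * sg (nth false w j)) = xs`_j.
Proof.
have ex0 ys : ex (size ys) (fun w => rad w ys) = 0 :> R.
  elim: ys => [|y ys IH]; first by rewrite /= rad_nil.
  rewrite /=; under eq_ex do rewrite rad_cons; under [X in _ + X]eq_ex do rewrite rad_cons.
  by rewrite !exD !ex_cst IH /sg; field.
elim: xs j => [|x xs IH] [|j] //= hj.
  under eq_ex do rewrite rad_cons; under [X in _ + X]eq_ex do rewrite rad_cons.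
  by rewrite !exZr !exD !ex_cst !ex0 /sg; field.
under eq_ex do rewrite rad_cons mulrDl; under [X in _ + X]eq_ex do rewrite rad_cons mulrDl.
by rewrite !exD !exZ (IH _ hj) /sg; field.
Qed.

(** The excess [|y| - b] is bounded by its exponential, whose expectation is controlled by
    exponential moments. *)
Lemma clip_near (b y : R) : 0 <= b -> `|clip b y - y| <= expR (`|y| - b).
Proof.
move=> b0; have e := expR_ge1Dx (`|y| - b); rewrite /clip; case: (leP b y) => h1.
  rewrite ler0_norm ?subr_le0 //; have := ler_norm y; lra.
case: (leP y (- b)) => h2.
  have -> : `|y| = - y by rewrite ler0_norm //; lra.
  rewrite ger0_norm; last by lra.
  by rewrite ler0_norm in e; lra.
by rewrite subrr normr0 expR_ge0.
Qed.

Lemma ex_exp_norm xs (b : R) : ex (size xs) (fun w => expR (`|rad w xs| - b)) <= 2 * expR (2 * sqs xs - b).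
Proof.
have h := ex_exp_rad 1 0 xs; have h' := ex_exp_rad (-1) 0 xs.
apply: (@le_trans _ _ (ex (size xs) (fun w => (expR (1 * (0 + rad w xs)) + expR (-1 * (0 + rad w xs))) * expR (- b)))).
  apply: ex_le => w _; rewrite expRD ler_pM2r ?expR_gt0 // !add0r mul1r mulN1r.
  by case: (ger0P (rad w xs)) => _; rewrite ?lerDl ?lerDr expR_ge0.
rewrite exZr exD expRD mulrA ler_pM2r ?expR_gt0 //.
move: h h'; rewrite sqrrN expr1n !mulr0 !add0r mulr1; lra.
Qed.
End Rademacher.

(** * Concentration over the users and orthogonality of characters *)

Section Chernoff.
Context {R : realType}.
Variables (W : finType) (n : nat).
Hypothesis W0 : (0 < #|W|)%N.
Hypothesis n0 : (0 < n)%N.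

(** Exponential moment at parameter [1 / sqrt n]: as the variables are bounded by 1, each factor
    exceeds the exponential of its scaled mean by at most [expR (2 / n)], so all of them together
    cost [expR 2]. *)
Lemma chernoff (X : 'I_n -> W -> R) (s : R) : (forall i w, `|X i w| <= 1) ->
  av (fun w : {ffun 'I_n -> W} => ind (s * Num.sqrt n%:R <= \sum_i (X i (w i) - av (X i))))
    <= expR (2 - s).
Proof.
move=> hX; set r : R := Num.sqrt n%:R.
have r1 : 1 <= r by rewrite -sqrtr1 ler_wsqrtr // ler1n.
have r0 : 0 < r by apply: lt_le_trans r1.
have rr2 : r ^+ 2 = n%:R by rewrite sqr_sqrtr.
pose g i w := expR (X i w / r).
pose mu := \sum_i av (X i).
have h1 (w : {ffun 'I_n -> W}) : ind (s * r <= \sum_i (X i (w i) - av (X i))) <= (\prod_i g i (w i)) * expR (- (mu / r) - s).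
  have -> : \prod_i g i (w i) = expR (\sum_i X i (w i) / r) by rewrite expR_sum.
  rewrite -expRD -mulr_suml; rewrite /ind; case: asboolP => [h|_]; last exact: expR_ge0.
  rewrite sumrB -/mu in h.
  rewrite -[1%:R]expR0 ler_expR addrA -mulrBl subr_ge0 ler_pdivlMr //.
apply: le_trans (av_le h1) _.
have -> : av (fun w : {ffun 'I_n -> W} => (\prod_i g i (w i)) * expR (- (mu / r) - s)) =
    (\prod_i av (g i)) * expR (- (mu / r) - s).
  by rewrite -av_prod [RHS]mulrC -avZ; apply: eq_av => w; rewrite mulrC.
have h2 i : av (g i) <= expR (av (X i) / r + 2 / n%:R).
  have h3 w : g i w <= (1 + 2 / n%:R) + r^-1 * X i w.
    have hz : `|X i w / r| <= 1.
      by rewrite normrM normfV (gtr0_norm r0) ler_pdivrMr // mul1r (le_trans (hX i w)).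
    apply: le_trans (expR_quad hz) _.
    have : (X i w) ^+ 2 <= 1 by rewrite -real_normK ?num_real // expr_le1.
    move=> h4; have : (X i w / r) ^+ 2 <= 1 / n%:R by rewrite expr_div_n rr2 ler_pM2r // invr_gt0 ltr0n.
    by rewrite [r^-1 * _]mulrC; lra.
  apply: le_trans (av_le h3) _; rewrite avD avZ av_cst //.
  by apply: le_trans (expR_ge1Dx _); rewrite [r^-1 * _]mulrC; lra.
have h5 : \prod_i av (g i) <= expR (mu / r + 2).
  have -> : mu / r + 2 = \sum_(i < n) (av (X i) / r + 2 / n%:R).
    rewrite big_split /= -mulr_suml sumr_const card_ord; congr (_ + _).
    by rewrite -[RHS]mulr_natr divfK // pnatr_eq0 -lt0n.
  rewrite expR_sum; apply: ler_prod => i _; rewrite h2 andbT.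
  by rewrite -(av_cst 0 W0); apply: av_le => w; exact: expR_ge0.
apply: (@le_trans _ _ (expR (mu / r + 2) * expR (- (mu / r) - s))).
  by rewrite ler_pM2r ?expR_gt0.
by rewrite -expRD ler_expR; lra.
Qed.

Lemma chernoff2 (X : 'I_n -> W -> R) (s : R) : (forall i w, `|X i w| <= 1) ->
  av (fun w : {ffun 'I_n -> W} => ind (s * Num.sqrt n%:R <= `|\sum_i (X i (w i) - av (X i))|))
    <= 2 * expR (2 - s).
Proof.
move=> hX; have hX' i w : `|- X i w| <= 1 by rewrite normrN.
have := chernoff s hX; have := chernoff s hX'; set a := av _; set b := av _ => h1 h2.
suff : av (fun w : {ffun 'I_n -> W} => ind (s * Num.sqrt n%:R <= `|\sum_i (X i (w i) - av (X i))|)) <= a + b by lra.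
rewrite /a /b -avD; apply: av_le => w.
have -> : \sum_i (- X i (w i) - av (fun w => - X i w)) = - \sum_i (X i (w i) - av (X i)).
  rewrite -sumrN; apply: eq_bigr => i _; rewrite opprB addrC.
  have -> : av (fun w => - X i w) = - av (X i).
    by rewrite -mulN1r -avZ; apply: eq_av => w'; rewrite mulN1r.
  by rewrite opprK.
set z := \sum_i _; apply: le_trans (ind_or _ _); apply: ind_le.
by case: (ger0P z) => _ h; [right|left].
Qed.
End Chernoff.

Lemma nth_flatten_uniform (T : Type) (x0 : T) (ss : seq (seq T)) s i o :
  all (fun m => size m == s) ss -> (o < s)%N ->
  nth x0 (flatten ss) (i * s + o) = nth x0 (nth [::] ss i) o.
Proof.
elim: ss i => [|m ss IH] i /=; first by rewrite !nth_nil.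
case/andP=> /eqP hm h ho; case: i => [|i] /=; first by rewrite mul0n add0n nth_cat hm ho.
by rewrite nth_cat mulSn hm -addnA ltnNge leq_addr addKn IH.
Qed.

Definition innode (p : nat -> bool) (v : seq bool) : bool := v == mkseq p (size v).
Definition nodes (H : nat) : seq (seq bool) :=
  flatten [seq [seq tval w | w <- enum {: l.+1.-tuple bool}] | l <- iota 0 H].

Lemma mem_nodes H v : (0 < size v <= H)%N -> v \in nodes H.
Proof.
case: v => [|b v] // /andP[_ hv]; apply/flattenP.
exists [seq tval w | w <- enum {: (size v).+1.-tuple bool}].
  by apply/mapP; exists (size v); rewrite // mem_iota.
by apply/mapP; exists (in_tuple (b :: v)); rewrite ?mem_enum.
Qed.

Lemma nodes_size H v : v \in nodes H -> (0 < size v <= H)%N.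
Proof.
case/flattenP => s /mapP[l]; rewrite mem_iota => hl -> /mapP[w _ ->].
by rewrite size_tuple.
Qed.

Lemma size_nodes H : (size (nodes H) <= 4 ^ H)%N.
Proof.
elim: H => [//|H IH]; rewrite /nodes -[X in iota 0 X]addn1 iotaD map_cat flatten_cat size_cat /= cats0.
rewrite size_map -cardE card_tuple card_bool expnS -/(nodes H).
have p h : (2 ^ h <= 4 ^ h)%N by elim: h => // h IH'; rewrite !expnS; lia.
have := p H; rewrite !expnS add0n; lia.
Qed.

Section ChiExpectation.
Context {R : realType}.
Lemma chi_cons (c : bool) s f l : chi (c :: s) f l.+1 = (if c && f 0%N then -1 else 1) * chi s (fun b => f b.+1) l :> R.
Proof. by rewrite /chi big_ord_recl. Qed.

(** Orthogonality of characters. Correlating a report with the character of a node therefore tests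
    whether the path of the user passes through that node. *)
Lemma ex_chi L l f g : (l <= L)%N ->
  ex L (fun s => chi s f l * chi s g l) = (all (fun b => f b == g b) (iota 0 l) : nat)%:R :> R.
Proof.
elim: L l f g => [|L IH] [|l] f g // hl.
- by rewrite /= /chi !big_ord0 mulr1.
- by rewrite -[RHS](ex_cst L.+1); apply: eq_ex => w _; rewrite /chi !big_ord0 mulr1.
have E : all (fun b => f b == g b) (iota 0 l.+1) = (f 0%N == g 0%N) && all (fun b => f b.+1 == g b.+1) (iota 0 l).
  by rewrite /= -[1%N]addn0 iotaDl all_map.
rewrite E [LHS]/=.
under eq_ex do rewrite !chi_cons /= !mul1r.
under [X in _ + X]eq_ex do rewrite !chi_cons /= mulrACA.
rewrite exZ !(IH l (fun b => f b.+1) (fun b => g b.+1)) //.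
set A := nat_of_bool (all _ _).
by case: (f 0%N); case: (g 0%N) => /=; rewrite -/A ?mulr0n; field.
Qed.
End ChiExpectation.

Section Noise.
Context {R : realType}.
Variables (c0 G n d k : nat) (eps : R).
Local Notation q := (pq c0 k).
Local Notation H := (pH c0 n k).
Local Notation m := (pm c0 n k).
Local Notation B := (@Bnd R c0 n k).
Local Notation stride := (stride c0 n d k).
Local Notation a := (acoef eps n).
Hypothesis n0 : (0 < n)%N.
Hypothesis q0 : (0 < q)%N.

Definition zf (v : seq bool) j (M : seq R) : R := if M`_0 + 1 == (size v)%:R then
     M`_(d + H + 2) * (\prod_(0 <= b < size v)
        (1 - 2 * M`_(d + 2 + b) * (nat_of_bool (nth false v b))%:R)) * M`_(1 + j)
   else 0.

Lemma est_zf (ms : seq (seq R)) v j : all (fun M => size M == stride) ms ->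
  (size v <= H)%N -> (j < d + 1)%N ->
  est c0 n d k eps (flatten ms) v j = (\sum_(i < n) zf v j (nth [::] ms i)) * scaleF c0 n k eps.
Proof.
move=> hs hv hj; rewrite /est; congr (_ * _); apply: eq_bigr => i _.
have F o : (o < stride)%N -> field c0 n d k (flatten ms) i o = (nth [::] ms i)`_o.
  by move=> ho; rewrite /field nth_flatten_uniform.
rewrite /zf !F /stride; try lia.
case: ifP => // _; congr (_ * _ * _); rewrite !big_mkord; apply: eq_bigr => b _.
by rewrite F // /stride; have := ltn_ord b; lia.
Qed.

Lemma zf_msg v j t u s b : size u = (d + 1)%N -> size s = H -> (size v <= H)%N -> (j < d + 1)%N ->
  zf v j (msg t u s b) = if (t + 1 == size v)%N then
     sg b * (chi s (nth false v) (size v) * sg (nth false u j)) else 0.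
Proof.
move=> hu hs hv hj; rewrite /zf /msg [_`_0]/= natr1 eqr_nat addn1; case: ifP => // _.
have nu : (t%:R :: [seq sg b | b <- u] ++ [seq (nat_of_bool b)%:R | b <- s] ++ [:: sg b])`_(1 + j) = sg (nth false u j) :> R.
  by rewrite add1n /= nth_cat size_map hu hj (nth_map false) // hu.
have nb : (t%:R :: [seq sg b | b <- u] ++ [seq (nat_of_bool b)%:R | b <- s] ++ [:: sg b])`_(d + H + 2) = sg b :> R.
  rewrite addn2 [LHS]/= nth_cat size_map hu ifF; last by apply/negbTE; lia.
  rewrite nth_cat size_map hs ifF; last by apply/negbTE; lia.
  by rewrite (_ : ((d + H).+1 - (d + 1) - H = 0)%N) //; lia.
rewrite nu nb -mulrA; congr (_ * (_ * _)); rewrite big_mkord; apply: eq_bigr => i _.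
have hi := ltn_ord i.
have -> : (t%:R :: [seq sg b | b <- u] ++ [seq (nat_of_bool b)%:R | b <- s] ++ [:: sg b])`_(d + 2 + i) = (nat_of_bool (nth false s i))%:R :> R.
  rewrite addn2 addSn [LHS]/= nth_cat size_map hu ifF; last by apply/negbTE; lia.
  rewrite (_ : (d.+1 + i - (d + 1) = i)%N); last by lia.
  by rewrite nth_cat size_map hs (leq_trans hi hv) (nth_map false) // hs (leq_trans hi).
by case: (nth false s i); case: (nth false v i) => /=; ring.
Qed.

Lemma norm_sg b : `|sg b : R| = 1.
Proof. by case: b; rewrite /sg ?normrN normr1. Qed.

Lemma norm_zf v j t u s b : size u = (d + 1)%N -> size s = H -> (size v <= H)%N -> (j < d + 1)%N ->
  `|zf v j (msg t u s b)| <= 1.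
Proof.
move=> hu hs hv hj; rewrite zf_msg //; case: ifP => _; last by rewrite normr0 ler01.
by rewrite !normrM !norm_sg norm_chi !mulr1.
Qed.

Lemma encout_msg xs pub w : exists t u s b, [/\ size u = (d + 1)%N, size s = H &
  encout c0 n d k eps xs pub w = msg t u s b].
Proof. by do 4!eexists; split; last reflexivity; rewrite size_mkseq. Qed.

Lemma size_encout xs pub w : size (encout c0 n d k eps xs pub w) = stride.
Proof.
have [t [u [s [b [hu hs ->]]]]] := encout_msg xs pub w.
by rewrite /msg /= !size_cat !size_map hu hs /stride /=; lia.
Qed.

Lemma ex_report th (c : R) : ex (pm2 n) (fun U => sg ((bits2nat U + 1)%:R <= th) * c) = (2 * rr n th - 1) * c.
Proof.
rewrite exZr; congr (_ * _); rewrite /rr -exZ -(ex_cst (pm2 n) 1) -exB; apply: eq_ex => U _.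
by rewrite ex_cst; case: (_ <= th); rewrite /sg /=; ring.
Qed.

Definition dmean xs pub v j t : R := ex (d + 1) (fun u => ex H (fun s =>
  (2 * rr n (threshold c0 n k eps pub xs t u s) - 1) * (chi s (nth false v) (size v) * sg (nth false u j)))).

(** Only the draw [t = (size v).-1], of probability [1 / H], contributes to the estimate of [v]. *)
Lemma ex_zf xs pub v j T : (used c0 n d k <= T)%N -> (0 < size v <= H)%N -> (j < d + 1)%N ->
  ex T (fun w => zf v j (encout c0 n d k eps xs pub w)) = dmean xs pub v j (size v).-1 / H%:R.
Proof.
move=> hT /andP[v0 hv] hj; rewrite (ex_encout eps xs pub (zf v j) hT).
pose g t := if (t + 1 == size v)%N then dmean xs pub v j t else 0.
rewrite (eq_ex (g := fun t => g (bits2nat t))) => [|t ht]; last first.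
  rewrite /g; case: ifP => ht'.
    apply: eq_ex => u hu; apply: eq_ex => s hs.
    rewrite -ex_report; apply: eq_ex => U _; by rewrite zf_msg // ht'.
  rewrite -[RHS](ex_cst (d + 1)); apply: eq_ex => u hu.
  rewrite -[RHS](ex_cst H); apply: eq_ex => s hs.
  by rewrite -[RHS](ex_cst (pm2 n)); apply: eq_ex => U _; rewrite zf_msg // ht'.
rewrite (ex_bits2nat n0 q0 m g) -/(pH c0 n k) big_mkord; congr (_ / _).
have hl : ((size v).-1 < H)%N by lia.
rewrite (bigD1 (Ordinal hl)) //= big1 ?addr0 => [|i /eqP hi].
  by rewrite /g addn1 prednK // eqxx.
rewrite /g ifF //; apply/negbTE/eqP => e; apply: hi; apply: val_inj => /=; lia.
Qed.

Lemma innode_all p v : innode p v = all (fun b => nth false v b == p b) (iota 0 (size v)).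
Proof.
apply/eqP/allP => [hv b|h].
  by rewrite mem_iota add0n => /= hb; rewrite hv nth_mkseq ?size_mkseq //; rewrite hv size_mkseq in hb.
apply: (@eq_from_nth _ false) => [|b hb]; first by rewrite size_mkseq.
by rewrite nth_mkseq //; apply/eqP; apply: h; rewrite mem_iota.
Qed.

(** Turns the clipping error [expR (- Bnd)] of one user into [1 / n], a constant for all users
    together. *)
Lemma expB : n%:R <= expR B.
Proof.
apply: (@le_trans _ _ ((2 ^ pen n)%:R)); first by rewrite ler_nat up_logP.
have e2 : 2 <= expR 1 :> R by have := expR_ge1Dx (1 : R); lra.
rewrite natrX; apply: (@le_trans _ _ (expR 1 ^+ pen n)); first by rewrite lerXn2r ?nnegrE ?expR_ge0.
by rewrite -expRM_natr mul1r ler_expR /Bnd natrD lerDr.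
Qed.

(** Without clipping and rounding the mean would be exact, by orthogonality of the characters and of
    the signs. Clipping costs [2 * expR (4 - B)], since the vector [1 :: xs] has squared norm at
    most 2, and rounding costs [2 / pV n]. *)
Lemma dmean_near xs pub v j : size xs = d -> sqs xs <= 1 -> (0 < size v <= H)%N -> (j < d + 1)%N ->
  `|dmean xs pub v j (size v).-1 - 2 * a / B * ((innode (path c0 n k pub xs) v : nat)%:R * (1 :: xs)`_j)|
  <= 2 * a / B * (2 * expR (4 - B)) + 2 / (pV n)%:R.
Proof.
move=> sx hx /andP[v0 hv] hj; set l := size v; set p := path c0 n k pub xs.
set N := (nat_of_bool (innode _ _))%:R * _.
have B0 := @Bnd_gt0 R c0 n k q0; have /andP[a0 _] := @acoef_bounds R n n0 eps.
have sx1 : size (1 :: xs) = (d + 1)%N by rewrite /= sx addn1.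
pose C u := clip B (rad u (1 :: xs)).
have eN : N = ex (d + 1) (fun u => ex H (fun s =>
    rad u (1 :: xs) * chi s p l * (chi s (nth false v) l * sg (nth false u j)))).
  rewrite /N -(ex_rad_sg (xs := 1 :: xs)) ?sx1 // -exZ; apply: eq_ex => u _.
  rewrite innode_all -(ex_chi (nth false v) p hv) -exZr; apply: eq_ex => s _; rewrite -/l; ring.
have ab0 : 0 <= 2 * a / B by rewrite divr_ge0 ?mulr_ge0 // ltW.
rewrite eN -exZ /dmean -exB; apply: le_trans (ex_norm _ _) _.
apply: (@le_trans _ _ (ex (d + 1) (fun u => 2 * a / B * expR (`|rad u (1 :: xs)| - B) + 2 / (pV n)%:R))); last first.
  rewrite exD exZ ex_cst lerD2r; apply: ler_wpM2l => //; rewrite -sx1.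
  apply: le_trans (ex_exp_norm _ _) _; rewrite ler_pM2l // ler_expR sqs_cons expr1n; lra.
apply: ex_le => u _; rewrite -exZ -exB; apply: le_trans (ex_norm _ _) _.
rewrite -[X in _ <= X](ex_cst H); apply: ex_le => s _.
set th := threshold _ _ _ _ _ _ _ _ _.
have h1 : `|rr n th - (1 / 2 + a * ratio c0 n k xs pub (size v).-1 u s)| <= (pV n)%:R^-1 by exact: rr_near.
have h2 := clip_near (rad u (1 :: xs)) (ltW B0).
rewrite [X in _ - X]mulrA -mulrBl normrM normrM norm_chi norm_sg !mulr1.
have e1 : ratio c0 n k xs pub (size v).-1 u s = C u * chi s p l / B by rewrite /ratio addn1 prednK.
rewrite e1 in h1.
have -> : 2 * rr n th - 1 - 2 * a / B * (rad u (1 :: xs) * chi s p l) =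
   2 * (rr n th - (1 / 2 + a * (C u * chi s p l / B))) + 2 * a / B * ((C u - rad u (1 :: xs)) * chi s p l).
  by move: (B) B0 => b b0; field; rewrite gt_eqF.
apply: le_trans (ler_normD _ _) _; rewrite addrC; apply: lerD.
  by rewrite normrM (ger0_norm ab0) normrM norm_chi mulr1 ler_wpM2l.
by rewrite normrM (ger0_norm (ler0n _ 2)) ler_pM2l.
Qed.

Hypothesis a0 : 0 < a.

Lemma acoef_lb : 1 <= 16 * a * n%:R.
Proof.
move: a0; rewrite /acoef; case: ifP => [h1|_]; last by rewrite ltxx.
have n1 : 1 <= n%:R :> R by rewrite ler1n.
by case: ifP => _ _; lra.
Qed.

Lemma H_gt0 : 0 < H%:R :> R. Proof. by rewrite ltr0n expn_gt0. Qed.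

Lemma scaleF_gt0 : 0 < scaleF c0 n k eps.
Proof. by rewrite /scaleF divr_gt0 ?mulr_gt0 ?H_gt0 ?Bnd_gt0. Qed.

(** The bias per user is of order [1 / n] up to [Bnd], so the bias of the sum stays far below the
    deviation of order [sqrt n]. *)
Lemma mean_zf xs pub v j T : (used c0 n d k <= T)%N -> size xs = d -> sqs xs <= 1 ->
  (0 < size v <= H)%N -> (j < d + 1)%N ->
  `|ex T (fun w => zf v j (encout c0 n d k eps xs pub w)) * scaleF c0 n k eps
     - (innode (path c0 n k pub xs) v : nat)%:R * (1 :: xs)`_j| <= (2 * expR 4 + B) / n%:R.
Proof.
move=> hT sx hx hv hj; rewrite ex_zf //.
have B0 := @Bnd_gt0 R c0 n k q0; have H0 := H_gt0.
have := dmean_near pub sx hx hv hj; set D := dmean _ _ _ _ _; set N := (nat_of_bool (innode _ _))%:R * _ => h.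
have c0' : 0 < 2 * a / B by rewrite divr_gt0 ?mulr_gt0.
have -> : D / H%:R * scaleF c0 n k eps - N = (D - 2 * a / B * N) / (2 * a / B).
  by rewrite /scaleF; move: (B) B0 (H%:R) H0 => b b0 h1 h2; field; rewrite !gt_eqF.
rewrite normrM normfV (gtr0_norm c0') ler_pdivrMr //; apply: le_trans h _.
have n1 : 0 < n%:R :> R by rewrite ltr0n.
have V0 : 0 < (pV n)%:R :> R by rewrite ltr0n expn_gt0.
have -> : (2 * expR 4 + B) / n%:R * (2 * a / B) = 2 * a / B * (2 * expR 4 / n%:R) + B / n%:R * (2 * a / B) by ring.
apply: lerD.
  apply: ler_wpM2l; first exact: ltW.
  rewrite expRD expRN -mulrA ler_pM2l // ler_pM2l ?expR_gt0 //.
  by rewrite lef_pV2 ?posrE ?expR_gt0 // expB.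
have -> : B / n%:R * (2 * a / B) = 2 * a / n%:R by move: (B) B0 => b b0; field; rewrite !gt_eqF.
have hV : 16 * n%:R * n%:R <= (pV n)%:R :> R by rewrite -!natrM ler_nat (pV_ge n0 q0).
rewrite ler_pdivrMr // mulrAC ler_pdivlMr //.
have := acoef_lb => ha.
apply: (@le_trans _ _ (2 * a * (16 * n%:R * n%:R))); last by rewrite ler_pM2l // mulr_gt0.
nra.
Qed.

(** The random deviation plus the bias of all users. The deviation is taken at [8 * H] times
    [sqrt n], because the union bound ranges over up to [4 ^ H] nodes and [d + 1] coordinates. *)
Definition eta : R := scaleF c0 n k eps * (8 * H%:R * Num.sqrt n%:R) + (2 * expR 4 + B).

Variables (T : nat) (xs : 'I_n -> seq R) (pub : seq bool).
Hypothesis hT : (used c0 n d k <= T)%N.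
Hypothesis sx : forall i, size (xs i) = d.
Hypothesis hx : forall i, sqs (xs i) <= 1.

Definition msgs (w : {ffun 'I_n -> T.-tuple bool}) : seq (seq R) :=
  [seq encout c0 n d k eps (xs i) pub (w i) | i <- enum 'I_n].
Definition mass v j : R := \sum_(i < n) (innode (path c0 n k pub (xs i)) v : nat)%:R * (1 :: xs i)`_j.

Lemma noise1 v j : (0 < size v <= H)%N -> (j < d + 1)%N ->
  av (fun w => @ind R (~~ (`|est c0 n d k eps (flatten (msgs w)) v j - mass v j| <= eta))) <= 2 * expR (2 - 8 * H%:R).
Proof.
move=> hv hj; have /andP[_ hv2] := hv.
pose X (i : 'I_n) (w : T.-tuple bool) := zf v j (encout c0 n d k eps (xs i) pub w).
have hX i w : `|X i w| <= 1.
  by rewrite /X; have [t [u [s [b [hu hs ->]]]]] := encout_msg (xs i) pub w; exact: norm_zf.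
have W0 : (0 < #|{: T.-tuple bool}|)%N by rewrite card_tuple expn_gt0 card_bool.
apply: le_trans (chernoff2 W0 n0 (8 * H%:R) hX); apply: av_le => w; apply: ind_le.
rewrite -ltNge => h; have F0 := scaleF_gt0; rewrite -(ler_pM2l F0).
have e1 : est c0 n d k eps (flatten (msgs w)) v j = (\sum_i X i (w i)) * scaleF c0 n k eps.
  rewrite est_zf //; last by apply/allP => M /mapP[i _ ->]; rewrite size_encout.
  congr (_ * _); apply: eq_bigr => i _; rewrite /X /msgs; congr zf.
  by rewrite (nth_map i) ?size_enum_ord // nth_ord_enum.
have e2 : `|\sum_i av (X i) * scaleF c0 n k eps - mass v j| <= 2 * expR 4 + B.
  rewrite /mass -sumrB; apply: le_trans (ler_norm_sum _ _ _) _.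
  apply: (@le_trans _ _ (\sum_(i < n) (2 * expR 4 + B) / n%:R)).
    apply: ler_sum => i _; rewrite /X (av_tuple T (fun w => zf v j (encout c0 n d k eps (xs i) pub w))).
    exact: mean_zf.
  by rewrite sumr_const card_ord -[X in X <= _]mulr_natr divfK // pnatr_eq0 -lt0n.
rewrite -mulr_suml in e2.
rewrite -[X in _ <= X * _](gtr0_norm F0) -normrM sumrB mulrBr ![scaleF _ _ _ _ * _]mulrC.
rewrite e1 /eta [scaleF _ _ _ _ * _]mulrC in h.
set P := \sum_i X i (w i) in h *; set Q := _ * _ in e2 *; set M := mass v j in h e2.
have : `|P * scaleF c0 n k eps - M| <= `|P * scaleF c0 n k eps - Q| + `|Q - M|.
  by apply: le_trans (ler_normD _ _); rewrite addrA subrK.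
set A := 8 * _ * _ * _ in h *; lra.
Qed.

Definition noisy (w : {ffun 'I_n -> T.-tuple bool}) : Prop :=
  exists2 vj, vj \in [seq (v, j) | v <- nodes H, j <- iota 0 (d + 1)] &
   ~~ (`|est c0 n d k eps (flatten (msgs w)) vj.1 vj.2 - mass vj.1 vj.2| <= eta).

Lemma noise : av (fun w => @ind R (noisy w)) <= (4 ^ H * (d + 1))%:R * (2 * expR (2 - 8 * H%:R)).
Proof.
set L := [seq (v, j) | v <- nodes H, j <- iota 0 (d + 1)].
apply: (@le_trans _ _ ((size L)%:R * (2 * expR (2 - 8 * H%:R)))); last first.
  rewrite ler_wpM2r ?mulr_ge0 ?expR_ge0 // ler_nat size_allpairs size_iota leq_mul //.
  exact: size_nodes.
apply: le_trans (av_le (fun w => ind_exists _ _)) _; rewrite av_sum.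
have -> : (size L)%:R * (2 * expR (2 - 8 * H%:R)) = \sum_(i <- L) 2 * expR (2 - 8 * H%:R) :> R.
  by rewrite big_const_seq count_predT iter_addr_0 mulr_natl.
rewrite big_seq [X in _ <= X]big_seq; apply: ler_sum => -[v j] /allpairsP[[v' j'] [/= hv hj [-> ->]]].
by apply: noise1; [exact: nodes_size|move: hj; rewrite mem_iota].
Qed.

Lemma not_noisy w v j : ~ noisy w -> (0 < size v <= H)%N -> (j < d + 1)%N ->
  `|est c0 n d k eps (flatten (msgs w)) v j - mass v j| <= eta.
Proof.
move=> h hv hj; apply/negP => h'; apply: h; exists (v, j); last by apply/negP.
by apply/allpairsP; exists (v, j); split=> //=; [exact: mem_nodes|rewrite mem_iota].
Qed.
End Noise.

(** * Random projections *)

Section Euclid.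
Context {R : realType}.
Variable d : nat.
Implicit Types x y z : 'rV[R]_d.

Definition dot x y : R := \sum_(j < d) x 0 j * y 0 j.

Lemma dot_ge0 x : 0 <= dot x x.
Proof. by apply: sumr_ge0 => j _; rewrite -expr2 sqr_ge0. Qed.

Lemma enorm2 x : enorm x ^+ 2 = dot x x.
Proof.
rewrite /enorm sqr_sqrtr; first by apply: eq_bigr => j _; rewrite expr2.
by apply: sumr_ge0 => j _; exact: sqr_ge0.
Qed.

Lemma enorm_ge0 x : 0 <= enorm x. Proof. exact: sqrtr_ge0. Qed.

Lemma dotC x y : dot x y = dot y x. Proof. by apply: eq_bigr => j _; rewrite mulrC. Qed.
Lemma dotDr x y z : dot x (y + z) = dot x y + dot x z.
Proof. by rewrite /dot -big_split; apply: eq_bigr => j _; rewrite mxE mulrDr. Qed.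
Lemma dotZr x (a : R) y : dot x (a *: y) = a * dot x y.
Proof. by rewrite /dot mulr_sumr; apply: eq_bigr => j _; rewrite mxE mulrCA. Qed.
Lemma dotDl x y z : dot (x + y) z = dot x z + dot y z. Proof. by rewrite dotC dotDr !(dotC z). Qed.
Lemma dotZl x (a : R) y : dot (a *: x) y = a * dot x y. Proof. by rewrite dotC dotZr dotC. Qed.
Lemma dotNr x y : dot x (- y) = - dot x y. Proof. by rewrite -scaleN1r dotZr mulN1r. Qed.
Lemma dotNl x y : dot (- x) y = - dot x y. Proof. by rewrite dotC dotNr dotC. Qed.

Lemma enormB2 x y : enorm (x - y) ^+ 2 = enorm x ^+ 2 - 2 * dot x y + enorm y ^+ 2.
Proof. by rewrite !enorm2 dotDr !dotDl !dotNr !dotNl (dotC y x); ring. Qed.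

Lemma enormD2 x y : enorm (x + y) ^+ 2 = enorm x ^+ 2 + 2 * dot x y + enorm y ^+ 2.
Proof. by rewrite !enorm2 dotDr !dotDl (dotC y x); ring. Qed.

Lemma dot_le x y : dot x y <= enorm x * enorm y.
Proof.
have hx := enorm_ge0 x; have hy := enorm_ge0 y.
have key a b : 0 <= a ^+ 2 * enorm x ^+ 2 - 2 * (a * b) * dot x y + b ^+ 2 * enorm y ^+ 2.
  have := dot_ge0 (a *: x - b *: y); rewrite dotDr !dotDl !dotNr !dotNl !dotZr !dotZl (dotC y x) -!enorm2.
  by congr (_ <= _); ring.
have [x0|x0] := eqVneq (enorm x) 0.
  rewrite x0 mul0r leNgt; apply/negP => h.
  (* When a norm vanishes, the form is affine in the free coefficient; this value would make it
     negative. *)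
  have := key ((enorm y ^+ 2 + 1) / dot x y) 1; rewrite x0 expr0n /= mulr0 mulr1 expr1n mul1r add0r.
  rewrite mulrA mulrAC -mulrA divff ?gt_eqF // mulr1; have := sqr_ge0 (enorm y); lra.
have [y0|y0] := eqVneq (enorm y) 0.
  rewrite y0 mulr0 leNgt; apply/negP => h.
  have := key 1 ((enorm x ^+ 2 + 1) / dot x y); rewrite y0 expr0n /= mulr0 mul1r expr1n mul1r addr0.
  rewrite mulrA mulrAC -mulrA divff ?gt_eqF // mulr1; have := sqr_ge0 (enorm x); lra.
have xp : 0 < enorm x by rewrite lt_def x0. have yp : 0 < enorm y by rewrite lt_def y0.
have := key (enorm y) (enorm x).
set a := enorm x in xp *; set b := enorm y in yp *; set D := dot x y => h.
have ab : 0 < a * b by rewrite mulr_gt0.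
rewrite -(ler_pM2l ab); lra.
Qed.

Lemma ler_enormD x y : enorm (x + y) <= enorm x + enorm y.
Proof.
rewrite -(@ler_pXn2r _ 2) ?nnegrE ?addr_ge0 ?enorm_ge0 // enormD2.
have := dot_le x y; lra.
Qed.

Lemma enormN x : enorm (- x) = enorm x.
Proof. by rewrite /enorm; congr Num.sqrt; apply: eq_bigr => j _; rewrite mxE sqrrN. Qed.

Lemma enormZ a x : enorm (a *: x) = `|a| * enorm x.
Proof.
apply/eqP; rewrite -(@eqrXn2 _ 2) ?mulr_ge0 ?enorm_ge0 ?normr_ge0 //.
by rewrite exprMn !enorm2 dotZr dotZl real_normK ?num_real //; apply/eqP; ring.
Qed.

Lemma enorm0 : enorm (0 : 'rV[R]_d) = 0.
Proof. by rewrite -(scale0r (0 : 'rV[R]_d)) enormZ normr0 mul0r. Qed.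

Lemma ler_enorm_sub x y z : enorm (x - z) <= enorm (x - y) + enorm (y - z).
Proof. by apply: le_trans (ler_enormD _ _); rewrite addrA subrK. Qed.

Lemma size_coords x : size (coords x) = d.
Proof. by rewrite size_map size_enum_ord. Qed.

Lemma nth_coords x (j : 'I_d) : (coords x)`_j = x 0 j.
Proof. by rewrite (nth_map j) ?size_enum_ord // nth_ord_enum. Qed.

Lemma sqs_coords x : sqs (coords x) = enorm x ^+ 2.
Proof.
rewrite enorm2 /sqs big_map big_enum /=; apply: eq_bigr => j _; exact: expr2.
Qed.

Lemma rad_coords w x : rad w (coords x) = \sum_(j < d) sg (nth false w j) * x 0 j.
Proof.
rewrite /rad size_coords; apply: eq_bigr => j _; by rewrite nth_coords.
Qed.
End Euclid.

(** * Concentration of the projected norm *)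

Section Projection.
Context {R : realType}.
Implicit Types (xs : seq R) (w : seq bool).

Definition nrm q w xs : R := \sum_(a < q) rad (drop (a * size xs) w) xs ^+ 2.

Lemma nrm_ge0 q w xs : 0 <= nrm q w xs.
Proof. by apply: sumr_ge0 => a _; exact: sqr_ge0. Qed.

Lemma nrmS q u w xs : size u = size xs -> nrm q.+1 (u ++ w) xs = rad u xs ^+ 2 + nrm q w xs.
Proof.
move=> hu; rewrite /nrm big_ord_recl mul0n drop0; congr (_ + _).
  congr (_ ^+ 2); apply: eq_bigr => j _; by rewrite nth_cat hu ltn_ord.
apply: eq_bigr => a _; congr (rad _ _ ^+ 2).
by rewrite lift0 mulSn -hu addnC -drop_drop drop_size_cat.
Qed.

Lemma ex_exp_nrm q N (l : R) xs : `|l| * sqs xs <= 1 / 32 ->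
  ex (q * size xs + N) (fun w => expR (l * nrm q w xs)) <=
  expR (q%:R * (l * sqs xs + 8 * (l * sqs xs) ^+ 2)).
Proof.
move=> h; elim: q => [|q IH].
  rewrite mul0r expR0 -[X in _ <= X](ex_cst (0 * size xs + N)); apply: ex_le => w _.
  by rewrite /nrm big_ord0 mulr0 expR0.
set E := l * sqs xs + _ in IH *.
rewrite mulSn -addnA ex_cat.
rewrite (eq_ex (g := fun u => expR (l * rad u xs ^+ 2) *
    ex (q * size xs + N) (fun w => expR (l * nrm q w xs)))) => [|u hu].
  2: by rewrite -exZ; apply: eq_ex => w _; rewrite nrmS // mulrDr expRD.
have -> : q.+1%:R * E = E + q%:R * E by rewrite -natr1; ring.
rewrite exZr expRD; apply: ler_pM => //; last exact: ex_exp_sqr.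
- by apply: ex_ge0 => w _; exact: expR_ge0.
- by apply: ex_ge0 => w _; exact: expR_ge0.
Qed.

Lemma nrm_null q w xs : sqs xs = 0 -> nrm q w xs = 0.
Proof.
move=> h; rewrite /nrm big1 // => a _; rewrite /rad big1 ?expr0n // => j _.
have : xs`_j ^+ 2 <= sqs xs.
  rewrite /sqs (big_nth 0) big_mkord (bigD1 j) //= lerDl.
  by apply: sumr_ge0 => i _; exact: sqr_ge0.
rewrite h => h2; have /eqP : xs`_j ^+ 2 = 0 by apply/eqP; rewrite eq_le h2 sqr_ge0.
by rewrite sqrf_eq0 => /eqP ->; rewrite mulr0.
Qed.

Section Tails.
Variables (q N : nat) (xs : seq R) (g : R).
Hypothesis g0 : 0 < g.
Hypothesis g1 : g <= 1 / 2.
Let s := sqs xs.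
Let L := (q * size xs + N)%N.

(** Exponential Markov inequality with [l * s = g / 16]: the gain [q * g^2 / 16] is twice the
    second-order loss [8 * q * (g / 16)^2]. The lower tail uses [- l] in the same way. *)
Lemma nrm_upper : pr L (fun w => (1 + g) * (q%:R * s) < nrm q w xs) <= expR (- (q%:R * g ^+ 2 / 32)).
Proof.
have [s0|s0] := eqVneq s 0.
  rewrite (_ : pr L _ = 0) ?expR_ge0 // -(ex_cst L 0); apply: eq_ex => w _.
  by rewrite indF // nrm_null // s0 !mulr0 ltxx.
have sp : 0 < s by rewrite lt_def s0 sqs_ge0.
have g16 : g / 16 <= 1 / 32 by move: g1; lra.
pose l := g / 16 / s.
have ls : l * s = g / 16 by rewrite /l divfK.
have l0 : 0 < l by rewrite !divr_gt0.
have hl : `|l| * sqs xs <= 1 / 32 by rewrite gtr0_norm // -/s ls.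
have h w : ind ((1 + g) * (q%:R * s) < nrm q w xs) <= expR (- (q%:R * ((1 + g) * (l * s)))) * expR (l * nrm q w xs).
  rewrite -expRD /ind; case: asboolP => [h|_]; last exact: expR_ge0.
  rewrite -[1%:R]expR0 ler_expR addrC subr_ge0.
  by rewrite [X in X <= _](_ : _ = l * ((1 + g) * (q%:R * s))); [rewrite ler_pM2l // ltW|ring].
apply: le_trans (ex_le (fun w _ => h w)) _; rewrite exZ.
apply: le_trans (ler_wpM2l (expR_ge0 _) (ex_exp_nrm q N hl)) _.
rewrite -expRD ler_expR -/s ls; lra.
Qed.

Lemma nrm_lower : pr L (fun w => nrm q w xs < (1 - g) * (q%:R * s)) <= expR (- (q%:R * g ^+ 2 / 32)).
Proof.
have [s0|s0] := eqVneq s 0.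
  rewrite (_ : pr L _ = 0) ?expR_ge0 // -(ex_cst L 0); apply: eq_ex => w _.
  by rewrite indF // nrm_null // s0 !mulr0 ltxx.
have sp : 0 < s by rewrite lt_def s0 sqs_ge0.
have g16 : g / 16 <= 1 / 32 by move: g1; lra.
pose l := g / 16 / s.
have ls : l * s = g / 16 by rewrite /l divfK.
have l0 : 0 < l by rewrite !divr_gt0.
have hl : `|- l| * sqs xs <= 1 / 32 by rewrite normrN gtr0_norm // -/s ls.
have h w : ind (nrm q w xs < (1 - g) * (q%:R * s)) <= expR (q%:R * ((1 - g) * (l * s))) * expR (- l * nrm q w xs).
  rewrite -expRD /ind; case: asboolP => [h|_]; last exact: expR_ge0.
  rewrite -[1%:R]expR0 ler_expR mulNr subr_ge0.
  by rewrite [X in _ <= X](_ : _ = l * ((1 - g) * (q%:R * s))); [rewrite ler_pM2l // ltW|ring].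
apply: le_trans (ex_le (fun w _ => h w)) _; rewrite exZ.
apply: le_trans (ler_wpM2l (expR_ge0 _) (ex_exp_nrm q N hl)) _.
rewrite -expRD ler_expR -/s mulNr ls; lra.
Qed.

(** A truncated first moment rather than a tail, as the size of a failure matters and not only its
    probability. With [l * s = 1 / 32] the exponential moment costs [5 / 128] and the level
    [4 * q * s] gains [16 / 128] per projection. *)
Lemma nrm_big : (8 <= q)%N ->
  ex L (fun w => nrm q w xs * ind (4 * (q%:R * s) < nrm q w xs)) <= 4 * expR (- (q%:R * (11 / 128))) * (q%:R * s).
Proof.
move=> hq; have q8 : 8 <= q%:R :> R by rewrite ler_nat.
have [s0|s0] := eqVneq s 0.
  rewrite s0 !mulr0 -(ex_cst L 0); apply: ex_le => w _.
  by rewrite nrm_null // mul0r.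
have sp : 0 < s by rewrite lt_def s0 sqs_ge0.
have qs : 0 < q%:R * s by rewrite mulr_gt0 //; lra.
pose l := 1 / 32 / s.
have ls : l * s = 1 / 32 by rewrite /l divfK.
have l0 : 0 < l by rewrite !divr_gt0.
have hl : `|l| * sqs xs <= 1 / 32 by rewrite gtr0_norm // -/s ls.
have h w : nrm q w xs * ind (4 * (q%:R * s) < nrm q w xs) <=
    (4 * (q%:R * s) * expR (- (q%:R * (1 / 8)))) * expR (l * nrm q w xs).
  rewrite -mulrA -expRD /ind; case: asboolP => [h|_]; last by rewrite mulr0 mulr_ge0 ?expR_ge0 // mulr_ge0 // ltW.
  rewrite mulr1 (_ : - (q%:R * (1 / 8)) + l * nrm q w xs = l * (nrm q w xs - 4 * (q%:R * s))); last first.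
    by rewrite mulrBr (_ : l * (4 * (q%:R * s)) = 4 * q%:R * (l * s)); [rewrite ls; field|ring].
  set z := nrm q w xs - _; have z0 : 0 < z by rewrite subr_gt0.
  apply: (@le_trans _ _ (4 * (q%:R * s) * (1 + l * z))); last first.
    by rewrite ler_pM2l ?expR_ge1Dx // mulr_gt0.
  (* The factor [4 * q * (l * s)] equals [q / 8], which is at least 1 because [8 <= q]. *)
  rewrite mulrDr mulr1 -lerBlDl -/z (_ : 4 * (q%:R * s) * (l * z) = 4 * q%:R * (l * s) * z); last by ring.
  by rewrite ls -[X in X <= _]mul1r ler_pM2r //; lra.
apply: le_trans (ex_le (fun w _ => h w)) _; rewrite exZ.
rewrite -[4 * expR _ * _]mulrAC -!mulrA !ler_pM2l //; last by lra.
apply: le_trans (ler_wpM2l (expR_ge0 _) (ex_exp_nrm q N hl)) _.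
rewrite -expRD ler_expR -/s ls; lra.
Qed.
End Tails.
End Projection.

Section Events.
Context {R : realType}.
Variables (q d n k : nat).
Variables (X : 'I_n -> 'rV[R]_d) (c : 'I_k -> 'rV[R]_d) (s : 'I_n -> 'I_k) (g : R).
Hypothesis hg : 0 < g <= 1 / 2.
Hypothesis hX : forall i, enorm (X i) <= 1.
Hypothesis q8 : (8 <= q)%N.

Definition prj (w : seq bool) (x : 'rV[R]_d) : 'rV[R]_q :=
  \row_(a < q) rad (drop (a * d) w) (coords x).

Lemma prjB w x y : prj w (x - y) = prj w x - prj w y.
Proof.
apply/rowP => a; rewrite !mxE !rad_coords -sumrB; apply: eq_bigr => j _.
by rewrite !mxE mulrBr.
Qed.

Lemma enorm_prj w x : enorm (prj w x) ^+ 2 = nrm q w (coords x).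
Proof.
rewrite enorm2 /nrm size_coords; apply: eq_bigr => a _; by rewrite !mxE expr2.
Qed.

Definition shrunk w (x : 'rV[R]_d) : Prop := nrm q w (coords x) < (1 - g) * (q%:R * enorm x ^+ 2).
Definition pairs_bad w := exists2 p : 'I_k * 'I_k, p \in enum {: 'I_k * 'I_k} & shrunk w (c p.1 - c p.2).
(** One-sided preservation is enough to compare centers: no center may come too close and the user's
    own center may not recede too far. *)
Definition bad w i := (exists2 j, j \in enum 'I_k & shrunk w (X i - c j)) \/
  (1 + g) * (q%:R * enorm (X i - c (s i)) ^+ 2) < nrm q w (coords (X i - c (s i))).
(** The coefficients come from [(r + 3P + 3D)^2 <= 3r^2 + 27P^2 + 27D^2] in [dist_bound], in the
    case where [D <= P]. *)
Definition loss w : R := \sum_(i < n) ind (bad w i) *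
  (3 * enorm (X i - c (s i)) ^+ 2 + 54 * (nrm q w (coords (X i - c (s i))) / q%:R)).
Definition out_of_range (B : R) w := exists2 p : 'I_n * 'I_q, p \in enum {: 'I_n * 'I_q} &
  B <= `|rad (drop (p.2 * d) w) (coords (X p.1))|.

Variables (L : nat).
Hypothesis hL : (q * d <= L)%N.
Local Notation e := (expR (- (q%:R * g ^+ 2 / 32))).

Lemma L_split (x : 'rV[R]_d) : L = (q * size (coords x) + (L - q * d))%N.
Proof. by rewrite size_coords subnKC. Qed.

Lemma shrunk_prob x : pr L (fun w => shrunk w x) <= e.
Proof.
case/andP: hg => g0 g1; rewrite /shrunk (L_split x) -sqs_coords; exact: nrm_lower.
Qed.

Lemma pairs_prob : pr L pairs_bad <= (k * k)%:R * e.
Proof.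
apply: le_trans (pr_exists (c := e) _) _ => [p _|]; first exact: shrunk_prob.
by rewrite -cardE card_prod card_ord.
Qed.

Lemma bad_prob i : pr L (fun w => bad w i) <= (k + 1)%:R * e.
Proof.
case/andP: hg => g0 g1; apply: le_trans (pr_or _ _ _) _.
have -> : (k + 1)%:R * e = k%:R * e + e by rewrite natrD mulrDl mul1r.
apply: lerD.
  apply: le_trans (pr_exists (c := e) _) _ => [j _|]; first exact: shrunk_prob.
  by rewrite size_enum_ord.
rewrite (L_split (X i - c (s i))) -sqs_coords; exact: nrm_upper.
Qed.

(** As long as the projected square is at most four times its mean, a bad user costs at most
    [(3 + 54 * 4) * r2 = 219 * r2]. Beyond that, [nrm_big] bounds the expectation by [216 * r2]
    times the same exponential, and the sum is 435. *)
Lemma ex_loss : ex L loss <= 435 * (k + 1)%:R * e * \sum_(i < n) enorm (X i - c (s i)) ^+ 2.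
Proof.
case/andP: hg => g0 g1.
have q0 : 0 < q%:R :> R by rewrite ltr0n; apply: leq_trans q8.
rewrite /loss ex_sum mulr_sumr; apply: ler_sum => i _.
set x := X i - c (s i); set r2 := enorm x ^+ 2.
have r0 : 0 <= r2 by exact: sqr_ge0.
apply: (@le_trans _ _ (ex L (fun w => 219 * r2 * ind (bad w i) +
   54 / q%:R * (nrm q w (coords x) * ind (4 * (q%:R * r2) < nrm q w (coords x)))))).
  apply: ex_le => w _; set y := nrm q w _; have y0 : 0 <= y := nrm_ge0 _ _ _.
  set b := ind (bad w i); have b0 : 0 <= b := ind_ge0 _. have b1 : b <= 1 := ind_le1 _.
  have [h|h] := ltP (4 * (q%:R * r2)) y.
    rewrite indT // mulr1.
    have yq : 0 <= y / q%:R by rewrite divr_ge0 // ltW.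
    have -> : 54 / q%:R * y = 54 * (y / q%:R) by ring.
    nra.
  rewrite indF // !mulr0 addr0.
  have hy : y / q%:R <= 4 * r2 by rewrite ler_pdivrMr // -mulrA [r2 * _]mulrC.
  nra.
rewrite exD !exZ.
have h1 : ex L (fun w => ind (bad w i)) <= (k + 1)%:R * e by exact: bad_prob.
have h2 : ex L (fun w => nrm q w (coords x) * ind (4 * (q%:R * r2) < nrm q w (coords x))) <=
   4 * e * (q%:R * r2).
  rewrite (L_split x) /r2 -sqs_coords; apply: le_trans (nrm_big _ _ q8) _.
  apply: ler_wpM2r; first by rewrite mulr_ge0 ?sqs_ge0 // ltW.
  rewrite ler_pM2l // ler_expR lerN2 -mulrA ler_pM2l //.
  by rewrite expr2; nra.
have k1 : 1 <= (k + 1)%:R :> R by rewrite ler1n addn1.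
have e0 : 0 < e by exact: expR_gt0.
apply: (@le_trans _ _ (219 * r2 * ((k + 1)%:R * e) + 54 / q%:R * (4 * e * (q%:R * r2)))).
  have p1 : 0 <= 219 * r2 by rewrite mulr_ge0.
  have p2 : 0 <= 54 / q%:R :> R by rewrite divr_ge0 // ltW.
  by apply: lerD; apply: ler_wpM2l.
have -> : 54 / q%:R * (4 * e * (q%:R * r2)) = 216 * (1 * (e * r2)) by field; rewrite gt_eqF.
have -> : 219 * r2 * ((k + 1)%:R * e) = 219 * ((k + 1)%:R * (e * r2)) by ring.
have -> : 435 * (k + 1)%:R * e * r2 = 435 * ((k + 1)%:R * (e * r2)) by ring.
have : 1 * (e * r2) <= (k + 1)%:R * (e * r2) by rewrite ler_wpM2r // mulr_ge0 // ltW.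
lra.
Qed.

Lemma ex_drop a N (f : seq bool -> R) : ex (a + N) (fun w => f (drop a w)) = ex N f.
Proof. by elim: a => [|a IH] /=; [apply: eq_ex => w _; rewrite drop0|rewrite !IH; field]. Qed.

(** Exponential moments at 2 and -2. The resulting [expR (- (2 * B))] leaves [expR (- B)] after the
    union bound over [n * q] coordinates. *)
Lemma rad_prob (x : 'rV[R]_d) N (B : R) : enorm x <= 1 ->
  pr (d + N) (fun w => B <= `|rad w (coords x)|) <= 2 * expR (8 - 2 * B).
Proof.
move=> hx; have s1 : sqs (coords x) <= 1 by rewrite sqs_coords expr_le1 // enorm_ge0.
have h1 := ex_exp_rad 2 0 (coords x); have h2 := ex_exp_rad (-2) 0 (coords x).
rewrite size_coords in h1 h2.
rewrite /pr ex_cat; apply: (@le_trans _ _ (ex d (fun w =>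
  (expR (2 * (0 + rad w (coords x))) + expR (-2 * (0 + rad w (coords x)))) * expR (- (2 * B))))).
  apply: ex_le => u hu; rewrite -[X in _ <= X](ex_cst N); apply: ex_le => v _.
  have -> : rad (u ++ v) (coords x) = rad u (coords x) :> R.
    by rewrite /rad; apply: eq_bigr => j _; rewrite nth_cat hu -{2}(size_coords x) ltn_ord.
  set y := rad u _; rewrite /ind; case: asboolP => [h|_]; last by rewrite mulr_ge0 ?addr_ge0 ?expR_ge0.
  have e0 := expR_ge0 (2 * (0 + y) - 2 * B); have e1 := expR_ge0 (-2 * (0 + y) - 2 * B).
  rewrite mulrDl -!expRD.
  case: (ger0P y) h => hy h.
    have : 1 <= expR (2 * (0 + y) - 2 * B) by rewrite -[X in X <= _]expR0 ler_expR; lra.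
    by move=> h'; rewrite mulr1n; lra.
  have : 1 <= expR (-2 * (0 + y) - 2 * B) by rewrite -[X in X <= _]expR0 ler_expR; lra.
  by move=> h'; rewrite mulr1n; lra.
rewrite exZr exD expRD mulrA ler_pM2r ?expR_gt0 //.
have m1 : expR (2 * 0 + 2 * 2 ^+ 2 * sqs (coords x)) <= expR 8 :> R by rewrite ler_expR; lra.
have m2 : expR (-2 * 0 + 2 * (-2) ^+ 2 * sqs (coords x)) <= expR 8 :> R by rewrite ler_expR sqrrN; lra.
lra.
Qed.

Lemma range_prob B : pr L (out_of_range B) <= (n * q)%:R * (2 * expR (8 - 2 * B)).
Proof.
apply: le_trans (pr_exists (c := 2 * expR (8 - 2 * B)) _) _ => [[i a] _ /=|].
  have -> : L = (a * d + (d + (L - a.+1 * d)))%N.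
    by rewrite addnA [(_ + d)%N]addnC -mulSn subnKC // (leq_trans _ hL) // leq_mul2r ltn_ord orbT.
  rewrite /pr (ex_drop (a * d) _ (fun w => ind (B <= `|rad w (coords (X i))|))); exact: rad_prob.
by rewrite -cardE card_prod !card_ord.
Qed.

(** [D] will be the width of the user's cell and [j] the center assigned to the cell, which in
    projection is at most [2 * D] farther than the user's own. Either [D] is small against [P] and
    is charged to the distance, or the user pays the last term. A bad user pays through [loss]
    instead of a relative error. *)
Lemma dist_bound w (al D : R) i j : 0 < al <= 1 -> 0 <= D -> ~ pairs_bad w ->
  let P := enorm (prj w (X i - c (s i))) / Num.sqrt q%:R in
  enorm (prj w (X i - c j)) <= Num.sqrt q%:R * (P + 2 * D) ->
  enorm (X i - c j) ^+ 2 <= (1 + al) ^+ 2 * (1 + g) / (1 - g) * enorm (X i - c (s i)) ^+ 2 +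
    ind (bad w i) * (3 * enorm (X i - c (s i)) ^+ 2 + 54 * P ^+ 2) +
    (27 + 8 / al) * D ^+ 2 * (nat_of_bool (P < 2 * D / al))%:R.
Proof.
case/andP: hg => g0 g1 /andP[al0 al1] D0 hp P hj.
set x := X i in P hj *; set r := enorm (x - c (s i)).
set Q := Num.sqrt q%:R in P hj *.
have q0 : 0 < q%:R :> R by rewrite ltr0n; apply: leq_trans q8.
have Q0 : 0 < Q by rewrite sqrtr_gt0.
have Q2 : Q ^+ 2 = q%:R by rewrite sqr_sqrtr // ltW.
have P0 : 0 <= P by rewrite divr_ge0 ?enorm_ge0 // ltW.
have eP : enorm (prj w (x - c (s i))) = Q * P by rewrite /P mulrC divfK // gt_eqF.
have r0 : 0 <= r := enorm_ge0 _.
have near_le : (2 * D <= al * P) \/ (P < 2 * D / al)%R.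
  have [h|h] := leP (2 * D) (al * P); [by left|right].
  by rewrite ltr_pdivlMr // mulrC.
have extra0 : 0 <= (27 + 8 / al) * D ^+ 2.
  by rewrite mulr_ge0 ?sqr_ge0 // addr_ge0 // divr_ge0 // ltW.
have e8 : (27 + 8 / al) * D ^+ 2 = 27 * D ^+ 2 + 8 * (D ^+ 2 / al) by ring.
have Dal : 0 <= D ^+ 2 / al by rewrite divr_ge0 ?sqr_ge0 // ltW.
have [hb|hb] := pselect (bad w i).
  rewrite indT // mul1r.
  (* The distances of a bad user are unreliable, so the detour goes through its own center:
     distances between centers do not shrink, and [4 (P + D)^2 / (1 - g)] is at most
     [8 (P + D)^2]. *)
  have h1 : enorm (c (s i) - c j) <= 3 * (P + D).
    rewrite -(@ler_pXn2r _ 2) ?nnegrE ?mulr_ge0 ?addr_ge0 ?enorm_ge0 //.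
    have h2 : ~ shrunk w (c (s i) - c j).
      by move=> h; apply: hp; exists (s i, j); rewrite // mem_enum.
    have h3 : (1 - g) * (q%:R * enorm (c (s i) - c j) ^+ 2) <= nrm q w (coords (c (s i) - c j)).
      by rewrite leNgt; apply/negP.
    have h4 : enorm (prj w (c (s i) - c j)) <= Q * (2 * (P + D)).
      have -> : prj w (c (s i) - c j) = prj w (x - c j) - prj w (x - c (s i)).
        rewrite !prjB; move: (prj w x) (prj w (c (s i))) (prj w (c j)) => u v z.
        by apply/rowP => a; rewrite !mxE; ring.
      apply: le_trans (ler_enormD _ _) _; rewrite enormN eP; nra.
    have h5 : nrm q w (coords (c (s i) - c j)) <= q%:R * (2 * (P + D)) ^+ 2.
      rewrite -enorm_prj -Q2 -exprMn ler_pXn2r ?nnegrE ?enorm_ge0 //.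
      by rewrite !mulr_ge0 ?addr_ge0 // ltW.
    have h6 : (1 - g) * enorm (c (s i) - c j) ^+ 2 <= (2 * (P + D)) ^+ 2.
      by rewrite -(ler_pM2l q0) mulrCA; apply: le_trans h3 h5.
    have := sqr_ge0 (enorm (c (s i) - c j)); have := sqr_ge0 (P + D).
    by rewrite !exprMn in h6 *; nra.
  have h7 : enorm (x - c j) <= r + 3 * (P + D).
    by apply: le_trans (ler_enorm_sub x (c (s i)) (c j)) _; rewrite lerD2l.
  have h8 : enorm (x - c j) ^+ 2 <= 3 * r ^+ 2 + 27 * P ^+ 2 + 27 * D ^+ 2.
    apply: (@le_trans _ _ ((r + 3 * (P + D)) ^+ 2)).
      by rewrite ler_pXn2r ?nnegrE ?enorm_ge0 // addr_ge0 // mulr_ge0 // addr_ge0.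
    have := sqr_ge0 (r - 3 * P); have := sqr_ge0 (r - 3 * D); have := sqr_ge0 (3 * P - 3 * D); nra.
  have h9 : 0 <= (1 + al) ^+ 2 * (1 + g) / (1 - g) * r ^+ 2.
    apply: mulr_ge0; last exact: sqr_ge0.
    by apply: divr_ge0; [apply: mulr_ge0; [exact: sqr_ge0|lra]|lra].
  case: near_le => h.
    have : 0 <= (27 + 8 / al) * D ^+ 2 * (nat_of_bool (P < 2 * D / al))%:R by rewrite mulr_ge0.
    have : D ^+ 2 <= P ^+ 2 by rewrite ler_pXn2r ?nnegrE //; nra.
    lra.
  rewrite h mulr1 e8; have := sqr_ge0 P; lra.
rewrite indF // mul0r addr0.
have h1 : ~ shrunk w (x - c j) by move=> h; apply: hb; left; exists j; rewrite // mem_enum.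
have h2 : (1 - g) * (q%:R * enorm (x - c j) ^+ 2) <= nrm q w (coords (x - c j)).
  by rewrite leNgt; apply/negP.
have h3 : nrm q w (coords (x - c (s i))) <= (1 + g) * (q%:R * r ^+ 2).
  by rewrite leNgt; apply/negP => h; apply: hb; right.
have h4 : P ^+ 2 <= (1 + g) * r ^+ 2.
  by rewrite -(ler_pM2l q0) -Q2 -exprMn -eP enorm_prj Q2 mulrCA.
have h5 : enorm (x - c j) ^+ 2 <= (P + 2 * D) ^+ 2 / (1 - g).
  rewrite ler_pdivlMr; last by lra.
  rewrite -(ler_pM2l q0) mulrC [_ * (1 - g)]mulrC -mulrA [_ * q%:R]mulrC; apply: le_trans h2 _.
  rewrite -enorm_prj -Q2 -exprMn ler_pXn2r ?nnegrE ?enorm_ge0 //.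
  by apply: mulr_ge0; [exact: ltW|apply: addr_ge0 => //; apply: mulr_ge0].
apply: le_trans h5 _.
have g2 : 0 < (1 - g)^-1 by rewrite invr_gt0; lra.
have g3 : (1 - g)^-1 <= 2 by rewrite -[X in _ <= X]invrK lef_pV2 ?posrE //; lra.
have h6 : (1 + al) ^+ 2 * (1 + g) / (1 - g) * r ^+ 2 = (1 + al) ^+ 2 * ((1 + g) * r ^+ 2) / (1 - g) by ring.
rewrite h6.
have P2 := sqr_ge0 P.
case: near_le => h.
  have : 0 <= (27 + 8 / al) * D ^+ 2 * (nat_of_bool (P < 2 * D / al))%:R by rewrite mulr_ge0.
  suff : (P + 2 * D) ^+ 2 / (1 - g) <= (1 + al) ^+ 2 * ((1 + g) * r ^+ 2) / (1 - g) by lra.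
  rewrite ler_pM2r //; apply: (@le_trans _ _ ((1 + al) ^+ 2 * P ^+ 2)).
    have z1 : 0 <= P + 2 * D by lra.
    have z2 : 0 <= (1 + al) * P by apply: mulr_ge0 => //; lra.
    by rewrite -exprMn ler_pXn2r ?nnegrE //; lra.
  by rewrite ler_pM2l // exprn_gt0 //; lra.
rewrite h mulr1.
apply: (@le_trans _ _ (((1 + al) * P ^+ 2 + 4 * (D ^+ 2 + D ^+ 2 / al)) / (1 - g))).
  rewrite ler_pM2r //.
  (* Young's inequality for the cross term [4 * P * D], weighted so that [P ^+ 2] gains a factor of
     [1 + al] only. *)
  have k1 : 0 <= (al * P - 2 * D) ^+ 2 / al by rewrite divr_ge0 ?sqr_ge0 // ltW.
  have k2 : (al * P - 2 * D) ^+ 2 / al = al * P ^+ 2 - 4 * P * D + 4 * (D ^+ 2 / al).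
    by field; rewrite gt_eqF.
  rewrite k2 in k1; lra.
rewrite mulrDl e8; apply: lerD.
  rewrite ler_pM2r //; apply: (@le_trans _ _ ((1 + al) ^+ 2 * P ^+ 2)).
    rewrite ler_wpM2r // expr2 -[X in X <= _]mul1r ler_wpM2r //; lra.
  by rewrite ler_pM2l // exprn_gt0 //; lra.
have : 0 <= D ^+ 2 + D ^+ 2 / al by rewrite addr_ge0 ?sqr_ge0.
set z := D ^+ 2 + _ => z0; have : 4 * z / (1 - g) <= 4 * z * 2 by rewrite ler_wpM2l // mulr_ge0.
have := sqr_ge0 D; rewrite /z; lra.
Qed.
End Events.

(** * Cells of the tree *)

Section Digits.
Context {R : realType}.
Implicit Type z : R.

Lemma zrem_bounds z l : 0 <= z <= 1 -> 0 <= zrem z l <= 1.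
Proof.
move=> hz; elim: l => [//|l /andP[h1 h2]] /=.
by case: ifP => h; [|move/negbT: h; rewrite -ltNge => h]; apply/andP; split; lra.
Qed.

Fixpoint dg z l : nat := if l is l.+1 then (2 * dg z l + bitz z l)%N else 0.

Lemma dg_zrem z l : z * 2 ^+ l = (dg z l)%:R + zrem z l.
Proof.
elim: l => [|l IH] /=; first by rewrite expr0 mulr1 add0r.
rewrite exprS mulrCA IH natrD natrM /bitz; case: ifP => _ /=; ring.
Qed.

Lemma dg_lt z l : (dg z l < 2 ^ l)%N.
Proof. by elim: l => //= l IH; rewrite expnS; case: (bitz z l) => /=; lia. Qed.

Lemma dg_inj z z' l : dg z l = dg z' l -> forall j, (j < l)%N -> bitz z j = bitz z' j.
Proof.
elim: l => // l IH /= h j; rewrite ltnS leq_eqVlt => /orP[/eqP ->|]; last first.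
  by apply: IH; move: h; case: (bitz z l); case: (bitz z' l) => /=; lia.
by move: h; case: (bitz z l); case: (bitz z' l) => //=; lia.
Qed.

Lemma dg_eq z z' l : (forall j, (j < l)%N -> bitz z j = bitz z' j) -> dg z l = dg z' l.
Proof.
elim: l => //= l IH h; rewrite IH ?h // => j hj; apply: h; exact: ltnW.
Qed.

Lemma dg_close z z' l : 0 <= z <= 1 -> 0 <= z' <= 1 -> dg z l = dg z' l -> `|z - z'| * 2 ^+ l <= 1.
Proof.
move=> hz hz' h; have /andP[a1 a2] := zrem_bounds l hz; have /andP[b1 b2] := zrem_bounds l hz'.
have e2 : 0 <= 2 ^+ l :> R by exact: exprn_ge0.
rewrite -[X in _ * X](ger0_norm e2) -normrM mulrBl !dg_zrem h ler_norml; apply/andP; split; lra.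
Qed.

Definition ndist (x y : nat) : nat := (x - y + (y - x))%N.

Lemma dg_ndist z z' l : 0 <= z <= 1 -> 0 <= z' <= 1 ->
  (ndist (dg z l) (dg z' l))%:R <= `|z - z'| * 2 ^+ l + 1.
Proof.
move=> hz hz'; have /andP[a1 a2] := zrem_bounds l hz; have /andP[b1 b2] := zrem_bounds l hz'.
have e2 : 0 <= 2 ^+ l :> R by exact: exprn_ge0.
rewrite -[X in _ * X](ger0_norm e2) -normrM mulrBl !dg_zrem /ndist.
move: (dg z l) (dg z' l) => x y.
have [h|h] := leqP x y.
  rewrite (eqP h) add0n natrB //; have := ler_norm (- (x%:R + zrem z l - (y%:R + zrem z' l))).
  by rewrite normrN; lra.
have h' := ltnW h; rewrite (eqP h') addn0 natrB //.
by have := ler_norm (x%:R + zrem z l - (y%:R + zrem z' l)); lra.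
Qed.

Lemma half_sum M y : \sum_(0 <= x < M) (1 / 2) ^+ ndist x y <= 3 :> R.
Proof.
have h2 : 0 <= 1 / 2 :> R by lra.
pose S m : R := \sum_(0 <= x < m) (1 / 2) ^+ ndist x y.
have rec m : S m.+1 = S m + (1 / 2) ^+ ndist m y by rewrite /S big_nat_recr.
(* Closed bounds for the partial sums of the two geometric series, rising up to [y] and falling
   behind it. *)
have key m : if (m <= y)%N then S m <= (1 / 2) ^+ (y - m) else S m <= 3 - (1 / 2) ^+ (m - y.+1).
  elim: m => [|m IH]; first by rewrite /S big_geq // exprn_ge0.
  rewrite rec; move: IH; case: (leqP m y) => hm; last first.
    rewrite ifF; last by apply/negbTE; rewrite -ltnNge ltnW.
    rewrite /ndist (_ : (y - m)%N = 0%N); last by lia.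
    rewrite addn0 subSS (_ : (m - y = (m - y.+1).+1)%N); last by lia.
    by rewrite exprS; lra.
  rewrite /ndist (_ : (m - y)%N = 0%N) ?add0n; last by lia.
  move: hm; rewrite leq_eqVlt => /orP[/eqP ->|hm] IH.
    by rewrite ltnn subnn subSS subnn expr0; rewrite subnn expr0 in IH; lra.
  rewrite hm; have e : (y - m = (y - m.+1).+1)%N by lia.
  by rewrite e exprS in IH *; lra.
have := key M; rewrite -/(S M); case: ifP => _ h; apply: le_trans h _.
  by apply: le_trans (exprn_ile1 _ h2 _) _; lra.
by rewrite lerBlDr lerDl exprn_ge0.
Qed.

(** Give a lattice point the weight [2^-] its l1 distance from [g0]. The total weight factors over
    the coordinates and is at most [3 ^ q], and every point of the ball weighs at least [2 ^ -K]. *)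
Lemma ball_count q M (g0 : 'I_q -> nat) K :
  (#|[set g : {ffun 'I_q -> 'I_M} | (\sum_a ndist (g a) (g0 a) <= K)%N]| <= 2 ^ K * 3 ^ q)%N.
Proof.
set A := [set g | _]; rewrite -(ler_nat R) natrM !natrX.
have e2 : 0 < 2 ^+ K :> R by rewrite exprn_gt0.
rewrite mulrC -ler_pdivrMr // -exprVn.
have h2 : 0 <= 2^-1 :> R by rewrite invr_ge0.
apply: (@le_trans _ _ (\sum_(g : {ffun 'I_q -> 'I_M}) \prod_a (1 / 2 : R) ^+ ndist (g a) (g0 a))).
  rewrite -sum1_card natr_sum mulr_suml [X in _ <= X](bigID (mem A)) /= -[X in X <= _]addr0.
  apply: lerD; last by apply: sumr_ge0 => g _; apply: prodr_ge0 => a _; rewrite exprn_ge0 // mul1r.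
  apply: ler_sum => g; rewrite inE => hg; rewrite mul1r prodrXr.
  by rewrite mul1r; apply: ler_wiXn2l => //; lra.
rewrite -(bigA_distr_bigA (fun (a : 'I_q) (x : 'I_M) => (1 / 2 : R) ^+ ndist x (g0 a))).
rewrite -[X in _ ^+ X](card_ord q) -prodr_const; apply: ler_prod => a _.
rewrite -(big_mkord xpredT (fun x => (1 / 2 : R) ^+ ndist x (g0 a))) half_sum andbT.
by apply: sumr_ge0 => x _; rewrite exprn_ge0 // mul1r.
Qed.
End Digits.

Section Cells.
Context {R : realType}.
Variables (c0 n d k : nat) (pub : seq bool) (X : 'I_n -> 'rV[R]_d).
Local Notation q := (pq c0 k).
Local Notation B := (@Bnd R c0 n k).
Hypothesis q0 : (0 < q)%N.
Hypothesis rng : forall i (a : 'I_q), `|rad (drop (a * d) pub) (coords (X i))| < B.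

Definition zz i a : R := pz c0 n k pub (coords (X i)) a.
Definition upath i := path c0 n k pub (coords (X i)).
(** Side of a cell of depth [t] before rescaling: at this depth at least [t %/ q] digits of each
    coordinate are known. *)
Definition width t : R := 2 * B / 2 ^+ (t %/ q).

Lemma upathE i b : upath i b = bitz (zz i (b %% q)) (b %/ q). Proof. by []. Qed.

Let B0 : 0 < B. Proof. by rewrite ltr0n addn_gt0 q0. Qed.

Lemma zz_bounds i (a : 'I_q) : 0 <= zz i a <= 1.
Proof.
have := rng i a; rewrite /zz /pz size_coords ltr_norml => /andP[h1 h2].
rewrite divr_ge0 /=; [|lra|by rewrite mulr_ge0 // ltW].
by rewrite ler_pdivrMr ?mul1r ?mulr_gt0 //; lra.
Qed.

Lemma zzB i i' (a : 'I_q) : zz i a - zz i' a = prj q pub (X i - X i') 0 a / (2 * B).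
Proof. by rewrite prjB !mxE /zz /pz !size_coords; field; rewrite -natrD gt_eqF. Qed.

Lemma width_gt0 t : 0 < width t.
Proof. by rewrite /width divr_gt0 ?mulr_gt0 ?exprn_gt0. Qed.

Lemma cell_close i i' v : innode (upath i) v -> innode (upath i') v ->
  enorm (prj q pub (X i - X i')) <= Num.sqrt q%:R * width (size v).
Proof.
rewrite !innode_all => /allP h /allP h'; set l := (size v %/ q)%N.
have W0 := width_gt0 (size v); have W1 := ltW W0.
rewrite -(@ler_pXn2r _ 2) ?nnegrE ?enorm_ge0 ?mulr_ge0 ?sqrtr_ge0 //.
rewrite enorm2 exprMn sqr_sqrtr // -[X in X%:R * _](card_ord q) mulr_natl -sumr_const.
apply: ler_sum => a _; rewrite -expr2.
rewrite -real_normK ?num_real // ler_pXn2r ?nnegrE ?normr_ge0 //.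
have e : prj q pub (X i - X i') 0 a = (zz i a - zz i' a) * (2 * B).
  by rewrite zzB divfK // gt_eqF // mulr_gt0.
rewrite e normrM (gtr0_norm (mulr_gt0 _ B0)) // /width -/l ler_pdivlMr ?exprn_gt0 //.
rewrite mulrAC -[X in _ <= X]mul1r ler_pM2r ?mulr_gt0 //.
apply: dg_close; [exact: zz_bounds|exact: zz_bounds|]; apply: dg_eq => j hj.
have hb : (j * q + a < size v)%N.
  apply: leq_trans (leq_divM (size v) q); rewrite -/l.
  have : (j.+1 * q <= l * q)%N by rewrite leq_mul2r hj orbT.
  by have := ltn_ord a; rewrite mulSn; lia.
have hm : (j * q + a)%N \in iota 0 (size v) by rewrite mem_iota.
have := h _ hm; have := h' _ hm; rewrite !upathE modnMDl divnMDl // modn_small // divn_small // addn0.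
by move=> /eqP <- /eqP.
Qed.

Variables (c : 'I_k -> 'rV[R]_d) (s : 'I_n -> 'I_k) (al : R) (K : nat).
Hypothesis al0 : 0 < al.
Hypothesis hK : 32 / al ^+ 2 + 2 <= K%:R.
Definition Pn i : R := enorm (prj q pub (X i - c (s i))) / Num.sqrt q%:R.
Definition near t i : bool := Pn i < 2 * width t / al.

(** Two near users of the same cluster are close in projection, by the triangle inequality through
    their center. Digits up to level [(t %/ q).+1] are compared because depth [t] may end in the
    middle of a level. *)
Lemma near_dg t i i' : s i = s i' -> near t i -> near t i' ->
  (\sum_(a < q) ndist (dg (zz i a) (t %/ q).+1) (dg (zz i' a) (t %/ q).+1) <= K * q)%N.
Proof.
move=> hs h h'; set l := (t %/ q)%N; rewrite -(ler_nat R) natr_sum.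
have W0 := width_gt0 t.
have qq : 0 < q%:R :> R by rewrite ltr0n.
pose u (a : 'I_q) : R := `|zz i a - zz i' a| * 2 ^+ l.+1.
have hP : enorm (prj q pub (X i - X i')) <= Num.sqrt q%:R * (4 * width t / al).
  have -> : prj q pub (X i - X i') = prj q pub (X i - c (s i)) - prj q pub (X i' - c (s i')).
    rewrite hs !prjB; move: (prj q pub (X i)) (prj q pub (X i')) (prj q pub _) => x y z.
    by apply/rowP => a; rewrite !mxE; ring.
  apply: le_trans (ler_enormD _ _) _; rewrite enormN.
  have sq : 0 < Num.sqrt q%:R :> R by rewrite sqrtr_gt0.
  rewrite /near /Pn in h h'; rewrite ltr_pdivrMr // in h; rewrite ltr_pdivrMr // in h'.
  have -> : Num.sqrt q%:R * (4 * width t / al) = 2 * width t / al * Num.sqrt q%:R + 2 * width t / al * Num.sqrt q%:R by ring.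
  by apply: lerD; exact: ltW.
have hu2 : \sum_a u a ^+ 2 <= q%:R * (64 / al ^+ 2).
  have -> : \sum_a u a ^+ 2 = enorm (prj q pub (X i - X i')) ^+ 2 * (2 ^+ l / B) ^+ 2.
    rewrite enorm2 /dot mulr_suml; apply: eq_bigr => a _; rewrite /u exprMn real_normK ?num_real //.
    by rewrite zzB [2 ^+ l.+1]exprS; move: (B) B0 => b b0; field; rewrite gt_eqF.
  apply: (@le_trans _ _ ((Num.sqrt q%:R * (4 * width t / al)) ^+ 2 * (2 ^+ l / B) ^+ 2)).
    rewrite ler_wpM2r ?sqr_ge0 // ler_pXn2r ?nnegrE ?enorm_ge0 //.
    by rewrite mulr_ge0 ?sqrtr_ge0 // divr_ge0 ?mulr_ge0 // ltW.
  rewrite exprMn sqr_sqrtr; last exact: ltW.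
  rewrite -[X in X <= _]mulrA; apply: ler_wpM2l; first exact: ltW.
  rewrite /width -/l le_eqVlt; apply/orP; left; apply/eqP.
  have e2 : 0 < 2 ^+ l :> R by exact: exprn_gt0.
  by move: (B) B0 (2 ^+ l) e2 => b b0 e e0; field; rewrite !gt_eqF.
apply: (@le_trans _ _ (\sum_(a < q) (u a + 1))).
  by apply: ler_sum => a _; apply: dg_ndist; exact: zz_bounds.
(* [u <= u^2 / 2 + 1 / 2] passes from the Euclidean to the l1 distance, at the expense of a constant
   per coordinate; the sum explains the condition [32 / al ^+ 2 + 2 <= K]. *)
apply: (@le_trans _ _ (\sum_(a < q) (u a ^+ 2 / 2 + 3 / 2))).
  by apply: ler_sum => a _; have := sqr_ge0 (u a - 1); nra.
rewrite big_split /= -mulr_suml sumr_const card_ord -[_ *+ q]mulr_natr natrM.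
have : q%:R * (32 / al ^+ 2 + 2) <= q%:R * K%:R :> R by rewrite ler_pM2l.
lra.
Qed.

(** A cell is recovered from the cluster and the digits of one near user in it. For each cluster
    these digit vectors lie in an l1 ball of radius [K * q], so [ball_count] applies, with [3 ^ q]
    rounded up to [2 ^ (2 * q)]. *)
Lemma near_count t (vs : seq (seq bool)) : uniq vs -> (forall v, v \in vs -> size v = t) ->
  (forall v, v \in vs -> exists2 i, innode (upath i) v & near t i) ->
  (size vs <= k * 2 ^ ((K + 2) * q))%N.
Proof.
move=> uv sv hv.
have [->//|vs0] := eqVneq vs [::].
have [i0 _] : exists i : 'I_n, True.
  by case: vs vs0 hv {uv sv} => // v vs' _ hv; have [i _ _] := hv v (mem_head _ _); exists i.
pose us v := odflt i0 [pick i | innode (upath i) v && near t i].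
have husP v : v \in vs -> innode (upath (us v)) v /\ near t (us v).
  move=> /hv[i h1 h2]; rewrite /us; case: pickP => [j /andP[]//|/(_ i)].
  by rewrite h1 h2.
pose rf j := odflt i0 [pick i | (s i == j) && near t i].
pose M := (2 ^ (t %/ q).+1)%N.
pose gv i : {ffun 'I_q -> 'I_M} := [ffun a : 'I_q => Ordinal (dg_lt (zz i a) (t %/ q).+1)].
pose A j := [set g : {ffun 'I_q -> 'I_M} | (\sum_a ndist (g a) (gv (rf j) a) <= K * q)%N].
pose f v := (s (us v), gv (us v)).
have finj : {in vs &, injective f}.
  move=> v v' hv1 hv2 [_ hg].
  have [h1 _] := husP v hv1; have [h2 _] := husP v' hv2.
  rewrite (eqP h1) (eqP h2) (sv v) // (sv v') //; apply: (@eq_from_nth _ false); rewrite !size_mkseq // => b hb.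
  rewrite !nth_mkseq // !upathE.
  have hq : (b %% q < q)%N by rewrite ltn_mod.
  have := congr1 (fun g : {ffun 'I_q -> 'I_M} => val (g (Ordinal hq))) hg; rewrite !ffunE => hh.
  by apply: (@dg_inj _ _ _ (t %/ q).+1 hh); rewrite ltnS leq_div2r // ltnW.
rewrite -(size_map f) -(card_uniqP _); last by rewrite map_inj_in_uniq.
apply: (@leq_trans #|\bigcup_(j : 'I_k) finset.setX [set j] (A j)|).
  apply: subset_leq_card; apply/fintype.subsetP => p /mapP[v hv1 ->]; have [h1 h2] := husP v hv1.
  apply/finset.bigcupP; exists (s (us v)) => //; rewrite finset.in_setX inE eqxx inE /=.
  have hr : s (rf (s (us v))) = s (us v) /\ near t (rf (s (us v))).
    by rewrite /rf; case: pickP => [j /andP[/eqP]//|/(_ (us v))]; rewrite eqxx h2.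
  have := near_dg (esym hr.1) h2 hr.2; rewrite (eq_bigr (fun a => ndist (gv (us v) a) (gv (rf (s (us v))) a))) //.
  by move=> a _; rewrite !ffunE.
apply: (@leq_trans (\sum_(j : 'I_k) #|finset.setX [set j] (A j)|)).
  elim/big_rec2: _ => [|j m D _ h]; first by rewrite cards0.
  by apply: leq_trans (leq_card_setU _ _) _; rewrite leq_add2l.
rewrite -[X in (_ <= X * _)%N](card_ord k) -sum_nat_const; apply: leq_sum => j _.
rewrite cardsX cards1 mul1n; apply: leq_trans (@ball_count R _ _ _ _) _.
rewrite mulnDl expnD leq_mul2l; apply/orP; right.
by rewrite expnM leq_exp2r.
Qed.
End Cells.

(** * The leaves as a partition of the users *)

Section Leaves.
Context {R : realType}.
Variables (c0 G n d k : nat) (eps : R) (m : seq R).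
Local Notation q := (pq c0 k).
Local Notation H := (pH c0 n k).
Local Notation Gam := (pGam c0 G n k).
Local Notation cands := (cands c0 G n d k eps m).
Local Notation leaves := (leaves c0 G n d k eps m).
Local Notation expanded := (expanded c0 G n d k eps m).
Local Notation rank := (rank c0 n d k eps m).

Lemma innode_rcons p v b : innode p (rcons v b) = innode p v && (b == p (size v)).
Proof.
rewrite !innode_all size_rcons -addn1 iotaD all_cat /= andbT nth_rcons ltnn eqxx add0n.
by congr (_ && _); apply: eq_in_all => j; rewrite mem_iota add0n => /= hj; rewrite nth_rcons hj.
Qed.

Lemma count_children p vs : count (innode p) (children vs) = count (innode p) vs.
Proof.
elim: vs => //= v vs IH; rewrite /children /= -/(children vs) IH !innode_rcons.
by case: (innode p v); case: (p (size v)).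
Qed.

(** A candidate on the path either becomes a leaf or passes the path on to exactly one of its
    children, so the total over leaves and current candidates does not change with the depth. *)
Lemma count_leaves p t : (count (innode p) (leaves t) + count (innode p) (cands t) = 1)%N.
Proof.
elim: t => [|t IH]; first by rewrite /= /innode /= !eqseq_cons; case: (p 0%N).
rewrite leavesS count_cat /= count_children -[RHS]IH -addnA; congr (_ + _)%N.
move: (expanded t.+1 (cands t)) => a.
by elim: (cands t) => //= v vs <-; case: (a v) => /=; lia.
Qed.

Lemma cands_H : cands H = [::].
Proof.
have H0 : (0 < H)%N by rewrite expn_gt0.
rewrite -(prednK H0) /=; set vs := [seq v <- _ | _].
suff -> : vs = [::] by [].
rewrite /vs (eq_filter (a2 := pred0)) ?filter_pred0 // => v.
by rewrite /expanded prednK // ltnn andbF.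
Qed.

Lemma count_leavesH p : count (innode p) (leaves H) = 1%N.
Proof. by have := count_leaves p H; rewrite cands_H addn0. Qed.

Definition leaf p := head [::] [seq v <- leaves H | innode p v].

Lemma leafE p : [seq v <- leaves H | innode p v] = [:: leaf p].
Proof.
have := count_leavesH p; rewrite -size_filter /leaf.
by case: [seq v <- _ | _] => [|v []].
Qed.

Lemma sum_leaves p (F : seq bool -> R) : \sum_(v <- leaves H) (nat_of_bool (innode p v))%:R * F v = F (leaf p).
Proof.
transitivity (\sum_(v <- [seq v <- leaves H | innode p v]) F v); last by rewrite leafE big_seq1.
by rewrite big_filter [RHS]big_mkcond; apply: eq_bigr => v _; case: innode; rewrite ?mul1r ?mul0r.
Qed.

Lemma leaf_in p : leaf p \in leaves H /\ innode p (leaf p).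
Proof.
have : leaf p \in [seq v <- leaves H | innode p v] by rewrite leafE inE.
by rewrite mem_filter => /andP[].
Qed.

Lemma mem_leaves t v : v \in leaves t -> exists2 j, (j < t)%N & v \in cands j /\ ~~ expanded j.+1 (cands j) v.
Proof.
case/flattenP => s /mapP[j]; rewrite mem_iota add0n => /= hj ->; rewrite mem_filter => /andP[h1 h2].
by exists j.
Qed.

Lemma leaves_size v : v \in leaves H -> (0 < size v <= H)%N.
Proof. by case/mem_leaves => j hj [/cands_size -> _]. Qed.

Lemma size_leaves t : (size (leaves t) <= t * (2 * Gam))%N.
Proof.
elim: t => [//|t IH]; rewrite leavesS size_cat mulSn addnC leq_add //.
by rewrite size_filter (leq_trans (count_size _ _)) // size_cands.
Qed.

Lemma uniq_children vs : uniq vs -> uniq (children vs).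
Proof.
elim: vs => //= v vs IH /andP[hv hu]; rewrite /children /= -/(children vs).
have h b : rcons v b \notin children vs.
  apply: contra hv => /flattenP[s /mapP[v' hv' ->]]; rewrite !inE.
  by case/orP=> /eqP /rcons_inj [-> _].
by rewrite inE negb_or !h IH // !andbT; apply/negP => /eqP /rcons_inj [].
Qed.

Lemma uniq_cands t : uniq (cands t).
Proof. by elim: t => //= t IH; apply: uniq_children; exact: filter_uniq. Qed.

Lemma count_innode p t (vs : seq (seq bool)) : uniq vs -> {in vs, forall v, size v = t} ->
  (count (innode p) vs <= 1)%N.
Proof.
move=> u h; rewrite -size_filter.
apply: (@uniq_leq_size _ _ [:: mkseq p t]); first exact: filter_uniq.
move=> v; rewrite mem_filter => /andP[/eqP hv /h hs]; by rewrite inE {1}hv hs.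
Qed.
End Leaves.

(** * The cost of leaves that are wide compared with the distance to a center *)

Section Extra.
Context {R : realType}.
Variables (c0 G n d k : nat) (eps : R) (m : seq R) (pub : seq bool) (X : 'I_n -> 'rV[R]_d).
Local Notation q := (pq c0 k).
Local Notation H := (pH c0 n k).
Local Notation Gam := (pGam c0 G n k).
Local Notation cands := (cands c0 G n d k eps m).
Local Notation leaves := (leaves c0 G n d k eps m).
Local Notation expanded := (expanded c0 G n d k eps m).
Local Notation est := (est c0 n d k eps m).
Local Notation B := (@Bnd R c0 n k).
Local Notation up := (upath c0 k pub X).
Local Notation leaf i := (leaf c0 G n d k eps m (up i)).
Local Notation width := (@width R c0 n k).
Hypothesis n0 : (0 < n)%N.
Hypothesis q0 : (0 < q)%N.
Hypothesis rng : forall i (a : 'I_q), `|rad (drop (a * d) pub) (coords (X i))| < B.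

Definition cnt v : R := \sum_i (nat_of_bool (innode (up i) v))%:R.

Variable et : R.
Hypothesis et0 : 0 <= et.
Hypothesis hest : forall v, (0 < size v <= H)%N -> `|est v 0 - cnt v| <= et.
Variables (c : 'I_k -> 'rV[R]_d) (s : 'I_n -> 'I_k) (al : R) (K M : nat).
Hypothesis al0 : 0 < al.
Hypothesis hK : 32 / al ^+ 2 + 2 <= K%:R.
Hypothesis M0 : (0 < M)%N.
Local Notation N := (k * 2 ^ ((K + 2) * q))%N.
Hypothesis N0 : (0 < N)%N.
Hypothesis hG : (N * (1 + H * M) <= Gam)%N.
Local Notation P := (Pn c0 pub X c s).
Local Notation near := (near c0 pub X c s al).

Definition has_near t v := [exists i, innode (up i) v && near t i].
Definition near_leaves t := [seq v <- cands t | ~~ expanded t.+1 (cands t) v && has_near t.+1 v].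
Definition nfar t : R := \sum_i (nat_of_bool (~~ near t i))%:R.

Lemma H_gt0' : (0 < H)%N. Proof. by rewrite expn_gt0. Qed.

Lemma GamN : 0 < Gam%:R - N%:R :> R.
Proof.
rewrite subr_gt0 ltr_nat; apply: leq_trans hG.
by rewrite mulnDr muln1 -[X in (X < _)%N]addn0 ltn_add2l muln_gt0 N0 muln_gt0 H_gt0'.
Qed.

Lemma has_near_count t (vs : seq (seq bool)) : uniq vs -> {in vs, forall v, size v = t} ->
  all (has_near t) vs -> (size vs <= N)%N.
Proof.
move=> u h /allP hv; apply: (near_count q0 rng (c := c) (s := s) al0 hK u h) => v /hv /existsP[i /andP[h1 h2]].
by exists i.
Qed.

Lemma cnt_leaf t v : (t.+1 < H)%N -> v \in cands t -> ~~ expanded t.+1 (cands t) v ->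
  cnt v <= 2 * et + nfar t.+1 / (Gam%:R - N%:R).
Proof.
move=> ht hv; rewrite /expanded ht andbT -ltnNge => hr.
pose A := [seq v' <- cands t | est v 0 <= est v' 0].
(* The nodes of [F] have true weights at least [cnt v - 2 * et], they are disjoint as they have the
   same depth, and all their users are far. *)
pose F := [seq v' <- A | ~~ has_near t.+1 v'].
have uA : uniq A by apply: filter_uniq; exact: uniq_cands.
have sA : {in A, forall v', size v' = t.+1} by move=> v'; rewrite mem_filter => /andP[_ /cands_size].
have sF : Gam%:R - N%:R <= (size F)%:R :> R.
  rewrite lerBlDr -natrD ler_nat; apply: leq_trans (ltnW hr) _.
  rewrite /rank -size_filter -/A -(count_predC (has_near t.+1) A) [X in (_ <= X)%N]addnC leq_add //; last by rewrite /F size_filter.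
  rewrite -size_filter; apply: (@has_near_count t.+1) => [|v'|]; first exact: filter_uniq.
    by rewrite mem_filter => /andP[_ /sA].
  exact: filter_all.
have hF : (size F)%:R * (cnt v - 2 * et) <= nfar t.+1.
  have -> : (size F)%:R * (cnt v - 2 * et) = \sum_(v' <- F) (cnt v - 2 * et).
    by rewrite big_const_seq count_predT iter_addr_0 mulr_natl.
  apply: (@le_trans _ _ (\sum_(v' <- F) cnt v')).
    rewrite big_seq [X in _ <= X]big_seq; apply: ler_sum => v'; rewrite !mem_filter => /andP[_ /andP[h1 h2]].
    have d1 : (0 < size v <= H)%N by rewrite (cands_size hv) /= ltnW.
    have d2 : (0 < size v' <= H)%N by rewrite (cands_size h2) /= ltnW.
    have := hest d1; have := hest d2; rewrite !ler_norml => /andP[a1 a2] /andP[a3 a4]; lra.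
  rewrite /cnt exchange_big /nfar /=; apply: ler_sum => i _.
  have c1 : (count (innode (up i)) F <= 1)%N.
    by apply: (@count_innode _ t.+1); [exact: filter_uniq|move=> v'; rewrite mem_filter => /andP[_ /sA]].
  have -> : \sum_(v' <- F) (nat_of_bool (innode (up i) v'))%:R = (count (innode (up i)) F)%:R :> R.
    by rewrite -sum1_count natr_sum [RHS]big_mkcond; apply: eq_bigr => v' _; case: innode.
  have [hn|hn] := boolP (near t.+1 i); last by rewrite ler_nat.
  rewrite ler_nat leqn0; apply/eqP; apply/eqP; rewrite -leqn0 leqNgt -has_count.
  apply/hasP => -[v']; rewrite mem_filter => /andP[/existsP h _] h'.
  by apply: h; exists i; rewrite h' hn.
have g0 := GamN.
have f0 : 0 <= nfar t.+1 by apply: sumr_ge0 => i _; exact: ler0n.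
rewrite -lerBlDl; have [h|h] := leP (cnt v - 2 * et) 0; first by apply: le_trans h _; rewrite divr_ge0 // ltW.
by rewrite ler_pdivlMr // mulrC; apply: le_trans hF; rewrite ler_pM2r.
Qed.

Lemma width_le t : width t <= 2 * B.
Proof.
have B0 : 0 < B by rewrite ltr0n addn_gt0 q0.
have B1 : 0 <= 2 * B by rewrite mulr_ge0 // ltW.
by rewrite /width ler_pdivrMr ?exprn_gt0 // ler_peMr // exprn_ege1 // ler1n.
Qed.

(** For a far user the width is at most [al * P / 2], so counting far users by squared width is
    Markov's inequality for [P ^+ 2]. *)
Lemma nfar_width t : nfar t * width t ^+ 2 <= al ^+ 2 / 4 * \sum_i P i ^+ 2.
Proof.
rewrite /nfar mulr_suml mulr_sumr; apply: ler_sum => i _.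
have W0 := @width_gt0 R c0 n k q0 t.
case: (boolP (near t i)) => h; first by rewrite mul0r mulr_ge0 ?sqr_ge0 // divr_ge0 ?sqr_ge0.
rewrite mul1r; move: h; rewrite /near -leNgt ler_pdivrMr // => h.
have -> : al ^+ 2 / 4 * P i ^+ 2 = (P i * al / 2) ^+ 2 by field.
have h2 : width t <= P i * al / 2 by move: h W0; set x := P i * al; set y := width t; lra.
have h3 : 0 <= P i * al / 2 by exact: le_trans (ltW W0) h2.
by rewrite ler_pXn2r ?nnegrE // ltW.
Qed.

(** [hG] makes [N / (Gam - N)] at most [1 / (H * M)]: the factor [H] pays for summing over all
    depths, and [M] makes the charge to the squared distances small. *)
Lemma near_leaves_cost t : (t.+1 < H)%N ->
  \sum_(v <- near_leaves t) cnt v * width t.+1 ^+ 2 <=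
   8 * N%:R * et * B ^+ 2 + H%:R^-1 * (al ^+ 2 / (4 * M%:R) * \sum_i P i ^+ 2).
Proof.
move=> ht; set S := \sum_i P i ^+ 2.
have S0 : 0 <= S by apply: sumr_ge0 => i _; exact: sqr_ge0.
have W0 := @width_gt0 R c0 n k q0 t.+1; have W1 := width_le t.+1.
have B0 : 0 < B by rewrite ltr0n addn_gt0 q0.
have g0 := GamN.
set w2 := width t.+1 ^+ 2.
have w20 : 0 <= w2 by exact: sqr_ge0.
have w21 : w2 <= 4 * B ^+ 2.
  have -> : 4 * B ^+ 2 = (2 * B) ^+ 2 by ring.
  by rewrite /w2 ler_pXn2r ?nnegrE //; [exact: ltW|rewrite mulr_ge0 // ltW].
pose b := 8 * et * B ^+ 2 + (al ^+ 2 / 4 * S) / (Gam%:R - N%:R).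
have hv v : v \in near_leaves t -> cnt v * w2 <= b.
  rewrite mem_filter => /andP[/andP[h1 _] h2].
  apply: (@le_trans _ _ ((2 * et + nfar t.+1 / (Gam%:R - N%:R)) * w2)).
    by rewrite ler_wpM2r // cnt_leaf.
  rewrite mulrDl /b; apply: lerD; first by have h3 := ler_wpM2l et0 w21; lra.
  by rewrite mulrAC ler_pM2r ?invr_gt0 // nfar_width.
have sN : (size (near_leaves t) <= N)%N.
  apply: (@has_near_count t.+1); first by apply: filter_uniq; exact: uniq_cands.
    by move=> v; rewrite mem_filter => /andP[_ /cands_size].
  by apply/allP => v; rewrite mem_filter => /andP[/andP[]].
have b0 : 0 <= b.
  rewrite /b addr_ge0 //; first by rewrite !mulr_ge0 // ?sqr_ge0.
  by rewrite divr_ge0 ?(ltW g0) // mulr_ge0 // divr_ge0 ?sqr_ge0.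
apply: (@le_trans _ _ (N%:R * b)).
  apply: (@le_trans _ _ ((size (near_leaves t))%:R * b)); last by rewrite ler_wpM2r // ler_nat.
  have -> : (size (near_leaves t))%:R * b = \sum_(v <- near_leaves t) b.
    by rewrite big_const_seq count_predT iter_addr_0 mulr_natl.
  by rewrite big_seq [X in _ <= X]big_seq; apply: ler_sum => v; exact: hv.
rewrite /b mulrDr; apply: lerD; first by rewrite le_eqVlt; apply/orP; left; apply/eqP; ring.
have H0 : 0 < H%:R :> R by rewrite ltr0n H_gt0'.
have Mp : 0 < M%:R :> R by rewrite ltr0n.
have -> : H%:R^-1 * (al ^+ 2 / (4 * M%:R) * S) = (al ^+ 2 / 4 * S) * (H%:R * M%:R)^-1 by field; rewrite !gt_eqF.
have -> : N%:R * (al ^+ 2 / 4 * S / (Gam%:R - N%:R)) = al ^+ 2 / 4 * S * (N%:R / (Gam%:R - N%:R)) by ring.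
apply: ler_wpM2l; first by rewrite mulr_ge0 // divr_ge0 ?sqr_ge0.
rewrite ler_pdivrMr // mulrC ler_pdivlMr ?mulr_gt0 //.
have : N%:R * (1 + H%:R * M%:R) <= Gam%:R :> R by rewrite -[1]/(1%:R) -natrM -natrD -natrM ler_nat.
rewrite mulrDr mulr1; lra.
Qed.

(** The depth is at least [q * (pen n + 1)], so every coordinate has [pen n + 1] digits at the last
    level. Users in leaves of depth [H] then cost at most [n * (B / n)^2], which is below
    [B ^+ 2]. *)
Lemma width_H : width H * n%:R <= B.
Proof.
have B0 : 0 < B by rewrite ltr0n addn_gt0 q0.
rewrite /width mulrAC ler_pdivrMr ?exprn_gt0 // mulrAC [_ * B]mulrC ler_pM2l //.
apply: (@le_trans _ _ (2 ^+ (pen n).+1)).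
  by rewrite exprS ler_pM2l // -natrX ler_nat up_logP.
rewrite ler_eXn2l ?ltr1n // leq_divRL //; apply: (@leq_trans (pH0 c0 n k)); last exact: up_logP.
by rewrite /pH0 mulnC addn1.
Qed.

Definition extra : R := \sum_i width (size (leaf i)) ^+ 2 * (nat_of_bool (near (size (leaf i)) i))%:R.

Lemma extra_bound : extra <= 8 * H%:R * N%:R * et * B ^+ 2 + al ^+ 2 / (4 * M%:R) * \sum_i P i ^+ 2 + B ^+ 2.
Proof.
have B0 : 0 < B by rewrite ltr0n addn_gt0 q0.
have H0 : 0 < H%:R :> R by rewrite ltr0n H_gt0'.
set S := \sum_i P i ^+ 2.
have S0 : 0 <= S by apply: sumr_ge0 => i _; exact: sqr_ge0.
pose T (t : nat) : R := \sum_(v <- near_leaves t) cnt v * width t.+1 ^+ 2.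
apply: (@le_trans _ _ (\sum_(t < H | (t.+1 < H)%N) T t + \sum_(i < n) width H ^+ 2)).
  have -> : \sum_(t < H | (t.+1 < H)%N) T t = \sum_i \sum_(t < H | (t.+1 < H)%N) \sum_(v <- near_leaves t) (nat_of_bool (innode (up i) v))%:R * width t.+1 ^+ 2.
    rewrite exchange_big; apply: eq_bigr => t _; rewrite /T exchange_big; apply: eq_bigr => v _.
    by rewrite /cnt mulr_suml.
  rewrite -big_split /extra; apply: ler_sum => i _ /=.
  have z0 (t : nat) : 0 <= \sum_(v <- near_leaves t) (nat_of_bool (innode (up i) v))%:R * width t.+1 ^+ 2.
    by apply: sumr_ge0 => v _; rewrite mulr_ge0 ?sqr_ge0.
  have [hl hi] := leaf_in c0 G n d k eps m (up i).
  have [t ht [h1 h2]] := mem_leaves hl; rewrite (cands_size h1).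
  have [hn|_] := boolP (near t.+1 i); last by rewrite mulr0 addr_ge0 ?sqr_ge0 // sumr_ge0.
  (* A leaf of depth [H] may be heavy, but its width is tiny; only shallower leaves owe their
     existence to a low rank. *)
  rewrite mulr1; move: ht; rewrite leq_eqVlt => /orP[/eqP ->|ht].
    by rewrite lerDr sumr_ge0.
  have hv : leaf i \in near_leaves t.
    by rewrite mem_filter h1 h2 andbT; apply/existsP; exists i; rewrite hi hn.
  rewrite (bigD1 (Ordinal (ltnW ht))) //= (big_rem _ hv) /= hi mul1r -!addrA lerDl.
  rewrite addr_ge0 //; first by apply: sumr_ge0 => v _; rewrite mulr_ge0 ?sqr_ge0.
  by rewrite addr_ge0 ?sqr_ge0 // sumr_ge0.
apply: lerD; last first.
  rewrite sumr_const card_ord -[_ *+ n]mulr_natr.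
  have w0 := @width_gt0 R c0 n k q0 H; have := width_H.
  have n1 : 1 <= n%:R :> R by rewrite ler1n.
  set w := width H in w0 *; set nn := n%:R in n1 * => h.
  have : w ^+ 2 * nn <= (w * nn) ^+ 2.
    have -> : (w * nn) ^+ 2 = w ^+ 2 * nn * nn by ring.
    by rewrite ler_peMr // mulr_ge0 ?sqr_ge0 // (le_trans ler01).
  have wn : 0 <= w * nn by rewrite mulr_ge0 ?(ltW w0) // (le_trans ler01).
  by move=> h'; apply: le_trans h' _; rewrite ler_pXn2r ?nnegrE // ltW.
set b := 8 * N%:R * et * B ^+ 2 + H%:R^-1 * (al ^+ 2 / (4 * M%:R) * S).
have b0 : 0 <= b.
  rewrite addr_ge0 //; first by rewrite !mulr_ge0 ?sqr_ge0.
  by rewrite mulr_ge0 ?invr_ge0 // mulr_ge0 // divr_ge0 ?sqr_ge0 // mulr_ge0.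
apply: (@le_trans _ _ (\sum_(t < H) b)).
  rewrite big_mkcond; apply: ler_sum => t _; case: ifP => // ht; exact: near_leaves_cost.
have -> : \sum_(t < H) b = H%:R * b by rewrite sumr_const card_ord mulr_natl.
rewrite /b mulrDr [H%:R * (H%:R^-1 * _)]mulrA divff ?gt_eqF // mul1r lerD2r.
by rewrite le_eqVlt; apply/orP; left; apply/eqP; ring.
Qed.

Hypothesis hX : forall i, enorm (X i) <= 1.
Hypothesis al1 : al <= 1.
Variable g : R.
Hypothesis hg : 0 < g <= 1 / 2.
Hypothesis q8 : (8 <= q)%N.
Hypothesis hpairs : ~ pairs_bad q c g pub.

(** A leaf receives the center nearest in projection to one representative of it. Passing from a
    user to the representative and back costs the width of the cell twice, as [dist_bound]
    expects. *)
Lemma assignment : exists asg : seq bool -> 'I_k,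
  \sum_i enorm (X i - c (asg (leaf i))) ^+ 2 <=
   (1 + al) ^+ 2 * (1 + g) / (1 - g) * (\sum_i enorm (X i - c (s i)) ^+ 2) + loss q X c s g pub +
   (27 + 8 / al) * extra.
Proof.
pose i0 := Ordinal n0.
pose rep v := odflt i0 [pick i | innode (up i) v].
pose f v j := enorm (prj q pub (X (rep v) - c j)).
pose asg v : 'I_k := [arg min_(j < s i0) f v j]%O.
have asgP v j : f v (asg v) <= f v j by rewrite /asg; case: arg_minP => // i _; apply.
exists asg; rewrite mulr_sumr /loss /extra mulr_sumr -!big_split /=; apply: ler_sum => i _.
set v := leaf i; have [_ hi] := leaf_in c0 G n d k eps m (up i); rewrite -/v in hi.
have hr : innode (up (rep v)) v by rewrite /rep; case: pickP => // /(_ i); rewrite hi.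
have W0 := @width_gt0 R c0 n k q0 (size v).
have qq : 0 < Num.sqrt q%:R :> R by rewrite sqrtr_gt0 ltr0n.
have e1 : Num.sqrt q%:R * P i = enorm (prj q pub (X i - c (s i))) by rewrite /Pn mulrC divfK // gt_eqF.
have e2 : P i ^+ 2 = nrm q pub (coords (X i - c (s i))) / q%:R.
  by rewrite /Pn expr_div_n enorm_prj sqr_sqrtr.
have h1 := cell_close q0 rng hi hr.
have h2 : enorm (prj q pub (X i - c (asg v))) <= Num.sqrt q%:R * (P i + 2 * width (size v)).
  have -> : prj q pub (X i - c (asg v)) = prj q pub (X i - X (rep v)) + prj q pub (X (rep v) - c (asg v)).
    by rewrite !prjB; move: (prj q pub _) (prj q pub _) (prj q pub _) => x y z; rewrite addrA subrK.
  apply: le_trans (ler_enormD _ _) _.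
  have h3 : enorm (prj q pub (X (rep v) - c (asg v))) <= enorm (prj q pub (X (rep v) - c (s i))) by exact: asgP.
  have h4 : enorm (prj q pub (X (rep v) - c (s i))) <= enorm (prj q pub (X i - X (rep v))) + enorm (prj q pub (X i - c (s i))).
    rewrite -(enormN (prj q pub (X i - X (rep v)))); apply: le_trans _ (ler_enormD _ _).
    rewrite le_eqVlt; apply/orP; left; apply/eqP; congr enorm; rewrite !prjB.
    by move: (prj q pub _) (prj q pub _) (prj q pub _) => x y z; apply/rowP => a; rewrite !mxE; ring.
  rewrite mulrDr e1; have -> : Num.sqrt q%:R * (2 * width (size v)) = 2 * (Num.sqrt q%:R * width (size v)) by ring.
  lra.
have al01 : 0 < al <= 1 by rewrite al0.
have := dist_bound hg q8 al01 (ltW W0) hpairs h2; rewrite -/(Pn c0 pub X c s i) e2.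
by move=> h; apply: le_trans h _; rewrite lerD2l -[X in X <= _]mulrA.
Qed.

Lemma sum_P2 : \sum_i P i ^+ 2 <= 2 * (\sum_i enorm (X i - c (s i)) ^+ 2) + loss q X c s g pub.
Proof.
rewrite mulr_sumr /loss -big_split /=; apply: ler_sum => i _.
have e2 : P i ^+ 2 = nrm q pub (coords (X i - c (s i))) / q%:R.
  by rewrite /Pn expr_div_n enorm_prj sqr_sqrtr.
rewrite -e2; have r2 := sqr_ge0 (enorm (X i - c (s i))); have p2 := sqr_ge0 (P i).
have [hb|hb] := pselect (bad q X c s g pub i); first by rewrite indT // mul1r; lra.
rewrite indF // mul0r addr0.
have qq : 0 < q%:R :> R by rewrite ltr0n.
have : nrm q pub (coords (X i - c (s i))) <= (1 + g) * (q%:R * enorm (X i - c (s i)) ^+ 2).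
  by rewrite leNgt; apply/negP => h; apply: hb; right.
have -> : nrm q pub (coords (X i - c (s i))) = q%:R * P i ^+ 2 by rewrite e2 mulrC divfK // gt_eqF.
rewrite [X in _ <= X]mulrCA ler_pM2l // => h; case/andP: hg => g1 g2; nra.
Qed.
End Extra.

(** * Clustering costs *)

Section Costs.
Context {R : realType}.
Variable d : nat.
Implicit Types (x y : 'rV[R]_d) (C : {fset 'rV[R]_d}).
Local Open Scope fset_scope.
Local Open Scope ring_scope.

Definition mincost x C : R := inf [set enorm (x - c) ^+ 2 | c in [set` C]]%classic.

Lemma mincost_le x C c : c \in C -> mincost x C <= enorm (x - c) ^+ 2.
Proof.
move=> hc; apply: ge_inf; last by exists c.
by exists 0 => _ [c' _ <-]; exact: sqr_ge0.
Qed.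

Lemma nearest x C : C != fset0 -> exists2 c, c \in C & mincost x C = enorm (x - c) ^+ 2.
Proof.
move=> C0; have [c hc hm] : exists2 c, c \in C & forall c', c' \in C -> enorm (x - c) ^+ 2 <= enorm (x - c') ^+ 2.
  case/fset0Pn: C0 => c0 hc0.
  have [c hc hm] : exists2 c, c \in enum_fset C & forall c', c' \in enum_fset C -> enorm (x - c) ^+ 2 <= enorm (x - c') ^+ 2.
    have : c0 \in enum_fset C by [].
    elim: (enum_fset C) c0 {hc0} => // a [|b s] IH c0 _.
      by exists a; rewrite ?mem_head // => c'; rewrite inE => /eqP ->.
    have [c hc hm] := IH b (mem_head _ _).
    have [h|h] := leP (enorm (x - c) ^+ 2) (enorm (x - a) ^+ 2).
      by exists c; [rewrite inE hc orbT|move=> c'; rewrite inE => /orP[/eqP ->|/hm]].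
    exists a; first exact: mem_head.
    by move=> c'; rewrite inE => /orP[/eqP ->|/hm] // h'; apply: le_trans (ltW h) h'.
  by exists c.
exists c => //; apply/eqP; rewrite eq_le mincost_le //=.
apply: lb_le_inf; first by exists (enorm (x - c) ^+ 2), c.
by move=> _ [c' hc' <-]; exact: hm.
Qed.

Lemma mincost_ge0 x C : C != fset0 -> 0 <= mincost x C.
Proof. by move=> /(nearest x)[c _ ->]; exact: sqr_ge0. Qed.

Lemma costE n (X : 'I_n -> 'rV[R]_d) C : cost X C = \sum_i mincost (X i) C. Proof. by []. Qed.

Lemma cost_ge0 n (X : 'I_n -> 'rV[R]_d) C : C != fset0 -> 0 <= cost X C.
Proof. by move=> h; rewrite costE; apply: sumr_ge0 => i _; exact: mincost_ge0. Qed.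

Lemma cost_le n (X : 'I_n -> 'rV[R]_d) C (f : 'I_n -> 'rV[R]_d) :
  (forall i, f i \in C) -> cost X C <= \sum_i enorm (X i - f i) ^+ 2.
Proof. by move=> h; rewrite costE; apply: ler_sum => i _; exact: mincost_le. Qed.

Hypothesis d0 : (0 < d)%N.

(** Solutions must have exactly [k] centers. As [0 < d], the constant vectors provide infinitely
    many points to fill up a smaller set, which never increases the cost. *)
Lemma fset_extend C k : (#|` C| <= k)%N -> exists2 C', C `<=` C' & #|` C'| = k.
Proof.
move=> /subnKC <-; elim: (k - _)%N => [|r [C' h1 h2]]; first by exists C; rewrite ?addn0.
pose f (i : nat) : 'rV[R]_d := const_mx i%:R.
have finj : injective f.
  move=> i j /rowP /(_ (Ordinal d0)); rewrite !mxE => /eqP; rewrite eqr_nat; exact: eqP.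
pose s := [seq f i | i <- iota 0 #|` C'|.+1].
have [/allP h|/allPn[y hy hn]] := boolP (all (mem C') s).
  have := @uniq_leq_size _ s (enum_fset C'); rewrite map_inj_uniq // iota_uniq => /(_ isT).
  have hs : {subset s <= enum_fset C'} by move=> y /h.
  by move=> /(_ hs); rewrite size_map size_iota ltnn.
exists (y |` C'); first by apply: fsubset_trans h1 _; exact: fsubsetUr.
by rewrite cardfsU1 hn h2 addnS.
Qed.

Lemma opt_le n k (X : 'I_n -> 'rV[R]_d) C : #|` C| = k -> (0 < k)%N -> opt k X <= cost X C.
Proof.
move=> hC k0; apply: ge_inf; last by exists C.
exists 0 => _ [C' hC' <-]; apply: cost_ge0; rewrite -cardfs_gt0; by rewrite hC'.
Qed.

Lemma opt_le_sum n k (X : 'I_n -> 'rV[R]_d) (c : 'I_k -> 'rV[R]_d) (g : 'I_n -> 'I_k) : (0 < k)%N ->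
  opt k X <= \sum_i enorm (X i - c (g i)) ^+ 2.
Proof.
move=> k0; have hs : (#|` [fset y in [seq c j | j <- enum 'I_k]]| <= k)%N.
  by rewrite card_fseq (leq_trans (size_undup _)) // size_map size_enum_ord.
have [C h1 h2] := fset_extend hs.
apply: le_trans (opt_le X h2 k0) _; apply: cost_le => i.
apply: (fsubsetP h1); rewrite in_fset /=; apply: map_f; exact: mem_enum.
Qed.

(** Nearest-point projection to the unit ball. It does not increase distances from points of the
    ball, so near-optimal centers may be taken inside it. *)
Definition ballproj x : 'rV[R]_d := if enorm x <= 1 then x else (enorm x)^-1 *: x.

Lemma ballproj_le1 x : enorm (ballproj x) <= 1.
Proof.
rewrite /ballproj; case: ifP => // /negbT; rewrite -ltNge => h.
have h0 : 0 < enorm x by apply: lt_trans h.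
by rewrite enormZ normfV gtr0_norm // mulVf // gt_eqF.
Qed.

Lemma ballproj_near x y : enorm x <= 1 -> enorm (x - ballproj y) ^+ 2 <= enorm (x - y) ^+ 2.
Proof.
move=> hx; rewrite /ballproj; case: ifP => // /negbT; rewrite -ltNge => h.
have h0 : 0 < enorm y by apply: lt_trans h.
rewrite !enormB2 enormZ normfV gtr0_norm // mulVf ?gt_eqF // dotZr.
set s := enorm y in h h0 *; set D := dot x y.
have hD : D <= s by apply: le_trans (dot_le x y) _; rewrite -/s ler_piMl // ltW.
have i1 : s^-1 <= 1 by rewrite invf_le1 // ltW.
have e : (1 - s^-1) * s = s - 1 by field; rewrite gt_eqF.
have : (1 - s^-1) * D <= (1 - s^-1) * s by rewrite ler_wpM2l // subr_ge0.
rewrite e mulrBl mul1r; nra.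
Qed.

(** A slack of 1 in the infimum avoids any compactness argument and is absorbed by the additive
    error. *)
Lemma near_opt n k (X : 'I_n -> 'rV[R]_d) : (0 < k)%N -> in_uball X ->
  exists (c : 'I_k -> 'rV[R]_d) (s : 'I_n -> 'I_k), (forall j, enorm (c j) <= 1) /\
   \sum_i enorm (X i - c (s i)) ^+ 2 <= opt k X + 1.
Proof.
move=> k0 hX.
have hi : has_inf [set cost X C | C in [set C : {fset 'rV[R]_d} | #|` C| = k]]%classic.
  split; last by exists 0 => _ [C' hC' <-]; apply: cost_ge0; rewrite -cardfs_gt0 hC'.
  by have [C _ hC] := @fset_extend fset0 k isT; exists (cost X C), C.
have [_ [C hC <-] hlt] := inf_adherent ltr01 hi; rewrite -/(opt k X) in hlt.
have C0 : C != fset0 by rewrite -cardfs_gt0 hC.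
have sz : size (enum_fset C) = k by rewrite -hC.
have hs i : exists j : 'I_k, enorm (X i - nth 0 (enum_fset C) j) ^+ 2 = mincost (X i) C.
  have [c hc e] := nearest (X i) C0.
  have hc' : c \in enum_fset C by [].
  have hj : (index c (enum_fset C) < k)%N by rewrite -[X in (_ < X)%N]sz index_mem.
  by exists (Ordinal hj); rewrite /= nth_index.
have [s hs'] := choice hs.
exists (fun j => ballproj (nth 0 (enum_fset C) j)), s.
split=> [j|]; first exact: ballproj_le1.
apply: le_trans (ltW hlt); rewrite costE; apply: ler_sum => i _.
rewrite -(hs' i); apply: ballproj_near; exact: hX.
Qed.
End Costs.

(** On the points 0 and 1 of the line with [k = 1] the optimum is positive. Since [beta < 1], some
    tape produces a solution, whose cost is at least the optimum and at most [kappa] times the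
    optimum. *)
Lemma approx_ratio_ge1 (R : realType) (kappa beta : R) : 0 < beta < 1 ->
  ptime_kmeans_approx kappa beta -> 1 <= kappa.
Proof.
case/andP=> b0 b1 [p [A h]].
pose X (i : 'I_2) : 'rV[R]_1 := const_mx (i : nat)%:R.
have eX i (x : 'rV[R]_1) : enorm (X i - x) ^+ 2 = ((i : nat)%:R - x 0 0) ^+ 2.
  by rewrite enorm2 /dot big_ord1 !mxE expr2.
have e1 (x : 'rV[R]_1) : enorm x ^+ 2 = x 0 0 ^+ 2 by rewrite enorm2 /dot big_ord1 expr2.
have hX : in_uball X.
  move=> i; rewrite /uball /= -(@expr_le1 _ 2) ?enorm_ge0 // e1 !mxE.
  by rewrite -natrX lern1; case: i => -[|[|]].
have [_] := h 2 1 1%N isT isT isT X hX; set T := poly_bound A 2 1 1; set E := [set w | _]%classic => hp.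
have [w [hC hw]] : exists w, E w.
  apply: contrapT => hn; have : Pr R E = 0.
    rewrite /Pr (_ : #|_| = 0%N) ?mul0r //; apply: eq_card0 => w; rewrite inE.
    by apply/asboolP => hw; apply: hn; exists w.
  by move=> e; rewrite e in hp; lra.
set C := centers _ _ _ in hC hw.
have C0 : C != fset0 by rewrite -cardfs_gt0 hC.
have lb D : D != fset0 -> #|` D| = 1%N -> 1 / 2 <= cost X D.
  move=> D0 /eqP /cardfs1P [x hx]; rewrite costE big_ord_recl big_ord1.
  have m i : mincost (X i) D = ((i : nat)%:R - x 0 0) ^+ 2.
    by have [c] := nearest (X i) D0; rewrite hx inE => /eqP -> ->; rewrite eX.
  rewrite !m lift0 [nat_of_ord ord0]/= mulr0n mulr1n; set y := x 0 0.
  by have := sqr_ge0 (1 - 2 * y); lra.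
have ho : 1 / 2 <= opt 1 X.
  apply: lb_le_inf; first by exists (cost X C), C.
  by move=> _ [D hD <-]; apply: lb => //; rewrite -cardfs_gt0 hD.
have := opt_le X hC isT; rewrite addr0 in hw => h2.
have h3 : opt 1 X <= kappa * opt 1 X := le_trans h2 hw.
by rewrite -(ler_pM2r (lt_le_trans _ ho)) ?mul1r //; lra.
Qed.

Lemma count_threshold (R : realType) (w : R) n :
  let m := count (fun i => (i + 1)%:R <= w) (iota 0 n) in
  [/\ (m%:R <= w \/ m = 0%N), (m = n \/ w < m%:R + 1) & (m <= n)%N].
Proof.
set p := fun i => _.
elim: n => [|n [IH1 IH2 IH3]]; first by split; [right|left|].
cbv zeta; have -> : count p (iota 0 n.+1) = (count p (iota 0 n) + p n)%N.
  by rewrite -addn1 iotaD count_cat /= addn0 add0n.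
set m := count _ _ in IH1 IH2 IH3 *; rewrite /p.
have [h|h] := leP (n + 1)%:R w.
  have -> : m = n.
    case: IH2 => // h2; apply/eqP; rewrite eqn_leq IH3 leqNgt; apply/negP => h3.
    have : (m + 1)%:R <= (n + 1)%:R :> R by rewrite ler_nat leq_add2r ltnW.
    by rewrite [in X in X -> _]natrD; lra.
  by split; [left|left; rewrite addn1|rewrite addn1].
rewrite addn0; split=> //; last exact: leqW.
by right; case: IH2 => // ->; rewrite natrD in h.
Qed.

(** * The synthetic data set *)

Section SynthPoints.
Local Open Scope fset_scope.
Local Open Scope ring_scope.
Context {R : realType}.
Variables (c0 G n d k : nat) (eps : R) (m : seq R).
Local Notation q := (pq c0 k).
Local Notation H := (pH c0 n k).
Local Notation Gam := (pGam c0 G n k).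
Local Notation est := (est c0 n d k eps m).
Local Notation mult v := (mult c0 n d k eps m v).
Local Notation leaves := (leaves c0 G n d k eps m H).

Definition shat v : 'rV[R]_d := \row_(j < d) est v j.+1.
(* Twice the point of which the decoder puts [mult v] copies in the synthetic data set. *)
Definition ctr v : 'rV[R]_d := if mult v == 0%N then 0 else (est v 0)^-1 *: shat v.

Lemma mult_test v : (0 < mult v)%N -> enorm (shat v) ^+ 2 <= 4 * est v 0 ^+ 2 /\ (mult v)%:R <= est v 0.
Proof.
rewrite /Submission.mult; case: ifP => // h1 h2; split.
  rewrite enorm2 /dot; move: h1; rewrite -mulrA -expr2; congr (_ <= _).
  by apply: eq_bigr => j _; rewrite !mxE expr2.
by have [[//|e] _ _] := count_threshold (est v 0) n; rewrite e in h2.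
Qed.

Lemma ctr_le2 v : enorm (ctr v) <= 2.
Proof.
rewrite /ctr; case: posnP => h; first by rewrite enorm0.
have [h1 h2] := mult_test h.
have w0 : 0 < est v 0 by apply: lt_le_trans h2; rewrite ltr0n.
rewrite enormZ normfV gtr0_norm // mulrC ler_pdivrMr //.
have w2 : 0 <= 2 * est v 0 by lra.
rewrite -(@ler_pXn2r _ 2) ?nnegrE ?enorm_ge0 ?w2 //.
by move: h1; congr (_ <= _); ring.
Qed.

Definition synth_pts : seq 'rV[R]_d := 0 :: flatten [seq nseq (mult v) (2^-1 *: ctr v) | v <- leaves].

Lemma coords0 : coords (0 : 'rV[R]_d) = nseq d 0.
Proof.
apply: (@eq_from_nth _ 0) => [|j]; rewrite size_coords ?size_nseq // => hj.
by rewrite (nth_coords _ (Ordinal hj)) mxE nth_nseq if_same.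
Qed.

Lemma synthE : synth c0 G n d k eps m = [seq coords y | y <- synth_pts].
Proof.
rewrite /synth /synth_pts /= coords0; congr (_ :: _).
rewrite map_flatten -map_comp; congr flatten; apply: eq_map => v /=.
rewrite map_nseq; case: (posnP (mult v)) => [->//|h]; congr nseq.
apply: (@eq_from_nth _ 0) => [|j]; rewrite ?size_coords size_map size_iota // => hj.
rewrite (nth_map 0%N) ?size_iota // nth_iota // add0n (nth_coords _ (Ordinal hj)) !mxE.
rewrite /ctr gtn_eqF // !mxE /= invfM; ring.
Qed.

Definition Yf (i : 'I_(size synth_pts)) : 'rV[R]_d := nth 0 synth_pts i.

Lemma flatten_Yf : flatten (synth c0 G n d k eps m) = flatten [seq coords (Yf i) | i <- enum 'I_(size synth_pts)].
Proof.
rewrite synthE; congr flatten.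
have {1}-> : synth_pts = [seq Yf i | i <- enum 'I_(size synth_pts)].
  apply: (@eq_from_nth _ 0) => [|j hj]; first by rewrite size_map size_enum_ord.
  by rewrite (nth_map (Ordinal hj)) ?size_enum_ord // /Yf nth_enum_ord.
by rewrite -map_comp.
Qed.

Lemma size_synthE : size (synth c0 G n d k eps m) = size synth_pts.
Proof. by rewrite synthE size_map. Qed.

Lemma Yf_uball : in_uball Yf.
Proof.
move=> i; rewrite /uball /=; have := mem_nth 0 (ltn_ord i); rewrite -/(Yf i) inE => /orP[/eqP ->|].
  by rewrite enorm0 ler01.
case/flattenP => s /mapP[v _ ->]; rewrite mem_nseq => /andP[_ /eqP ->].
by rewrite enormZ gtr0_norm ?invr_gt0 //; have := ctr_le2 v; lra.
Qed.

Lemma sum_Yf (F : 'rV[R]_d -> R) : \sum_i F (Yf i) = F 0 + \sum_(v <- leaves) (mult v)%:R * F (2^-1 *: ctr v).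
Proof.
rewrite /Yf -(big_mkord xpredT (fun i => F (nth 0 synth_pts i))) -(big_nth 0 xpredT F) /synth_pts big_cons; congr (_ + _).
elim: leaves => [|v vs IH]; first by rewrite !big_nil.
rewrite /= big_cat IH big_cons; congr (_ + _).
by rewrite big_nseq iter_addr_0 mulr_natl.
Qed.

Lemma size_synth : (size (synth c0 G n d k eps m) <= 1 + n * (H * (2 * Gam)))%N.
Proof.
rewrite size_synthE /synth_pts /= add1n ltnS.
apply: (@leq_trans (n * size leaves)); last by rewrite leq_mul2l size_leaves orbT.
elim: leaves => //= v vs IH; rewrite size_cat size_nseq mulnS leq_add //.
rewrite /Submission.mult; case: ifP => // _; by have [] := count_threshold (est v 0) n.
Qed.

(* Since the synthetic data lies in the unit ball, some center of a good solution is not far from it. *)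
Lemma good_center (kappa : R) (C : {fset 'rV[R]_d}) : 1 <= kappa -> (0 < d)%N -> (0 < k)%N -> #|` C|%fset = k ->
  cost Yf C <= kappa * opt k Yf -> exists2 c, c \in C & enorm c <= 1 + kappa.
Proof.
move=> k1 d0 k0 hC h; pose N := size synth_pts.
have hopt : opt k Yf <= N%:R.
  apply: le_trans (opt_le_sum d0 Yf (fun=> 0) (fun=> Ordinal k0) k0) _.
  rewrite -[X in _ <= X%:R]card_ord -sumr_const; apply: ler_sum => i _.
  by rewrite subr0 expr_le1 ?enorm_ge0 //; exact: Yf_uball.
have C0 : C != fset0 by rewrite -cardfs_gt0 hC.
have [i hi] : exists i, mincost (Yf i) C <= kappa.
  apply: contrapT => hn; have : kappa * N%:R < cost Yf C.
    rewrite costE mulrC -[X in X%:R * _](card_ord N) mulr_natl -sumr_const.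
    apply: ltr_sum => [|i _]; first by apply/hasP; exists (Ordinal (isT : (0 < N)%N)); rewrite ?mem_index_enum.
    by rewrite ltNge; apply/negP => hi; apply: hn; exists i.
  have : kappa * opt k Yf <= kappa * N%:R by rewrite ler_wpM2l // (le_trans ler01).
  lra.
have [c hc e] := nearest (Yf i) C0; exists c => //.
rewrite e in hi; have hk : enorm (Yf i - c) <= kappa.
  rewrite -(@ler_pXn2r _ 2) ?nnegrE ?enorm_ge0 ?(le_trans ler01) //; apply: le_trans hi _.
  by rewrite expr2 ler_peMr // (le_trans ler01).
have -> : c = Yf i - (Yf i - c) by rewrite opprB addrC subrK.
apply: le_trans (ler_enormD _ _) _; rewrite enormN lerD //; exact: Yf_uball.
Qed.
End SynthPoints.

(** * From the cost of the synthetic data to the cost of the users *)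

Section Quality.
Local Open Scope fset_scope.
Local Open Scope ring_scope.
Context {R : realType}.
Variables (c0 G n d k : nat) (eps : R) (m : seq R) (pub : seq bool) (X : 'I_n -> 'rV[R]_d).
Local Notation q := (pq c0 k).
Local Notation H := (pH c0 n k).
Local Notation est := (est c0 n d k eps m).
Local Notation mult v := (mult c0 n d k eps m v).
Local Notation leaves := (leaves c0 G n d k eps m H).
Local Notation up := (upath c0 k pub X).
Local Notation leaf i := (leaf c0 G n d k eps m (up i)).
Local Notation cnt := (cnt c0 k pub X).
Local Notation shat := (shat c0 n d k eps m).
Local Notation ctr := (ctr c0 n d k eps m).
Local Notation Yf := (@Yf R c0 G n d k eps m).
Local Notation mass := (mass c0 k (fun i => coords (X i)) pub).
Hypothesis n0 : (0 < n)%N.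
Hypothesis hX : forall i, enorm (X i) <= 1.
Variable et : R.
Hypothesis et0 : 0 <= et.
Hypothesis hest : forall v j, (0 < size v <= H)%N -> (j < d + 1)%N -> `|est v j - mass v j| <= et.

Definition vsum v : 'rV[R]_d := \sum_i (nat_of_bool (innode (up i) v))%:R *: X i.
Definition theta : R := Num.sqrt d%:R * et + 4 * et + 2.

Lemma mass0 v : mass v 0 = cnt v.
Proof. by apply: eq_bigr => i _; rewrite /= mulr1. Qed.

Lemma massS v (j : 'I_d) : mass v j.+1 = vsum v 0 j.
Proof. by rewrite /vsum summxE; apply: eq_bigr => i _; rewrite /= nth_coords mxE. Qed.

Lemma vsum_err v : (0 < size v <= H)%N -> enorm (vsum v - shat v) <= Num.sqrt d%:R * et.
Proof.
move=> hv; have sd := sqrtr_ge0 (d%:R : R).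
rewrite -(@ler_pXn2r _ 2) ?nnegrE ?enorm_ge0 ?mulr_ge0 //.
rewrite enorm2 exprMn sqr_sqrtr // -[X in X%:R * _](card_ord d) mulr_natl -sumr_const.
apply: ler_sum => j _; rewrite !mxE -massS -expr2 -real_normK ?num_real // distrC.
by rewrite ler_pXn2r ?nnegrE //; apply: hest => //; rewrite addn1 ltnS.
Qed.

Lemma enorm_sum (I : Type) (r : seq I) (F : I -> 'rV[R]_d) : enorm (\sum_(i <- r) F i) <= \sum_(i <- r) enorm (F i).
Proof.
elim: r => [|i r IH]; first by rewrite !big_nil enorm0.
by rewrite !big_cons; apply: le_trans (ler_enormD _ _) _; rewrite lerD2l.
Qed.

Lemma vsum_le v : enorm (vsum v) <= cnt v.
Proof.
apply: le_trans (enorm_sum _ _) _; apply: ler_sum => i _.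
by rewrite enormZ ger0_norm // ler_piMr.
Qed.

Lemma cnt_le v : cnt v <= n%:R.
Proof. by rewrite -[X in _ <= X%:R]card_ord -sumr_const; apply: ler_sum => i _; rewrite lern1 leq_b1. Qed.

(** For a leaf that is kept, the weight is off by the noise and the rounding. A leaf that is dropped
    contains few users: either its estimate is below 1, or the estimated sum is longer than twice
    the estimated weight while the true sum is no longer than the true weight, so noise is
    comparable to the weight. *)
Lemma leaf_weight v : (0 < size v <= H)%N ->
  `|cnt v - (mult v)%:R| <= theta /\ enorm (vsum v - (mult v)%:R *: ctr v) <= theta.
Proof.
move=> hv; have E := vsum_err hv; set e := Num.sqrt d%:R * et in E *.
have e0 : 0 <= e by apply: le_trans (enorm_ge0 _) E.
have := hest hv (_ : (0 < d + 1)%N); rewrite addn1 => /(_ isT); rewrite mass0 ler_norml => /andP[w1 w2].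
have v1 := vsum_le v; have v2 := cnt_le v; have v3 : 0 <= cnt v := le_trans (enorm_ge0 _) v1.
rewrite /theta -/e; case: (posnP (mult v)) => [h|h]; last first.
  have [h1 h2] := mult_test h.
  have [_ h3] : (mult v)%:R <= est v 0 /\ (mult v = n \/ est v 0 < (mult v)%:R + 1).
    by split=> //; move: h; rewrite /Submission.mult; case: ifP => // _ _; case: (count_threshold (est v 0) n).
  (* If the count was capped at [n], the estimate exceeds it by noise only, as the true weight is at
     most [n]. *)
  have h4 : est v 0 - (mult v)%:R <= et + 1 by case: h3 => [->|]; lra.
  have m1 : 1 <= (mult v)%:R :> R by rewrite ler1n.
  split; first by rewrite ler_norml; apply/andP; split; case: h3 => [e3|]; rewrite ?e3 in h2 *; lra.
  have ec : shat v = est v 0 *: ctr v.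
    by rewrite /ctr gtn_eqF // scalerA divff ?scale1r // gt_eqF //; lra.
  have -> : vsum v - (mult v)%:R *: ctr v = (vsum v - shat v) + (est v 0 - (mult v)%:R) *: ctr v.
    by rewrite scalerBl -ec addrA subrK.
  apply: le_trans (ler_enormD _ _) _; rewrite enormZ ger0_norm; last by lra.
  have c2 : enorm (ctr v) <= 2 by exact: ctr_le2.
  have c3 := enorm_ge0 (ctr v).
  have : (est v 0 - (mult v)%:R) * enorm (ctr v) <= (et + 1) * 2 by apply: ler_pM => //; lra.
  lra.
rewrite h scale0r !subr0 (ger0_norm v3).
suff : cnt v <= e + 4 * et + 2 by move=> h'; split=> //; apply: le_trans v1 h'.
move: h; rewrite /Submission.mult; case: ifP => [_ h|h _].
  have [_ [h2|h2] _] := count_threshold (est v 0) n; last by rewrite h in h2; lra.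
  have n00 : n = 0%N by rewrite -h2 h.
  by have : (0 < 0)%N by rewrite -{2}n00.
have hs : enorm (shat v) <= cnt v + e.
  have -> : shat v = vsum v - (vsum v - shat v) by rewrite opprB addrC subrK.
  by apply: le_trans (ler_enormD _ _) _; rewrite enormN lerD.
have h1 : (2 * est v 0) ^+ 2 < enorm (shat v) ^+ 2.
  rewrite ltNge; apply/negP => h1; move/negP: h; apply.
  move: h1; rewrite enorm2 /dot (_ : (2 * est v 0) ^+ 2 = 4 * est v 0 * est v 0); last by ring.
  by congr (_ <= _); apply: eq_bigr => j _; rewrite !mxE expr2.
have : 2 * est v 0 <= enorm (shat v).
  rewrite leNgt; apply/negP => h2; have s0 := enorm_ge0 (shat v).
  move: h1; rewrite ltNge; move/negP; apply.
  have h3 : 0 <= 2 * est v 0 by apply: ltW; exact: le_lt_trans s0 h2.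
  by rewrite ler_pXn2r ?nnegrE // ltW.
lra.
Qed.

Definition leaf_cost v z : R := \sum_i (nat_of_bool (innode (up i) v))%:R * enorm (X i - z) ^+ 2.
(** The value at [z = 0] of the difference between the true cost of the leaf and that of its copies,
    in the original scale. It is roughly the spread of the leaf around its mean. *)
Definition offset v : R := leaf_cost v 0 - (mult v)%:R * enorm (ctr v) ^+ 2.

Lemma leaf_costE v z : leaf_cost v z = leaf_cost v 0 - 2 * dot (vsum v) z + cnt v * enorm z ^+ 2.
Proof.
have -> : dot (vsum v) z = \sum_i (nat_of_bool (innode (up i) v))%:R * dot (X i) z.
  rewrite /vsum; elim: (index_enum _) => [|i r IH].
    by rewrite !big_nil /dot big1 // => j _; rewrite mxE mul0r.
  by rewrite !big_cons dotDl dotZl IH.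
rewrite /leaf_cost mulr_sumr /cnt mulr_suml -sumrB -big_split /=; apply: eq_bigr => i _.
by rewrite enormB2 subr0; ring.
Qed.

(** Both costs are quadratic in [z], with leading coefficients [cnt v] and [mult v] and linear ones
    given by the two vector sums. [leaf_weight] bounds both discrepancies, so the difference is
    constant up to noise on bounded sets. *)
Lemma leaf_near v z (rho : R) : (0 < size v <= H)%N -> enorm z <= rho ->
  `|leaf_cost v z - (mult v)%:R * enorm (ctr v - z) ^+ 2 - offset v| <= theta * (rho * (2 + rho)).
Proof.
move=> hv hz; have [h1 h2] := leaf_weight hv; have z0 := enorm_ge0 z.
have -> : leaf_cost v z - (mult v)%:R * enorm (ctr v - z) ^+ 2 - offset v =
    (cnt v - (mult v)%:R) * enorm z ^+ 2 - 2 * dot (vsum v - (mult v)%:R *: ctr v) z.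
  by rewrite leaf_costE /offset enormB2 dotDl dotNl dotZl; ring.
have t0 : 0 <= theta := le_trans (normr_ge0 _) h1.
have h3 u : `|dot u z| <= enorm u * enorm z.
  by rewrite ler_norml; apply/andP; split; [rewrite lerNl -dotNl -(enormN u)|]; exact: dot_le.
have h4 : enorm z ^+ 2 <= rho ^+ 2 by rewrite ler_pXn2r ?nnegrE // (le_trans z0).
have h5 : `|cnt v - (mult v)%:R| * enorm z ^+ 2 <= theta * rho ^+ 2 by apply: ler_pM => //; exact: sqr_ge0.
have h6 : `|dot (vsum v - (mult v)%:R *: ctr v) z| <= theta * rho.
  by apply: le_trans (h3 _) _; apply: ler_pM => //; exact: enorm_ge0.
apply: le_trans (ler_normB _ _) _; set P := dot _ _ in h6 *.
have -> : `|2 * P| = 2 * `|P| by rewrite normrM ger0_norm.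
have -> : `|(cnt v - (mult v)%:R) * enorm z ^+ 2| = `|cnt v - (mult v)%:R| * enorm z ^+ 2.
  by rewrite normrM (ger0_norm (sqr_ge0 _)).
have -> : theta * (rho * (2 + rho)) = theta * rho ^+ 2 + 2 * (theta * rho) by ring.
by rewrite lerD // ler_pM2l.
Qed.

(** At [z = ctr v] the copies cost nothing while the true cost is nonnegative. The factor 8 is
    [rho * (2 + rho)] for [rho = 2]. *)
Lemma offset_ge v : (0 < size v <= H)%N -> - (8 * theta) <= offset v.
Proof.
move=> hv; have c2 : enorm (ctr v) <= 2 by exact: ctr_le2.
have := leaf_near hv c2.
rewrite subrr enorm0 expr0n /= mulr0 subr0 ler_norml => /andP[_ h].
have : 0 <= leaf_cost v (ctr v) by apply: sumr_ge0 => i _; rewrite mulr_ge0 ?sqr_ge0.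
lra.
Qed.

Lemma sum_leaf_cost (z : seq bool -> 'rV[R]_d) :
  \sum_(v <- leaves) leaf_cost v (z v) = \sum_i enorm (X i - z (leaf i)) ^+ 2.
Proof.
rewrite /leaf_cost exchange_big; apply: eq_bigr => i _ /=.
exact: (sum_leaves c0 G n d k eps m (up i) (fun v => enorm (X i - z v) ^+ 2)).
Qed.

Lemma opt_synth (c : 'I_k -> 'rV[R]_d) (asg : seq bool -> 'I_k) j0 : (0 < d)%N -> (0 < k)%N ->
  opt k Yf <= enorm (0 - 2^-1 *: c j0) ^+ 2 +
    \sum_(v <- leaves) (mult v)%:R * enorm (2^-1 *: ctr v - 2^-1 *: c (asg v)) ^+ 2.
Proof.
move=> d0 k0; pose f (y : 'rV[R]_d) j := enorm (y - 2^-1 *: c j) ^+ 2.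
pose h y : 'I_k := [arg min_(j < j0) f y j]%O.
have hP y j : f y (h y) <= f y j by rewrite /h; case: arg_minP => // i _; apply.
apply: le_trans (opt_le_sum d0 Yf (fun j => 2^-1 *: c j) (fun i => h (Yf i)) k0) _.
rewrite (@sum_Yf R c0 G n d k eps m (fun y => f y (h y))); apply: lerD; first exact: hP.
by apply: ler_sum => v _; rewrite ler_wpM2l //; exact: hP.
Qed.

(** With [Q] the sum of the offsets, the true cost is about [Q] plus the synthetic cost, and the
    synthetic cost is at most [kappa] times about [D - Q], where [D] is the cost of the comparison
    centers. Hence [Q] remains with factor [1 - kappa], and a lower bound on [Q] suffices. *)
Lemma decoded_cost (kappa : R) (c : 'I_k -> 'rV[R]_d) (asg : seq bool -> 'I_k) (C C2 : {fset 'rV[R]_d}) :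
  1 <= kappa -> (0 < d)%N -> (0 < k)%N -> (forall j, enorm (c j) <= 1) ->
  #|` C|%fset = k -> cost Yf C <= kappa * opt k Yf ->
  (forall x, x \in C -> 2 *: x \in C2) ->
  cost X C2 <= kappa * (\sum_i enorm (X i - c (asg (leaf i))) ^+ 2) +
    (size leaves)%:R * (theta * (11 * kappa + (6 + 2 * kappa) * (8 + 2 * kappa))) + kappa.
Proof.
move=> k1 d0 k0 hc hC hcost hC2.
have [x0 hx0 hx0n] := good_center k1 d0 k0 hC hcost.
have C0 : C != fset0 by rewrite -cardfs_gt0 hC.
have hz0 (y : 'rV[R]_d) : exists x : 'rV[R]_d, x \in C /\ mincost y C = enorm (y - x) ^+ 2.
  by have [x h1 h2] := nearest y C0; exists x.
have [z hz] := choice hz0.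
have hzC y : z y \in C by case: (hz y).
have hzE y : mincost y C = enorm (y - z y) ^+ 2 by case: (hz y).
pose y v := 2^-1 *: ctr v.
have hy v : enorm (y v) <= 1.
  by rewrite enormZ gtr0_norm ?invr_gt0 //; rewrite -[X in _ <= X](mulVf (_ : 2 != 0)) // ler_pM2l ?invr_gt0 //; exact: ctr_le2.
(* The algorithm may return centers that are far away, but then they are not nearest to any [y v]:
   [x0] has norm at most [1 + kappa], so a nearest center has norm at most [3 + kappa]. [leaf_near]
   needs such a bound. *)
have hzn v : enorm (2 *: z (y v)) <= 6 + 2 * kappa.
  have h1 : enorm (y v - z (y v)) <= enorm (y v - x0).
    by rewrite -(@ler_pXn2r _ 2) ?nnegrE ?enorm_ge0 // -hzE; exact: mincost_le.
  have h2 : enorm (y v - x0) <= enorm (y v) + enorm x0 by apply: le_trans (ler_enormD _ _) _; rewrite enormN.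
  have h3 : enorm (z (y v)) <= enorm (y v) + enorm (y v - z (y v)).
    have {1}-> : z (y v) = y v - (y v - z (y v)) by rewrite opprB addrC subrK.
    by apply: le_trans (ler_enormD _ _) _; rewrite enormN.
  by rewrite enormZ gtr0_norm //; have := hy v; lra.
have hl v : v \in leaves -> (0 < size v <= H)%N by exact: leaves_size.
set rho := 6 + 2 * kappa in hzn *.
have s1 : cost X C2 <= \sum_(v <- leaves) leaf_cost v (2 *: z (y v)).
  rewrite (sum_leaf_cost (fun v => 2 *: z (y v))); apply: cost_le => i; exact/hC2/hzC.
pose L : R := (size leaves)%:R.
have cst (a : R) : \sum_(v <- leaves) a = L * a.
  by rewrite big_const_seq count_predT iter_addr_0 mulr_natl.
pose Q := \sum_(v <- leaves) offset v.
have s2 : \sum_(v <- leaves) leaf_cost v (2 *: z (y v)) <=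
   Q + 4 * cost Yf C + L * (theta * (rho * (2 + rho))).
  apply: (@le_trans _ _ (Q + \sum_(v <- leaves) (mult v)%:R * enorm (ctr v - 2 *: z (y v)) ^+ 2 + \sum_(v <- leaves) theta * (rho * (2 + rho)))).
    rewrite -!big_split /= big_seq [X in _ <= X]big_seq; apply: ler_sum => v /hl hv.
    have := leaf_near hv (hzn v); rewrite ler_norml => /andP[_ h]; lra.
  rewrite cst lerD2r lerD2l costE (@sum_Yf R c0 G n d k eps m (fun y => mincost y C)) mulrDr.
  apply: (@le_trans _ _ (4 * \sum_(v <- leaves) (mult v)%:R * mincost (2^-1 *: ctr v) C)); last first.
    by rewrite lerDr mulr_ge0 // mincost_ge0.
  rewrite mulr_sumr; apply: ler_sum => v _; rewrite -/(y v) hzE.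
  have -> : ctr v - 2 *: z (y v) = 2 *: (y v - z (y v)) by rewrite scalerBr scalerA divff ?scale1r.
  by rewrite enormZ exprMn gtr0_norm // le_eqVlt; apply/orP; left; apply/eqP; ring.
(* The factor 4 returns to the original scale, and the 1 pays for the additional origin. *)
have s3 : 4 * opt k Yf <= 1 + \sum_(v <- leaves) (mult v)%:R * enorm (ctr v - c (asg v)) ^+ 2.
  pose j0 := asg [::].
  apply: (@le_trans _ _ (4 * (enorm (0 - 2^-1 *: c j0) ^+ 2 + \sum_(v <- leaves) (mult v)%:R * enorm (y v - 2^-1 *: c (asg v)) ^+ 2))).
    by rewrite ler_pM2l //; exact: opt_synth.
  rewrite mulrDr mulr_sumr; apply: lerD.
    rewrite sub0r enormN enormZ gtr0_norm ?invr_gt0 //.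
    have : enorm (c j0) ^+ 2 <= 1 by rewrite expr_le1 ?enorm_ge0.
    by rewrite exprMn; lra.
  apply: ler_sum => v _.
  have -> : y v - 2^-1 *: c (asg v) = 2^-1 *: (ctr v - c (asg v)) by rewrite scalerBr.
  by rewrite enormZ exprMn gtr0_norm ?invr_gt0 // le_eqVlt; apply/orP; left; apply/eqP; field.
have s4 : \sum_(v <- leaves) (mult v)%:R * enorm (ctr v - c (asg v)) ^+ 2 <=
    \sum_i enorm (X i - c (asg (leaf i))) ^+ 2 - Q + L * (theta * 3).
  rewrite -(sum_leaf_cost (fun v => c (asg v))) -cst /Q -sumrB -big_split /=.
  rewrite big_seq [X in _ <= X]big_seq; apply: ler_sum => v /hl hv.
  have := leaf_near hv (hc (asg v)); rewrite ler_norml => /andP[h _]; lra.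
have s5 : - (L * (8 * theta)) <= Q.
  rewrite -mulrN -cst /Q big_seq [X in _ <= X]big_seq; apply: ler_sum => v /hl; exact: offset_ge.
have s6 : 4 * cost Yf C <= kappa * (1 + (\sum_i enorm (X i - c (asg (leaf i))) ^+ 2 - Q + L * (theta * 3))).
  apply: (@le_trans _ _ (kappa * (4 * opt k Yf))); first by rewrite mulrCA ler_pM2l.
  by rewrite ler_wpM2l ?(le_trans ler01) //; apply: le_trans s3 _; rewrite lerD2l.
apply: le_trans s1 _; apply: le_trans s2 _.
set D := \sum_i _ in s4 s6 *.
(* This is where [1 <= kappa] decides the direction in which the offsets count. *)
have s7 : (kappa - 1) * - (L * (8 * theta)) <= (kappa - 1) * Q by rewrite ler_wpM2l // subr_ge0.
have t0 : 0 <= L * theta.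
  by rewrite mulr_ge0 // /theta !addr_ge0 // ?mulr_ge0 // sqrtr_ge0.
have -> : L * (theta * (11 * kappa + rho * (8 + 2 * kappa))) = 11 * kappa * (L * theta) + L * (theta * (rho * (2 + rho))).
  by rewrite /rho; ring.
set Z := L * (theta * (rho * (2 + rho))).
move: s6 s7 t0; rewrite (_ : L * (theta * 3) = 3 * (L * theta)); last by ring.
rewrite (_ : L * (8 * theta) = 8 * (L * theta)); last by ring.
set T := L * theta; nra.
Qed.
End Quality.

(** * Correctness of the comparison of the two answers *)

Section Choice.
Context {R : realType}.
Variables (d k N : nat) (Yf : 'I_N -> 'rV[R]_d).
Local Open Scope fset_scope.
Local Open Scope ring_scope.
Hypothesis k0 : (0 < k)%N.

Definition cen (o : nat -> R) i : 'rV[R]_d := \row_(j < d) o (i * d + j)%N.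
Definition cens (o : nat -> R) := [seq cen o i | i <- iota 0 k].
Definition cset (o : nat -> R) : {fset 'rV[R]_d} := [fset y in cens o].

Lemma sqdistE (f g : nat -> R) i j : sqdist d f g (i * d) (j * d) = enorm (cen f i - cen g j) ^+ 2.
Proof. by rewrite enorm2 /dot /sqdist; apply: eq_bigr => a _; rewrite !mxE expr2. Qed.

Lemma enorm_eq0 (x : 'rV[R]_d) : enorm x ^+ 2 <= 0 -> x = 0.
Proof.
rewrite enorm2 => h; apply/rowP => j; rewrite mxE; apply/eqP; rewrite -sqrf_eq0 eq_le sqr_ge0 andbT.
apply: le_trans h; rewrite /dot (bigD1 j) //= -expr2 lerDl.
by apply: sumr_ge0 => i _; rewrite -expr2 sqr_ge0.
Qed.

Lemma repeatsE o : repeats d k o = ~~ uniq (cens o).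
Proof.
have szc : size (cens o) = k by rewrite size_map size_iota.
have nthc i : (i < k)%N -> nth 0 (cens o) i = cen o i.
  by move=> hi; rewrite (nth_map 0%N) ?size_iota // nth_iota.
apply/idP/idP => [/hasP[i hi /hasP[j hj /andP[lij]]]|].
  rewrite sqdistE => /enorm_eq0 /eqP; rewrite subr_eq0 => /eqP e; rewrite !mem_iota !add0n /= in hi hj.
  apply/negP => u; have := @nth_uniq _ 0 (cens o) i j.
  by rewrite szc hi hj !nthc // e eqxx => /(_ isT isT u) => h; move: lij; rewrite -(eqP (esym h)) ltnn.
apply: contraR => /hasPn h; apply/(uniqP 0) => i j; rewrite !inE szc => hi hj; rewrite !nthc // => e.
wlog lij : i j hi hj e / (i < j)%N.
  move=> hw; case: (ltngtP i j) => // lij; [exact: hw|exact/esym/hw].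
have /h /hasPn h2 : i \in iota 0 k by rewrite mem_iota.
have /h2 : j \in iota 0 k by rewrite mem_iota.
by rewrite lij sqdistE e subrr enorm0 expr0n lexx.
Qed.

Lemma card_cset o : (#|` cset o| = k) <-> ~~ repeats d k o.
Proof.
have szc : size (cens o) = k by rewrite size_map size_iota.
rewrite repeatsE negbK card_fseq; split=> [e|u]; last by rewrite undup_id.
by apply: contraT => h; rewrite -ltn_size_undup szc e ltnn in h.
Qed.

Lemma minval_le (f : nat -> R) l c : (c < l)%N -> minval f l <= f c.
Proof.
elim: l => //= l IH; rewrite ltnS; case: eqP => [->|/eqP l0]; first by rewrite leqn0 => /eqP ->.
rewrite leq_eqVlt ge_min => /orP[/eqP ->|/IH ->] //; by rewrite lexx orbT.
Qed.

Lemma minval_in (f : nat -> R) l : (0 < l)%N -> exists2 c, (c < l)%N & minval f l = f c.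
Proof.
elim: l => // l IH _ /=; case: eqP => [->|/eqP l0]; first by exists 0%N.
have [c hc e] := IH (ltac:(by rewrite lt0n)); rewrite minEle e.
by case: ifP => _; [exists c; rewrite // ltnW|exists l].
Qed.

Lemma mincostE (y : 'rV[R]_d) o : minval (fun c => enorm (y - cen o c) ^+ 2) k = mincost y (cset o).
Proof.
have memc c : (c < k)%N -> cen o c \in cset o.
  by move=> hc; rewrite in_fset /=; apply: map_f; rewrite mem_iota.
have C0 : cset o != fset0 by apply/fset0Pn; exists (cen o 0%N); exact: memc.
apply/eqP; rewrite eq_le; apply/andP; split.
  have [c hc ->] := nearest y C0; move: hc; rewrite in_fset /= => /mapP[i]; rewrite mem_iota add0n => /= hi ->.
  exact: (minval_le (fun c => enorm (y - cen o c) ^+ 2)).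
have [c hc ->] := minval_in (fun c => enorm (y - cen o c) ^+ 2) k0.
exact/mincost_le/memc.
Qed.

Let f := nth 0 (flatten [seq coords (Yf i) | i <- enum 'I_N]).

Lemma cen_f i : cen f (i : 'I_N) = Yf i.
Proof.
apply/rowP => j; rewrite mxE /f nth_flatten_uniform //; last first.
  by apply/allP => y /mapP[i' _ ->]; rewrite size_coords.
by rewrite (nth_map i) ?size_enum_ord // nth_ord_enum nth_coords.
Qed.

Lemma cost_valE o : cost_val d k f o N = cost Yf (cset o).
Proof.
rewrite costE; apply: eq_bigr => i _; rewrite -mincostE.
have : (fun c => sqdist d f o (i * d) (c * d)) = (fun c => enorm (Yf i - cen o c) ^+ 2).
  by apply: funext => c; rewrite sqdistE cen_f.
by move=> ->.
Qed.

Lemma centersE s : centers d k s = cset (nth 0 s). Proof. by []. Qed.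

(** If one answer is a solution, the other is preferred only when it also has [k] distinct centers
    and costs no more. Doubling is injective, so the number of centers survives it. *)
Lemma choose_good (kappa : R) (o1 o2 : seq R) :
  let out := mkseq (fun x => 2 * better d k f (nth 0 o1) (nth 0 o2) N x) (k * d) in
  approx_solution k Yf kappa 0 (centers d k o1) \/ approx_solution k Yf kappa 0 (centers d k o2) ->
  exists C : {fset 'rV[R]_d}, [/\ #|` C| = k, cost Yf C <= kappa * opt k Yf,
    (forall x, x \in C -> 2 *: x \in centers d k out) & #|` centers d k out| = k].
Proof.
move=> out hgood; set b := better d k f (nth 0 o1) (nth 0 o2) N.
have hb : #|` cset b| = k /\ cost Yf (cset b) <= kappa * opt k Yf.
  rewrite /b /better; case: hgood => -[]; rewrite centersE addr0 => /card_cset /negbTE h hc.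
    rewrite h; have [h2|h2] := boolP (repeats d k (nth 0 o2)); first by split=> //; apply/card_cset/negbT.
    case: ifP => hle; first by split=> //; apply/card_cset/negbT.
    split; first exact/card_cset.
    move/negbT: hle; rewrite -ltNge !cost_valE => /ltW hle; exact: le_trans hle hc.
  rewrite h; have [h2|h2] := boolP (repeats d k (nth 0 o1)); first by split=> //; apply/card_cset/negbT.
  case: ifP => hle; last by split=> //; apply/card_cset/negbT.
  split; first exact/card_cset.
  by move: hle; rewrite !cost_valE => hle; exact: le_trans hle hc.
have e i : (i < k)%N -> cen (nth 0 out) i = 2 *: cen b i.
  move=> hi; apply/rowP => j; rewrite !mxE /out nth_mkseq //.
  apply: (@leq_trans (i.+1 * d)); last by rewrite leq_mul2r hi orbT.
  by rewrite mulSn addnC ltn_add2r.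
have ec : cens (nth 0 out) = [seq 2 *: x | x <- cens b].
  rewrite /cens -map_comp; apply/eq_in_map => i; rewrite mem_iota add0n => /= hi; exact: e.
case: hb => hb1 hb2; exists (cset b); split=> //.
  by move=> x; rewrite centersE !in_fset /= => hx; rewrite ec; apply: map_f.
rewrite centersE; apply/card_cset; rewrite repeatsE negbK ec map_inj_uniq.
  by move/card_cset: hb1; rewrite repeatsE negbK.
by apply: scalerI; rewrite pnatr_eq0.
Qed.
End Choice.

(** * The protocol *)

Section PolyBounds.
Implicit Types f g : nat -> nat -> nat -> nat.
Local Open Scope nat_scope.

Definition polyb f := exists A, forall n d k, 0 < n -> 0 < d -> 0 < k -> f n d k <= poly_bound A n d k.

Lemma poly_bound_mono A A' n d k : 0 < n -> A <= A' -> poly_bound A n d k <= poly_bound A' n d k.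
Proof.
move=> n0 h; rewrite /poly_bound leq_mul // leq_pexp2l //; lia.
Qed.

Lemma polyb_le f g : (forall n d k, 0 < n -> 0 < d -> 0 < k -> f n d k <= g n d k) -> polyb g -> polyb f.
Proof. by move=> h [A hA]; exists A => n d k n0 d0 k0; apply: leq_trans (h _ _ _ n0 d0 k0) (hA _ _ _ n0 d0 k0). Qed.

Lemma polyb_cst c : polyb (fun _ _ _ => c).
Proof.
exists c => n d k n0 d0 k0; rewrite /poly_bound leq_pmulr // expn_gt0; apply/orP; left; lia.
Qed.

Lemma polyb_n : polyb (fun n _ _ => n).
Proof. by exists 1 => n d k *; rewrite /poly_bound expn1 mul1n; lia. Qed.
Lemma polyb_d : polyb (fun _ d _ => d).
Proof. by exists 1 => n d k *; rewrite /poly_bound expn1 mul1n; lia. Qed.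
Lemma polyb_k : polyb (fun _ _ k => k).
Proof. by exists 1 => n d k *; rewrite /poly_bound expn1 mul1n; lia. Qed.

Lemma polybD f g : polyb f -> polyb g -> polyb (fun n d k => f n d k + g n d k).
Proof.
move=> [A hA] [B hB]; exists (A + B) => n d k n0 d0 k0.
apply: leq_trans (leq_add (hA _ _ _ n0 d0 k0) (hB _ _ _ n0 d0 k0)) _; rewrite /poly_bound mulnDl.
by rewrite leq_add // leq_mul2l leq_pexp2l ?leq_addl ?leq_addr ?orbT //; lia.
Qed.

Lemma polybM f g : polyb f -> polyb g -> polyb (fun n d k => f n d k * g n d k).
Proof.
move=> [A hA] [B hB]; exists (A * B + (A + B)) => n d k n0 d0 k0.
apply: leq_trans (leq_mul (hA _ _ _ n0 d0 k0) (hB _ _ _ n0 d0 k0)) _; rewrite /poly_bound.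
rewrite mulnACA -expnD leq_mul ?leq_addr // leq_pexp2l ?leq_addl //; lia.
Qed.

Lemma polybX f c : polyb f -> polyb (fun n d k => f n d k ^ c).
Proof.
move=> h; elim: c => [|c IH]; first exact: polyb_cst.
by apply: polyb_le (polybM h IH) => n d k *; rewrite expnS.
Qed.

Lemma exp_up_log x : 0 < x -> 2 ^ up_log 2 x <= 2 * x.
Proof.
case: x => // -[|x] _; first by rewrite up_log1.
have /andP[h _] := @up_log_bounds 2 x.+2 isT isT.
have u0 : 0 < up_log 2 x.+2 by rewrite up_log_gt0.
by rewrite -(prednK u0) expnS leq_mul2l /= ltnW.
Qed.

Lemma up_log_le x : up_log 2 x <= x.
Proof. by apply: up_log_min => //; rewrite ltnW // ltn_expl. Qed.

Variables c0 G : nat.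
Hypothesis c00 : 0 < c0.

Lemma pq_le k : pq c0 k <= c0 * (k + 1).
Proof. by rewrite /pq leq_mul2l leq_add2r up_log_le orbT. Qed.

Lemma pen_le n : pen n <= n. Proof. exact: up_log_le. Qed.

Lemma pH_le n k : pH c0 n k <= 2 * pH0 c0 n k.
Proof. by apply: exp_up_log; rewrite /pH0 /pq !muln_gt0 c00 !addn1. Qed.

Lemma exp_Gq_le k : 0 < k -> 2 ^ (G * pq c0 k) <= (4 * k) ^ (G * c0).
Proof.
move=> k0; rewrite /pq mulnA mulnC expnM.
have h : 2 ^ (up_log 2 k + 1) <= 4 * k by rewrite addn1 expnS; have := exp_up_log k0; lia.
by case: (G * c0) => [|a]; [rewrite !expn0|rewrite leq_exp2r].
Qed.

Lemma polyb_q : polyb (fun _ _ k => pq c0 k).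
Proof.
by apply: polyb_le (polybM (polyb_cst c0) (polybD polyb_k (polyb_cst 1))) => n d k *; exact: pq_le.
Qed.

Lemma polyb_pen : polyb (fun n _ _ => pen n).
Proof. by apply: polyb_le polyb_n => n d k *; exact: pen_le. Qed.

Lemma polyb_H0 : polyb (fun n _ k => pH0 c0 n k).
Proof. exact: polybM polyb_q (polybD polyb_pen (polyb_cst 1)). Qed.

Lemma polyb_H : polyb (fun n _ k => pH c0 n k).
Proof. by apply: polyb_le (polybM (polyb_cst 2) polyb_H0) => n d k *; exact: pH_le. Qed.

Lemma polyb_pm : polyb (fun n _ k => pm c0 n k).
Proof. by apply: polyb_le polyb_H0 => n d k *; exact: up_log_le. Qed.

Lemma polyb_Gq : polyb (fun _ _ k => 2 ^ (G * pq c0 k)).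
Proof.
apply: polyb_le (polybX (G * c0) (polybM (polyb_cst 4) polyb_k)) => n d k *; exact: exp_Gq_le.
Qed.

Lemma polyb_Gam : polyb (fun n _ k => pGam c0 G n k).
Proof. exact: polybM polyb_Gq polyb_H. Qed.

Lemma polyb_pm2 : polyb (fun n _ _ => pm2 n).
Proof. exact: polybD (polybM (polyb_cst 2) polyb_pen) (polyb_cst 4). Qed.

Lemma polyb_V : polyb (fun n _ _ => pV n).
Proof.
apply: polyb_le (polybM (polybX 2 (polybM (polyb_cst 2) polyb_n)) (polyb_cst 16)) => n d k n0 *.
rewrite /pV /pm2 expnD leq_mul // mulnC expnM.
by rewrite leq_exp2r //; exact: exp_up_log.
Qed.

Lemma polyb_used : polyb (fun n d k => used c0 n d k).
Proof.
exact: polybD polyb_pm (polybD (polybD polyb_d (polyb_cst 1)) (polybD polyb_H polyb_pm2)).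
Qed.

Lemma polyb_pmax : polyb (fun n d k => pmax c0 G n d k).
Proof.
rewrite /pmax /plist [sumn]/=.
by repeat (apply: polybD); (exact: polyb_n || exact: polyb_d || exact: polyb_k || exact: polyb_q ||
  exact: polyb_pen || exact: polyb_H0 || exact: polyb_pm || exact: polyb_H || exact: polyb_pm2 ||
  exact: polyb_Gq || exact: polyb_Gam || exact: polyb_V || exact: polyb_cst ||
  exact: (polybM (polyb_cst G) polyb_q) || idtac).
Qed.

Definition maxY n k := 1 + n * (pH c0 n k * (2 * pGam c0 G n k)).

Lemma polyb_maxY : polyb (fun n _ k => maxY n k).
Proof.
exact: polybD (polyb_cst 1) (polybM polyb_n (polybM polyb_H (polybM (polyb_cst 2) polyb_Gam))).
Qed.

Lemma polyb_comp A f : polyb f -> polyb (fun n d k => poly_bound A (f n d k) d k).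
Proof.
move=> h; rewrite /poly_bound.
exact: polybM (polyb_cst A) (polybX A (polybD (polybD h polyb_d) polyb_k)).
Qed.

Lemma polyb_cost f cs : polyb f -> polyb (fun n d k => cost_all (f n d k) cs).
Proof.
move=> h; have [K hK] := cost_all_poly cs.
by apply: polyb_le (polybX K (polybD h (polyb_cst 2))) => n d k *; exact: hK.
Qed.

(** The number [l] of synthetic points is random, hence the quantification. The summand
    [pq c0 k * d] leaves enough public coins for the second run after those used by the
    projections. *)
Definition enough_time Ap n d k T := [/\ used c0 n d k <= T, cost_all (pmax c0 G n d k) (enc_cmds c0 G) <= T &
  forall l, l <= maxY n k -> poly_bound Ap l d k + pq c0 k * d <= T /\
   cost_all (pmax c0 G n d k + l) (pre_cmds c0 G) + cost_all (pmax c0 G n d k + l) [:: choose_cmd] +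
    6 * poly_bound Ap l d k + 3 <= T].

Lemma enough_time_poly Ap : exists A1, forall A n d k, A1 <= A -> 0 < n -> 0 < d -> 0 < k ->
  enough_time Ap n d k (poly_bound A n d k).
Proof.
pose M := fun n d k => pmax c0 G n d k + maxY n k.
pose P := fun n d k => poly_bound Ap (maxY n k) d k.
have [K1 h1] := cost_all_poly (pre_cmds c0 G); have [K2 h2] := cost_all_poly [:: choose_cmd].
have hM : polyb M by exact: polybD polyb_pmax polyb_maxY.
have hP : polyb P by exact: (polyb_comp Ap polyb_maxY).
pose F n d k := used c0 n d k + (cost_all (pmax c0 G n d k) (enc_cmds c0 G) + (P n d k + pq c0 k * d +
  ((M n d k + 2) ^ K1 + (M n d k + 2) ^ K2 + 6 * P n d k + 3))).
have [A1 hA] : polyb F.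
  apply: polybD polyb_used (polybD (polyb_cost _ polyb_pmax) (polybD (polybD hP (polybM polyb_q polyb_d)) _)).
  have hM2 := polybD hM (polyb_cst 2).
  exact: polybD (polybD (polybD (polybX K1 hM2) (polybX K2 hM2)) (polybM (polyb_cst 6) hP)) (polyb_cst 3).
exists A1 => A n d k hA1 n0 d0 k0.
have hF := leq_trans (hA n d k n0 d0 k0) (poly_bound_mono d k n0 hA1).
move: (poly_bound A n d k) hF => T hF; rewrite /F in hF.
split; [lia|lia|] => l hl.
have hPl : poly_bound Ap l d k <= P n d k.
  rewrite /P /poly_bound leq_mul2l; apply/orP; right; case: (Ap) => // a; rewrite leq_exp2r //; lia.
have e K : (pmax c0 G n d k + l + 2) ^ K <= (M n d k + 2) ^ K.
  by case: K => // K; rewrite leq_exp2r // /M; lia.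
have := h1 (pmax c0 G n d k + l); have := h2 (pmax c0 G n d k + l); have := e K1; have := e K2.
move: hF hPl; move: (poly_bound Ap l d k) (P n d k) => a b.
move: ((_ + l + 2) ^ K1) ((_ + l + 2) ^ K2) ((M n d k + 2) ^ K1) ((M n d k + 2) ^ K2) => *.
split; lia.
Qed.
End PolyBounds.

(** * Privacy, running time and independence of the two runs *)

Section Protocol.
Context {R : realType}.
Variables (c0 G : nat) (p : prog) (Ap : nat) (kappa beta : R).
Hypothesis c00 : (0 < c0)%N.
Hypothesis hp : forall (n d k : nat), (0 < n)%N -> (0 < d)%N -> (0 < k)%N ->
  forall X : 'I_n -> 'rV[R]_d, in_uball X ->
  let T := poly_bound Ap n d k in
  let start (w : T.-tuple bool) :=
    init [:: n; d; k] (flatten [seq coords (X i) | i <- enum 'I_n]) w [::] in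
  (forall w, halts T p (start w)) /\
  1 - beta <= Pr R [set w : T.-tuple bool |
    approx_solution k X kappa 0 (centers d k (output T p (start w)))]%classic.

Lemma indC (P : Prop) : ind (~ P) = 1 - ind P :> R.
Proof.
have [h|h] := pselect P; first by rewrite (indT h) indF ?subrr // => h'; exact: h'.
by rewrite (indT h) indF // subr0.
Qed.

Section Solver.
Variables (n d k : nat) (X : 'I_n -> 'rV[R]_d).
Hypotheses (n0 : (0 < n)%N) (d0 : (0 < d)%N) (k0 : (0 < k)%N) (hX : in_uball X).
Let T := poly_bound Ap n d k.
Let start (w : seq bool) := init [:: n; d; k] (flatten [seq coords (X i) | i <- enum 'I_n]) w [::].

Lemma start_take (w : seq bool) : (T <= size w)%N ->
  run T p (start w) = ((run T p (start (take T w))).1, add_tape (drop T w) (run T p (start (take T w))).2).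
Proof.
move=> hw; rewrite -run_add_tape; last by rewrite /= size_takel.
by rewrite /add_tape /= cat_take_drop.
Qed.

Lemma solver_halts w : (T <= size w)%N -> halts T p (start w).
Proof.
move=> hw; rewrite /halts start_take //=.
have sz : size (take T w) == T by rewrite size_takel.
by have [h _] := hp n0 d0 k0 hX; exact: (h (Tuple sz)).
Qed.

Lemma solver_fails L : (T <= L)%N ->
  pr L (fun w => ~ approx_solution k X kappa 0 (centers d k (output T p (start w)))) <= beta.
Proof.
move=> hL; pose bad w := ~ approx_solution k X kappa 0 (centers d k (output T p (start w))).
have -> : pr L bad = pr T bad :> R.
  rewrite -(subnKC hL) /pr ex_cat; apply: eq_ex => u hu; rewrite -[RHS](ex_cst (L - T)).
  apply: eq_ex => v _; congr ind; rewrite /bad /output start_take ?size_cat ?hu ?leq_addr //.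
  by rewrite -{1}hu take_size_cat.
have [_] := hp n0 d0 k0 hX; rewrite Pr_av.
rewrite (av_tuple T (fun w => ind (approx_solution k X kappa 0 (centers d k (output T p (start w)))))).
set g := fun w => ind _; move=> h.
have -> : pr T bad = ex T (fun w => 1 - g w) :> R by apply: eq_ex => w _; rewrite /bad indC.
rewrite exB ex_cst; lra.
Qed.
End Solver.

Variables (n d k T : nat) (eps : R).
Hypotheses (n0 : (0 < n)%N) (d0 : (0 < d)%N) (k0 : (0 < k)%N) (e0 : 0 < eps).
Hypothesis hT : enough_time c0 G Ap n d k T.
Local Notation q := (pq c0 k).
Local Notation enc := (enc_prog c0 G).
Local Notation dec := (dec_prog c0 G p).
Local Notation msgs X pub w := (msgs c0 d k eps (fun i => coords (X i)) pub w).

Lemma enc_run (x : 'rV[R]_d) pub w : halts T enc (enc_start n k eps x pub w) /\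
  output T enc (enc_start n k eps x pub w) = encout c0 n d k eps (coords x) pub w.
Proof.
have [_ h _] := hT; have [s [t [h1 h2 h3]]] := @enc_correct c0 G R n d k c00 eps x pub w.
have e := exec_run h1 (leq_trans h3 h); by rewrite /halts /output e.
Qed.

Lemma messagesE (pub : T.-tuple bool) (X : 'I_n -> 'rV[R]_d) (w : {ffun 'I_n -> T.-tuple bool}) : messages enc k eps pub X w = msgs X pub w.
Proof. by apply: eq_map => i; case: (enc_run (X i) pub (w i)). Qed.

(** Redrawing the coins of user [i0] turns each probability into an average, over the coins of the
    others, of an expectation over one message; [F] contains the messages of the other users, and
    [dp_local] compares the two expectations. *)
Lemma local_dp_holds : local_dp enc T n d k eps 0.
Proof.
move=> pub X X' _ _ [i0 hi0] S; rewrite addr0 !Pr_av.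
have W0 : (0 < #|{: T.-tuple bool}|)%N by rewrite card_tuple expn_gt0 card_bool.
rewrite (av_resample i0 _ W0) [X in _ <= _ * X](av_resample i0 _ W0) -avZ; apply: av_le => w.
pose F o : R := ind (S [seq (if i == i0 then o else encout c0 n d k eps (coords (X' i)) pub (w i)) | i <- enum 'I_n]).
have E (Z : 'I_n -> 'rV[R]_d) : (forall j, j != i0 -> Z j = X' j) ->
  av (fun a : T.-tuple bool => @ind R (S (messages enc k eps pub Z [ffun i => if i == i0 then a else w i]))) =
  ex T (fun a => F (encout c0 n d k eps (coords (Z i0)) pub a)).
  move=> hZ; rewrite -(av_tuple T (fun a => F (encout c0 n d k eps (coords (Z i0)) pub a))); apply: eq_av => a.
  rewrite messagesE /F /Submission.msgs; congr (ind (S _)); apply: eq_map => i; rewrite ffunE.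
  by case: eqP => [->//|/eqP h]; rewrite hZ.
rewrite (E X hi0) (E X') //; have [hu _ _] := hT.
have q0 : (0 < q)%N by exact: q_gt0.
by apply: dp_local => // o; exact: ind_ge0.
Qed.

Lemma size_msgs (X : 'I_n -> 'rV[R]_d) (pub : seq bool) (w : {ffun 'I_n -> T.-tuple bool}) : size (flatten (msgs X pub w)) = (n * stride c0 n d k)%N.
Proof.
rewrite size_flatten /shape -map_comp (eq_map (g := fun=> stride c0 n d k)); last first.
  by move=> i; apply: size_encout => //; exact: q_gt0.
by rewrite sumnE big_map big_const_seq count_predT iter_addn_0 size_enum_ord mulnC.
Qed.

Section DecoderRun.
Variables (m : seq R) (pub v : seq bool).
Hypotheses (sm : size m = (n * stride c0 n d k)%N) (spub : size pub = T) (sv : size v = T).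
Local Notation N := (size (synth_pts c0 G n d k eps m)).
Local Notation Yf := (@Yf R c0 G n d k eps m).
Definition solver_out (w : seq bool) :=
  output (poly_bound Ap N d k) p (init [:: N; d; k] (flatten [seq coords (Yf i) | i <- enum 'I_N]) w [::]).

Lemma dec_run : halts T dec (dec_start n d k eps m pub v) /\
  output T dec (dec_start n d k eps m pub v) =
   mkseq (fun x => 2 * better d k (nth 0 (flatten [seq coords (Yf i) | i <- enum 'I_N]))
     (nth 0 (solver_out v)) (nth 0 (solver_out (drop (q * d) pub))) N x) (k * d).
Proof.
have sY : (N <= maxY c0 G n k)%N by rewrite -size_synthE; exact: size_synth.
have [_ _ /(_ _ sY) [t1 t2]] := hT.
have hY : in_uball Yf by exact: Yf_uball.
have tv : (poly_bound Ap N d k <= size v)%N by rewrite sv; lia.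
have tp : (poly_bound Ap N d k <= size (drop (q * d) pub))%N by rewrite size_drop spub; lia.
have hh1 := solver_halts (isT : (0 < N)%N) d0 k0 hY tv.
have hh2 := solver_halts (isT : (0 < N)%N) d0 k0 hY tp.
have e1 : run1 c0 G n d k eps m v = init [:: N; d; k] (flatten [seq coords (Yf i) | i <- enum 'I_N]) v [::].
  by rewrite /run1 size_synthE flatten_Yf.
have e2 : run2 c0 G n d k eps m pub = init [:: N; d; k] (flatten [seq coords (Yf i) | i <- enum 'I_N]) (drop (q * d) pub) [::].
  by rewrite /run2 size_synthE flatten_Yf.
have := @dec_correct c0 G R n d k c00 k0 eps m pub v p (poly_bound Ap N d k) sm.
rewrite e1 e2 => /(_ hh1 hh2) [s [t [h1 h2 h3]]].
rewrite size_synthE in h3; have e := exec_run h1 (leq_trans h3 t2).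
by rewrite /halts /output e; split=> //; rewrite [out _]h2 flatten_Yf size_synthE.
Qed.
End DecoderRun.

Lemma runs_in_time_holds : runs_in_time enc dec T n d k eps.
Proof.
move=> X pub w v hX; split=> [i|]; first by case: (enc_run (X i) pub (w i)).
rewrite messagesE; apply: (dec_run _ _ _).1; rewrite ?size_tuple //; exact: size_msgs.
Qed.

Definition one_good (m : seq R) (pub v : seq bool) : Prop :=
  let N := size (synth_pts c0 G n d k eps m) in let Y := @Yf R c0 G n d k eps m in
  approx_solution k Y kappa 0 (centers d k (solver_out m v)) \/
  approx_solution k Y kappa 0 (centers d k (solver_out m (drop (q * d) pub))).

(* The messages depend on the public tape through its first [q * d] bits only. *)
Lemma rad_take xs (pub : seq bool) a : (a < q)%N -> size xs = d ->
  rad (drop (a * d) (take (q * d) pub)) xs = rad (drop (a * d) pub) xs :> R.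
Proof.
move=> ha sx; apply: eq_bigr => j _; congr (sg _ * _); rewrite !nth_drop nth_take //.
have hj : (j < d)%N by rewrite -sx ltn_ord.
apply: (@leq_trans (a.+1 * d)); last by rewrite leq_mul2r ha orbT.
by rewrite mulSn; lia.
Qed.

Lemma path_take (xs : seq R) (pub : seq bool) b : size xs = d ->
  path c0 n k (take (q * d) pub) xs b = path c0 n k pub xs b.
Proof. by move=> sx; rewrite /path /pz sx rad_take // ltn_mod q_gt0. Qed.

Lemma msgs_take (X : 'I_n -> 'rV[R]_d) (pub : seq bool) (w : {ffun 'I_n -> T.-tuple bool}) :
  msgs X (take (q * d) pub) w = msgs X pub w.
Proof.
apply: eq_map => i; have h : path c0 n k (take (q * d) pub) (coords (X i)) = path c0 n k pub (coords (X i)).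
  by apply: funext => b; rewrite path_take // size_coords.
by rewrite /encout /threshold h.
Qed.

(** The two runs share their data, so independence holds only conditionally on the synthetic data.
    The averages are exchanged so that the private coins of the users and the prefix of the public
    tape are fixed first. *)
Lemma both_fail (X : 'I_n -> 'rV[R]_d) : in_uball X ->
  av (fun r : T.-tuple bool * {ffun 'I_n -> T.-tuple bool} * T.-tuple bool =>
    @ind R (~ one_good (flatten (msgs X r.1.1 r.1.2)) r.1.1 r.2)) <= beta * beta.
Proof.
move=> hX; rewrite av_pair av_pair /=.
pose f (w : {ffun 'I_n -> T.-tuple bool}) (u : seq bool) : R :=
  av (fun v : T.-tuple bool => ind (~ one_good (flatten (msgs X u w)) u v)).
have sw : av (fun u : T.-tuple bool => av (fun w => f w u)) = av (fun w => av (fun u : T.-tuple bool => f w u)).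
  by rewrite /av -!mulr_suml exchange_big mulrAC.
change (av (fun u : T.-tuple bool => av (fun w => f w u)) <= beta * beta).
rewrite sw.
have W0 : (0 < #|{: {ffun 'I_n -> T.-tuple bool}}|)%N by rewrite card_ffun expn_gt0 card_tuple expn_gt0 card_bool.
rewrite -(av_cst (beta * beta) W0); apply: av_le => w.
rewrite (av_tuple T (f w)).
have qT : (q * d <= T)%N by have [_ _ /(_ 0%N isT) [h _]] := hT; lia.
rewrite -(subnKC qT) ex_cat -[X in _ <= X](ex_cst (q * d)); apply: ex_le => u hu.
set m := flatten (msgs X u w).
(* For a fixed prefix [u] the messages ignore the rest [z] of the public tape; [z] and [v] are then
   fresh independent coins for the two runs on the same data. *)
have hm z : flatten (msgs X (u ++ z) w) = m by rewrite -msgs_take -{1}hu take_size_cat.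
pose Y := @Yf R c0 G n d k eps m; pose N := size (synth_pts c0 G n d k eps m).
have hY : in_uball Y by exact: Yf_uball.
have sY : (N <= maxY c0 G n k)%N by rewrite /N -size_synthE; exact: size_synth.
have [_ _ /(_ _ sY) [t1 _]] := hT.
pose bad w := ~ approx_solution k Y kappa 0 (centers d k (solver_out m w)).
have b1 : pr T bad <= beta by apply: (solver_fails (isT : (0 < N)%N) d0 k0 hY); lia.
have b2 : pr (T - q * d) bad <= beta by apply: (solver_fails (isT : (0 < N)%N) d0 k0 hY); lia.
apply: (@le_trans _ _ (ex (T - q * d) (fun z => ind (bad z) * pr T bad))); last first.
  by rewrite exZr; apply: ler_pM => //; exact: pr_ge0.
apply: ex_le => z _; rewrite /f (av_tuple T (fun v => ind (~ one_good (flatten (msgs X (u ++ z) w)) (u ++ z) v))).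
rewrite hm /pr -exZ; apply: ex_le => v _; rewrite /one_good (_ : drop (q * d) (u ++ z) = z); last by rewrite -hu drop_size_cat.
have [h1|h1] := pselect (bad v); last by rewrite indF ?mulr_ge0 ?ind_ge0 // => h2; apply: h1 => h3; apply: h2; left.
have [h2|h2] := pselect (bad z); last by rewrite indF ?mulr_ge0 ?ind_ge0 // => h3; apply: h2 => h4; apply: h3; right.
by rewrite (indT h1) (indT h2) mulr1 ind_le1.
Qed.
End Protocol.

(** * The success of the protocol *)

Section NodeBound.
Variables (c0 K n k : nat).
Hypothesis c00 : (0 < c0)%N.
Hypothesis q8 : (8 <= pq c0 k)%N.
Local Notation q := (pq c0 k).
Local Notation H := (pH c0 n k).
Local Notation Gam := (pGam c0 (K + 7) n k).
Local Notation N := (k * 2 ^ ((K + 2) * q))%N.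

Lemma N_le : (N <= 2 ^ ((K + 3) * q))%N.
Proof.
have hk : (k <= 2 ^ q)%N.
  have h1 : (k <= 2 ^ up_log 2 k)%N by exact: up_logP.
  apply: leq_trans h1 _; rewrite leq_exp2l // /pq; apply: (@leq_trans (1 * (up_log 2 k + 1))).
    by rewrite mul1n leq_addr.
  by rewrite leq_mul2r c00 orbT.
by apply: leq_trans (leq_mul hk (leqnn _)) _; rewrite -expnD leq_exp2l //; lia.
Qed.

(** Here [G = K + 7] splits into [K + 3] for the cells near the [k] centers and 4 for the factor
    [1 + 10 * H], which is at most [16 * H]. The 10 is the value at which [M] is used. *)
Lemma Gam_big : (N * (1 + H * 10) <= Gam)%N.
Proof.
have H0 : (0 < H)%N by rewrite expn_gt0.
apply: leq_trans (leq_mul N_le (leqnn _)) _.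
rewrite /pGam (_ : (K + 7) * q = (K + 3) * q + 4 * q)%N; last by lia.
rewrite expnD -mulnA leq_mul2l; apply/orP; right.
have : (2 ^ 4 <= 2 ^ (4 * q))%N by rewrite leq_exp2l // leq_pmulr // (leq_trans _ q8).
move: (2 ^ (4 * q))%N => x hx; apply: (@leq_trans (16 * H)); first by lia.
by rewrite leq_mul2r hx orbT.
Qed.

End NodeBound.

Section Guarantee.
Context {R : realType}.
Variables (c0 : nat) (p : prog) (Ap : nat) (kappa beta : R) (K : nat).
Local Notation G := (K + 7)%N.
Hypothesis c00 : (0 < c0)%N.
Hypothesis hp : forall (n d k : nat), (0 < n)%N -> (0 < d)%N -> (0 < k)%N ->
  forall X : 'I_n -> 'rV[R]_d, in_uball X ->
  let T := poly_bound Ap n d k in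
  let start (w : T.-tuple bool) :=
    init [:: n; d; k] (flatten [seq coords (X i) | i <- enum 'I_n]) w [::] in
  (forall w, halts T p (start w)) /\
  1 - beta <= Pr R [set w : T.-tuple bool |
    approx_solution k X kappa 0 (centers d k (output T p (start w)))]%classic.
Hypothesis kappa1 : 1 <= kappa.
Variables (n d k T : nat) (eps : R).
Hypotheses (n0 : (0 < n)%N) (d0 : (0 < d)%N) (k0 : (0 < k)%N) (e0 : 0 < eps).
Hypothesis hT : enough_time c0 G Ap n d k T.
Local Notation q := (pq c0 k).
Local Notation H := (pH c0 n k).
Local Notation B := (@Bnd R c0 n k).
Local Notation Gam := (pGam c0 G n k).
Local Notation N := (k * 2 ^ ((K + 2) * q))%N.
Local Notation dec := (dec_prog c0 G p).
Variable X : 'I_n -> 'rV[R]_d.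
Hypothesis hX : in_uball X.
Local Notation msgs pub w := (flatten (msgs c0 d k eps (fun i => coords (X i)) pub w)).
Local Notation Yf m := (@Yf R c0 G n d k eps m).

Lemma decode_approx (ka t : R) (m : seq R) (pub v : seq bool) :
  size m = (n * stride c0 n d k)%N -> size pub = T -> size v = T ->
  (forall C C2 : {fset 'rV[R]_d}, #|` C|%fset = k -> cost (Yf m) C <= kappa * opt k (Yf m) ->
    (forall x, x \in C -> 2 *: x \in C2) -> cost X C2 <= ka * opt k X + t) ->
  @one_good R c0 G p Ap kappa n d k eps m pub v ->
  approx_solution k X ka t (centers d k (output T dec (dec_start n d k eps m pub v))).
Proof.
move=> sm sp sv h hg; have [_ ->] := dec_run c00 hp n0 d0 k0 e0 hT sm sp sv.
have [C [h1 h2 h3 h4]] := choose_good k0 hg.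
by split; [exact: h4|exact: h h1 h2 h3].
Qed.

(** Some synthetic center has norm at most [1 + kappa]; doubled, it is within [3 + 2 * kappa] of
    every user. *)
Lemma trivial_cost m (C C2 : {fset 'rV[R]_d}) : #|` C|%fset = k -> cost (Yf m) C <= kappa * opt k (Yf m) ->
  (forall x, x \in C -> 2 *: x \in C2) -> cost X C2 <= n%:R * (3 + 2 * kappa) ^+ 2.
Proof.
move=> h1 h2 h3; have [x hx xn] := good_center kappa1 d0 k0 h1 h2.
apply: le_trans (cost_le X (fun i => h3 _ hx)) _.
rewrite -[X in _ <= X%:R * _](card_ord n) mulr_natl -sumr_const; apply: ler_sum => i _.
rewrite ler_pXn2r ?nnegrE ?enorm_ge0 //; last by have := kappa1; lra.
apply: le_trans (ler_enormD _ _) _; rewrite enormN enormZ gtr0_norm //.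
have : enorm (X i) <= 1 by exact: hX.
lra.
Qed.

Variables (al : R) (c : 'I_k -> 'rV[R]_d) (s : 'I_n -> 'I_k).
Hypothesis hal : 0 < al <= 1 / 16.
Hypothesis hK : 32 / al ^+ 2 + 2 <= K%:R.
Hypothesis hc : forall j, enorm (c j) <= 1.
Hypothesis hs : \sum_i enorm (X i - c (s i)) ^+ 2 <= opt k X + 1.
Hypothesis q8 : (8 <= q)%N.
Hypothesis a0 : 0 < acoef eps n.
Local Notation g := (al / 4).
Local Notation S := (\sum_i enorm (X i - c (s i)) ^+ 2).
Local Notation eta := (eta c0 n k eps).

Definition jl_bad (pub : seq bool) : Prop := pairs_bad q c g pub \/
  (out_of_range q X B pub \/ al * S + 1 <= loss q X c s g pub).

Lemma eta_ge0 : 0 <= eta.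
Proof.
have q0 := q_gt0 k c00; have F0 := scaleF_gt0 (eps := eps) q0 a0; have B0 := @Bnd_gt0 R c0 n k q0.
have s1 := sqrtr_ge0 (n%:R : R); have F1 := ltW F0; have B1 := ltW B0.
apply: addr_ge0; last by apply: addr_ge0 => //; apply: mulr_ge0 => //; exact: expR_ge0.
by apply: mulr_ge0 => //; apply: mulr_ge0 => //; apply: mulr_ge0.
Qed.

Definition slack : R := kappa * (6 + (27 + 8 / al) * (8 * H%:R * N%:R * eta * B ^+ 2 + B ^+ 2)) +
  (H * (2 * Gam))%:R * (theta d eta * (11 * kappa + (6 + 2 * kappa) * (8 + 2 * kappa))).

(** The relative error [11 * al] has these sources: [7 * al] from projecting with distortion
    [g = al / 4] and comparing with slack [al], [al] from the loss of bad users, and [2 * al + al]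
    from the far users, through the bound on the sum of [P ^+ 2] and the loss contained in it. *)
Lemma good_cost (pub : seq bool) (w : {ffun 'I_n -> T.-tuple bool}) (C C2 : {fset 'rV[R]_d}) :
  ~ jl_bad pub -> ~ noisy c0 d k eps (fun i => coords (X i)) pub w ->
  #|` C|%fset = k -> cost (Yf (msgs pub w)) C <= kappa * opt k (Yf (msgs pub w)) ->
  (forall x, x \in C -> 2 *: x \in C2) -> cost X C2 <= kappa * (1 + 11 * al) * opt k X + slack.
Proof.
move=> hj hn h1 h2 h3; case/andP: hal => al0 al1.
have q0 : (0 < q)%N by exact: q_gt0.
have hX1 i : enorm (X i) <= 1 by exact: hX.
set m := msgs pub w in h2.
have hp1 : ~ pairs_bad q c g pub by move=> h; apply: hj; left.
have hr i (a : 'I_q) : `|rad (drop (a * d) pub) (coords (X i))| < B.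
  by rewrite ltNge; apply/negP => h; apply: hj; right; left; exists (i, a); rewrite // mem_enum.
have hl : loss q X c s g pub <= al * S + 1.
  by apply/ltW; rewrite ltNge; apply/negP => h; apply: hj; right; right.
have et0 := eta_ge0.
have hest v j : (0 < size v <= H)%N -> (j < d + 1)%N ->
    `|est c0 n d k eps m v j - mass c0 k (fun i => coords (X i)) pub v j| <= eta.
  by move=> hv hj'; exact: (not_noisy hn).
have hest0 v : (0 < size v <= H)%N -> `|est c0 n d k eps m v 0 - cnt c0 k pub X v| <= eta.
  by move=> hv; rewrite -mass0; apply: hest; rewrite // addn1.
have N0 : (0 < N)%N by rewrite muln_gt0 k0 expn_gt0.
have hg : 0 < g <= 1 / 2 by apply/andP; split; lra.
have al1' : al <= 1 by lra.
have [asg hD] := assignment G eps m n0 q0 hr s al0 al1' hg q8 hp1.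
have hE := extra_bound n0 q0 hr et0 hest0 c s al0 hK (isT : (0 < 10)%N) N0 (Gam_big K n c00 q8).
have hP := sum_P2 pub X q0 c s hg.
have hfin := decoded_cost (X := X) n0 hX1 et0 hest asg kappa1 d0 k0 hc h1 h2 h3.
set D := \sum_i enorm (X i - c (asg _)) ^+ 2 in hD hfin.
set E := extra _ _ _ _ _ _ _ _ _ in hE hD.
set P2 := \sum_i Pn _ _ _ _ _ _ ^+ 2 in hE hP.
set W := 8 * H%:R * N%:R * eta * B ^+ 2 in hE *.
have B20 : 0 <= B ^+ 2 by exact: sqr_ge0.
have W0 : 0 <= W by rewrite /W !mulr_ge0.
have S0 : 0 <= S by apply: sumr_ge0 => i _; exact: sqr_ge0.
have P20 : 0 <= P2 by apply: sumr_ge0 => i _; exact: sqr_ge0.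
set l := loss _ _ _ _ _ _ in hl hD hP.
pose Z := 27 + 8 / al.
have Z0 : 0 <= Z by rewrite /Z addr_ge0 // divr_ge0 // ltW.
(* The factor [8 / al] in [Z] is compensated by [al ^+ 2], and [M = 10] makes the remaining constant
   small enough. *)
have Zal : Z * (al ^+ 2 / (4 * 10%:R)) <= al.
  rewrite /Z (_ : (27 + 8 / al) * (al ^+ 2 / (4 * 10%:R)) = (27 * al ^+ 2 + 8 * al) / 40); last by field; rewrite gt_eqF.
  by nra.
have coef : (1 + al) ^+ 2 * (1 + g) / (1 - g) <= 1 + 7 * al.
  rewrite ler_pdivrMr; last by lra.
  nra.
have e1 : Z * E <= Z * (W + B ^+ 2) + al * P2.
  apply: le_trans (ler_wpM2l Z0 hE) _.
  have -> : Z * (W + al ^+ 2 / (4 * 10%:R) * P2 + B ^+ 2) = Z * (W + B ^+ 2) + Z * (al ^+ 2 / (4 * 10%:R)) * P2 by ring.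
  by rewrite lerD2l ler_wpM2r.
have e2 : D <= (1 + 11 * al) * S + 2 + Z * (W + B ^+ 2).
  have h4 := ler_wpM2r S0 coef.
  have h5 : al * P2 <= al * (2 * S + l) by rewrite ler_pM2l.
  have h6 : al * l <= al * (al * S + 1) by rewrite ler_pM2l.
  have h7 : al * (al * S) <= al * S by rewrite ler_pM2l // ler_piMl.
  rewrite -/Z in hD; lra.
have e3 : D <= (1 + 11 * al) * opt k X + (4 + Z * (W + B ^+ 2)).
  have h4 : (1 + 11 * al) * S <= (1 + 11 * al) * (opt k X + 1) by rewrite ler_pM2l //; lra.
  lra.
apply: le_trans hfin _.
have e4 : kappa * D <= kappa * ((1 + 11 * al) * opt k X + (4 + Z * (W + B ^+ 2))).
  by rewrite ler_wpM2l // (le_trans ler01).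
have K1 : 0 <= theta d eta * (11 * kappa + (6 + 2 * kappa) * (8 + 2 * kappa)).
  have k1 := kappa1; apply: mulr_ge0; last by nra.
  by rewrite /theta !addr_ge0 // ?mulr_ge0 // sqrtr_ge0.
have e5 : (size (leaves c0 G n d k eps m H))%:R * (theta d eta * (11 * kappa + (6 + 2 * kappa) * (8 + 2 * kappa))) <=
   (H * (2 * Gam))%:R * (theta d eta * (11 * kappa + (6 + 2 * kappa) * (8 + 2 * kappa))).
  by rewrite ler_wpM2r // ler_nat size_leaves.
rewrite /slack -/W -/Z; have := kappa1; lra.
Qed.

Local Notation ee := (expR (- (q%:R * g ^+ 2 / 32)) : R).

Lemma jl_prob : pr T jl_bad <= (k * k)%:R * ee + (n * q)%:R * (2 * expR (8 - 2 * B)) + 435 * (k + 1)%:R * ee / al.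
Proof.
case/andP: hal => al0 al1.
have hg : 0 < g <= 1 / 2 by apply/andP; split; lra.
have qT : (q * d <= T)%N by have [_ _ /(_ 0%N isT) [h _]] := hT; lia.
have hX1 i : enorm (X i) <= 1 by exact: hX.
have S0 : 0 <= S by apply: sumr_ge0 => i _; exact: sqr_ge0.
apply: le_trans (pr_or _ _ _) _; rewrite -addrA; apply: lerD; first exact: pairs_prob.
apply: le_trans (pr_or _ _ _) _; apply: lerD; first exact: range_prob.
(* The 1 in the threshold allows Markov's inequality even if all users sit on centers and [S]
   vanishes. *)
have c1 : 0 < al * S + 1 by rewrite ltr_wpDl // mulr_ge0 // ltW.
apply: le_trans (pr_markov c1 _) _ => [w _|].
  apply: sumr_ge0 => i _; apply: mulr_ge0; first exact: ind_ge0.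
  apply: addr_ge0; apply: mulr_ge0 => //; first exact: sqr_ge0.
  by apply: divr_ge0 => //; exact: nrm_ge0.
have hx := ex_loss X c s hg q8 qT.
rewrite (ler_pdivrMr _ _ c1); apply: le_trans hx _.
set a := 435 * _ * _; have a1 : 0 <= a / al by rewrite divr_ge0 ?(ltW al0) // mulr_ge0 ?expR_ge0 // mulr_ge0.
have -> : a / al * (al * S + 1) = a * S + a / al by field; rewrite gt_eqF.
by rewrite lerDl.
Qed.

Lemma success_prob (F : T.-tuple bool * {ffun 'I_n -> T.-tuple bool} * T.-tuple bool -> Prop) :
  (forall (pub : T.-tuple bool) (w : {ffun 'I_n -> T.-tuple bool}) (v : T.-tuple bool), ~ jl_bad pub -> ~ noisy c0 d k eps (fun i => coords (X i)) pub w ->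
    @one_good R c0 G p Ap kappa n d k eps (msgs pub w) pub v -> F (pub, w, v)) ->
  (k * k)%:R * ee + (n * q)%:R * (2 * expR (8 - 2 * B)) + 435 * (k + 1)%:R * ee / al +
   (4 ^ H * (d + 1))%:R * (2 * expR (2 - 8 * H%:R)) + beta * beta <= beta ->
  1 - beta <= Pr R [set r | F r]%classic.
Proof.
move=> hF hb; rewrite Pr_av.
have W1 : (0 < #|{: T.-tuple bool}|)%N by rewrite card_tuple expn_gt0 card_bool.
have W2 : (0 < #|{: {ffun 'I_n -> T.-tuple bool}}|)%N by rewrite card_ffun expn_gt0 W1.
pose W := ((T.-tuple bool * {ffun 'I_n -> T.-tuple bool}) * T.-tuple bool)%type.
have W3 : (0 < #|{: W}|)%N by rewrite !card_prod !muln_gt0 W1 W2.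
have q0 : (0 < q)%N by exact: q_gt0.
have [hu _ _] := hT.
have sx i : size (coords (X i)) = d by rewrite size_coords.
have hx i : sqs (coords (X i)) <= 1 by rewrite sqs_coords expr_le1 ?enorm_ge0 //; exact: hX.
have h1 : av (fun r : W => @ind R (jl_bad r.1.1)) = pr T jl_bad.
  rewrite av_pair av_pair /= /pr -(av_tuple T (fun w => ind (jl_bad w))); apply: eq_av => u.
  by rewrite (eq_av (g := fun=> ind (jl_bad u))) ?av_cst // => w; rewrite av_cst.
have h2 : av (fun r : W => @ind R (noisy c0 d k eps (fun i => coords (X i)) r.1.1 r.1.2)) <=
   (4 ^ H * (d + 1))%:R * (2 * expR (2 - 8 * H%:R)).
  rewrite av_pair av_pair /= -[X in _ <= X](av_cst _ W1); apply: av_le => u.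
  rewrite (eq_av (g := fun w => @ind R (noisy c0 d k eps (fun i => coords (X i)) u w))) => [|w]; last by rewrite av_cst.
  exact: noise.
have h3 := both_fail c00 hp n0 d0 k0 e0 hT hX.
suff : av (fun r : W => 1 - @ind R (F r)) <= beta.
  rewrite (eq_av (g := fun r => 1 + -1 * @ind R (F r))) => [|r]; last by rewrite mulN1r.
  by rewrite avD avZ av_cst //; lra.
apply: le_trans hb; apply: le_trans (lerD (lerD jl_prob h2) h3).
rewrite -h1 -!avD; apply: av_le => -[[u w] v] /=; rewrite -indC.
have [f|f] := pselect (F (u, w, v)); first by rewrite indF ?addr_ge0 ?ind_ge0 // => h; exact: h.
rewrite (indT f); have [j|j] := pselect (jl_bad u).
  by rewrite (indT j) -addrA lerDl addr_ge0 ?ind_ge0.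
have [z|z] := pselect (noisy c0 d k eps (fun i => coords (X i)) u w).
  by rewrite (indT z) addrAC lerDr addr_ge0 ?ind_ge0.
have h : ~ @one_good R c0 G p Ap kappa n d k eps (msgs u w) u v by move=> h; apply: f; exact: hF.
by rewrite [X in _ <= _ + X]indT // lerDr addr_ge0 ?ind_ge0.
Qed.
End Guarantee.

(** * The choice of the constants *)

Section Constants.
Context {R : realType}.

Lemma nat_above (x : R) : exists m : nat, x <= m%:R.
Proof.
have [x0|x0] := leP 0 x; last by exists 0%N; exact: ltW.
by exists (Num.bound x); rewrite ltW // archi_boundP.
Qed.

Lemma expR_pow2 m : (2 ^ m)%:R <= expR m%:R :> R.
Proof.
have e2 : 2 <= expR 1 :> R by have := expR_ge1Dx (1 : R); lra.
rewrite natrX -[X in expR X]mul1r expRM_natr lerXn2r ?nnegrE ?expR_ge0 //.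
Qed.

Lemma div_swap (u v w : R) : 0 < v -> 0 < w -> u / v <= w -> u / w <= v.
Proof. by move=> v0 w0; rewrite !ler_pdivrMr // [v * w]mulrC. Qed.

Lemma expRN_le (x : R) : 0 < x -> expR (- x) <= x^-1.
Proof.
move=> x0; rewrite expRN lef_pV2 ?posrE ?expR_gt0 //.
by have := expR_ge1Dx x; lra.
Qed.

Lemma ex_above3 (c1 c2 c3 : nat) : exists c0, [/\ 8 <= c0, c1 <= c0, c2 <= c0 & c3 <= c0]%N.
Proof. by exists (8 + c1 + c2 + c3)%N; split; lia. Qed.

(** Every failure term other than [beta * beta] tends to 0 as [c0] grows, uniformly in [n], [d] and
    [k]. They are collected in three groups of at most [xi] each, which fit into the gap between
    [beta * beta] and [beta]. *)
Lemma fail_bound (beta al : R) : 0 < beta < 1 -> 0 < al -> exists2 c0, (8 <= c0)%N &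
  forall n d k, (0 < n)%N -> (0 < k)%N -> (d <= n)%N ->
  forall (q H : nat) (e : R), q = pq c0 k -> H = pH c0 n k ->
  e = expR (- (q%:R * (al / 4) ^+ 2 / 32)) ->
  (k * k)%:R * e + (n * q)%:R * (2 * expR (8 - 2 * @Bnd R c0 n k)) + 435 * (k + 1)%:R * e / al +
   (4 ^ H * (d + 1))%:R * (2 * expR (2 - 8 * H%:R)) + beta * beta <= beta.
Proof.
case/andP=> b0 b1 al0; pose xi := (beta - beta * beta) / 4.
have xi0 : 0 < xi by rewrite /xi divr_gt0 // subr_gt0 -[X in _ < X]mulr1 ltr_pM2l.
have [Q Q0 hQ] : exists2 Q : R, 0 < Q & Q = 435 / al.
  by exists (435 / al); [apply: divr_gt0; [rewrite ltr0n|exact: al0]|].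
have [J hJ] := nat_above ((1 + 2 * Q) / xi).
have e80 := expR_gt0 (8 : R); have e20 := expR_gt0 (2 : R).
pose r := (al / 4) ^+ 2 / 32.
have r0 : 0 < r by rewrite divr_gt0 // exprn_gt0 // divr_gt0.
have [c1 hc1] := nat_above ((2 + J%:R) / r).
have [c2 hc2] := nat_above (2 * expR 8 / xi).
have [c3 hc3] := nat_above (4 * expR 2 / xi).
have J0 : 0 < J%:R :> R by apply: lt_le_trans hJ; apply: divr_gt0 => //; lra.
have [c0 [g0 g1 g2 g3]] : exists c0, [/\ 8 <= c0, c1 <= c0, c2 <= c0 & c3 <= c0]%N.
  exact: ex_above3.
refine (ex_intro2 _ _ c0 g0 _).
move=> n d k n0 k0 dn q H e eq_q eq_H eq_e.
have c00 : (0 < c0)%N by exact: leq_trans g0.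
pose l := up_log 2 k.
have qE : q = (c0 * (l + 1))%N by exact: eq_q.
have qc : c0%:R <= q%:R :> R by rewrite ler_nat qE leq_pmulr // addn1.
have q1 : 0 < q%:R :> R by apply: lt_le_trans qc; rewrite ltr0n.
have kl : k%:R <= expR l%:R :> R by apply: le_trans (expR_pow2 l); rewrite ler_nat up_logP.
have k1 : 1 <= k%:R :> R by rewrite ler1n.
have e0 : 0 < e by rewrite eq_e; exact: expR_gt0.
(* [q] contains [c0] times [log k], so [e] beats [k * k] with a constant factor [expR (- J)] to
   spare. *)
have he : e <= expR (- (2 * l%:R) - J%:R).
  rewrite eq_e ler_expR -mulrA -/r.
  have h1 : 2 + J%:R <= c0%:R * r.
    rewrite -ler_pdivrMr //; by apply: le_trans hc1 _; rewrite ler_nat.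
  have -> : q%:R * r = c0%:R * r * (l%:R + 1) by rewrite qE natrM natrD; ring.
  have h2 : (2 + J%:R) * (l%:R + 1) <= c0%:R * r * (l%:R + 1) by rewrite ler_wpM2r // addr_ge0.
  have h3 : 0 <= J%:R * l%:R :> R by rewrite mulr_ge0.
  by rewrite -opprD lerN2; apply: le_trans h2; nra.
have hkk : k%:R * (k%:R * e) <= J%:R^-1.
  have h1 : k%:R * (k%:R * e) <= expR l%:R * (expR l%:R * expR (- (2 * l%:R) - J%:R)).
    by apply: ler_pM => //; rewrite ?mulr_ge0 ?(ltW e0) //; apply: ler_pM; rewrite ?(ltW e0).
  apply: le_trans h1 _; rewrite -!expRD (_ : l%:R + (l%:R + (- (2 * l%:R) - J%:R)) = - J%:R); last by ring.
  exact: expRN_le.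
have hJ2 : J%:R^-1 * (1 + 2 * Q) <= xi.
  by rewrite mulrC; apply: div_swap.
have t13 : (k * k)%:R * e + 435 * (k + 1)%:R * e / al <= xi.
  apply: le_trans hJ2; have hk1 : k%:R * e <= J%:R^-1.
    by apply: le_trans hkk; rewrite ler_peMl // mulr_ge0 // ltW.
  have h1 : (k + 1)%:R * e <= 2 * J%:R^-1.
    have : e <= k%:R * e by rewrite ler_peMl // ltW.
    by rewrite natrD mulrDl mul1r; lra.
  rewrite mulrDr mulr1 natrM -mulrA; apply: lerD; first exact: hkk.
  have -> : 435 * (k + 1)%:R * e / al = Q * ((k + 1)%:R * e) by rewrite hQ; ring.
  have -> : J%:R^-1 * (2 * Q) = Q * (2 * J%:R^-1) by ring.
  by rewrite ler_wpM2l // ltW.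
have c0r : c0%:R <= H%:R :> R /\ (pen n)%:R <= H%:R :> R.
  have h1 : (pH0 c0 n k <= H)%N by rewrite eq_H; exact: up_logP.
  have h2 : (q * (pen n + 1) <= H)%N by rewrite eq_q; exact: h1.
  have h3 : (c0 <= q)%N by rewrite qE leq_pmulr // addn1.
  split; rewrite ler_nat; apply: leq_trans h2.
    by apply: leq_trans h3 _; rewrite leq_pmulr // addn1.
  by apply: (@leq_trans (1 * (pen n + 1))); [rewrite mul1n leq_addr|rewrite leq_mul2r (leq_trans c00 h3) orbT].
have nl : n%:R <= expR (pen n)%:R :> R by apply: le_trans (expR_pow2 _); rewrite ler_nat up_logP.
have t2 : (n * q)%:R * (2 * expR (8 - 2 * @Bnd R c0 n k)) <= xi.
  have qe : q%:R <= expR q%:R :> R by have := expR_ge1Dx (q%:R : R); lra.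
  have h1 : n%:R * q%:R <= expR (pen n)%:R * expR q%:R :> R by apply: ler_pM.
  rewrite natrM; apply: (@le_trans _ _ (expR (pen n)%:R * expR q%:R * (2 * expR (8 - 2 * @Bnd R c0 n k)))).
    by rewrite ler_wpM2r // mulr_ge0 // expR_ge0.
  have -> : expR (pen n)%:R * expR q%:R * (2 * expR (8 - 2 * @Bnd R c0 n k)) = 2 * expR 8 * expR (- (q%:R + (pen n)%:R)).
    have -> : @Bnd R c0 n k = q%:R + (pen n)%:R by rewrite eq_q /Bnd natrD.
    move: (q%:R : R) ((pen n)%:R : R) => u v.
    have -> : 8 - 2 * (u + v) = 8 + (- (u + v) + - (u + v)) by ring.
    by rewrite !expRD !expRN !expRD; field; rewrite !gt_eqF ?expR_gt0.
  apply: (@le_trans _ _ (2 * expR 8 * c0%:R^-1)).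
    rewrite ler_wpM2l ?mulr_ge0 ?expR_ge0 //; apply: le_trans (expRN_le _) _.
      by rewrite ltr_pwDl.
    rewrite lef_pV2 ?posrE ?ltr0n //; last by rewrite ltr_pwDl.
    by apply: le_trans qc _; rewrite lerDl.
  by apply: div_swap; rewrite ?ltr0n //; apply: le_trans hc2 _; rewrite ler_nat.
have t4 : (4 ^ H * (d + 1))%:R * (2 * expR (2 - 8 * H%:R)) <= xi.
  case: c0r => r1 r2; have H1 : 0 < H%:R :> R by apply: lt_le_trans r1; rewrite ltr0n.
  have h4 : (4 ^ H)%:R <= expR (2 * H%:R) :> R.
    have -> : (4 ^ H = 2 ^ (2 * H))%N by rewrite expnM.
    by apply: le_trans (expR_pow2 _) _; rewrite natrM.
  (* The union bound over coordinates uses [d <= n]: then [d] is at most [expR H], since [H] is at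
     least the logarithm of [n]. *)
  have hd : (d + 1)%:R <= 2 * expR H%:R :> R.
    apply: (@le_trans _ _ (2 * n%:R)).
      by rewrite -natrM ler_nat mul2n -addnn; apply: leq_add.
    by rewrite ler_pM2l //; apply: le_trans nl _; rewrite ler_expR.
  rewrite natrM; apply: (@le_trans _ _ (expR (2 * H%:R) * (2 * expR H%:R) * (2 * expR (2 - 8 * H%:R)))).
    by rewrite ler_wpM2r ?mulr_ge0 ?expR_ge0 //; apply: ler_pM.
  have -> : expR (2 * (H%:R : R)) * (2 * expR H%:R) * (2 * expR (2 - 8 * H%:R)) = 4 * (expR (2 * H%:R) * expR H%:R * expR (2 - 8 * H%:R)) by ring.
  rewrite -!expRD (_ : 2 * H%:R + H%:R + (2 - 8 * H%:R) = 2 + - (5 * H%:R)); last by ring.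
  rewrite expRD mulrA; apply: (@le_trans _ _ (4 * expR 2 * c0%:R^-1)).
    rewrite ler_wpM2l ?mulr_ge0 ?expR_ge0 //; apply: le_trans (expRN_le _) _; first by rewrite mulr_gt0.
    rewrite lef_pV2 ?posrE ?ltr0n ?mulr_gt0 //; lra.
  by apply: div_swap; rewrite ?ltr0n //; apply: le_trans hc3 _; rewrite ler_nat.
have : xi + xi + xi <= beta - beta * beta by rewrite /xi; move: xi0; rewrite /xi; lra.
lra.
Qed.

(** Passes from the rounded binary logarithm to the natural one, by [expR (1 / 2) <= 2]. *)
Lemma pen_ln n : (0 < n)%N -> (pen n + 1)%:R <= 2 * (1 + ln n%:R) :> R.
Proof.
move=> n0; have n1 : 1 <= n%:R :> R by rewrite ler1n.
suff : (pen n).-1%:R / 2 <= ln n%:R :> R.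
  have : (pen n)%:R <= (pen n).-1%:R + 1 :> R by rewrite natr1 ler_nat; lia.
  by rewrite natrD; lra.
have h : expR ((pen n).-1%:R / 2) <= n%:R :> R.
  apply: (@le_trans _ _ ((2 ^ (pen n).-1)%:R)).
    rewrite mulrC expRM_natr natrX lerXn2r ?nnegrE ?expR_ge0 //.
    have : `|2^-1 : R| <= 1 by rewrite ger0_norm //; lra.
    move/expR_quad; lra.
  rewrite ler_nat; have := exp_up_log n0; rewrite -/(pen n).
  by case: (pen n) => [|m] //=; rewrite expnS leq_mul2l.
rewrite -(expRK (_ / 2)) ler_ln ?posrE ?expR_gt0 //; lra.
Qed.

(** Origin of the two exponents in the error: [2 ^ (G * q)] is polynomial in [k] of degree [G * c0],
    as [q] is logarithmic in [k], and the seven further factors [H] and [q + pen n] are each of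
    order at most [q * (pen n + 1)]. *)
Lemma size_param c0 G n k : (0 < c0)%N -> (0 < k)%N ->
  (pGam c0 G n k * pH c0 n k ^ 3 * (pq c0 k + pen n) ^ 3 <=
   4 ^ (G * c0) * 16 * (2 * c0) ^ 7 * k ^ (G * c0 + 7) * (pen n + 1) ^ 7)%N.
Proof.
move=> c00 k0; set q := pq c0 k; set e := (pen n + 1)%N.
have hq : (q <= 2 * c0 * k)%N by apply: leq_trans (pq_le c0 k) _; rewrite -mulnA mulnCA leq_mul2l; apply/orP; right; lia.
have hH : (pH c0 n k <= 2 * (q * e))%N by exact: pH_le.
have q0 : (0 < q)%N by exact: q_gt0.
have hB : (q + pen n <= q * e)%N by rewrite /e mulnDr muln1 addnC leq_add2r leq_pmull.
rewrite /pGam; apply: (@leq_trans ((4 * k) ^ (G * c0) * (2 * (q * e)) * (2 * (q * e)) ^ 3 * (q * e) ^ 3)).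
  by rewrite !leq_mul ?leq_exp2r //; exact: exp_Gq_le.
clearbody q e.
apply: (@leq_trans ((4 * k) ^ (G * c0) * (16 * (2 * c0 * k) ^ 7 * e ^ 7))).
  have aux a x y z t : (x * y * z <= t)%N -> (a * x * y * z <= a * t)%N.
    by move=> h; rewrite -!mulnA leq_mul2l mulnA h orbT.
  apply: aux.
  have -> : (2 * (q * e) * (2 * (q * e)) ^ 3 * (q * e) ^ 3 = 16 * (q ^ 7 * e ^ 7))%N by ring.
  have -> : (16 * (2 * c0 * k) ^ 7 * e ^ 7 = 16 * ((2 * c0 * k) ^ 7 * e ^ 7))%N by ring.
  by rewrite leq_mul2l /= leq_mul2r leq_exp2r // hq orbT.
by rewrite !expnMn expnD; apply: eq_leq; ring.
Qed.
End Constants.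

Section SlackBound.
Context {R : realType}.
Variables (c0 K n d k : nat) (kappa al eps eps0 : R).
Hypotheses (c00 : (0 < c0)%N) (n0 : (0 < n)%N) (d0 : (0 < d)%N) (k0 : (0 < k)%N).
Hypotheses (kappa1 : 1 <= kappa) (al0 : 0 < al) (e0 : 0 < eps) (ee0 : eps <= eps0) (a0 : 0 < acoef eps n).
Hypothesis q8 : (8 <= pq c0 k)%N.
Local Notation G := (K + 7)%N.
Local Notation q := (pq c0 k).
Local Notation H := (pH c0 n k).
Local Notation B := (@Bnd R c0 n k).
Local Notation Gam := (pGam c0 G n k).
Local Notation E := (1 + eps0).
Local Notation C1 := (E * (65 + 2 * expR 4)).
Local Notation Z := (27 + 8 / al).
Local Notation K1 := (11 * kappa + (6 + 2 * kappa) * (8 + 2 * kappa)).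
Definition slack_const : R := 6 * kappa * E + 8 * kappa * Z * C1 + kappa * Z * E + 14 * C1 * K1.

(** [eta] is of order [H^2 * Bnd * sqrt n / eps]. The product [H * N * eta * Bnd^2] from the wide
    leaves gives the powers of [H] and [Bnd], while [sqrt d] comes from the vector sums in
    [theta]. *)
Lemma slack_le : slack c0 kappa K n d k eps al <=
  slack_const * (Gam * H ^ 3 * (q + pen n) ^ 3)%:R * (Num.sqrt (n * d)%:R / eps).
Proof.
have q0 : (0 < q)%N by exact: q_gt0.
have e0' := e0; have ee0' := ee0; have kappa1' := kappa1; have al0' := al0.
set h : R := H%:R; set b : R := B; set Ga : R := Gam%:R.
have h1 : 1 <= h by rewrite ler1n expn_gt0.
have b1 : 1 <= b by rewrite ler1n addn_gt0 q0.
have G1 : 1 <= Ga by rewrite ler1n /pGam muln_gt0 !expn_gt0.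
set sn : R := Num.sqrt n%:R; set sd : R := Num.sqrt d%:R.
have sn1 : 1 <= sn by rewrite -sqrtr1 ler_wsqrtr // ler1n.
have sd1 : 1 <= sd by rewrite -sqrtr1 ler_wsqrtr // ler1n.
have -> : Num.sqrt (n * d)%:R = sn * sd :> R by rewrite natrM sqrtrM.
have -> : (Gam * H ^ 3 * (q + pen n) ^ 3)%:R = Ga * h ^+ 3 * b ^+ 3.
  have e1 : (H ^ 3)%:R = h ^+ 3 by exact: natrX.
  have e2 : ((q + pen n) ^ 3)%:R = b ^+ 3 by exact: natrX.
  by rewrite -e1 -e2 -!natrM.
have [x x0 xE] : exists2 x, 0 < x & x = sn / eps.
  by exists (sn / eps) => //; apply: divr_gt0 => //; lra.
have E1 : 1 <= E by lra.
(* Additive constants are absorbed into the main term; this is possible because [eps] is at most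
   [eps0]. *)
have Ex : 1 <= E * x.
  rewrite xE mulrA ler_pdivlMr // mul1r; apply: (@le_trans _ _ (E * 1)); first by lra.
  by rewrite ler_pM2l //; lra.
have h21 : 1 <= h ^+ 2 by rewrite exprn_ege1.
have h31 : 1 <= h ^+ 3 by rewrite exprn_ege1.
have b31 : 1 <= b ^+ 3 by rewrite exprn_ege1.
have ge1M (u v : R) : 1 <= u -> 1 <= v -> 1 <= u * v.
  by move=> hu hv; rewrite -[1]mulr1; apply: ler_pM.
have P4 := ge1M _ _ Ex (ge1M _ _ (ge1M _ _ (ge1M _ _ G1 h31) b31) sd1).
have Q4 := ge1M _ _ Ex (ge1M _ _ (ge1M _ _ (ge1M _ _ G1 h31) sd1) b1).
have [hp bp Gp] : [/\ 0 < h, 0 < b & 0 < Ga] by split; lra.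
have [snp sdp] : 0 < sn /\ 0 < sd by split; lra.
have Fs : scaleF c0 n k eps <= 8 * E * h * b / eps.
  rewrite /scaleF -/h -/b ler_pdivrMr; last by rewrite mulr_gt0.
  (* For [eps > 1] the bias no longer grows with [eps], and the factor [E] makes up for it. *)
  have ha : eps <= 16 * E * acoef eps n.
    move: a0; rewrite /acoef; case: ifP => [_|_]; last by rewrite ltxx.
    by case: ifP => _ _; nra.
  rewrite mulrAC ler_pdivlMr //.
  have hb0 : 0 <= h * b by rewrite mulr_ge0 //; lra.
  have := ler_wpM2l hb0 ha; lra.
have C10 : 0 <= C1 by rewrite mulr_ge0 ?addr_ge0 ?mulr_ge0 ?expR_ge0 //; lra.
pose hx := h ^+ 2 * b * x.
have hx0 : 0 < hx by rewrite /hx !mulr_gt0.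
have bhx : b <= E * hx.
  have -> : E * hx = (E * x * h ^+ 2) * b by rewrite /hx; ring.
  have := ge1M _ _ Ex h21; move: (E * x * h ^+ 2) => y hy.
  by rewrite ler_peMl // ltW.
have he : eta c0 n k eps <= C1 * hx.
  rewrite /eta -/h -/b -/sn.
  have s1 : scaleF c0 n k eps * (8 * h * sn) <= 8 * E * h * b / eps * (8 * h * sn).
    by rewrite ler_wpM2r // !mulr_ge0 //; lra.
  have s2 : 8 * E * h * b / eps * (8 * h * sn) = 64 * (E * hx) by rewrite /hx xE; ring.
  have s3 : 2 * expR 4 * 1 <= 2 * expR 4 * (E * hx).
    by rewrite ler_wpM2l ?mulr_ge0 ?expR_ge0 // (le_trans b1).
  have -> : C1 * hx = 64 * (E * hx) + 2 * expR 4 * (E * hx) + E * hx by ring.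
  rewrite s2 in s1; lra.
have et0 : 0 <= eta c0 n k eps by exact: eta_ge0.
have ht : theta d (eta c0 n k eps) <= 7 * (sd * (C1 * hx)).
  rewrite /theta -/sd; set et := eta _ _ _ _ in he et0 *.
  have c1 : 1 <= C1 * hx.
    apply: (@le_trans _ _ (E * hx)); first exact: le_trans bhx.
    apply: ler_wpM2r; first exact: ltW.
    by have := expR_ge0 (4 : R); move: (expR 4) => y hy; rewrite ler_peMr; lra.
  have s1 : sd * et <= sd * (C1 * hx) by rewrite ler_pM2l.
  have s2 : C1 * hx <= sd * (C1 * hx) by rewrite ler_peMl //; lra.
  lra.
pose U := Ga * h ^+ 3 * b ^+ 3 * (sn * sd / eps).
have UE : U = Ga * h ^+ 3 * b ^+ 3 * sd * x by rewrite /U xE; ring.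
have EU : 1 <= E * U.
  have -> : E * U = (E * x) * (Ga * h ^+ 3 * b ^+ 3 * sd) by rewrite UE; ring.
  exact: P4.
have U0 : 0 < U by rewrite UE !mulr_gt0 ?exprn_gt0 //.
have b2U : b ^+ 2 <= E * U.
  have -> : E * U = (E * x * (Ga * h ^+ 3 * sd * b)) * b ^+ 2 by rewrite UE; ring.
  by rewrite ler_peMl ?sqr_ge0.
have WU : 8 * h * (k * 2 ^ ((K + 2) * q))%:R * eta c0 n k eps * b ^+ 2 <= 8 * (C1 * U).
  have hN : (k * 2 ^ ((K + 2) * q))%:R <= Ga.
    rewrite ler_nat; apply: leq_trans _ (Gam_big K n c00 q8).
    by rewrite leq_pmulr.
  apply: (@le_trans _ _ (8 * h * Ga * (C1 * hx) * b ^+ 2)).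
    rewrite ler_wpM2r ?sqr_ge0 //; apply: ler_pM => //; first by rewrite !mulr_ge0 //; lra.
    by rewrite ler_wpM2l // mulr_ge0 //; lra.
  have -> : 8 * h * Ga * (C1 * hx) * b ^+ 2 = 8 * (C1 * (Ga * h ^+ 3 * b ^+ 3 * x)) by rewrite /hx; ring.
  rewrite ler_pM2l // ler_wpM2l // UE [X in _ <= X]mulrAC ler_peMr //.
  by apply: ltW; rewrite !mulr_gt0 ?exprn_gt0 //.
have TU : (H * (2 * Gam))%:R * (theta d (eta c0 n k eps) * K1) <= 14 * (C1 * K1 * U).
  have K10 : 0 <= K1 by have := kappa1; nra.
  apply: (@le_trans _ _ (h * (2 * Ga) * (7 * (sd * (C1 * hx)) * K1))).
    have -> : (H * (2 * Gam))%:R = h * (2 * Ga) by rewrite (natrM _ H) (natrM _ 2 Gam).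
    apply: ler_wpM2l; first by rewrite !mulr_ge0 //; lra.
    by rewrite ler_wpM2r.
  have -> : h * (2 * Ga) * (7 * (sd * (C1 * hx)) * K1) = 14 * (C1 * K1 * (Ga * h ^+ 3 * b * sd * x)) by rewrite /hx; ring.
  rewrite ler_pM2l //; apply: ler_wpM2l; first by rewrite mulr_ge0.
  rewrite UE ler_wpM2r ?(ltW x0) // ler_wpM2r ?(ltW sdp) // ler_wpM2l //.
  - by apply: ltW; rewrite !mulr_gt0 ?exprn_gt0 //.
  - by rewrite exprS ler_peMr ?exprn_ege1 // ltW.
rewrite /slack -/h -/b; set W := 8 * h * _ * _ * _ in WU *.
have Z0 : 0 <= Z by rewrite addr_ge0 // divr_ge0 // ltW.
have kp : 0 <= kappa by apply: le_trans kappa1.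
have s1 : kappa * 6 <= kappa * 6 * (E * U) by rewrite ler_peMr // mulr_ge0.
have s2 : kappa * Z * W <= kappa * Z * (8 * (C1 * U)) by rewrite ler_wpM2l // mulr_ge0.
have s3 : kappa * Z * b ^+ 2 <= kappa * Z * (E * U) by rewrite ler_wpM2l // mulr_ge0.
have -> : slack_const * (Ga * h ^+ 3 * b ^+ 3) * (sn * sd / eps) = slack_const * U by rewrite /U; ring.
have -> : slack_const * U = kappa * 6 * (E * U) + (kappa * Z * (8 * (C1 * U)) + kappa * Z * (E * U)) + 14 * (C1 * K1 * U).
  by rewrite /slack_const; ring.
have -> : kappa * (6 + Z * (W + b ^+ 2)) = kappa * 6 + (kappa * Z * W + kappa * Z * b ^+ 2) by ring.
apply: lerD; last exact: TU.
by apply: lerD; [exact: s1|exact: lerD].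
Qed.
End SlackBound.

Lemma opt_ge0 (R : realType) n d k (X : 'I_n -> 'rV[R]_d) : (0 < d)%N -> (0 < k)%N -> 0 <= opt k X.
Proof.
move=> d0 k0; apply: lb_le_inf.
  have [C _ hC] := @fset_extend R d d0 fset0 k isT.
  by exists (cost X C), C.
by move=> _ [C hC <-]; apply: cost_ge0; rewrite -cardfs_gt0 hC.
Qed.

Section Trivial.
Context {R : realType}.
Variables (c0 G : nat) (p : prog) (Ap : nat) (kappa beta : R).
Hypothesis c00 : (0 < c0)%N.
Hypothesis hp : forall (n d k : nat), (0 < n)%N -> (0 < d)%N -> (0 < k)%N ->
  forall X : 'I_n -> 'rV[R]_d, in_uball X ->
  let T := poly_bound Ap n d k in
  let start (w : T.-tuple bool) :=
    init [:: n; d; k] (flatten [seq coords (X i) | i <- enum 'I_n]) w [::] in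
  (forall w, halts T p (start w)) /\
  1 - beta <= Pr R [set w : T.-tuple bool |
    approx_solution k X kappa 0 (centers d k (output T p (start w)))]%classic.
Variables (n d k T : nat) (eps : R) (X : 'I_n -> 'rV[R]_d).
Hypotheses (n0 : (0 < n)%N) (d0 : (0 < d)%N) (k0 : (0 < k)%N) (e0 : 0 < eps).
Hypothesis hT : enough_time c0 G Ap n d k T.
Hypothesis hX : in_uball X.

Lemma success_either (F : T.-tuple bool * {ffun 'I_n -> T.-tuple bool} * T.-tuple bool -> Prop) :
  (forall (pub : T.-tuple bool) (w : {ffun 'I_n -> T.-tuple bool}) (v : T.-tuple bool),
    @one_good R c0 G p Ap kappa n d k eps (flatten (msgs c0 d k eps (fun i => coords (X i)) pub w)) pub v -> F (pub, w, v)) ->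
  beta * beta <= beta -> 1 - beta <= Pr R [set r | F r]%classic.
Proof.
move=> hF hb; rewrite Pr_av.
have W1 : (0 < #|{: T.-tuple bool}|)%N by rewrite card_tuple expn_gt0 card_bool.
have W2 : (0 < #|{: {ffun 'I_n -> T.-tuple bool}}|)%N by rewrite card_ffun expn_gt0 W1.
pose W := ((T.-tuple bool * {ffun 'I_n -> T.-tuple bool}) * T.-tuple bool)%type.
have W3 : (0 < #|{: W}|)%N by rewrite !card_prod !muln_gt0 W1 W2.
have h3 := both_fail c00 hp n0 d0 k0 e0 hT hX.
suff : av (fun r : W => 1 - @ind R (F r)) <= beta.
  rewrite (eq_av (g := fun r => 1 + -1 * @ind R (F r))) => [|r]; last by rewrite mulN1r.
  by rewrite avD avZ av_cst //; lra.
apply: le_trans hb; apply: le_trans h3; apply: av_le => -[[u w] v] /=; rewrite -indC; apply: ind_le.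
by move=> h h2; apply: h; exact: hF.
Qed.
End Trivial.

Section TimeAndError.
Context {R : realType}.
Variables (n d k A : nat) (eps eps0 : R).
Hypotheses (n0 : (0 < n)%N) (d0 : (0 < d)%N) (k0 : (0 < k)%N) (e0 : 0 < eps) (ee0 : eps <= eps0).
Local Notation y := (Num.sqrt (n * d)%:R / eps : R).
Local Notation t := ((A * k ^ A)%:R * Num.sqrt (n * d)%:R * (1 + ln n%:R) ^+ 7 / eps : R).

Lemma lnn_ge1 : 1 <= 1 + ln n%:R :> R.
Proof. by rewrite lerDl ln_ge0 // ler1n. Qed.

Lemma error_ge (B a : nat) : (B <= A)%N -> (a <= A)%N -> B%:R * k%:R ^+ a * (1 + ln n%:R) ^+ 7 * y <= t.
Proof.
move=> hB ha; have l1 := lnn_ge1; have l0 : 0 <= (1 + ln n%:R) ^+ 7 :> R by rewrite exprn_ge0 // (le_trans ler01).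
have -> : t = (A * k ^ A)%:R * ((1 + ln n%:R) ^+ 7 * y) by ring.
rewrite -mulrA; apply: ler_wpM2r; first by rewrite mulr_ge0 // divr_ge0 ?sqrtr_ge0 // ltW.
by rewrite -natrX -natrM ler_nat leq_mul // leq_pexp2l.
Qed.

(** In both cases [n] is at most [(1 + eps0) * sqrt (n * d) / eps]: if [eps * n < 1] because
    [1 / eps] alone exceeds [n], and if [n < d] because [sqrt (n * d)] does. *)
Lemma trivial_error (kappa : R) (B : nat) : 1 <= kappa -> (B <= A)%N -> (3 + 2 * kappa) ^+ 2 * (1 + eps0) <= B%:R ->
  acoef eps n = 0 \/ (n < d)%N -> n%:R * (3 + 2 * kappa) ^+ 2 <= t.
Proof.
move=> k1 hB hk hc; have e0' := e0; have ee0' := ee0.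
have n1 : 1 <= n%:R :> R by rewrite ler1n.
have y0 : 0 <= y by rewrite divr_ge0 ?sqrtr_ge0 // ltW.
have hn : n%:R <= (1 + eps0) * y.
  case: hc => [|hd].
    rewrite /acoef; case: ifP => [_|/negbT].
      by case: ifP => _ /eqP; rewrite gt_eqF //; lra.
    rewrite -ltNge => he _.
    have s0 : 1 <= (n * d)%:R :> R by rewrite ler1n muln_gt0 n0.
    have s1 : 1 <= Num.sqrt (n * d)%:R :> R by rewrite -{1}sqrtr1; exact: ler_wsqrtr.
    have h1 : n%:R <= y.
      rewrite ler_pdivlMr // mulrC; apply: le_trans (ltW he) s1.
    apply: le_trans h1 _; rewrite ler_peMl //; lra.
  have s1 : n%:R <= Num.sqrt (n * d)%:R :> R.
    have e : n%:R = Num.sqrt (n * n)%:R :> R by rewrite natrM -expr2 sqrtr_sqr ger0_norm.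
    by rewrite {1}e ler_wsqrtr // ler_nat leq_mul2l ltnW ?orbT.
  rewrite mulrCA; apply: le_trans s1 _; rewrite ler_peMr ?sqrtr_ge0 //.
  by rewrite ler_pdivlMr //; lra.
have h0 := error_ge hB (leq0n A); apply: le_trans h0; rewrite expr0 mulr1.
have l7 : 1 <= (1 + ln n%:R) ^+ 7 :> R by rewrite exprn_ege1 // lnn_ge1.
apply: (@le_trans _ _ (B%:R * y)); last first.
  rewrite [X in _ <= X * _]mulrC -mulrA ler_peMl // mulr_ge0 //.
apply: (@le_trans _ _ ((3 + 2 * kappa) ^+ 2 * (1 + eps0) * y)); last by rewrite ler_wpM2r.
by rewrite mulrC -mulrA ler_wpM2l // sqr_ge0.
Qed.

Lemma slack_error (c0 K : nat) (kappa al : R) (A0 : nat) : (0 < c0)%N -> 1 <= kappa -> 0 < al ->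
  0 < acoef eps n -> (8 <= pq c0 k)%N -> (A0 <= A)%N -> ((K + 7) * c0 + 7 <= A)%N ->
  slack_const kappa al eps0 * (4 ^ ((K + 7) * c0) * 16 * (2 * c0) ^ 7)%N%:R * 2 ^+ 7 <= A0%:R ->
  slack c0 kappa K n d k eps al <= t.
Proof.
move=> c00 k1 al0 a0 q8 hA0 hA hc.
have S0 : 0 <= slack_const kappa al eps0.
  have e4 := expR_ge0 (4 : R); have e0' := e0; have ee0' := ee0.
  have z0 : 0 <= 8 / al by rewrite divr_ge0 // ltW.
  have E0 : 0 <= 1 + eps0 by lra.
  have C0 : 0 <= (1 + eps0) * (65 + 2 * expR 4) by rewrite mulr_ge0 // addr_ge0 // mulr_ge0.
  have Z0 : 0 <= 27 + 8 / al by rewrite addr_ge0.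
  have K0 : 0 <= 11 * kappa + (6 + 2 * kappa) * (8 + 2 * kappa) by nra.
  have kp : 0 <= kappa by lra.
  rewrite /slack_const; move: (_ * (65 + _)) (27 + _) (11 * kappa + _) C0 Z0 K0 => a b c *.
  by rewrite !addr_ge0 ?mulr_ge0.
have y0 : 0 <= y by rewrite divr_ge0 ?sqrtr_ge0 // ltW.
have hs := slack_le K c00 n0 d0 k1 al0 e0 ee0 a0 q8.
apply: le_trans hs _.
apply: le_trans (error_ge hA0 hA); apply: ler_wpM2r => //.
set a := ((K + 7) * c0 + 7)%N; set M := (4 ^ _ * 16 * _)%N in hc.
apply: (@le_trans _ _ (slack_const kappa al eps0 * (M * k ^ a * (pen n + 1) ^ 7)%:R)).
  by rewrite ler_wpM2l // ler_nat; exact: size_param.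
have l1 := lnn_ge1.
have l7 : ((pen n + 1) ^ 7)%:R <= 2 ^+ 7 * (1 + ln n%:R) ^+ 7 :> R.
  rewrite natrX -exprMn; apply: lerXn2r; rewrite ?nnegrE //; last exact: (pen_ln n0).
  by rewrite mulr_ge0 // (le_trans ler01).
have e1 : (M * k ^ a * (pen n + 1) ^ 7)%:R = M%:R * k%:R ^+ a * ((pen n + 1) ^ 7)%:R :> R.
  by rewrite (natrM _ (M * k ^ a)) (natrM _ M) (natrX _ k).
rewrite e1; move: (((pen n + 1) ^ 7)%:R : R) l7 => u l7.
move: (slack_const _ _ _) S0 hc => s S0; move: (M%:R : R) (ler0n R M) => mm mm0 hc.
have kk0 : 0 <= k%:R ^+ a :> R by rewrite exprn_ge0.
move: (k%:R ^+ a : R) kk0 => kk kk0.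
have L0 : 0 <= (1 + ln n%:R) ^+ 7 :> R by rewrite exprn_ge0 // (le_trans ler01).
move: ((1 + ln n%:R) ^+ 7 : R) L0 l7 => L L0 l7.
apply: (@le_trans _ _ (s * (mm * kk * (2 ^+ 7 * L)))).
  by apply: ler_wpM2l => //; apply: ler_wpM2l => //; rewrite mulr_ge0.
move: (2 ^+ 7 : R) hc => c2 hc.
have -> : s * (mm * kk * (c2 * L)) = (s * mm * c2) * (kk * L) by ring.
by rewrite -[X in _ <= X]mulrA; apply: ler_wpM2r => //; rewrite mulr_ge0.
Qed.
End TimeAndError.

Unset Implicit Arguments.

Theorem theorem1 (R : realType) (kappa beta eps0 : R)
  (hbeta : 0 < beta < 1) (heps0 : 0 < eps0)
  (halg : ptime_kmeans_approx kappa beta) :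
  exists b : nat, forall alpha : R, 0 < alpha ->
  exists (enc dec : prog) (A : nat),
  forall (eps : R) (n d k : nat), 0 < eps <= eps0 ->
    (0 < n)%N -> (0 < d)%N -> (0 < k)%N ->
  let T := poly_bound A n d k in
  let t := (A * k ^ A)%:R * Num.sqrt (n * d)%:R * (1 + ln n%:R) ^+ b / eps in
  [/\ local_dp enc T n d k eps 0,
      runs_in_time enc dec T n d k eps &
      protocol_approx enc dec T n d k eps (kappa * (1 + alpha)) t beta].
Proof.
have k1 := approx_ratio_ge1 hbeta halg; case: halg => p [Ap hp].
(* The power of the logarithm counts factors [H] and [Bnd] and is the same for all [alpha], unlike
   the power of [k]. *)
exists 7%N => alpha alpha0.
have [al hal al_le] : exists2 al : R, 0 < al <= 1 / 16 & 11 * al <= alpha.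
  (* [good_cost] spends [11 * al] of relative error, and several of its estimates require
     [al <= 1 / 16]. *)
  exists (Num.min alpha 1 / 16); first by rewrite divr_gt0 ?lt_min ?alpha0 //= ler_pM2r // ge_min lexx orbT.
  have : Num.min alpha 1 <= alpha by rewrite ge_min lexx.
  by lra.
have al0 : 0 < al by case/andP: hal.
have [c0 c8 hfail] := fail_bound hbeta al0; have c00 : (0 < c0)%N by exact: leq_trans c8.
have [K hK] := nat_above (32 / al ^+ 2 + 2).
have [A1 hA1] := enough_time_poly (K + 7) c00 Ap.
have [A2 hA2] := nat_above (slack_const kappa al eps0 * (4 ^ ((K + 7) * c0) * 16 * (2 * c0) ^ 7)%N%:R * 2 ^+ 7).
have [A3 hA3] := nat_above ((3 + 2 * kappa) ^+ 2 * (1 + eps0)).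
have [A [l1 l2 l3 l4]] : exists A, [/\ A1 <= A, A2 <= A, A3 <= A & (K + 7) * c0 + 7 <= A]%N.
  have [A [_ h1 h2 h3]] := ex_above3 (A1 + A2) A3 ((K + 7) * c0 + 7); exists A.
  by split=> //; apply: leq_trans h1; rewrite ?leq_addr ?leq_addl.
exists (enc_prog c0 (K + 7)), (dec_prog c0 (K + 7) p), A => eps n d k /andP[e0 ee0] n0 d0 k0 T t.
have hT : enough_time c0 (K + 7) Ap n d k T := hA1 A n d k l1 n0 d0 k0.
split; [exact: (local_dp_holds c00 n0 e0 hT)|exact: (runs_in_time_holds c00 hp n0 d0 k0 e0 hT)|].
move=> X hX; have ho := opt_ge0 X d0 k0.
have kp : 0 <= kappa by apply: le_trans k1.
have hb2 : beta * beta <= beta by case/andP: hbeta => b0 b1; rewrite ler_piMl ?ltW.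
have hopt : kappa * (1 + 11 * al) * opt k X <= kappa * (1 + alpha) * opt k X.
  by apply: ler_wpM2r => //; apply: ler_wpM2l => //; rewrite lerD2l.
(* In the trivial case the messages may be useless, but the output must still consist of [k]
   distinct centers, so the success of one of the two runs is required there as well. *)
have [triv|ntriv] := pselect (acoef eps n = 0 \/ (n < d)%N).
  apply: (success_either c00 hp n0 d0 k0 e0 hT hX) => // pub w v hg.
  rewrite (messagesE c00 eps hT); apply: (decode_approx c00 hp n0 d0 k0 e0 hT _ _ _ _ hg).
  - by apply: size_msgs.
  - by rewrite size_tuple.
  - by rewrite size_tuple.
  move=> C C2 h1 h2 h3; apply: le_trans (trivial_cost k1 d0 k0 hX h1 h2 h3) _.
  apply: (@le_trans _ _ t); first exact: (trivial_error n0 d0 k0 e0 ee0 k1 l3 hA3 triv).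
  by rewrite lerDr mulr_ge0 // mulr_ge0 // addr_ge0 // ltW.
have dn : (d <= n)%N by rewrite leqNgt; apply/negP => h; apply: ntriv; right.
have a0 : 0 < acoef eps n.
  have /andP[h _] := acoef_bounds n0 eps; rewrite lt_def h andbT; apply/negP => /eqP h'.
  by apply: ntriv; left.
have q8 : (8 <= pq c0 k)%N by apply: leq_trans c8 _; rewrite /pq leq_pmulr // addn1.
have [c [s [hc hs]]] := near_opt d0 k0 hX.
have hsl := slack_error n0 d0 k0 e0 ee0 c00 k1 al0 a0 q8 l2 l4 hA2.
apply: (success_prob c00 hp k1 n0 d0 k0 e0 hT hX hal hK hs q8 a0) => [pub w v hj hn hg|]; last first.
  exact: hfail.
rewrite (messagesE c00 eps hT); apply: (decode_approx c00 hp n0 d0 k0 e0 hT _ _ _ _ hg).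
- by apply: size_msgs.
- by rewrite size_tuple.
- by rewrite size_tuple.
move=> C C2 h1 h2 h3.
apply: le_trans (good_cost c00 k1 n0 d0 k0 hX hal hK hc hs q8 a0 hj hn h1 h2 h3) _.
exact: lerD.
Qed.
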